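(* Let $1\le d\le 3$, $\nu>0$, $\epsilon\ge 0$. Let $(\sqrt{R_0},\Lambda_0)\in L^2(\mathbb R^d)\times L^2(\mathbb R^d)$ satisfy $\mathcal E(0)<\infty$, $\mathcal E_{\rm BD}(0)<\infty$, $\sqrt{R_0}\ge0$ a.e. on $\mathbb R^d$, $\Lambda_0=0$ a.e. on $\{\sqrt{R_0}=0\}$, with mass normalized by $\int_{\mathbb R^d}R_0\,dy=\int_{\mathbb R^d}\Gamma\,dy$, where $\Gamma(y)=e^{-|y|^2}$. Then every global weak solution $(R,U)$ to the system (RU) associated to $(\sqrt{R_0},\Lambda_0)$ that enjoys the energy inequality $$\mathcal E(t)+\int_0^t\mathcal D(s)\,ds\le C(\mathcal E(0))\quad\text{for almost all }t\ge0$$ (for some finite constant $C(\mathcal E(0))$) satisfies $$R(t)\rightharpoonup\Gamma\quad\text{weakly in }L^1(\mathbb R^d)\text{ as }t\to\infty.$$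
   Context: The function $\tau\in C^\infty([0,\infty))$ is the global solution of $\ddot\tau=2/\tau$, $\tau(0)=1$, $\dot\tau(0)=0$. $\langle y\rangle=(1+|y|^2)^{1/2}$. Conventions: $(a\otimes b)_{ij}=a_ib_j$, $(\nabla V)_{ij}=\partial_jV_i$; $\mathbb DU$ is the symmetric part of $\nabla U$. The system (RU), with unknowns $R(t,y)\ge0$, $U(t,y)\in\mathbb R^d$, $y\in\mathbb R^d$, is formally $$\partial_tR+\tfrac1{\tau^2}{\rm div}(RU)=0,$$ $$\partial_t(RU)+\tfrac1{\tau^2}{\rm div}(RU\otimes U)+2yR+\nabla R=\tfrac{\epsilon^2}{2\tau^2}R\nabla\Big(\tfrac{\Delta\sqrt R}{\sqrt R}\Big)+\tfrac{\nu}{\tau^2}{\rm div}(R\,\mathbb DU)+\tfrac{\nu\dot\tau}{\tau}\nabla R.$$ Definition (global weak solution to (RU), $\nu>0$, $\epsilon\ge0$). A global weak solution associated to $(\sqrt{R_0},\Lambda_0)$ is a pair $(R,U)$ for which there is a collection $(\sqrt R,\sqrt RU,\mathbf S_K,\mathbf T_N)$ such that: (i) $(\langle y\rangle+|U|)\sqrt R\in L^\infty_{\rm loc}(0,\infty;L^2(\mathbb R^d))$, $\nabla\sqrt R\in L^\infty_{\rm loc}(0,\infty;L^2(\mathbb R^d))$, $\epsilon\nabla^2\sqrt R\in L^2_{\rm loc}(0,\infty;L^2(\mathbb R^d))$, $\sqrt\epsilon\,\nabla R^{1/4}\in L^4_{\rm loc}(0,\infty;L^4(\mathbb R^d))$,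 $\mathbf T_N\in L^2_{\rm loc}(0,\infty;L^2(\mathbb R^d))$, with $\sqrt R\ge0$ a.e. on $(0,\infty)\times\mathbb R^d$ and $\sqrt RU=0$ a.e. on $\{\sqrt R=0\}$. (ii) In $\mathcal D'((0,\infty)\times\mathbb R^d)$, $$\partial_t\sqrt R+\tfrac1{\tau^2}{\rm div}(\sqrt RU)=\tfrac1{2\tau^2}{\rm Trace}(\mathbf T_N),$$ $$\partial_t(RU)+\tfrac1{\tau^2}{\rm div}(\sqrt RU\otimes\sqrt RU)+2y|\sqrt R|^2+\nabla(|\sqrt R|^2)={\rm div}\Big(\tfrac{\nu}{\tau^2}\sqrt R\,\mathbf S_N+\tfrac{\epsilon^2}{2\tau^2}\mathbf S_K\Big)+\tfrac{\nu\dot\tau}{\tau}\nabla R,$$ where $R=(\sqrt R)^2$, $RU=\sqrt R\,(\sqrt RU)$, $\mathbf S_N$ is the symmetric part of $\mathbf T_N$, and $$\sqrt R\,\mathbf T_N=\nabla(\sqrt R\,\sqrt RU)-2\sqrt RU\otimes\nabla\sqrt R,\qquad \mathbf S_K=\sqrt R\,\nabla^2\sqrt R-\nabla\sqrt R\otimes\nabla\sqrt R.$$ (iii) For every $\psi\in C_0^\infty(\mathbb R^d)$, as $t\to0$, $\int\sqrt R(t)\psi\,dy\to\int\sqrt{R_0}\,\psi\,dy$ and $\int\sqrt R(t)(\sqrt RU)(t)\psi\,dy\to\int\sqrt{R_0}\,\Lambda_0\psi\,dy$. Here $U$ is understood as $\frac{\sqrt RU}{\sqrt R}\mathbf 1_{\sqrt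 R>0}$. Energy, dissipation and BD-entropy: $$\mathcal E=\tfrac1{2\tau^2}\int_{\mathbb R^d}\big(R|U|^2+\epsilon^2|\nabla\sqrt R|^2\big)+\int_{\mathbb R^d}\big(R|y|^2+R\log R\big),$$ $$\mathcal D=\tfrac{\dot\tau}{\tau^3}\int_{\mathbb R^d}\big(R|U|^2+\epsilon^2|\nabla\sqrt R|^2\big)+\tfrac{\nu}{\tau^4}\int_{\mathbb R^d}R|\mathbb DU|^2,$$ $$\mathcal E_{\rm BD}=\tfrac1{2\tau^2}\int_{\mathbb R^d}\big(R|U+\nu\nabla\log R|^2+\epsilon^2|\nabla\sqrt R|^2\big)+\int_{\mathbb R^d}\big(R|y|^2+R\log R\big).$$ For weak solutions, $R|U|^2$ means $|\sqrt RU|^2$, $R|U+\nu\nabla\log R|^2$ means $|\sqrt RU+2\nu\nabla\sqrt R|^2$, and $R|\mathbb DU|^2$ means $|\mathbf S_N|^2$. At $t=0$ (where $\tau=1$), $\mathcal E(0)$ and $\mathcal E_{\rm BD}(0)$ are evaluated with $\sqrt R=\sqrt{R_0}$ and $\sqrt RU=\Lambda_0$; finiteness means that all the integrals involved are finite. *)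

(* Defs.v *)
From HB Require Import structures.
From mathcomp Require Import all_boot all_order all_algebra.
From mathcomp Require Import all_classical all_reals all_analysis.

Set Implicit Arguments.
Unset Strict Implicit.
Unset Printing Implicit Defensive.

Import Order.TTheory GRing.Theory Num.Def Num.Theory.
Import numFieldNormedType.Exports.

Local Open Scope classical_set_scope.
Local Open Scope ring_scope.

(* ['rV[R]_n] carries the product (= Borel) sigma-algebra, generated by the
   coordinates, and [lebesgue_rV n] is the n-fold product of the
   one-dimensional Lebesgue measure. *)

Definition rV_display : measure_display.
Proof. exact: default_measure_display. Qed.

Section measurable_rV.
Context {R : realType} (n : nat).

Let coords (i : 'I_n) (v : 'rV[R]_n) : R := v 0 i.

Let rV_set0 : g_sigma_preimage coords set0.
Proof. exact: sigma_algebra0. Qed.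

Let rV_setC A : g_sigma_preimage coords A -> g_sigma_preimage coords (~` A).
Proof. exact: sigma_algebraC. Qed.

Let rV_bigcup (F : (set 'rV[R]_n)^nat) :
  (forall i, g_sigma_preimage coords (F i)) ->
  g_sigma_preimage coords (\bigcup_i (F i)).
Proof. exact: sigma_algebra_bigcup. Qed.

HB.instance Definition _ := @isMeasurable.Build rV_display
  'rV[R]_n (g_sigma_preimage coords) rV_set0 rV_setC rV_bigcup.

Lemma measurable_coord (i : 'I_n) :
  measurable_fun [set: 'rV[R]_n] (fun v : 'rV[R]_n => v 0 i).
Proof.
move=> _ Y mY; rewrite setTI; apply: sub_sigma_algebra => /=.
rewrite -bigcup_seq/=; exists i => /=; first by rewrite mem_index_enum.
by exists Y => //; rewrite setTI.
Qed.

Lemma measurable_fun_rVP d (T : measurableType d) (f : T -> 'rV[R]_n) :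
  measurable_fun setT f <-> forall i, measurable_fun setT (fun x => f x 0 i).
Proof.
split=> [mf i|mf].
  exact: (measurableT_comp (measurable_coord i) mf).
move=> _ A; rewrite setTI; move: A.
apply: (@smallest_sub _ (@sigma_algebra 'rV[R]_n setT) _
  [set A | measurable (f @^-1` A)]).
  split; first by rewrite /= preimage_set0.
    by move=> A /= mA; rewrite setTD -preimage_setC; apply: measurableC.
  move=> F mF /=; rewrite preimage_bigcup.
  by apply: bigcup_measurable => k _; exact: mF.
rewrite -bigcup_seq => A [i _] [Y mY <-] /=.
by have := mf i measurableT Y mY; rewrite !setTI.
Qed.

End measurable_rV.

Section lebesgue_rV_def.
Context {R : realType}.

Definition rV_cons n (z : R * 'rV[R]_n) : 'rV[R]_n.+1 := row_mx z.1%:M z.2.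

Definition rV_uncons n (v : 'rV[R]_n.+1) : R * 'rV[R]_n :=
  (v 0 0, \row_i v 0 (lift ord0 i)).

Lemma rV_consE n (z : R * 'rV[R]_n) i :
  rV_cons z 0 i = if unlift ord0 i is Some j then z.2 0 j else z.1.
Proof.
rewrite /rV_cons; case: unliftP => [j|] ->.
  rewrite (_ : lift ord0 j = rshift 1 j); last exact/val_inj.
  by rewrite (row_mxEr z.1%:M).
rewrite (_ : ord0 = lshift n (ord0 : 'I_1)); last exact/val_inj.
by rewrite (row_mxEl z.1%:M) mxE eqxx mulr1n.
Qed.

Lemma rV_consK n : cancel (@rV_cons n) (@rV_uncons n).
Proof.
move=> [x v]; rewrite /rV_uncons rV_consE unlift_none; congr pair.
by apply/rowP => i; rewrite mxE rV_consE liftK.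
Qed.

Lemma rV_unconsK n : cancel (@rV_uncons n) (@rV_cons n).
Proof.
move=> v; apply/rowP => i; rewrite rV_consE.
by case: unliftP => [j|] -> //=; rewrite mxE.
Qed.

Lemma measurable_rV_cons n : measurable_fun setT (@rV_cons n).
Proof.
apply/measurable_fun_rVP => i.
under eq_fun do rewrite rV_consE.
case: unliftP => [j|] _; last exact: measurable_fst.
exact: (measurableT_comp (measurable_coord j) measurable_snd).
Qed.

Lemma measurable_rV_uncons n : measurable_fun setT (@rV_uncons n).
Proof.
apply/measurable_fun_pairP; split; first exact: measurable_coord.
apply/measurable_fun_rVP => i.
under eq_fun do rewrite /= mxE.
exact: measurable_coord.
Qed.

Section cons_measure.
Context n (mu : {sigma_finite_measure set 'rV[R]_n -> \bar R}).

Definition cons_measure : set 'rV[R]_n.+1 -> \bar R :=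
  pushforward (lebesgue_measure \x mu)%E (@rV_cons n).

Let cons_measure0 : cons_measure set0 = 0%E.
Proof. by rewrite /cons_measure /pushforward preimage_set0 measure0. Qed.

Let cons_measure_ge0 A : (0 <= cons_measure A)%E.
Proof. by rewrite /cons_measure /pushforward measure_ge0. Qed.

Let cons_measure_sigma_additive : semi_sigma_additive cons_measure.
Proof.
have mcons A : measurable A -> measurable (@rV_cons n @^-1` A).
  by move=> mA; rewrite -[X in measurable X]setTI; exact: measurable_rV_cons.
move=> F mF tF mUF; rewrite /cons_measure /pushforward preimage_bigcup.
apply: measure_semi_sigma_additive.
- by move=> k; exact: mcons.
- apply/trivIsetP => /= i j _ _ ij; rewrite -preimage_setI.
  by move/trivIsetP : tF => /(_ _ _ _ _ ij) ->//; rewrite preimage_set0.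
- by rewrite -preimage_bigcup; exact: mcons.
Qed.

HB.instance Definition _ := isMeasure.Build _ _ _ cons_measure
  cons_measure0 cons_measure_ge0 cons_measure_sigma_additive.

Let sigma_finite_cons_measure : sigma_finite setT cons_measure.
Proof.
have /sigma_finiteP[F [TF ndF Foo]] := sigma_finiteT (@lebesgue_measure R).
have /sigma_finiteP[G [TG ndG Goo]] := sigma_finiteT mu.
exists (fun k => @rV_uncons n @^-1` (F k `*` G k)).
  rewrite -preimage_bigcup (_ : \bigcup_k _ = setT) ?preimage_setT//.
  apply/seteqP; split=> // -[x v] _.
  have [i _ Fix] : (\bigcup_i F i) x by rewrite -TF.
  have [j _ Gjv] : (\bigcup_j G j) v by rewrite -TG.
  exists (maxn i j) => //; split => /=.
    by move: Fix; apply/subsetPset/ndF/leq_maxl.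
  by move: Gjv; apply/subsetPset/ndG/leq_maxr.
move=> k; have [mFk Fkoo] := Foo k; have [mGk Gkoo] := Goo k; split.
  rewrite -[X in measurable X]setTI.
  by apply: measurable_rV_uncons => //; exact: measurableX.
rewrite /cons_measure /pushforward.
rewrite (_ : _ @^-1` _ = F k `*` G k); last first.
  by apply/funext => z; rewrite /preimage /mkset rV_consK.
by rewrite product_measure1E// lte_mul_pinfty// ge0_fin_numE.
Qed.

HB.instance Definition _ :=
  Measure_isSigmaFinite.Build _ _ _ cons_measure sigma_finite_cons_measure.

End cons_measure.

Fixpoint lebesgue_rV n : {sigma_finite_measure set 'rV[R]_n -> \bar R} :=
  match n with
  | 0 => dirac (0 : 'rV[R]_0)
  | n'.+1 => cons_measure (lebesgue_rV n')
  end.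

End lebesgue_rV_def.

Section vectors.
Context {R : realType}.

(* The library norm of a matrix is the maximum norm; [sqnorm] is the square of
   the Euclidean (Frobenius) norm. *)
Definition sqnorm m n (A : 'M[R]_(m, n)) : R := \sum_i \sum_j A i j ^+ 2.

Definition enorm m n (A : 'M[R]_(m, n)) : R := Num.sqrt (sqnorm A).

Definition japanese n (y : 'rV[R]_n) : R := Num.sqrt (1 + sqnorm y).

Definition outer n (a b : 'rV[R]_n) : 'M[R]_n := a^T *m b.

Definition symmetric_part n (A : 'M[R]_n) : 'M[R]_n := 2^-1 *: (A + A^T).

Definition Gamma n (y : 'rV[R]_n) : R := expR (- sqnorm y).

End vectors.

Section test_functions.
Context {R : realType} {V : normedModType R}.

Fixpoint iter_derive (vs : seq V) (f : V -> R) : V -> R :=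
  if vs is v :: vs' then 'D_v (iter_derive vs' f) else f.

(* All iterated directional derivatives exist and are continuous. *)
Definition smooth (f : V -> R) : Prop :=
  forall vs : seq V,
    continuous (iter_derive vs f) /\
    forall x v, derivable (iter_derive vs f) x v.

Definition test_function (Omega : set V) (f : V -> R) : Prop :=
  smooth f /\
  exists K : set V,
    [/\ compact K, K `<=` Omega & forall x, ~ K x -> f x = 0].

End test_functions.

Section distributions.
Context {R : realType} (d : nat).
Local Notation space := ('rV[R]_d).
Local Notation spacetime := (R * 'rV[R]_d)%type.

Definition positive_times : set spacetime := [set z | 0 < z.1].

(* [measurableTypeR R] is R with its Borel sigma-algebra, the type on which the
   library defines Lebesgue measure. *)
Local Notation mspacetime := (measurableTypeR R * 'rV[R]_d)%type.

Definition spacetime_measure : {measure set mspacetime -> \bar R} :=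
  (lebesgue_measure \x lebesgue_rV d)%E.

Definition basis_vec (j : 'I_d) : space := delta_mx 0 j.

Definition dt (phi : spacetime -> R) : spacetime -> R := 'D_((1, 0) : spacetime) phi.

Definition dy (j : 'I_d) (phi : spacetime -> R) : spacetime -> R :=
  'D_((0, basis_vec j) : spacetime) phi.

(* The pairing of a locally integrable f with a test function on
   (0, +oo) x R^d. *)
Definition pairing (f : R -> space -> R) (phi : spacetime -> R) : R :=
  \int[spacetime_measure]_(z in positive_times) (f z.1 z.2 * phi z).

Definition weak_gradient (f : R -> space -> R) (G : R -> space -> space) : Prop :=
  forall phi, test_function positive_times phi -> forall j,
    pairing (fun t y => G t y 0 j) phi = - pairing f (dy j phi).

Definition weak_gradient_space (f : space -> R) (G : space -> space) : Prop :=
  forall psi : space -> R, test_function setT psi -> forall j,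
    \int[lebesgue_rV d]_y (G y 0 j * psi y) =
    - \int[lebesgue_rV d]_y (f y * 'D_(basis_vec j) psi y).

Definition st_measurable (f : R -> space -> R) : Prop :=
  measurable_fun (positive_times : set mspacetime)
    (fun z : mspacetime => f z.1 z.2).

(* L^p_loc(0, oo; X) is read as L^p(0, T; X) for every T > 0. *)
Definition Loo_loc_L2 (f : R -> space -> R) : Prop :=
  forall T : R, 0 < T -> exists M : R,
    {ae lebesgue_measure, forall t : R, 0 < t < T ->
      ('N[lebesgue_rV d]_2%:E [EFin \o f t] <= M%:E)%E}.

Definition Lp_loc_Lp (p : nat) (f : R -> space -> R) : Prop :=
  forall T : R, 0 < T ->
    (\int[spacetime_measure]_(z in [set z : spacetime | (0 < z.1 < T)%R])
       (`|f z.1 z.2| ^+ p)%:E < +oo)%E.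

(* f(t) -> l as t tends to the limit point described by F, t avoiding a
   Lebesgue-null set of times: this does not depend on the representative of
   an almost everywhere defined f. *)
Definition ess_cvg (F : set_system R) (f : R -> R) (l : R) : Prop :=
  exists2 N : set R, lebesgue_measure.-negligible N &
    f t @[t --> within (~` N) F] --> l.

(* Weak convergence in L^1(R^d) as t -> +oo, again for t outside a null set;
   the null set does not depend on the test function in L^oo(R^d). *)
Definition weak_L1_cvg_pinfty (f : R -> space -> R) (g : space -> R) : Prop :=
  exists N : set R,
    [/\ lebesgue_measure.-negligible N,
        forall t, 0 < t -> ~ N t -> f t \in Lfun (lebesgue_rV d) 1%E,
        g \in Lfun (lebesgue_rV d) 1%E &
        forall phi, phi \in Lfun (lebesgue_rV d) +oo%E ->
          (\int[lebesgue_rV d]_y (f t y * phi y))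
            @[t --> within (~` N) (pinfty_nbhs R)] -->
          \int[lebesgue_rV d]_y (g y * phi y)].

End distributions.

Section system.
Context {R : realType}.

(* tau is only prescribed on [0, +oo), hence one-sided limits at 0. *)
Record is_tau (tau : R -> R) : Prop := IsTau {
  tau0 : tau 0 = 1 ;
  tau_cvg0 : tau t @[t --> 0^'+] --> tau 0 ;
  dtau_cvg0 : tau^`()%classic t @[t --> 0^'+] --> (0 : R) ;
  tau_gt0 : forall t, 0 <= t -> 0 < tau t ;
  tau_ode : forall t, 0 < t -> tau^`(2)%classic t = 2 / tau t ;
  tau_smooth : forall n t, 0 < t -> derivable (tau^`(n)%classic) t 1 ;
  tau_smooth0 : forall n, cvg (tau^`(n)%classic t @[t --> 0^'+]) }.

Variable d : nat.
Local Notation space := ('rV[R]_d).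
Local Notation spacetime := (R * 'rV[R]_d)%type.

(* The collection attached to a weak solution, together with the weak
   derivatives that occur in the definition. *)
Record collection := Collection {
  sqrtR : R -> space -> R ;
  sqrtRU : R -> space -> space ;
  SK : R -> space -> 'M[R]_d ;
  TN : R -> space -> 'M[R]_d ;
  grad_sqrtR : R -> space -> space ;
  hess_sqrtR : R -> space -> 'M[R]_d ;
  grad_R4 : R -> space -> space (* the gradient of R^(1/4) *) }.

Definition SN (c : collection) (t : R) (y : space) : 'M[R]_d :=
  symmetric_part (TN c t y).

Definition velocity (c : collection) (t : R) (y : space) : space :=
  if 0 < sqrtR c t y then (sqrtR c t y)^-1 *: sqrtRU c t y else 0.

Record regularity (eps : R) (c : collection) : Prop := Regularity {
  mes_sqrtR : st_measurable (sqrtR c) ;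
  mes_sqrtRU : forall i, st_measurable (fun t y => sqrtRU c t y 0 i) ;
  mes_TN : forall i j, st_measurable (fun t y => TN c t y i j) ;
  mes_grad_sqrtR : forall i, st_measurable (fun t y => grad_sqrtR c t y 0 i) ;
  sqrtR_Loo_L2 : Loo_loc_L2
    (fun t y => (japanese y + enorm (velocity c t y)) * sqrtR c t y) ;
  grad_sqrtRP : weak_gradient (sqrtR c) (grad_sqrtR c) ;
  grad_sqrtR_Loo_L2 : Loo_loc_L2 (fun t y => enorm (grad_sqrtR c t y)) ;
  quantum_regularity : 0 < eps ->
    [/\ forall i j, st_measurable (fun t y => SK c t y i j) /\
          st_measurable (fun t y => hess_sqrtR c t y i j),
        forall i, weak_gradient (fun t y => grad_sqrtR c t y 0 i)
          (fun t y => row i (hess_sqrtR c t y)),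
        Lp_loc_Lp 2 (fun t y => eps * enorm (hess_sqrtR c t y)) &
        [/\ forall i, st_measurable (fun t y => grad_R4 c t y 0 i),
            weak_gradient (fun t y => Num.sqrt (sqrtR c t y)) (grad_R4 c) &
            Lp_loc_Lp 4 (fun t y => Num.sqrt eps * enorm (grad_R4 c t y))]] ;
  TN_L2_L2 : Lp_loc_Lp 2 (fun t y => enorm (TN c t y)) ;
  sqrtR_ge0 : {ae spacetime_measure d, forall z : spacetime,
    0 < z.1 -> 0 <= sqrtR c z.1 z.2} ;
  sqrtRU_vacuum : {ae spacetime_measure d, forall z : spacetime,
    0 < z.1 -> sqrtR c z.1 z.2 = 0 -> sqrtRU c z.1 z.2 = 0} }.

(* d_t sqrtR + tau^-2 div (sqrtRU) = (2 tau^2)^-1 Trace TN *)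
Definition continuity_equation (tau : R -> R) (c : collection) : Prop :=
  forall phi, test_function (@positive_times R d) phi ->
    - pairing (sqrtR c) (dt phi)
    - \sum_j pairing (fun t y => (tau t ^+ 2)^-1 * sqrtRU c t y 0 j) (dy j phi)
    = pairing (fun t y => (2 * tau t ^+ 2)^-1 * \tr (TN c t y)) phi.

(* The i-th component of
     d_t (RU) + tau^-2 div (sqrtRU (x) sqrtRU) + 2 y R + grad R
     = div (nu tau^-2 sqrtR SN + eps^2 (2 tau^2)^-1 SK) + nu (tau'/tau) grad R,
   where (div A)_i = sum_j d_j A_ij. *)
Definition momentum_equation (tau : R -> R) (nu eps : R) (c : collection) : Prop :=
  forall phi, test_function (@positive_times R d) phi -> forall i,
    - pairing (fun t y => sqrtR c t y * sqrtRU c t y 0 i) (dt phi)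
    - \sum_j pairing (fun t y => (tau t ^+ 2)^-1 *
               outer (sqrtRU c t y) (sqrtRU c t y) i j) (dy j phi)
    + pairing (fun t y => 2 * y 0 i * sqrtR c t y ^+ 2) phi
    - pairing (fun t y => sqrtR c t y ^+ 2) (dy i phi)
    = - \sum_j pairing (fun t y =>
            nu / tau t ^+ 2 * (sqrtR c t y * SN c t y i j) +
            eps ^+ 2 / (2 * tau t ^+ 2) * SK c t y i j) (dy j phi)
      - pairing (fun t y => nu * tau^`()%classic t / tau t * sqrtR c t y ^+ 2) (dy i phi).

(* sqrtR TN = grad (sqrtR sqrtRU) - 2 sqrtRU (x) grad sqrtR, with
   (grad V)_ij = d_j V_i *)
Definition TN_equation (c : collection) : Prop :=
  forall phi, test_function (@positive_times R d) phi -> forall i j,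
    pairing (fun t y => sqrtR c t y * TN c t y i j) phi
    = - pairing (fun t y => sqrtR c t y * sqrtRU c t y 0 i) (dy j phi)
      - pairing (fun t y =>
            2 * outer (sqrtRU c t y) (grad_sqrtR c t y) i j) phi.

Definition SK_equation (c : collection) : Prop :=
  {ae spacetime_measure d, forall z : spacetime, 0 < z.1 ->
    SK c z.1 z.2 = sqrtR c z.1 z.2 *: hess_sqrtR c z.1 z.2
                   - outer (grad_sqrtR c z.1 z.2) (grad_sqrtR c z.1 z.2)}.

Definition initial_condition (r0 : space -> R) (L0 : space -> space)
    (c : collection) : Prop :=
  forall psi : space -> R, test_function setT psi ->
    ess_cvg 0^'+ (fun t => \int[lebesgue_rV d]_y (sqrtR c t y * psi y))
      (\int[lebesgue_rV d]_y (r0 y * psi y)) /\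
    forall i, ess_cvg 0^'+
      (fun t => \int[lebesgue_rV d]_y (sqrtR c t y * sqrtRU c t y 0 i * psi y))
      (\int[lebesgue_rV d]_y (r0 y * L0 y 0 i * psi y)).

(* (rho, U) is a global weak solution associated to (r0, L0), with the
   collection c.  When eps = 0, the second derivatives of sqrtR need not be
   functions; SK is then multiplied by 0 in the momentum equation. *)
Record global_weak_solution (tau : R -> R) (nu eps : R)
    (r0 : space -> R) (L0 : space -> space)
    (rho : R -> space -> R) (U : R -> space -> space) (c : collection) : Prop :=
  GlobalWeakSolution {
  gws_mes_rho : st_measurable rho ;
  gws_mes_U : forall i, st_measurable (fun t y => U t y 0 i) ;
  gws_rho : {ae spacetime_measure d, forall z : spacetime, 0 < z.1 ->
    rho z.1 z.2 = sqrtR c z.1 z.2 ^+ 2} ;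
  gws_U : {ae spacetime_measure d, forall z : spacetime, 0 < z.1 ->
    U z.1 z.2 = velocity c z.1 z.2} ;
  gws_regularity : regularity eps c ;
  gws_continuity : continuity_equation tau c ;
  gws_momentum : momentum_equation tau nu eps c ;
  gws_TN : TN_equation c ;
  gws_SK : 0 < eps -> SK_equation c ;
  gws_initial : initial_condition r0 L0 c }.

Section energy.
Implicit Types (r : space -> R) (q G : space -> space).

Definition kinetic_density (eps : R) q G (y : space) : R :=
  sqnorm (q y) + eps ^+ 2 * sqnorm (G y).

(* [ln 0 = 0] in the library, hence R log R = 0 where R = 0. *)
Definition potential_density r (y : space) : R :=
  r y ^+ 2 * sqnorm y + r y ^+ 2 * ln (r y ^+ 2).

(* The energy of sqrtR = r, sqrtRU = q, grad sqrtR = G when tau has value a. *)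
Definition energy (a eps : R) r q G : \bar R :=
  (((2 * a ^+ 2)^-1)%:E * \int[lebesgue_rV d]_y (kinetic_density eps q G y)%:E
   + \int[lebesgue_rV d]_y (potential_density r y)%:E)%E.

Definition finite_energy (eps : R) r q G : Prop :=
  (lebesgue_rV d).-integrable setT (EFin \o kinetic_density eps q G) /\
  (lebesgue_rV d).-integrable setT (EFin \o potential_density r).

(* The BD-entropy is the energy with sqrtRU + 2 nu grad sqrtR instead of
   sqrtRU. *)
Definition finite_BD_entropy (nu eps : R) r q G : Prop :=
  finite_energy eps r (fun y => q y + (2 * nu) *: G y) G.

End energy.

Definition dissipation (tau : R -> R) (nu eps : R) (c : collection) (t : R) : \bar R :=
  ((tau^`()%classic t / tau t ^+ 3)%:E *
     \int[lebesgue_rV d]_y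
       (kinetic_density eps (sqrtRU c t) (grad_sqrtR c t) y)%:E
   + (nu / tau t ^+ 4)%:E * \int[lebesgue_rV d]_y (sqnorm (SN c t y))%:E)%E.

Definition energy_inequality (tau : R -> R) (nu eps : R) (c : collection)
    (C : R) : Prop :=
  {ae lebesgue_measure, forall t : R, 0 <= t ->
    (energy (tau t) eps (sqrtR c t) (sqrtRU c t) (grad_sqrtR c t)
     + \int[lebesgue_measure]_(s in [set s : R | (0 < s < t)%R]) dissipation tau nu eps c s
     <= C%:E)%E}.

End system.

Arguments collection R d : clear implicits.

(* Main.v *)
(* Extended by its initial value to t <= 0, u = sqrtR solves
   d_t u + sum_j d_j F_j = g across t = 0, with F = tau^-2 sqrtRU.  Mollifying
   and testing with u itself, the equation of sqrtR TN turns this into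
   d_t R + sum_j d_j (F_j u) = 0 for R = u^2; in particular mass is conserved.
   Since R log R + R |y|^2 >= R - Gamma, the energy inequality then bounds the
   total dissipation over all times and the entropy of R(t).

   In the logarithmic time kappa = (ln tau') / 2, where
   kappa' = 1 / (tau tau'), test the momentum equation with chi(t) psi(y), chi
   supported in a window of unit length.  By Young's inequality all terms but
   the one with R (2 y_i psi - d_i psi) are at most the dissipation in the
   window plus a small multiple of the mass, so the average of
   int R(t) (2 y_i psi - d_i psi) dy over the window tends to 0; the equation of
   R bounds in the same way its oscillation in the window, and hence it tends to
   0 as t -> +oo outside a null set.

   A product g = prod_i g_i(y_i) of which one factor has zero Gaussian moment
   is of the form 2 y_i psi - d_i psi.  Hence int R(t) g - k(t) int Gamma g -> 0
   for all such products, with k independent of g.  The entropy bound gives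
   uniform integrability, so that g may tend boundedly to 1, and conservation
   of mass yields k -> 1.  Indicators of rational orthants form a countable
   family, for which one null set of times suffices; a monotone class argument
   along this null set reaches all bounded measurable functions. *)

Require Import Defs.
From HB Require Import structures.
From mathcomp Require Import all_boot all_order all_algebra.
From mathcomp Require Import all_classical all_reals all_analysis.
From mathcomp Require Import measurable_realfun ring lra zify.

Set Implicit Arguments.
Unset Strict Implicit.
Unset Printing Implicit Defensive.

Import Order.TTheory GRing.Theory Num.Def Num.Theory.
Import numFieldNormedType.Exports.

Local Open Scope classical_set_scope.
Local Open Scope ring_scope.

(** The dissipation measures velocities, not the distance to the Gaussian; a choice of weights
    brings out the balance 2 y R + grad R. The kinetic dissipation has weight tau' / tau^3 and the
    fluxes have weight tau^-2. Since tau^-4 = (tau' / tau^3) (1 / (tau tau')), Young's inequality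
    leaves the measure dt / (tau tau') = d kappa for the mass, so a unit window in kappa contains a
    fixed amount of it. The viscous drift has coefficient nu tau' / tau, which tends to 0 because
    tau'^2 = 4 ln tau.

    The dissipation does not see second derivatives of sqrtR, so the capillary stress is rewritten,
    weakly, with first derivatives only.

    The renormalisation needs no commutator estimate: the mollifier is even, so the time derivative
    falls on an odd kernel paired with equal arguments and drops out, while space derivatives move
    to u, whose gradient is locally in L^2. Test functions are products chi(t) psi(y), a class
    stable under multiplication by the kernels but not under addition; since testing with u phi^2
    yields identities on squares only, a polarisation step recovers all test functions. *)

Lemma cvg_distF (R : realType) (T : Type) (F : set_system T) {FF : Filter F}
    (f : T -> R) (l e : R) :
  f x @[x --> F] --> l -> 0 < e -> \forall x \near F, `|f x - l| <= e.
Proof.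
move=> fl e0; have := (@cvgrPdist_le _ _ _ F FF f l).1 fl e e0.
by apply: filterS => x; rewrite distrC.
Qed.

Lemma cvg_dist (R : realType) (u : nat -> R) (l e : R) :
  u n @[n --> \oo] --> l -> 0 < e -> \forall n \near \oo, `|u n - l| <= e.
Proof. by move=> ul e0; exact: cvg_distF. Qed.

(** * Real-valued Lebesgue integrals *)

Section integrals.
Context d (T : measurableType d) (R : realType).
Variable mu : {measure set T -> \bar R}.
Implicit Types f g h : T -> R.

Definition intg f := mu.-integrable setT (EFin \o f).

Lemma intg_meas f : intg f -> measurable_fun setT f.
Proof. by move=> /integrableP[/measurable_EFinP]. Qed.

Lemma intgD f g : intg f -> intg g -> intg (fun x => f x + g x).
Proof. by move=> If Ig; exact: (integrableD measurableT If Ig). Qed.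

Lemma intgN f : intg f -> intg (fun x => - f x).
Proof. by move=> If; exact: (integrableN If). Qed.

Lemma intgB f g : intg f -> intg g -> intg (fun x => f x - g x).
Proof. by move=> If Ig; exact: (integrableB measurableT If Ig). Qed.

Lemma intgZ c f : intg f -> intg (fun x => c * f x).
Proof. by move=> If; exact: (integrableZl measurableT c If). Qed.

Lemma intg0 : intg (fun=> 0).
Proof. exact: integrable0. Qed.

Lemma intg_sum (I : Type) (s : seq I) (F : I -> T -> R) :
  (forall i, intg (F i)) -> intg (fun x => \sum_(i <- s) F i x).
Proof.
move=> IF; elim: s => [|i s IH].
  by under [X in intg X]eq_fun do rewrite big_nil; exact: intg0.
under [X in intg X]eq_fun do rewrite big_cons.
exact: intgD.
Qed.

Lemma intg_le f g : measurable_fun setT f -> (forall x, `|f x| <= g x) ->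
  intg g -> intg f.
Proof.
move=> mf fg Ig; apply: (le_integrable measurableT _ _ Ig).
  exact/measurable_EFinP.
by move=> x _ /=; rewrite lee_fin (le_trans (fg x))// ler_norm.
Qed.

(** The measures in use are not complete, so the measurability of [f] does not follow from that of
    [g] and is a hypothesis. *)
Lemma intg_ae_eq f g : measurable_fun setT f ->
  {ae mu, forall x, f x = g x} -> intg g -> intg f.
Proof.
move=> mf fg /integrableP[mg Ig]; apply/integrableP; split.
  exact/measurable_EFinP.
rewrite (ae_eq_integral (fun x => `|(EFin \o g) x|%E))//.
- by apply/measurable_EFinP; apply: measurableT_comp.
- by apply: measurableT_comp.
- by apply: filterS fg => x /= -> _.
Qed.

Lemma intg_abs f : intg f -> intg (fun x => `|f x|).
Proof. by move=> If; apply: integrable_norm. Qed.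

Lemma I_eq f g : (forall x, f x = g x) -> \int[mu]_x f x = \int[mu]_x g x.
Proof. by move=> fg; apply: eq_Rintegral => x _; exact: fg. Qed.

Lemma I_ae f g : measurable_fun setT f -> measurable_fun setT g ->
  {ae mu, forall x, f x = g x} -> \int[mu]_x f x = \int[mu]_x g x.
Proof.
move=> mf mg fg; rewrite /Rintegral; congr fine; apply: ae_eq_integral => //.
- exact/measurable_EFinP.
- exact/measurable_EFinP.
- by apply: filterS fg => x /= -> _.
Qed.

Lemma ID f g : intg f -> intg g ->
  \int[mu]_x (f x + g x) = \int[mu]_x f x + \int[mu]_x g x.
Proof. by move=> If Ig; exact: RintegralD. Qed.

Lemma IB f g : intg f -> intg g ->
  \int[mu]_x (f x - g x) = \int[mu]_x f x - \int[mu]_x g x.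
Proof. by move=> If Ig; exact: RintegralB. Qed.

Lemma IZ c f : intg f -> \int[mu]_x (c * f x) = c * \int[mu]_x f x.
Proof. by move=> If; exact: RintegralZl. Qed.

Lemma I0 : \int[mu]_x (0 : R) = 0.
Proof. by rewrite /Rintegral integral0. Qed.

Lemma IN f : intg f -> \int[mu]_x (- f x) = - \int[mu]_x f x.
Proof.
by move=> If; rewrite -mulN1r -IZ//; apply: I_eq => x; rewrite mulN1r.
Qed.

Lemma I_sum (I : Type) (s : seq I) (F : I -> T -> R) :
  (forall i, intg (F i)) ->
  \int[mu]_x (\sum_(i <- s) F i x) = \sum_(i <- s) \int[mu]_x F i x.
Proof.
move=> IF; elim: s => [|i s IH].
  by rewrite big_nil -[RHS]I0; apply: I_eq => x; rewrite big_nil.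
rewrite big_cons -IH -ID//; last exact: intg_sum.
by apply: I_eq => x; rewrite big_cons.
Qed.

(** This covers infinite integrals too: their real value is 0 by the convention on [fine]. *)
Lemma I_ge0 f : (forall x, 0 <= f x) -> 0 <= \int[mu]_x f x.
Proof. by move=> f0; apply: Rintegral_ge0. Qed.

Lemma I_le f g : intg f -> intg g -> (forall x, f x <= g x) ->
  \int[mu]_x f x <= \int[mu]_x g x.
Proof. by move=> If Ig fg; apply: le_Rintegral. Qed.

Lemma I_norm f : intg f -> `|\int[mu]_x f x| <= \int[mu]_x `|f x|.
Proof. by move=> If; exact: le_normr_Rintegral. Qed.

Lemma I_norm_le f g : intg f -> intg g -> (forall x, `|f x| <= g x) ->
  `|\int[mu]_x f x| <= \int[mu]_x g x.
Proof.
move=> If Ig fg; apply: (le_trans (I_norm If)); apply: I_le => //.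
exact: intg_abs.
Qed.

Lemma I_EFin f : intg f -> (\int[mu]_x (f x)%:E)%E = (\int[mu]_x f x)%:E.
Proof. by move=> If; rewrite /Rintegral fineK//; exact: integrable_fin_num. Qed.

Lemma intg_lty f : measurable_fun setT f -> (forall x, 0 <= f x) ->
  (\int[mu]_x (f x)%:E < +oo)%E -> intg f.
Proof.
move=> mf f0 foo; apply/integrableP; split; first exact/measurable_EFinP.
rewrite (_ : (\int[mu]_x _)%E = \int[mu]_x (f x)%:E)%E//.
by apply: eq_integral => x _ /=; rewrite ger0_norm.
Qed.

Lemma intg_fin f : intg f -> (\int[mu]_x (f x)%:E < +oo)%E.
Proof. by move=> If; rewrite I_EFin// ltry. Qed.

Lemma I_eq0_ae f : intg f -> (forall x, 0 <= f x) -> \int[mu]_x f x = 0 ->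
  {ae mu, forall x, f x = 0}.
Proof.
move=> If f0 I0; have mf := intg_meas If.
have : (\int[mu]_x `|(EFin \o f) x| = 0)%E.
  have -> : (\int[mu]_x `|(EFin \o f) x| = \int[mu]_x (f x)%:E)%E.
    by apply: eq_integral => x _ /=; rewrite ger0_norm.
  by rewrite I_EFin// I0.
move/(ae_eq_integral_abs mu measurableT) => h.
have /h : measurable_fun setT (EFin \o f) by exact/measurable_EFinP.
by apply: filterS => x /= /(_ I) [].
Qed.

Lemma dct (F : nat -> T -> R) f g :
  (forall n, measurable_fun setT (F n)) -> measurable_fun setT f ->
  {ae mu, forall x, F ^~ x @ \oo --> f x} -> intg g ->
  (forall n x, `|F n x| <= g x) ->
  \int[mu]_x F n x @[n --> \oo] --> \int[mu]_x f x.
Proof.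
move=> mF mf Ff Ig Fg.
have [] := @dominated_convergence _ T R mu setT measurableT
  (fun n => EFin \o F n) (EFin \o f) (EFin \o g).
- by move=> n; exact/measurable_EFinP.
- exact/measurable_EFinP.
- by apply: filterS Ff => x Fx _; apply/fine_cvgP; split => //; exact: nearW.
- exact: Ig.
- by apply: filterE => x n _ /=; rewrite lee_fin.
move=> If _ h.
have IFn n : intg (F n) by exact: intg_le (mF n) (Fg n) Ig.
have /fine_cvgP[_] : [sequence (\int[mu]_x (EFin \o F n) x)%E]_n @ \oo -->
   (\int[mu]_x f x)%:E by rewrite -(I_EFin If).
exact.
Qed.

Definition L2 f := measurable_fun setT f /\ intg (fun x => f x ^+ 2).

Lemma norm_mul_le (a b : R) : `|a * b| <= 2^-1 * (a ^+ 2 + b ^+ 2).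
Proof.
rewrite ler_norml; apply/andP; split.
  have := sqr_ge0 (a + b); rewrite sqrrD; lra.
have := sqr_ge0 (a - b); rewrite sqrrB; lra.
Qed.

Lemma L2_mul f g : L2 f -> L2 g -> intg (fun x => f x * g x).
Proof.
move=> [mf If] [mg Ig]; apply: (@intg_le _ (fun x => 2^-1 * (f x ^+ 2 + g x ^+ 2))).
- exact: measurable_funM.
- by move=> x; exact: norm_mul_le.
- by apply: intgZ; exact: intgD.
Qed.

Lemma L2D f g : L2 f -> L2 g -> L2 (fun x => f x + g x).
Proof.
move=> [mf If] [mg Ig]; split; first exact: measurable_funD.
apply: (@intg_le _ (fun x => 2 * (f x ^+ 2 + g x ^+ 2))).
- by apply: measurable_funX; exact: measurable_funD.
- move=> x; rewrite ger0_norm ?sqr_ge0// sqrrD.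
  have := sqr_ge0 (f x - g x); rewrite sqrrB; lra.
- by apply: intgZ; exact: intgD.
Qed.

Lemma L2_bdM f g C : L2 f -> measurable_fun setT g -> (forall x, `|g x| <= C) ->
  L2 (fun x => f x * g x).
Proof.
move=> [mf If] mg gC; split; first exact: measurable_funM.
apply: (@intg_le _ (fun x => C ^+ 2 * f x ^+ 2)).
- by apply: measurable_funX; exact: measurable_funM.
- move=> x; rewrite ger0_norm ?sqr_ge0// exprMn mulrC ler_wpM2r ?sqr_ge0//.
  by rewrite -real_normK ?num_real// lerXn2r ?nnegrE ?(le_trans _ (gC x)).
- exact: intgZ.
Qed.

Lemma L2Z c f : L2 f -> L2 (fun x => c * f x).
Proof.
move=> Lf; have := @L2_bdM f (fun=> c) `|c| Lf (measurable_cst _) (fun=> lexx _).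
by under eq_fun do rewrite mulrC.
Qed.

Lemma intg_bdM f g C : intg f -> measurable_fun setT g -> (forall x, `|g x| <= C) ->
  intg (fun x => f x * g x).
Proof.
move=> If mg gC; apply: (@intg_le _ (fun x => C * `|f x|)).
- by apply: measurable_funM => //; exact: intg_meas.
- by move=> x; rewrite normrM mulrC ler_wpM2r.
- by apply: intgZ; exact: intg_abs.
Qed.

(* Young's inequality with a free parameter stands in for Cauchy-Schwarz. *)
Lemma young (s a b : R) : 0 < s -> `|a * b| <= 2^-1 * (s * a ^+ 2 + s^-1 * b ^+ 2).
Proof.
move=> s0; have r0 : 0 < Num.sqrt s by rewrite sqrtr_gt0.
have := @norm_mul_le (Num.sqrt s * a) ((Num.sqrt s)^-1 * b).
rewrite mulrACA mulfV ?gt_eqF// mul1r !exprMn exprVn sqr_sqrtr ?(ltW s0)//.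
Qed.

Lemma I_young f g s : 0 < s -> L2 f -> L2 g ->
  `|\int[mu]_x (f x * g x)| <=
  2^-1 * (s * \int[mu]_x f x ^+ 2 + s^-1 * \int[mu]_x g x ^+ 2).
Proof.
move=> s0 Lf Lg; have [_ If] := Lf; have [_ Ig] := Lg.
rewrite -!IZ// -ID; [|exact: intgZ..].
rewrite -IZ; last by apply: intgD; exact: intgZ.
apply: I_norm_le => [||x]; last exact: young.
  exact: L2_mul.
by apply: intgZ; apply: intgD; exact: intgZ.
Qed.

End integrals.
Arguments intg {d T R} mu f.
Arguments L2 {d T R} mu f.

(** * Fubini's theorem for real-valued integrals *)

Section fubini.
Context d1 d2 (T1 : measurableType d1) (T2 : measurableType d2) (R : realType).
Variables (m1 : {sigma_finite_measure set T1 -> \bar R})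
  (m2 : {sigma_finite_measure set T2 -> \bar R}).
Local Notation m12 := (m1 \x m2)%E.
Implicit Type f : T1 * T2 -> R.

Lemma measurable_sec1 f x : measurable_fun setT f ->
  measurable_fun setT (fun y => f (x, y)).
Proof. by move=> mf; exact: measurableT_comp. Qed.

Lemma measurable_sec2 f y : measurable_fun setT f ->
  measurable_fun setT (fun x => f (x, y)).
Proof. by move=> mf; exact: measurableT_comp. Qed.

(** Measurability in the parameter, even across slices that are not integrable: the integral is a
    difference of two Tonelli integrals. *)
Lemma measurable_I2 f : measurable_fun setT f ->
  measurable_fun setT (fun x => \int[m2]_y f (x, y)).
Proof.
move=> mf; apply: measurableT_comp => //.
have mf' : measurable_fun setT (EFin \o f) by exact/measurable_EFinP.
have h1 := @measurable_fun_fubini_tonelli_F _ _ T1 T2 R m2 _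
  (measurable_funepos mf') (fun z => funepos_ge0 _ z).
have h2 := @measurable_fun_fubini_tonelli_F _ _ T1 T2 R m2 _
  (measurable_funeneg mf') (fun z => funeneg_ge0 _ z).
have := emeasurable_funB h1 h2.
apply: eq_measurable_fun => x _; rewrite integralE.
rewrite /= /fubini_F; congr (_ - _)%E;
  by apply: eq_integral => y _; rewrite unlock.
Qed.

Lemma measurable_I1 f : measurable_fun setT f ->
  measurable_fun setT (fun y => \int[m1]_x f (x, y)).
Proof.
move=> mf; apply: measurableT_comp => //.
have mf' : measurable_fun setT (EFin \o f) by exact/measurable_EFinP.
have h1 := @measurable_fun_fubini_tonelli_G _ _ T1 T2 R m1 _
  (measurable_funepos mf') (fun z => funepos_ge0 _ z).
have h2 := @measurable_fun_fubini_tonelli_G _ _ T1 T2 R m1 _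
  (measurable_funeneg mf') (fun z => funeneg_ge0 _ z).
have := emeasurable_funB h1 h2.
apply: eq_measurable_fun => x _; rewrite integralE.
rewrite /= /fubini_F; congr (_ - _)%E;
  by apply: eq_integral => y _; rewrite unlock.
Qed.

Lemma ae_intg1 f : intg m12 f -> {ae m1, forall x, intg m2 (fun y => f (x, y))}.
Proof. exact: ae_integrable1. Qed.

Lemma ae_intg2 f : intg m12 f -> {ae m2, forall y, intg m1 (fun x => f (x, y))}.
Proof. exact: ae_integrable2. Qed.

Lemma fub1 f : intg m12 f -> intg m1 (fun x => \int[m2]_y f (x, y)) /\
  \int[m1]_x (\int[m2]_y f (x, y)) = \int[m12]_z f z.
Proof.
move=> If; have mf := intg_meas If; have mI := measurable_I2 mf.
(* Almost every slice is integrable, and on such a slice the real integral and the extended one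
   agree. *)
have eqF : {ae m1, forall x, setT x ->
    (\int[m2]_y f (x, y))%:E = fubini_F m2 (EFin \o f) x}.
  by apply: filterS (ae_intg1 If) => x Ix _; rewrite -I_EFin.
have mF : measurable_fun setT (fubini_F m2 (EFin \o f)).
  exact: (measurable_fubini_F If).
split; last first.
  rewrite /Rintegral; congr fine.
  rewrite -(integral12_prod_meas1 If); apply: ae_eq_integral => //.
  exact/measurable_EFinP.
apply/integrableP; split; first exact/measurable_EFinP.
rewrite (ae_eq_integral (fun x => `|fubini_F m2 (EFin \o f) x|%E))//.
- by have /integrableP[] := integrable_fubini_F If.
- by apply: measurableT_comp => //; exact/measurable_EFinP.
- by apply: measurableT_comp.
- by apply: filterS eqF => x h t; rewrite -(h t).
Qed.

Lemma fub2 f : intg m12 f -> intg m2 (fun y => \int[m1]_x f (x, y)) /\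
  \int[m2]_y (\int[m1]_x f (x, y)) = \int[m12]_z f z.
Proof.
move=> If; have mf := intg_meas If; have mI := measurable_I1 mf.
have eqF : {ae m2, forall y, setT y ->
    (\int[m1]_x f (x, y))%:E = fubini_G m1 (EFin \o f) y}.
  by apply: filterS (ae_intg2 If) => x Ix _; rewrite -I_EFin.
have mF : measurable_fun setT (fubini_G m1 (EFin \o f)).
  exact: (measurable_fubini_G If).
split; last first.
  rewrite /Rintegral; congr fine.
  rewrite -(integral21_prod_meas1 If); apply: ae_eq_integral => //.
  exact/measurable_EFinP.
apply/integrableP; split; first exact/measurable_EFinP.
have mf' : measurable_fun setT (EFin \o f) by exact/measurable_EFinP.
apply: le_lt_trans ((integrable21ltyP m1 m2 mf').1 If).
have mA : measurable_fun setT (fun y => (\int[m1]_x `|(EFin \o f) (x, y)|)%E).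
  apply: (@measurable_fun_fubini_tonelli_G _ _ T1 T2 R m1
    (fun z => `|(EFin \o f) z|%E)) => //.
  by apply: measurableT_comp.
apply: ae_ge0_le_integral => //.
- by apply: measurableT_comp => //; exact/measurable_EFinP.
- by move=> y _; exact: integral_ge0.
apply: filterS eqF => y h t.
rewrite [leLHS](_ : _ = `|fubini_G m1 (EFin \o f) y|%E); last by rewrite -(h t).
apply: le_abse_integral => //; apply: measurableT_comp => //.
Qed.

Lemma intg_prod1 f : measurable_fun setT f ->
  (forall x, intg m2 (fun y => f (x, y))) ->
  intg m1 (fun x => \int[m2]_y `|f (x, y)|) -> intg m12 f.
Proof.
move=> mf I1 I2; apply/integrable12ltyP; first exact/measurable_EFinP.
rewrite [ltLHS](_ : _ = (\int[m1]_x (\int[m2]_y `|f (x, y)|)%:E)%E).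
  exact: intg_fin.
by apply: eq_integral => x _; rewrite -I_EFin//; exact: intg_abs.
Qed.

Lemma intg_prod2 f : measurable_fun setT f ->
  (forall y, intg m1 (fun x => f (x, y))) ->
  intg m2 (fun y => \int[m1]_x `|f (x, y)|) -> intg m12 f.
Proof.
move=> mf I1 I2; apply/integrable21ltyP; first exact/measurable_EFinP.
rewrite [ltLHS](_ : _ = (\int[m2]_y (\int[m1]_x `|f (x, y)|)%:E)%E).
  exact: intg_fin.
by apply: eq_integral => x _; rewrite -I_EFin//; exact: intg_abs.
Qed.

(** The shape of the bilinear forms with a bounded kernel that the mollification produces. *)
Lemma intg_tensor (a : T1 -> R) (b : T2 -> R) (k : T1 * T2 -> R) C : intg m1 a -> intg m2 b ->
  measurable_fun setT k -> (forall z, `|k z| <= C) ->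
  intg m12 (fun z => a z.1 * b z.2 * k z).
Proof.
move=> Ia Ib mk kC; apply: (@intg_bdM _ _ _ _ _ _ C) => //.
apply: intg_prod1.
- exact: measurable_funM (measurableT_comp (intg_meas Ia) measurable_fst)
    (measurableT_comp (intg_meas Ib) measurable_snd).
- by move=> x /=; exact: intgZ.
- have -> : (fun x => \int[m2]_y `|a x * b y|) =
            (fun x => (\int[m2]_y `|b y|) * `|a x|).
    apply/funext => x; rewrite mulrC -IZ; last exact: intg_abs.
    by apply: I_eq => y; rewrite normrM.
  by apply: intgZ; exact: intg_abs.
Qed.

(** The double integral of [|f|] is 0, so by Fubini almost every slice of [|f|] has integral 0. *)
Lemma ae_ae f : measurable_fun setT f -> {ae m12, forall z, f z = 0} ->
  {ae m1, forall x, {ae m2, forall y, f (x, y) = 0}}.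
Proof.
move=> mf f0.
have Ia : intg m12 (fun z => `|f z|).
  apply: (intg_ae_eq _ _ (intg0 _)); first exact: measurableT_comp.
  by apply: filterS f0 => z ->; rewrite normr0.
have [J Je] := fub1 Ia.
have z : \int[m1]_x \int[m2]_y `|f (x, y)| = 0.
  rewrite Je -[RHS](I0 m12); apply: I_ae => //; first exact: measurableT_comp.
  by apply: filterS f0 => z ->; rewrite normr0.
have := I_eq0_ae J (fun x => I_ge0 _ (fun y => normr_ge0 _)) z.
apply: filterS2 (ae_intg1 Ia) => x Ix hx.
have := I_eq0_ae Ix (fun y => normr_ge0 _) hx.
by apply: filterS => y /normr0_eq0.
Qed.

End fubini.

(** * Induction over measurable sets *)

Section sigma_induction.
Context {R : realType}.

Lemma real_sigma_ind (S : set (set R)) :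
  (forall A, S A -> S (~` A)) ->
  (forall F : nat -> set R, (forall n, S (F n)) -> S (\bigcup_n F n)) ->
  (forall c, S [set x | x < c]) ->
  forall A : set R, measurable A -> S A.
Proof.
move=> SC SU Sr A; rewrite [measurable]RGenInftyO.measurableE.
move: A; apply: smallest_sub.
  split=> [|B SB|//]; last by rewrite setTD; exact: SC.
  (* The rays up to the integers cover the line, so the empty set is obtained from the given closure
     properties. *)
  have -> : set0 = ~` (\bigcup_n [set x : R | x < n%:R]).
    apply/seteqP; split=> // x; apply.
    exists (Num.bound `|x|) => //=; rewrite (le_lt_trans (ler_norm x))//.
    exact: archi_boundP (normr_ge0 x).
  by apply: SC; apply: SU => n; exact: Sr.
by move=> _ [x ->]; rewrite (_ : [set` _] = [set y | y < x]).
Qed.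

(** Measurability is carried along the induction, because the closure hypotheses on [S] ask for it.
    The empty set is a separate case since for [n = 0] there is no half-space to start from. *)
Lemma rV_sigma_ind n (S : set (set 'rV[R]_n)) :
  S set0 ->
  (forall A, measurable A -> S A -> S (~` A)) ->
  (forall F : nat -> set 'rV[R]_n, (forall n, measurable (F n)) ->
    (forall n, S (F n)) -> S (\bigcup_n F n)) ->
  (forall i c, S [set y : 'rV[R]_n | y 0 i < c]) ->
  forall A : set 'rV[R]_n, measurable A -> S A.
Proof.
move=> S0 SC SU Sr A mA; suff [] : S A /\ measurable A by [].
move: A mA.
apply: (@smallest_sub _ (@sigma_algebra 'rV[R]_n setT) _
  [set A | S A /\ measurable A]).
  split; first by split=> //; exact: measurable0.
    by move=> A [SA mA]; rewrite setTD; split; [exact: SC|exact: measurableC].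
  move=> F SF; split; first by apply: SU => k; have [] := SF k.
  by apply: bigcup_measurable => k _; have [] := SF k.
rewrite -bigcup_seq => A [i _] [Y mY <-] /=; rewrite setTI.
move: Y mY; apply: real_sigma_ind.
- move=> Y [SY mY]; rewrite preimage_setC.
  by split; [exact: SC|exact: measurableC].
- move=> F SF; rewrite preimage_bigcup; split.
    by apply: SU => k; have [] := SF k.
  by apply: bigcup_measurable => k _; have [] := SF k.
- move=> c; split; first exact: Sr.
  rewrite -[X in measurable X]setTI; apply: (measurable_coord i) => //.
  by rewrite (_ : mkset _ = `]-oo, c[%classic).
Qed.

Lemma prod_sigma_ind d1 d2 (T1 : measurableType d1) (T2 : measurableType d2)
    (S : set (set (T1 * T2))) :
  S set0 ->
  (forall A, measurable A -> S A -> S (~` A)) ->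
  (forall F : nat -> set (T1 * T2), (forall n, measurable (F n)) ->
    (forall n, S (F n)) -> S (\bigcup_n F n)) ->
  (forall A, measurable A -> S (A `*` setT)) ->
  (forall B, measurable B -> S (setT `*` B)) ->
  forall A : set (T1 * T2), measurable A -> S A.
Proof.
move=> S0 SC SU S1 S2 A mA; suff [] : S A /\ measurable A by [].
(* A rectangle is the intersection of two cylinders; closure under intersection comes from
   complements and from a union padded with empty sets. *)
have SI A' B' : S A' /\ measurable A' -> S B' /\ measurable B' ->
    S (A' `&` B') /\ measurable (A' `&` B').
  move=> [SA mA'] [SB mB]; split; last exact: measurableI.
  rewrite -[A' `&` B']setCK setCI -bigcup2E.
  apply: (SC).
    by rewrite bigcup2E; apply: measurableU; exact: measurableC.
  apply: SU => -[|[|k]] /=; [exact: measurableC|exact: measurableC|exact: measurable0|exact: (SC)|exact: (SC)|exact: S0].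
move: A mA; rewrite measurable_prod_measurableType; apply: smallest_sub.
  rewrite -measurable_prod_measurableType.
  split; first by split=> //; exact: measurable0.
    by move=> A [SA mA]; rewrite setTD; split; [exact: SC|exact: measurableC].
  move=> F SF; split; first by apply: SU => k; have [] := SF k.
  by apply: bigcup_measurable => k _; have [] := SF k.
move=> _ [A mA [B mB <-]].
rewrite (_ : A `*` B = (A `*` setT) `&` (setT `*` B)); last first.
  by apply/seteqP; split=> [[x y] [/= ? ?]|[x y] [[/= ? _] [_ /= ?]]].
by rewrite -measurable_prod_measurableType; apply: SI; split;
  [exact: S1|exact: measurableX|exact: S2|exact: measurableX].
Qed.

End sigma_induction.

(** * Borel measurability of continuous functions *)

Section continuous_measurable.
Context {R : realType}.

Lemma measurable_discrete d (T : measurableType d) (C : countType) (c : T -> C)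
    (g : C -> R) :
  (forall v, measurable [set x | c x = v]) -> measurable_fun setT (g \o c).
Proof.
move=> mc _ Y mY; rewrite setTI.
rewrite (_ : _ @^-1` _ = \bigcup_(k : nat)
   (if unpickle k is Some v then if v \in g @^-1` Y then [set x | c x = v]
    else set0 else set0)).
  apply: bigcupT_measurable => k; case: unpickle => [v|//].
  by case: ifP => _; [exact: mc|exact: measurable0].
apply/seteqP; split=> [x Yx|x [k _]].
  by exists (pickle (c x)) => //; rewrite pickleK; case: ifPn => //; rewrite notin_setE.
by case: unpickle => [v|//]; case: ifPn => //; rewrite inE => Yv /= ->.
Qed.

Definition disc (k : nat) (x : R) : R := (Num.floor (x * k.+1%:R))%:~R / k.+1%:R.

Lemma disc_cvg (x : R) : disc k x @[k --> \oo] --> x.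
Proof.
apply/cvgrPdist_le => e e0; near=> k.
rewrite /disc -[x in x - _](@mulfK _ k.+1%:R) ?pnatr_eq0// -mulrBl normrM.
have /andP[h1 h2] := floor_itv (x * k.+1%:R).
rewrite ger0_norm ?subr_ge0// ger0_norm ?invr_ge0//.
apply: (@le_trans _ _ (1 * k.+1%:R^-1)).
  by rewrite ler_wpM2r ?invr_ge0// lerBlDl ltW//; move: h2; rewrite intrD.
rewrite mul1r; near: k.
by apply: filterS (near_infty_natSinv_lt (PosNum e0)) => j /ltW.
Unshelve. all: by end_near. Qed.

Lemma floor_measurable (k : nat) (v : int) :
  measurable [set x : R | Num.floor (x * k.+1%:R) = v].
Proof.
rewrite (_ : mkset _ = `[v%:~R / k.+1%:R, (v + 1)%:~R / k.+1%:R[%classic) //.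
apply/seteqP; split=> x /=; rewrite in_itv /= ler_pdivrMr// ltr_pdivlMr//.
  by move=> <-; exact: floor_itv.
exact: floor_def.
Qed.

Lemma rV_cvg n (s : nat -> 'rV[R]_n) (y : 'rV[R]_n) :
  (forall i, s k 0 i @[k --> \oo] --> y 0 i) -> s k @[k --> \oo] --> y.
Proof.
move=> h A [P hP PA]; rewrite /nbhs/=.
have : \forall k \near \oo, forall i, P 0 i (s k 0 i).
  by apply: filter_forall => i; exact: h (hP _ _).
apply: filterS => k hk; apply: PA => i j; rewrite ord1; exact: hk.
Qed.

(** The sigma-algebra is generated by coordinates, not by open sets. Rounding the coordinates down
    to a grid of mesh 1 / (k + 1) gives measurable functions with countably many values, and by
    continuity [f] of the rounded point tends to [f]. *)
Lemma continuous_measurable_rV n (f : 'rV[R]_n -> R) : continuous f ->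
  measurable_fun setT f.
Proof.
move=> cf; pose c k (y : 'rV[R]_n) : 'rV[int]_n := \row_i Num.floor (y 0 i * k.+1%:R).
pose h k (v : 'rV[int]_n) : 'rV[R]_n := \row_i ((v 0 i)%:~R / k.+1%:R).
apply: (@measurable_fun_cvg _ _ _ setT (fun k => f \o h k \o c k)).
  move=> k; apply: measurable_discrete => v.
  rewrite (_ : mkset _ = \big[setI/setT]_(i < n)
    ((fun y : 'rV[R]_n => y 0 i) @^-1` [set x | Num.floor (x * k.+1%:R) = v 0 i])).
    apply: bigsetI_measurable => i _; rewrite -[X in measurable X]setTI.
    by apply: (measurable_coord i) => //; exact: floor_measurable.
  rewrite -bigcap_seq; apply/seteqP; split=> [y /= <- i _ /=|y hy /=].
    by rewrite mxE.
  by apply/rowP => i; rewrite mxE; apply: hy => /=; rewrite mem_index_enum.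
move=> y _; apply: (cvg_comp (fun k => h k (c k y)) f _ (cf y)).
apply: rV_cvg => i; rewrite (_ : (fun k => _) = (fun k => disc k (y 0 i))).
  exact: disc_cvg.
by apply/funext => k; rewrite !mxE.
Qed.

Local Notation Xst n := (measurableTypeR R * 'rV[R]_n)%type.

End continuous_measurable.

(** * Integration over R^n one coordinate at a time *)

Section lebesgue_rV_tools.
Context {R : realType}.

Local Notation Xst n := (measurableTypeR R * 'rV[R]_n)%type.

Lemma measurable_rV_cons_st n :
  measurable_fun setT (@rV_cons R n : Xst n -> 'rV[R]_n.+1).
Proof. exact: measurable_rV_cons. Qed.

Lemma intg_rVS n (f : 'rV[R]_n.+1 -> R) : measurable_fun setT f ->
  intg (lebesgue_measure \x lebesgue_rV n)%E (f \o @rV_cons R n) ->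
  intg (lebesgue_rV n.+1) f.
Proof.
move=> mf If; apply: integrable_pushforward => //.
- exact: measurable_rV_cons_st.
- exact/measurable_EFinP.
Qed.

Lemma I_rVS n (f : 'rV[R]_n.+1 -> R) : measurable_fun setT f ->
  intg (lebesgue_measure \x lebesgue_rV n)%E (f \o @rV_cons R n) ->
  \int[lebesgue_rV n.+1]_y f y =
  \int[(lebesgue_measure \x lebesgue_rV n)%E]_z f (rV_cons z).
Proof.
move=> mf If; rewrite /Rintegral; congr fine.
have mf' : measurable_fun setT (EFin \o f) by exact/measurable_EFinP.
have := integral_pushforward (@measurable_rV_cons_st n) mf' If measurableT.
by rewrite preimage_setT.
Qed.

Lemma I_rV0 (f : 'rV[R]_0 -> R) : \int[lebesgue_rV 0]_y f y = f 0.
Proof.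
rewrite /Rintegral integral_dirac//= ?indicT ?mul1r//.
move=> _ Y mY; rewrite setTI; have [h|h] := pselect (Y (f 0)%:E).
  rewrite (_ : _ @^-1` _ = setT); first exact: measurableT.
  by apply/seteqP; split=> // y _ /=; rewrite (_ : y = 0)//; apply/rowP => -[].
rewrite (_ : _ @^-1` _ = set0); first exact: measurable0.
apply/seteqP; split=> // y /=; rewrite (_ : y = 0)//; by apply/rowP => -[].
Qed.

Lemma intg_rV0 (f : 'rV[R]_0 -> R) : intg (lebesgue_rV 0) f.
Proof.
have -> : f = cst (f 0).
  by apply/funext => y; rewrite (_ : y = 0)//; apply/rowP => -[].
apply: (@finite_measure_integrable_cst _ _ _
  (dirac (0 : 'rV[R]_0) : {finite_measure set 'rV[R]_0 -> \bar R})).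
exact: measurableT.
Qed.

Lemma measurable_prod_coord n (g : 'I_n -> R -> R) :
  (forall i, measurable_fun setT (g i)) ->
  measurable_fun setT (fun y : 'rV[R]_n => \prod_i g i (y 0 i)).
Proof.
move=> mg; apply: measurable_prod => i _.
exact: (measurableT_comp (mg i) (measurable_coord i)).
Qed.

Lemma prod_rV n (g : 'I_n -> R -> R) :
  (forall i, intg lebesgue_measure (g i)) ->
  intg (lebesgue_rV n) (fun y => \prod_i g i (y 0 i)) /\
  \int[lebesgue_rV n]_y (\prod_i g i (y 0 i)) =
  \prod_i \int[lebesgue_measure]_x g i x.
Proof.
elim: n g => [|n IH] g Ig.
  by split; [exact: intg_rV0|rewrite I_rV0 !big_ord0].
have mg i := intg_meas (Ig i).
have [I1 I2] := IH (fun i => g (lift ord0 i)) (fun i => Ig (lift ord0 i)).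
have E (z : R * 'rV[R]_n) : \prod_i g i (rV_cons z 0 i) =
    g ord0 z.1 * (\prod_i g (lift ord0 i) (z.2 0 i)) * 1.
  rewrite big_ord_recl mulr1 rV_consE unlift_none; congr (_ * _).
  by apply: eq_bigr => i _; rewrite rV_consE liftK.
have n1 (z : R * 'rV[R]_n) : `|1 : R| <= 1 by rewrite normr1.
have It := @intg_tensor _ _ _ _ R lebesgue_measure (lebesgue_rV n) _ _
  (fun=> 1) 1 (Ig ord0) I1 (measurable_cst _) n1.
have I3 : intg (lebesgue_measure \x lebesgue_rV n)%E
    ((fun y : 'rV[R]_n.+1 => \prod_i g i (y 0 i)) \o @rV_cons R n).
  have -> : (fun y : 'rV[R]_n.+1 => \prod_i g i (y 0 i)) \o @rV_cons R n =
      (fun z => g ord0 z.1 * (\prod_i g (lift ord0 i) (z.2 0 i)) * 1).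
    by apply/funext => z; rewrite /= E.
  exact: It.
have mp := measurable_prod_coord mg.
split; first exact: intg_rVS.
rewrite I_rVS//.
transitivity (\int[(lebesgue_measure \x lebesgue_rV n)%E]_z
    (g ord0 z.1 * (\prod_i g (lift ord0 i) (z.2 0 i)) * 1)).
  by apply: I_eq => z; exact: E.
rewrite -(fub1 It).2 /= big_ord_recl -I2.
rewrite mulrC -IZ//; apply: I_eq => x; rewrite mulrC -IZ//.
by apply: I_eq => y; rewrite mulr1.
Qed.

Definition box n (m : R) : set 'rV[R]_n := [set y | forall i, `|y 0 i| <= m].

Lemma indic_le (c m x : R) : \1_`[c - m, c + m] x = (`|x - c| <= m)%R%:R :> R.
Proof. by rewrite indicE mem_setE in_itv /= ler_distl. Qed.

Lemma indic_box n m (y : 'rV[R]_n) :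
  \1_(@box n m) y = \prod_i \1_`[0 - m, 0 + m] (y 0 i) :> R.
Proof.
have [h|h] := pselect (@box n m y).
  rewrite indicE mem_set// big1// => i _.
  by rewrite indic_le subr0 h.
rewrite indicE memNset//; move/existsNP : h => [i h].
by rewrite (bigD1 i)//= indic_le subr0 (negbTE (introN idP h)) mul0r.
Qed.

Lemma measurable_indicR d (T : measurableType d) (A : set T) : measurable A ->
  measurable_fun setT (\1_A : T -> R).
Proof. by move=> mA; exact: measurable_indic. Qed.

Lemma measurable_box n m : measurable (@box n m).
Proof.
rewrite (_ : @box n m = \big[setI/setT]_(i < n)
    ((fun y : 'rV[R]_n => y 0 i) @^-1` `[0 - m, 0 + m]%classic)).
  apply: bigsetI_measurable => i _; rewrite -[X in measurable X]setTI.
  by apply: (measurable_coord i).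
rewrite -bigcap_seq; apply/seteqP; split=> y /= h i => [_ /=|].
  by rewrite in_itv /= sub0r add0r -ler_norml; exact: h.
have := h i; rewrite /= mem_index_enum in_itv /= sub0r add0r -ler_norml.
exact.
Qed.

Lemma I_indic_itv (c m : R) : 0 <= m ->
  intg lebesgue_measure (\1_`[c - m, c + m] : R -> R) /\
  \int[lebesgue_measure]_x (\1_`[c - m, c + m] x) = 2 * m :> R.
Proof.
move=> m0; split; first exact: (integrable_indic_itv _ _ true false).
rewrite /Rintegral integral_indic//= setIT lebesgue_measure_itv/= lte_fin.
case: ifPn => [_|]; first by rewrite /=; lra.
by rewrite -leNgt => h; rewrite /=; lra.
Qed.

Lemma intg_box n m : 0 <= m -> intg (lebesgue_rV n) (\1_(@box n m)).
Proof.
move=> m0; rewrite (_ : \1_(@box n m) =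
  (fun y : 'rV[R]_n => \prod_i \1_`[0 - m, 0 + m] (y 0 i))).
  by apply: (prod_rV (fun i => (I_indic_itv 0 m0).1)).1.
by apply/funext => y; exact: indic_box.
Qed.

(** A slab around the boundary of a half-space, where mollifying the indicator of the half-space has
    an effect. The slab is 2 e thick, and the other n - 1 sides, each 2 m long, are bounded by
    powers of 1 + 2 m to avoid the exponent n - 1. *)
Lemma slab_le n (i : 'I_n) (c m e : R) : 0 <= m -> 0 <= e ->
  intg (lebesgue_rV n)
    (fun y => \1_(@box n m) y * \1_`[c - e, c + e] (y 0 i)) /\
  \int[lebesgue_rV n]_y (\1_(@box n m) y * \1_`[c - e, c + e] (y 0 i))
   <= (1 + 2 * m) ^+ n * e *+ 2.
Proof.
move=> m0 e0.
pose g (j : 'I_n) x : R := \1_`[0 - m, 0 + m] x *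
  (if j == i then \1_`[c - e, c + e] x else 1).
have E y : \1_(@box n m) y * \1_`[c - e, c + e] (y 0 i) = \prod_j g j (y 0 j).
  rewrite /g big_split /= -indic_box; congr (_ * _).
  by rewrite (bigD1 i)//= eqxx big1 ?mulr1// => j /negbTE ->.
have Ig j : intg lebesgue_measure (g j).
  apply: (intg_bdM (C := 1) (I_indic_itv 0 m0).1).
    case: (j == i); last exact: measurable_cst.
    by apply: measurable_indic; exact: measurable_itv.
  by move=> x; case: (j == i); rewrite ?normr1// indicE; case: (x \in _);
    rewrite /= ?normr1 ?normr0 ?ler01.
have [I1 I2] := prod_rV Ig.
rewrite (_ : (fun y => _) = (fun y : 'rV[R]_n => \prod_j g j (y 0 j))).
  split=> //; rewrite [leLHS]I2 (bigD1 i)//= mulrC -mulrnAr.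
  have Ig0 j : 0 <= \int[lebesgue_measure]_x g j x.
    apply: I_ge0 => x; rewrite mulr_ge0 ?indicE//.
    by case: ifP; rewrite ?ler01// indicE.
  have I1' : \int[lebesgue_measure]_x (1 : R) * 0 = 0 by rewrite mulr0.
  apply: ler_pM => //; first exact: prodr_ge0.
    apply: (@le_trans _ _ (\prod_(j < n | j != i) (1 + 2 * m))).
      apply: ler_prod => j ji; rewrite Ig0 /=.
      rewrite (_ : \int[lebesgue_measure]_x g j x = 2 * m) ?lerDr//.
      rewrite -(I_indic_itv 0 m0).2; apply: I_eq => x.
      by rewrite /g (negbTE ji) mulr1.
    rewrite prodr_const; apply: ler_weXn2l; first by lra.
    by rewrite (leq_trans (max_card _))// card_ord.
  apply: (@le_trans _ _ (\int[lebesgue_measure]_x \1_`[c - e, c + e] x)).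
    apply: I_le => //; first exact: (I_indic_itv c e0).1.
    by move=> x; rewrite /g eqxx !indicE; case: (x \in _); case: (x \in _);
      rewrite /= ?mulr1 ?mulr0 ?ler01.
  by rewrite (I_indic_itv c e0).2 mulr_natl.
by apply/funext => y; exact: E.
Qed.

End lebesgue_rV_tools.

(** * Mollification *)

Section mollifiers.
Context d (T : measurableType d) (R : realType).
Variables (mu : {sigma_finite_measure set T -> \bar R}) (E : nat -> set T)
  (K : nat -> T * T -> R).
Hypothesis mE : forall m, measurable (E m).
Hypothesis IE : forall m, intg mu (\1_(E m)).
Hypothesis Einc : forall m, E m `<=` E m.+1.
Hypothesis ET : forall x, exists m, E m x.
Hypothesis mK : forall n, measurable_fun setT (K n).
Hypothesis K0 : forall n z, 0 <= K n z.
Hypothesis KC : forall n x y, K n (x, y) = K n (y, x).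
Hypothesis IK : forall n x, intg mu (fun y => K n (x, y)).
Hypothesis K1 : forall n x, \int[mu]_y K n (x, y) = 1.
Hypothesis Kloc : forall n m x y, E m x -> K n (x, y) != 0 -> E m.+1 y.
Local Notation mm := (mu \x mu)%E.
Implicit Types (a b f g h : T -> R) (A : set T).

(** For a mollifying kernel, the pairing of [a] with the mollification of [b], kept as a double
    integral so that the two factors play symmetric roles. *)
Definition bil (k : T * T -> R) a b := \int[mm]_z (a z.1 * b z.2 * k z).

Lemma m1c f : measurable_fun setT f -> measurable_fun setT (fun z : T * T => f z.1).
Proof. by move=> mf; exact: (measurableT_comp mf measurable_fst). Qed.

Lemma m2c f : measurable_fun setT f -> measurable_fun setT (fun z : T * T => f z.2).
Proof. by move=> mf; exact: (measurableT_comp mf measurable_snd). Qed.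

Lemma intgK1 n a : intg mu a -> intg mm (fun z => a z.1 * K n z) /\
  \int[mm]_z (a z.1 * K n z) = \int[mu]_x a x.
Proof.
move=> Ia.
have I12 : intg mm (fun z => a z.1 * K n z).
  apply: intg_prod1.
  - by apply: measurable_funM; [apply: m1c; exact: (intg_meas Ia)|exact: mK].
  - by move=> x /=; apply: intgZ; exact: IK.
  - have -> : (fun x => \int[mu]_y `|a (x, y).1 * K n (x, y)|) = (fun x => `|a x|).
      apply/funext => x; rewrite -[RHS]mulr1 -(K1 n x) -IZ//.
      by apply: I_eq => y /=; rewrite normrM (ger0_norm (K0 _ _)).
    exact: intg_abs.
split=> //; rewrite -(fub1 I12).2; apply: I_eq => x /=.
by rewrite IZ// K1 mulr1.
Qed.

Lemma intgK2 n a : intg mu a -> intg mm (fun z => a z.2 * K n z) /\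
  \int[mm]_z (a z.2 * K n z) = \int[mu]_x a x.
Proof.
move=> Ia.
have IK' y : intg mu (fun x => K n (x, y)).
  by under [X in intg _ X]eq_fun do rewrite KC; exact: IK.
have K1' y : \int[mu]_x K n (x, y) = 1.
  by rewrite -(K1 n y); apply: I_eq => x; rewrite KC.
have I12 : intg mm (fun z => a z.2 * K n z).
  apply: intg_prod2.
  - by apply: measurable_funM; [apply: m2c; exact: (intg_meas Ia)|exact: mK].
  - by move=> y /=; apply: intgZ; exact: IK'.
  - have -> : (fun y => \int[mu]_x `|a (x, y).2 * K n (x, y)|) = (fun x => `|a x|).
      apply/funext => y; rewrite -[RHS]mulr1 -(K1' y) -IZ//.
      by apply: I_eq => x /=; rewrite normrM (ger0_norm (K0 _ _)).
    exact: intg_abs.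
split=> //; rewrite -(fub2 I12).2; apply: I_eq => y /=.
by rewrite IZ// K1' mulr1.
Qed.

(** The mean oscillation of [f] on [E m] at the scale of the kernel. It replaces the density of
    continuous functions in L^2: it tends to 0 for indicators by induction over measurable sets,
    then for bounded functions, and truncation reaches L^2. *)
Definition osc n m f := \int[mm]_z (\1_(E m) z.1 * `|f z.1 - f z.2| * K n z).

Lemma ind01 A x : ((0 : R) <= (\1_A x : R)) && ((\1_A x : R) <= 1).
Proof. by rewrite indicE; case: (x \in A); rewrite /= ?lexx ?ler01. Qed.

Lemma osc_intg n m f C : measurable_fun setT f -> (forall x, `|f x| <= C) ->
  intg mm (fun z => \1_(E m) z.1 * `|f z.1 - f z.2| * K n z).
Proof.
move=> mf fC; apply: (@intg_le _ _ _ _ _ (fun z => (C + C) * (\1_(E m) z.1 * K n z))).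
- apply: measurable_funM => //; apply: measurable_funM.
    by apply: m1c; exact: measurable_indic.
  by apply: measurableT_comp => //; apply: measurable_funB; [exact: m1c|exact: m2c].
- move=> [x y] /=; have /andP[i0 i1] := ind01 (E m) x.
  rewrite !normrM normr_id (ger0_norm i0) (ger0_norm (K0 _ _)) mulrA ler_wpM2r//.
  rewrite mulrC ler_wpM2r// (le_trans (ler_normB _ _))//.
  by rewrite lerD.
- by apply: intgZ; exact: (intgK1 n (IE m)).1.
Qed.

Lemma osc_ge0 n m f : 0 <= osc n m f.
Proof.
by apply: I_ge0 => z; rewrite !mulr_ge0//; have /andP[] := ind01 (E m) z.1.
Qed.

Lemma osc_le n m f g h C : measurable_fun setT f -> measurable_fun setT g ->
  measurable_fun setT h -> (forall x, `|f x| <= C) -> (forall x, `|g x| <= C) ->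
  (forall x, `|h x| <= C) ->
  (forall x y, `|f x - f y| <= `|g x - g y| + `|h x - h y|) ->
  osc n m f <= osc n m g + osc n m h.
Proof.
move=> mf mg mh fC gC hC H; rewrite -ID; [|exact: osc_intg..].
apply: I_le; first exact: osc_intg.
  by apply: intgD; exact: osc_intg.
by move=> [x y] /=; rewrite -mulrDl ler_wpM2r// -mulrDr ler_wpM2l.
Qed.

Definition osc0 f := forall m, osc n m f @[n --> \oo] --> 0.

Lemma osc0C A : measurable A -> osc0 (\1_A) -> osc0 (\1_(~` A)).
Proof.
move=> mA h m; have := h m; rewrite (_ : (fun n => osc n m (\1_(~` A))) =
  (fun n => osc n m (\1_A)))//.
apply/funext => n; apply: I_eq => -[x y] /=; congr (_ * _ * _).
rewrite !indicE !in_setC.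
by case: (x \in A); case: (y \in A); rewrite /= ?subrr ?subr0 ?sub0r ?normrN.
Qed.

Lemma ind_norm A x : `|\1_A x : R| <= 1.
Proof. by have /andP[? ?] := ind01 A x; rewrite ger0_norm. Qed.

Lemma osc0U A B : measurable A -> measurable B -> osc0 (\1_A) -> osc0 (\1_B) ->
  osc0 (\1_(A `|` B)).
Proof.
move=> mA mB hA hB m.
apply: (@squeeze_cvgr _ _ _ _ (fun=> 0) (fun n => osc n m (\1_A) + osc n m (\1_B))).
- near=> n; rewrite osc_ge0 /=.
  apply: (@osc_le _ _ _ _ _ 1); try (by exact: ind_norm).
  + by apply: measurable_indic; exact: measurableU.
  + exact: measurable_indic.
  + exact: measurable_indic.
  move=> x y; rewrite !indicE !in_setU.
  by case: (x \in A); case: (x \in B); case: (y \in A); case: (y \in B);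
    rewrite /= ?subrr ?subr0 ?sub0r ?normrN ?normr0 ?normr1; lra.
- exact: cvg_cst.
- by rewrite -[X in _ --> X]addr0; apply: cvgD; [exact: hA|exact: hB].
Unshelve. all: by end_near. Qed.

Lemma osc0_set0 : osc0 (\1_set0).
Proof.
move=> m; rewrite (_ : (fun n => _) = (fun=> 0)); first exact: cvg_cst.
apply/funext => n; rewrite -[RHS](I0 mm); apply: I_eq => z.
by rewrite !indicE !in_set0 subrr normr0 mulr0 mul0r.
Qed.

(** If the kernel does not vanish and x lies in [E m], then both points lie in [E m.+1]; each of
    them contributes the measure of [A] there, since both marginals of the kernel have mass 1. *)
Lemma osc_tail n m A : measurable A ->
  osc n m (\1_A) <= 2 * \int[mu]_x (\1_(E m.+1) x * \1_A x).
Proof.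
move=> mA.
have I1 k : intg mu (fun x => \1_(E k) x * \1_A x : R).
  by apply: (intg_bdM (C := 1) (IE k)); [exact: measurable_indic|exact: ind_norm].
have [J1 J1e] := intgK1 n (I1 m.+1); have [J2 J2e] := intgK2 n (I1 m.+1).
rewrite mulr_natl mulr2n -{1}J1e -J2e -ID//.
apply: I_le => //.
- by apply: (@osc_intg _ _ _ 1); [exact: measurable_indic|exact: ind_norm].
- exact: intgD.
move=> [x y] /=; rewrite -mulrDl.
have [->|Kn] := eqVneq (K n (x, y)) 0; first by rewrite !mulr0.
apply: ler_wpM2r => //.
rewrite [\1_(E m) x]indicE; case: (boolP (x \in E m)) => [|_]; last first.
  by rewrite mul0r addr_ge0// mulr_ge0//; have /andP[] := ind01 _ _.
rewrite inE mul1r => Ex.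
rewrite !indicE (mem_set (Kloc Ex Kn)) (mem_set (Einc Ex)) !mul1r.
by case: (x \in A); case: (y \in A); rewrite /= ?subrr ?subr0 ?sub0r ?normrN ?normr0 ?normr1; lra.
Qed.

Lemma osc0_bigcup (F : nat -> set T) : (forall k, measurable (F k)) ->
  (forall k, osc0 (\1_(F k))) -> osc0 (\1_(\bigcup_k F k)).
Proof.
move=> mF hF m.
pose U N := \big[setU/set0]_(k < N) F k.
have mU N : measurable (U N) by apply: bigsetU_measurable.
have hU N : osc0 (\1_(U N)).
  elim: N => [|N IH]; first by rewrite /U big_ord0; exact: osc0_set0.
  by rewrite /U big_ord_recr /=; apply: osc0U => //; exact: mU.
pose D N := (\bigcup_k F k) `\` U N.
have mb : measurable (\bigcup_k F k) by exact: bigcupT_measurable.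
have mD N : measurable (D N) by exact: measurableD.
have tail : \int[mu]_x (\1_(E m.+1) x * \1_(D N) x) @[N --> \oo] --> (0 : R).
  rewrite -[X in _ --> X](I0 mu); apply: (dct (g := \1_(E m.+1))) => //.
  - by move=> N; apply: measurable_funM; exact: measurable_indic.
  - apply: aeW => x; apply: cvg_near_cst.
    have [[k _ Fk]|h] := pselect ((\bigcup_k F k) x); last first.
      near=> N; rewrite (_ : \1_(D N) x = 0) ?mulr0// indicE memNset// => -[Dx _].
      exact: (h Dx).
    near=> N; rewrite (_ : \1_(D N) x = 0) ?mulr0// indicE memNset// => -[_].
    apply; rewrite /U -bigcup_mkord; exists k => //=; near: N.
    exact: nbhs_infty_gt.
  - move=> N x; rewrite normrM ger0_norm; last by have /andP[] := ind01 (E m.+1) x.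
    by rewrite ler_piMr ?ind_norm//; have /andP[] := ind01 (E m.+1) x.
apply/cvgrPdist_le => e e0.
have e4 : 0 < e / 4 by lra.
(* A quarter, because [osc_tail] doubles it; the other half of [e] is spent on the finite union. *)
have [N _ hN] := cvg_dist tail e4.
have {hN} := hN N (leqnn N).
rewrite subr0 ger0_norm => [hN|]; last first.
  by apply: I_ge0 => x; rewrite mulr_ge0//; have /andP[] := ind01 _ _.
have e2 : 0 < e / 2 by lra.
have := cvg_dist (hU N m) e2; apply: filterS => n.
rewrite subr0 ger0_norm ?osc_ge0// => hn; rewrite sub0r normrN ger0_norm ?osc_ge0//.
apply: (@le_trans _ _ (osc n m (\1_(U N)) + osc n m (\1_(D N)))).
  apply: (@osc_le _ _ _ _ _ 1); try (by exact: ind_norm);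
    try (by exact: measurable_indic).
  have sub x : x \in U N -> x \in \bigcup_k F k.
    by rewrite !inE /U -bigcup_mkord => -[k _ Fk]; exists k.
  move=> x y; rewrite !indicE !in_setD.
  have := sub x; have := sub y.
  case: (x \in U N); case: (x \in \bigcup_k _); case: (y \in U N); case: (y \in \bigcup_k _) => //= h1 h2;
    try (by have := h1 isT); try (by have := h2 isT);
    rewrite /= ?subrr ?subr0 ?sub0r ?normrN ?normr0 ?normr1; lra.
have := osc_tail n m (mD N); lra.
Unshelve. all: by end_near. Qed.

Hypothesis Hsets : forall A, measurable A -> osc0 (\1_A).

(** Binary digits: b = (1_A + b') / 2 with A the set where b >= 1/2 and b' again between 0 and 1.
    The indicator has small oscillation, and each digit removed halves the trivial bound on the
    rest. *)
Lemma osc_digits N b m e : measurable_fun setT b -> (forall x, 0 <= b x <= 1) ->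
  0 < e -> \forall n \near \oo,
  osc n m b <= (2^-1) ^+ N * \int[mu]_x \1_(E m) x + e.
Proof.
elim: N b e => [|N IH] b e mb b01 e0.
  near=> n; rewrite expr0 mul1r -(intgK1 n (IE m)).2.
  apply: (@le_trans _ _ (\int[mm]_z (\1_(E m) z.1 * K n z))); last by lra.
  have bn x : `|b x| <= 1.
    by have /andP[? ?] := b01 x; rewrite ger0_norm.
  apply: I_le; first exact: (@osc_intg _ _ _ 1).
    exact: (intgK1 n (IE m)).1.
  move=> [x y] /=; rewrite ler_wpM2r// ler_piMr//.
  have /andP[? ?] := b01 x; have /andP[? ?] := b01 y.
  by rewrite ler_norml; apply/andP; split; lra.
pose A := [set x | 2^-1 <= b x].
have mA : measurable A.
  have := mb measurableT _ (measurable_itv `[2^-1, +oo[); rewrite setTI.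
  rewrite (_ : _ @^-1` _ = A)//.
  by apply/seteqP; split=> x; rewrite /A /= in_itv /= andbT.
pose b' x := 2 * b x - \1_A x.
have mb' : measurable_fun setT b'.
  apply: measurable_funB; last exact: measurable_indic.
  exact: measurable_funM.
have b'01 x : 0 <= b' x <= 1.
  rewrite /b' indicE; have /andP[h0 h1] := b01 x.
  case: (boolP (x \in A)); rewrite ?inE ?notin_setE /A /=.
    by move=> h; apply/andP; split; lra.
  by move=> /negP; rewrite -ltNge => h; apply/andP; split; lra.
have e2 : 0 < e / 2 by lra.
have h1 := IH b' _ mb' b'01 e2.
have h2 := cvg_dist (Hsets mA m) e2.
apply: filterS2 h1 h2 => n h1; rewrite subr0 ger0_norm ?osc_ge0// => h2.
have hb x : `|b x| <= 1 by have /andP[? ?] := b01 x; rewrite ger0_norm.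
have hb' x : `|b' x| <= 1 by have /andP[? ?] := b'01 x; rewrite ger0_norm.
have mA1 : measurable_fun setT (\1_A : T -> R) by exact: measurable_indic.
have J1 := osc_intg n m mA1 (ind_norm A).
have J2 := osc_intg n m mb' hb'.
have : osc n m b <= 2^-1 * (osc n m (\1_A) + osc n m b').
  rewrite -ID// -IZ; last exact: intgD.
  apply: I_le; first exact: (@osc_intg _ _ _ 1).
    by apply: intgZ; exact: intgD.
  move=> [x y] /=; rewrite -mulrDl mulrA ler_wpM2r// -mulrDr mulrCA ler_wpM2l//.
  rewrite /b'; have := ler_normD (\1_A x - \1_A y) (2 * b x - \1_A x - (2 * b y - \1_A y)).
  have -> : \1_A x - \1_A y + (2 * b x - \1_A x - (2 * b y - \1_A y)) = 2 * (b x - b y) by ring.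
  by rewrite normrM (ger0_norm (ler0n _ 2)); lra.
rewrite exprS -mulrA; lra.
Unshelve. all: by end_near. Qed.

Lemma osc0_bounded b C : measurable_fun setT b -> (forall x, `|b x| <= C) -> osc0 b.
Proof.
move=> mb bC m.
have C0 : 0 <= C by rewrite (le_trans _ (bC point)).
(* The added 1 keeps the divisor positive when [C] is 0; then [b'] takes its values between 0 and
   1. *)
pose D := C + 1.
have D0 : 0 < D by rewrite /D; lra.
pose b' x := (b x / D + 1) / 2.
have mb' : measurable_fun setT b'.
  apply: measurable_funM => //; apply: measurable_funD => //.
  exact: measurable_funM.
have b'01 x : 0 <= b' x <= 1.
  have : `|b x / D| <= 1.
    by rewrite normrM normfV (gtr0_norm D0) ler_pdivrMr// mul1r (le_trans (bC x))// /D; lra.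
  by rewrite ler_norml /b' => /andP[? ?]; apply/andP; split; lra.
have hb' x : `|b' x| <= 1 by have /andP[? ?] := b'01 x; rewrite ger0_norm.
have E0 n : osc n m b = 2 * D * osc n m b'.
  rewrite -IZ; last exact: (@osc_intg _ _ _ 1).
  apply: I_eq => -[x y] /=; rewrite /b'.
  have -> : (b x / D + 1) / 2 - (b y / D + 1) / 2 = (2 * D)^-1 * (b x - b y).
    by field; rewrite gt_eqF.
  rewrite normrM gtr0_norm ?invr_gt0; last by lra.
  by field; rewrite gt_eqF.
rewrite (_ : (fun n => _) = (fun n => 2 * D * osc n m b')); last exact/funext.
rewrite -[X in _ --> X](mulr0 (2 * D)); apply: cvgMr => /=.
apply/cvgrPdist_le => e e0.
have M0 : 0 <= \int[mu]_x \1_(E m) x :> R.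
  by apply: I_ge0 => x; have /andP[] := ind01 (E m) x.
have [N hN] : exists N, (2^-1) ^+ N * \int[mu]_x \1_(E m) x <= e / 2.
  have : (2^-1) ^+ N * (\int[mu]_x \1_(E m) x) @[N --> \oo] --> (0 : R).
    rewrite -[X in _ --> X](mul0r (\int[mu]_x \1_(E m) x)); apply: cvgMl => /=.
    by apply: cvg_expr; rewrite ger0_norm// invf_lt1//; lra.
  have e2 : 0 < e / 2 by lra.
  move=> /cvgrPdist_le /(_ _ e2) [N _ hN]; exists N; have := hN N (leqnn N).
  by rewrite sub0r normrN ger0_norm// mulr_ge0// exprn_ge0// invr_ge0.
have e2 : 0 < e / 2 by lra.
have := osc_digits N m mb' b'01 e2; apply: filterS => n.
by rewrite sub0r normrN ger0_norm ?osc_ge0//; lra.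
Qed.

Lemma bil_intg n a b : L2 mu a -> L2 mu b ->
  intg mm (fun z => a z.1 * b z.2 * K n z).
Proof.
move=> [ma Ia] [mb Ib].
apply: (@intg_le _ _ _ _ _ (fun z => 2^-1 * (a z.1 ^+ 2 * K n z + b z.2 ^+ 2 * K n z))).
- by apply: measurable_funM => //; apply: measurable_funM; [exact: m1c|exact: m2c].
- move=> [x y] /=; rewrite normrM (ger0_norm (K0 _ _)) -mulrDl mulrA ler_wpM2r//.
  exact: norm_mul_le.
- apply: intgZ; apply: intgD; [exact: (intgK1 n Ia).1|exact: (intgK2 n Ib).1].
Qed.

Lemma bil_le n a b s : 0 < s -> L2 mu a -> L2 mu b -> `|bil (K n) a b| <=
  2^-1 * (s * \int[mu]_x a x ^+ 2 + s^-1 * \int[mu]_x b x ^+ 2).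
Proof.
move=> s0 La Lb; have [_ Ia] := La; have [_ Ib] := Lb.
have [J1 J1e] := intgK1 n Ia; have [J2 J2e] := intgK2 n Ib.
rewrite -J1e -J2e -!IZ// -ID; [|exact: intgZ..].
rewrite -IZ; last by apply: intgD; exact: intgZ.
apply: I_norm_le => [||[x y]/=]; first exact: bil_intg.
  by apply: intgZ; apply: intgD; exact: intgZ.
rewrite normrM (ger0_norm (K0 _ _)).
have -> : 2^-1 * (s * (a x ^+ 2 * K n (x, y)) + s^-1 * (b y ^+ 2 * K n (x, y))) =
  2^-1 * (s * a x ^+ 2 + s^-1 * b y ^+ 2) * K n (x, y) by ring.
by rewrite ler_wpM2r//; exact: young.
Qed.

(** Cut in value and in space at once: the product of two truncations is controlled by [osc] on the
    single set [E k]. *)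
Definition trunc k a x := a x * \1_([set x | `|a x| <= k%:R] `&` E k) x.

Lemma trunc_meas k a : measurable_fun setT a -> measurable_fun setT (trunc k a).
Proof.
move=> ma; apply: measurable_funM => //; apply: measurable_indic.
apply: measurableI => //; rewrite -[X in measurable X]setTI.
have m' : measurable_fun setT (fun x => `|a x|) by apply: measurableT_comp.
rewrite (_ : mkset _ = (fun x => `|a x|) @^-1` `]-oo, k%:R]%classic).
  exact: m'.
by apply/seteqP; split=> x /=; rewrite in_itv.
Qed.

Lemma trunc_bd k a x : `|trunc k a x| <= k%:R * \1_(E k) x.
Proof.
rewrite /trunc !indicE in_setI normrM normr_nat.
case: (boolP (x \in E k)); rewrite ?andbF ?mulr0// andbT mulr1 => _.
case: (boolP (x \in _)); rewrite ?inE /= ?mulr1// mulr0//.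
Qed.

Lemma trunc_L2 k a : L2 mu a -> L2 mu (trunc k a).
Proof.
move=> [ma Ia]; split; first exact: trunc_meas.
apply: intg_le Ia; first by apply: measurable_funX; exact: trunc_meas.
move=> x; rewrite ger0_norm ?sqr_ge0// /trunc exprMn ler_piMr ?sqr_ge0//.
Qed.

Lemma trunc_cvg a : L2 mu a ->
  \int[mu]_x (a x - trunc k a x) ^+ 2 @[k --> \oo] --> (0 : R).
Proof.
move=> [ma Ia]; rewrite -[X in _ --> X](I0 mu); apply: dct Ia _ => //.
- move=> k; apply: measurable_funX; apply: measurable_funB => //; exact: trunc_meas.
- apply: aeW => x; apply: cvg_near_cst.
  have [m Em] := ET x.
  have Ek k : (m <= k)%N -> E k x.
    elim: k => [|k IH]; first by rewrite leqn0 => /eqP <-.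
    by rewrite leq_eqVlt => /orP[/eqP <-//|]; rewrite ltnS => /IH; exact: Einc.
  near=> k; rewrite /trunc indicE mem_set ?mulr1 ?subrr ?expr0n//; split => /=.
    apply: ltW; near: k; exact: nbhs_infty_gtr.
  by apply: Ek; near: k; exact: nbhs_infty_ge.
- move=> k x; rewrite ger0_norm ?sqr_ge0// /trunc -[X in X - _]mulr1 -mulrBr exprMn.
  rewrite ler_piMr ?sqr_ge0// indicE; case: (_ \in _); rewrite ?subrr ?subr0; lra.
Unshelve. all: by end_near. Qed.

(** For truncations the defect [D] is at most a multiple of [osc]; as [D] is bilinear and bounded on
    L^2 uniformly in [n], the truncation errors can be removed. *)
Lemma mollify a b : L2 mu a -> L2 mu b ->
  bil (K n) a b @[n --> \oo] --> \int[mu]_x (a x * b x).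
Proof.
move=> La Lb.
pose D n a b := bil (K n) a b - \int[mu]_x (a x * b x).
have DE n f g s : 0 < s -> L2 mu f -> L2 mu g ->
    `|D n f g| <= s * \int[mu]_x f x ^+ 2 + s^-1 * \int[mu]_x g x ^+ 2.
  move=> s0 Lf Lg; apply: (le_trans (ler_normB _ _)).
  have := bil_le n s0 Lf Lg; have := I_young s0 Lf Lg; lra.
have Dd n f g h : L2 mu f -> L2 mu g -> L2 mu h ->
    D n (fun x => f x + g x) h = D n f h + D n g h.
  move=> Lf Lg Lh; rewrite /D addrACA -opprD /bil -ID; [|exact: bil_intg..].
  rewrite -ID; [|exact: L2_mul..].
  by congr (_ - _); apply: I_eq => x; ring.
have Dd' n f g h : L2 mu f -> L2 mu g -> L2 mu h ->
    D n f (fun x => g x + h x) = D n f g + D n f h.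
  move=> Lf Lg Lh; rewrite /D addrACA -opprD /bil -ID; [|exact: bil_intg..].
  rewrite -ID; [|exact: L2_mul..].
  by congr (_ - _); apply: I_eq => x; ring.
have DT k : D n (trunc k a) (trunc k b) @[n --> \oo] --> 0.
  have [mT _] := trunc_L2 k Lb.
  have Tk x : `|trunc k b x| <= k%:R.
    by rewrite (le_trans (trunc_bd _ _ _))// ler_piMr.
  have h := osc0_bounded mT Tk k.
  apply/norm_cvg0P.
  apply: (@squeeze_cvgr _ _ _ _ (fun=> 0) (fun n => k%:R * osc n k (trunc k b))).
  - near=> n; rewrite normr_ge0 /= /D.
    have [J Je] := intgK1 n (L2_mul (trunc_L2 k La) (trunc_L2 k Lb)).
    rewrite -Je -IB//; last exact: bil_intg (trunc_L2 k La) (trunc_L2 k Lb).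
    rewrite -IZ; last exact: osc_intg.
    apply: I_norm_le.
    + by apply: intgB => //; exact: bil_intg (trunc_L2 k La) (trunc_L2 k Lb).
    + by apply: intgZ; exact: osc_intg.
    move=> [x y] /=; rewrite -mulrBl -mulrBr normrM normrM (ger0_norm (K0 _ _)) mulrA.
    by rewrite ler_wpM2r// mulrA distrC ler_wpM2r//; exact: trunc_bd.
  - exact: cvg_cst.
  - by rewrite -[X in _ --> X](mulr0 k%:R); apply: cvgMr; exact: h.
apply/cvgrPdist_le => e e0.
set Na := \int[mu]_x a x ^+ 2; set Nb := \int[mu]_x b x ^+ 2.
have Na0 : 0 <= Na by apply: I_ge0 => x; exact: sqr_ge0.
have Nb0 : 0 <= Nb by apply: I_ge0 => x; exact: sqr_ge0.
(* Both squared norms times [s] are then at most e / 8, and truncation errors below s e / 8 stay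
   below e / 8 after division by [s]. *)
pose s := e / (8 * (Na + Nb + 1)).
have s0 : 0 < s by rewrite divr_gt0//; lra.
have sa : s * Na <= e / 8.
  by rewrite /s mulrAC ler_pdivrMr; [nra|lra].
have sb : s * Nb <= e / 8.
  by rewrite /s mulrAC ler_pdivrMr; [nra|lra].
have es : 0 < s * (e / 8) by rewrite mulr_gt0//; lra.
have [k [ha hb]] : exists k, \int[mu]_x (a x - trunc k a x) ^+ 2 <= s * (e / 8) /\
    \int[mu]_x (b x - trunc k b x) ^+ 2 <= s * (e / 8).
  have h1 := cvg_dist (trunc_cvg La) es.
  have h2 := cvg_dist (trunc_cvg Lb) es.
  have [k _ hk] := filterI h1 h2; have [] := hk k (leqnn k).
  rewrite !subr0 !ger0_norm => [? ?||]; first by exists k.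
    by apply: I_ge0 => x; exact: sqr_ge0.
  by apply: (@I_ge0 _ _ _ mu) => x; exact: sqr_ge0.
have e2 : 0 < e / 2 by lra.
have := cvg_dist (DT k) e2; apply: filterS => n.
rewrite subr0 => hn; rewrite distrC -/(D n a b).
have La' := trunc_L2 k La; have Lb' := trunc_L2 k Lb.
have Lda : L2 mu (fun x => a x - trunc k a x).
  by have := L2D La (L2Z (-1) La'); under eq_fun do rewrite mulN1r.
have Ldb : L2 mu (fun x => b x - trunc k b x).
  by have := L2D Lb (L2Z (-1) Lb'); under eq_fun do rewrite mulN1r.
have -> : D n a b = D n (trunc k a) (trunc k b) + D n (trunc k a) (fun x => b x - trunc k b x)
    + D n (fun x => a x - trunc k a x) b.
  rewrite -(Dd' n _ _ _ La' Lb' Ldb).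
  rewrite (_ : (fun x => trunc k b x + (b x - trunc k b x)) = b); last first.
    by apply/funext => x; rewrite addrC subrK.
  rewrite -(Dd n _ _ _ La' Lda Lb); congr (D n _ _).
  by apply/funext => x; rewrite addrC subrK.
have h1 := DE n _ _ _ s0 La' Ldb.
have h2 : `|D n (fun x => a x - trunc k a x) b| <= s^-1 * (s * (e / 8)) + e / 8.
  have si : 0 < s^-1 by rewrite invr_gt0.
  apply: (le_trans (DE n _ _ _ si Lda Lb)); rewrite invrK lerD//.
  by apply: ler_wpM2l; [exact: ltW|exact: ha].
have h3 : s * \int[mu]_x trunc k a x ^+ 2 <= e / 8.
  apply: le_trans sa; apply: ler_wpM2l; first exact: ltW.
  apply: I_le; [by case: La'|by case: La|] => x.
  by rewrite /trunc exprMn ler_piMr ?sqr_ge0.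
have h4 : s^-1 * \int[mu]_x (b x - trunc k b x) ^+ 2 <= s^-1 * (s * (e / 8)).
  by apply: ler_wpM2l; [rewrite invr_ge0; exact: ltW|exact: hb].
have ss : s^-1 * (s * (e / 8)) = e / 8 by rewrite mulKf// gt_eqF.
rewrite ss in h2 h4.
apply: (le_trans (ler_normD _ _)); have := ler_normD (D n (trunc k a) (trunc k b)) (D n (trunc k a) (fun x => b x - trunc k b x)).
lra.
Unshelve. all: by end_near. Qed.

End mollifiers.

(** * Smooth functions *)

Section smooth_line.
Context {R : realType}.
Implicit Types (f g : R -> R).

Definition derive_stable (C : (R -> R) -> Prop) := forall f, C f ->
  exists2 f', C f' & forall x, is_derive x (1 : R) f (f' x).

(** A coinductive form of smoothness: a closure property is proved by exhibiting one class stable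
    under derivation, without any formula for higher derivatives. *)
Definition smooth1 f := exists2 C, C f & derive_stable C.

Lemma smooth1_derive f : smooth1 f ->
  exists2 f', smooth1 f' & forall x, is_derive x (1 : R) f (f' x).
Proof.
move=> [C Cf CP]; have [f' Cf' h] := CP _ Cf.
by exists f' => //; exists C.
Qed.

Lemma smooth1_primitive f f' : smooth1 f' ->
  (forall x, is_derive x (1 : R) f (f' x)) -> smooth1 f.
Proof.
move=> [C Cf CP] h; exists (fun g => g = f \/ C g); first by left.
move=> g [->|/CP[g' Cg' hg]]; first by exists f' => //; right.
by exists g' => //; right.
Qed.

Lemma is_derive_continuous f (x df : R) : is_derive x (1 : R) f df ->
  {for x, continuous f}.
Proof. by move=> h; apply: differentiable_continuous; apply/derivable1_diffP. Qed.

Lemma smooth1_continuous f : smooth1 f -> continuous f.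
Proof.
by move=> /smooth1_derive[f' _ h] x; exact: is_derive_continuous (h x).
Qed.

(** The Leibniz rule leaves the set of products but not the algebra generated by smooth functions,
    which is therefore the stable class. *)
Inductive smooth_alg : (R -> R) -> Prop :=
| smooth_alg_gen f : smooth1 f -> smooth_alg f
| smooth_algD f g : smooth_alg f -> smooth_alg g -> smooth_alg (fun x => f x + g x)
| smooth_algM f g : smooth_alg f -> smooth_alg g -> smooth_alg (fun x => f x * g x).

Lemma smooth_alg_smooth1 f : smooth_alg f -> smooth1 f.
Proof.
move=> sf; exists smooth_alg => //; move=> {f sf} f; elim=> {f}.
- move=> f /smooth1_derive[f' sf' h].
  by exists f' => //; exact: smooth_alg_gen.
- move=> f g _ [f' sf' hf] _ [g' sg' hg].
  exists (fun x => f' x + g' x); first exact: smooth_algD.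
  by move=> x; apply: is_deriveD.
- move=> f g sf [f' sf' hf] sg [g' sg' hg].
  exists (fun x => f x * g' x + g x * f' x).
    by apply: smooth_algD; exact: smooth_algM.
  by move=> x; apply: is_deriveM.
Qed.

Lemma smooth1D f g : smooth1 f -> smooth1 g -> smooth1 (fun x => f x + g x).
Proof.
by move=> sf sg; apply: smooth_alg_smooth1; apply: smooth_algD; exact: smooth_alg_gen.
Qed.

Lemma smooth1M f g : smooth1 f -> smooth1 g -> smooth1 (fun x => f x * g x).
Proof.
by move=> sf sg; apply: smooth_alg_smooth1; apply: smooth_algM; exact: smooth_alg_gen.
Qed.

Lemma smooth1_cst c : smooth1 (fun=> c).
Proof.
exists (fun g => exists c, g = fun=> c); first by exists c.
by move=> g [k ->]; exists (fun=> 0); [exists 0|move=> x; exact: is_derive_cst].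
Qed.

Lemma smooth1_id : smooth1 id.
Proof.
apply: smooth1_primitive (smooth1_cst 1) _ => x; exact: is_derive_id.
Qed.

Lemma is_derive_affine (a b x : R) : is_derive x (1 : R) (fun x => a * x + b) a.
Proof.
have h : is_derive x (1 : R) (fun x => a * x + b) (a *: 1 + 0).
  exact: (is_deriveD (is_deriveZ a (is_derive_id x 1)) (is_derive_cst b x 1)).
by move: h; rewrite addr0 /GRing.scale /= mulr1.
Qed.

Lemma smooth1_affine f a b : smooth1 f -> smooth1 (fun x => f (a * x + b)).
Proof.
move=> [C Cf CP].
exists (fun g => exists c f, C f /\ g = fun x => c * f (a * x + b)).
  by exists 1, f; split => //; apply/funext => x; rewrite mul1r.
move=> _ [c [g [Cg ->]]]; have [g' Cg' h] := CP _ Cg.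
exists (fun x => c * a * g' (a * x + b)); first by exists (c * a), g'.
move=> x; have ha := is_derive_affine a b x.
have hc := @is_derive1_comp _ g (fun x => a * x + b) x _ _ (h (a * x + b)) ha.
have h2 : is_derive x (1 : R) (fun x0 => c * g (a * x0 + b)) _ := is_deriveZ c hc.
apply: is_derive_eq h2 _.
by rewrite /GRing.scale /=; ring.
Qed.

(** The classical exp (- 1 / x), flat at 0. The powers of 1 / x are those that its derivatives
    produce, so the linear combinations of this family are stable under derivation. *)
Definition flat (n : nat) (x : R) : R :=
  if 0 < x then x^-1 ^+ n * expR (- x^-1) else 0.

Lemma flat_ge0 n x : 0 <= flat n x.
Proof.
rewrite /flat; case: ifPn => // x0.
by rewrite mulr_ge0 ?expR_ge0// exprn_ge0// invr_ge0 ltW.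
Qed.

Lemma expR_ge_pow (m : nat) (y : R) : 0 <= y ->
  y ^+ m <= m%:R ^+ m * expR y.
Proof.
move=> y0; case: m => [|m]; first by rewrite !expr0 mul1r (le_trans _ (expR_ge1Dx y))// lerDl.
have -> : expR y = expR (y / m.+1%:R) ^+ m.+1.
  by rewrite -expRM_natl mulrC divfK ?pnatr_eq0.
rewrite -exprMn lerXn2r ?nnegrE//.
rewrite -ler_pdivrMl ?ltr0n// mulrC.
have := expR_ge1Dx (y / m.+1%:R); apply: le_trans.
by rewrite lerDr.
Qed.

Lemma flat_le n x : 0 < x -> flat n x <= n.+1%:R ^+ n.+1 * x.
Proof.
move=> x0; rewrite /flat x0.
have xi : 0 < x^-1 by rewrite invr_gt0.
have := expR_ge_pow n.+1 (ltW xi); rewrite expRN exprS => h.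
rewrite ler_pdivrMr ?expR_gt0//.
have := ler_wpM2l (ltW x0) h.
rewrite mulrA mulfV ?gt_eqF// mul1r => /le_trans; apply.
by rewrite le_eqVlt; apply/orP; left; apply/eqP; ring.
Qed.

Lemma is_derive_flat n x :
  is_derive x (1 : R) (flat n) (flat n.+2 x - n%:R * flat n.+1 x).
Proof.
case: (ltgtP x 0) => [x0|x0|->].
- apply: (@near_eq_is_derive _ _ _ (fun=> 0)).
    near=> y; rewrite /flat ifF//; apply/negbTE; rewrite -leNgt ltW//.
    by near: y; exact: lt_nbhsl.
  by rewrite /flat !ifF ?mulr0 ?subr0; first exact: is_derive_cst;
    apply/negbTE; rewrite -leNgt ltW.
- apply: (@near_eq_is_derive _ _ _ (fun x : R => x^-1 ^+ n * expR (- x^-1) : R)).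
  + near=> y; rewrite /flat ifT//; near: y; exact: lt_nbhsr.
  have xn : x != 0 by rewrite gt_eqF.
  have h1 : is_derive x (1 : R) (fun x => x^-1) (- x^-2 *: 1) by exact: is_deriveV.
  have h2 : is_derive x (1 : R) (fun x : R => x^-1 ^+ n : R)
      (n%:R * x^-1 ^+ n.-1 *: (- x ^- 2 *: 1)).
    rewrite (_ : (fun x => _) = ((fun x : R => x^-1 : R) ^+ n)); first exact: is_deriveX.
    by apply/funext => y; rewrite exprfctE.
  have hN : is_derive x (1 : R) (fun x : R => - x^-1 : R) _ := is_deriveN h1.
  have h3 := @is_derive1_comp _ expR (fun x => - x^-1) x _ _ (is_derive_expR _) hN.
  have h4 : is_derive x (1 : R) (fun x : R => x^-1 ^+ n * expR (- x^-1)) _ := is_deriveM h2 h3.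
  apply: is_derive_eq h4 _.
  rewrite /flat !x0 /GRing.scale /= !exprS.
  clear h2; case: n => [|n]; first by rewrite /= !expr0; field.
  by rewrite /= !exprS; field.
have flat0 m : flat m 0 = 0 by rewrite /flat ltxx.
rewrite !flat0 mulr0 subr0.
suff h : h^-1 *: (flat n (h *: 1 + 0) - flat n 0) @[h --> 0^'] --> (0 : R).
  split; first by apply/cvg_ex; exists 0.
  exact: cvg_lim.
pose c := n.+2%:R ^+ n.+2 : R.
apply/norm_cvg0P.
apply: (@squeeze_cvgr _ _ _ _ (fun=> 0) (fun h => c * `|h|)).
- near=> h; rewrite normr_ge0 /= flat0 subr0 addr0 /GRing.scale /= mulr1.
  case: (ltP 0 h) => h0; last first.
    by rewrite {1}/flat ltNge h0 /= mulr0 normr0 mulr_ge0// exprn_ge0.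
  rewrite ger0_norm; last by rewrite mulr_ge0 ?flat_ge0// invr_ge0 ltW.
  (* The difference quotient at 0 is the next member of the family, which [flat_le] bounds
     linearly. *)
  rewrite (_ : h^-1 * flat n h = flat n.+1 h); last by rewrite /flat h0 exprS mulrA.
  by rewrite (gtr0_norm h0) flat_le.
- exact: cvg_cst.
- rewrite -[X in _ --> X](mulr0 c); apply: cvgMr.
  apply/cvgrPdist_le => e e0; near=> h; rewrite sub0r normrN normr_id.
  near: h; exact: dnbhs0_le.
Unshelve. all: by end_near. Qed.

Lemma smooth1_flat n : smooth1 (flat n).
Proof.
pose C f := exists (s : seq (R * nat)), f = fun x => \sum_(p <- s) p.1 * flat p.2 x.
exists C; first by exists [:: (1, n)]; apply/funext => x; rewrite big_seq1 mul1r.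
move=> _ [s ->].
elim: s => [|[a k] s [f' [s' ->] h]].
  exists (fun=> 0); first by exists [::]; apply/funext => x; rewrite big_nil.
  by move=> x; under [X in is_derive _ _ X]eq_fun do rewrite big_nil; exact: is_derive_cst.
exists (fun x => \sum_(p <- (a, k.+2) :: (- (a * k%:R), k.+1) :: s') p.1 * flat p.2 x).
  by eexists; reflexivity.
move=> x; under [X in is_derive _ _ X]eq_fun do rewrite big_cons.
have h1 := is_deriveD (is_deriveZ a (is_derive_flat k x)) (h x).
apply: is_derive_eq h1 _; rewrite !big_cons /= /GRing.scale /=; ring.
Qed.

(** Positive exactly on ]-1, 1[. The coefficients 1 and -1 are written out to fit
    [smooth1_affine]. *)
Definition bump0 (x : R) := flat 0 (1 * x + 1) * flat 0 ((-1) * x + 1).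

Lemma smooth1_bump0 : smooth1 bump0.
Proof. by apply: smooth1M; apply: smooth1_affine; exact: smooth1_flat. Qed.

Lemma bump0_ge0 x : 0 <= bump0 x.
Proof. by rewrite mulr_ge0// flat_ge0. Qed.

Lemma bump0N x : bump0 (- x) = bump0 x.
Proof. by rewrite /bump0 mulrC; congr (flat _ _ * flat _ _); ring. Qed.

Lemma bump0_out x : 1 <= `|x| -> bump0 x = 0.
Proof.
rewrite /bump0 /flat ler_normr => /orP[h|h].
  by rewrite [X in _ * X]ifF ?mulr0//; apply/negbTE; rewrite -leNgt; lra.
by rewrite ifF ?mul0r//; apply/negbTE; rewrite -leNgt; lra.
Qed.

Lemma bump0_gt0 x : `|x| < 1 -> 0 < bump0 x.
Proof.
rewrite ltr_norml => /andP[h1 h2]; rewrite /bump0 /flat !ifT; [|lra..].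
by rewrite !expr0 !mul1r mulr_gt0// expR_gt0.
Qed.

Lemma bump0_le1 x : bump0 x <= 1.
Proof.
have h y : flat 0 y <= 1.
  rewrite /flat; case: ifPn => // y0; rewrite expr0 mul1r -expR0 ler_expR.
  by rewrite oppr_le0 invr_ge0 ltW.
by rewrite -[leRHS]mulr1 ler_pM ?flat_ge0.
Qed.

Local Notation leb := (@lebesgue_measure R).

Lemma measurable_smooth1 f : smooth1 f -> measurable_fun setT f.
Proof. by move=> /smooth1_continuous; exact: continuous_measurable_fun. Qed.

Lemma intg_bump0 : intg leb bump0.
Proof.
apply: intg_le (I_indic_itv 0 (@ler01 R)).1.
  exact: measurable_smooth1 smooth1_bump0.
move=> x; rewrite ger0_norm ?bump0_ge0// indic_le subr0.
case: (leP `|x| 1) => h; first by rewrite bump0_le1.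
by rewrite bump0_out// ltW.
Qed.

Definition bump_mass := \int[leb]_x bump0 x.

Lemma bump_mass_gt0 : 0 < bump_mass.
Proof.
rewrite lt_neqAle I_ge0 ?andbT; last exact: bump0_ge0.
apply/negP => /eqP/esym /(I_eq0_ae intg_bump0 bump0_ge0) [N [mN N0 sN]].
have h : (leb (`](-1)%R, 1%R[%classic : set R) <= leb N)%E.
  apply: le_measure; rewrite ?inE//.
  move=> x /=; rewrite in_itv /= => hx; apply: sN => /= b0.
  have : 0 < bump0 x by apply: bump0_gt0; rewrite ltr_norml.
  by rewrite b0 ltxx.
move: h; rewrite N0 lebesgue_measure_itv /= lte_fin ifT; last by lra.
by rewrite -EFinB lee_fin; lra.
Qed.

Definition bumpf (x : R) := bump_mass^-1 * bump0 x.

Lemma smooth1_bump : smooth1 bumpf.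
Proof. exact: smooth1M (smooth1_cst _) smooth1_bump0. Qed.

Lemma bump_ge0 x : 0 <= bumpf x.
Proof. by rewrite mulr_ge0 ?bump0_ge0// invr_ge0 ltW// bump_mass_gt0. Qed.

Lemma bump_out x : 1 <= `|x| -> bumpf x = 0.
Proof. by move=> h; rewrite /bumpf bump0_out ?mulr0. Qed.

Lemma bumpN x : bumpf (- x) = bumpf x.
Proof. by rewrite /bumpf bump0N. Qed.

Lemma bump_le x : bumpf x <= bump_mass^-1.
Proof. by rewrite ler_piMr ?bump0_le1// invr_ge0 ltW// bump_mass_gt0. Qed.

Lemma intg_bump : intg leb bumpf.
Proof. exact/intgZ/intg_bump0. Qed.

Lemma I_bump : \int[leb]_x bumpf x = 1.
Proof. by rewrite IZ ?mulVf ?gt_eqF ?bump_mass_gt0//; exact: intg_bump0. Qed.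

(** A smooth passage from 0 at -1 to 1 at 1, from which [plateau], [onset] and the ramps are
    made. *)
Definition step (x : R) := \int[leb]_(t in `]-oo, x]) bumpf t.

Lemma is_derive_step x : is_derive x (1 : R) step (bumpf x).
Proof.
have xu : x < x + 1 by lra.
have Ib : leb.-integrable `]-oo, (x + 1)] (EFin \o bumpf).
  by apply: integrableS intg_bump => //.
have [] := @continuous_FTC1 _ bumpf -oo%O x _ xu Ib (ltNyr _).
  exact: smooth1_continuous smooth1_bump _.
by move=> h1; rewrite derive1E => h2; split.
Qed.

Lemma smooth1_step : smooth1 step.
Proof. exact: smooth1_primitive smooth1_bump is_derive_step. Qed.

Lemma stepE x : step x = \int[leb]_t (bumpf t * \1_`]-oo, x] t).
Proof.
rewrite /step Rintegral_mkcond; apply: I_eq => t.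
by rewrite patchE indicE; case: (_ \in _); rewrite ?mulr1 ?mulr0.
Qed.

Lemma intg_step x : intg leb (fun t => bumpf t * \1_`]-oo, x] t).
Proof.
apply: (intg_bdM (C := 1) intg_bump).
  by apply: measurable_indic; exact: measurable_itv.
by move=> t; rewrite indicE; case: (_ \in _); rewrite ?normr0 ?normr1.
Qed.

Lemma step0 x : x <= -1 -> step x = 0.
Proof.
move=> h; rewrite stepE -[RHS](I0 leb); apply: I_eq => t.
rewrite indicE mem_setE in_itv /=; case: (leP t x) => tx; rewrite ?mulr0//.
by rewrite bump_out ?mul0r// ler_normr; apply/orP; right; lra.
Qed.

Lemma step1 x : 1 <= x -> step x = 1.
Proof.
move=> h; rewrite stepE -I_bump; apply: I_eq => t.
rewrite indicE mem_setE in_itv /=; case: (leP t x) => tx; rewrite ?mulr1//.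
by rewrite bump_out ?mul0r// ler_normr; apply/orP; left; lra.
Qed.

Lemma step_ge0 x : 0 <= step x.
Proof. by rewrite stepE; apply: I_ge0 => t; rewrite mulr_ge0// bump_ge0. Qed.

Lemma step_le1 x : step x <= 1.
Proof.
rewrite stepE -I_bump; apply: I_le; [exact: intg_step|exact: intg_bump|] => t.
by rewrite indicE; case: (_ \in _); rewrite ?mulr1 ?mulr0// bump_ge0.
Qed.

Lemma smooth1_bounded f : smooth1 f -> (forall x, 1 <= `|x| -> f x = 0) ->
  exists C, forall x, `|f x| <= C.
Proof.
move=> sf f0.
have cf : {within `[-1, 1], continuous f}.
  by apply: continuous_subspaceT; exact: smooth1_continuous.
have m11 : (-1 : R) <= 1 by lra.
have [c _ hc] := EVT_max m11 cf; have [c' _ hc'] := EVT_min m11 cf.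
exists (`|f c| + `|f c'|) => x.
case: (leP 1 `|x|) => [/f0 ->|/ltW]; first by rewrite normr0 addr_ge0.
rewrite ler_norml => hx.
have h1 := hc x; have h2 := hc' x; move: h1 h2; rewrite in_itv /= hx => /(_ isT) h1 /(_ isT) h2.
have := ler_norm (f c); have := ler_norm (- f c'); rewrite normrN => h3 h4.
by rewrite ler_norml; have := normr_ge0 (f c); have := normr_ge0 (f c');
  move=> ? ?; apply/andP; split; lra.
Qed.

End smooth_line.

Section smooth_space.
Context {R : realType} {V : normedModType R}.
Implicit Types (f g phi psi : V -> R) (v x : V).

Lemma smooth_cont f : smooth f -> continuous f.
Proof. by move=> /(_ [::]) []. Qed.

Lemma smooth_derivable f x v : smooth f -> derivable f x v.
Proof. by move=> /(_ [::]) []. Qed.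

Lemma iter_derive_rcons vs v f :
  iter_derive (rcons vs v) f = iter_derive vs ('D_v f).
Proof. by elim: vs => //= w vs ->. Qed.

Lemma smooth_derive v f : smooth f -> smooth ('D_v f).
Proof. by move=> sf vs; rewrite -iter_derive_rcons. Qed.

(** Replaces inductions over lists of directions: each closure property below exhibits one stable
    class. *)
Lemma smooth_class (C : (V -> R) -> Prop) :
  (forall f, C f -> [/\ continuous f, forall x v, derivable f x v &
    forall v, C ('D_v f)]) -> forall f, C f -> smooth f.
Proof.
move=> CP f Cf vs.
suff : C (iter_derive vs f) by move=> /CP[].
by elim: vs => //= v vs /CP[].
Qed.

Inductive space_alg : (V -> R) -> Prop :=
| space_alg_gen f : smooth f -> space_alg f
| space_algD f g : space_alg f -> space_alg g -> space_alg (fun x => f x + g x)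
| space_algM f g : space_alg f -> space_alg g -> space_alg (fun x => f x * g x).

Lemma deriveMf f g x v : derivable f x v -> derivable g x v ->
  'D_v (fun x => f x * g x) x = f x * 'D_v g x + g x * 'D_v f x.
Proof. by move=> df dg; exact (deriveM df dg). Qed.

Lemma deriveDf f g x v : derivable f x v -> derivable g x v ->
  'D_v (fun x => f x + g x) x = 'D_v f x + 'D_v g x.
Proof. by move=> df dg; exact (deriveD df dg). Qed.

Lemma space_alg_smooth f : space_alg f -> smooth f.
Proof.
move: f; apply: smooth_class => f; elim=> {f}.
- move=> f sf; split; [exact: smooth_cont|by move=> x v; exact: smooth_derivable|].
  by move=> v; apply: space_alg_gen; exact: smooth_derive.
- move=> f g af [cf df sf] ag [cg dg sg]; split.
  + by move=> x; apply: cvgD; [exact: cf|exact: cg].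
  + by move=> x v; apply: derivableD.
  + move=> v; rewrite (_ : 'D_v _ = (fun x => 'D_v f x + 'D_v g x)).
      by apply: space_algD.
    by apply/funext => x; exact: deriveDf.
- move=> f g af [cf df sf] ag [cg dg sg]; split.
  + by move=> x; apply: cvgM; [exact: cf|exact: cg].
  + by move=> x v; apply: derivableM.
  + move=> v; rewrite (_ : 'D_v _ = (fun x => f x * 'D_v g x + g x * 'D_v f x)).
      by apply: space_algD; apply: space_algM.
    by apply/funext => x; exact: deriveMf.
Qed.

Lemma smoothD f g : smooth f -> smooth g -> smooth (fun x => f x + g x).
Proof. by move=> ? ?; apply/space_alg_smooth/space_algD; exact: space_alg_gen. Qed.

Lemma smoothM f g : smooth f -> smooth g -> smooth (fun x => f x * g x).
Proof. by move=> ? ?; apply/space_alg_smooth/space_algM; exact: space_alg_gen. Qed.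

Lemma smooth_cst (c : R) : smooth (fun _ : V => c).
Proof.
apply: (@smooth_class (fun f => exists c, f = fun=> c)); last by exists c.
move=> _ [k ->]; split; [exact: cst_continuous|by move=> x v; exact: derivable_cst|].
by move=> v; exists 0; apply/funext => x; exact: derive_cst.
Qed.

Lemma smooth_prod (I : Type) (s : seq I) (F : I -> V -> R) :
  (forall i, smooth (F i)) -> smooth (fun x => \prod_(i <- s) F i x).
Proof.
move=> sF; elim: s => [|i s IH].
  by under [X in smooth X]eq_fun do rewrite big_nil; exact: smooth_cst.
by under [X in smooth X]eq_fun do rewrite big_cons; exact: smoothM.
Qed.

(** [l] is affine with linear part [lam]; only its behaviour along lines is recorded, which is what
    directional derivatives use. *)
Definition affine_with (l lam : V -> R) :=
  continuous l /\ forall (h : R) v x, l (h *: v + x) = h * lam v + l x.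

(** The difference quotient along [v] is that of the one-variable function [g (lam v * h + l x)] at
    h = 0, so the chain rule on the line suffices. *)
Lemma is_derive_affine_comp (l lam : V -> R) (g : R -> R) (df : R) x v :
  affine_with l lam -> is_derive (l x) (1 : R) g df ->
  is_derive x v (fun x => g (l x)) (lam v * df).
Proof.
move=> [_ lE] hg.
have ha := is_derive_affine (lam v) (l x) (0 : R).
have hg' : is_derive (lam v * 0 + l x) (1 : R) g df by rewrite mulr0 add0r.
have [h1 h2] := @is_derive1_comp _ g (fun h => lam v * h + l x) 0 _ _ hg' ha.
have E : (fun h => h^-1 *: ((g \o (fun h => lam v * h + l x)) (h *: 1 + 0) -
    (g \o (fun h => lam v * h + l x)) 0)) =
   (fun h => h^-1 *: (((fun x => g (l x)) \o shift x) (h *: v) - g (l x))).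
  apply/funext => h; rewrite /= lE mulr0 add0r; congr (_ *: (g _ - _)).
  by rewrite addr0 /GRing.scale /= mulr1 mulrC.
split; first by move: h1; rewrite /derivable /= E.
by move: h2; rewrite /derive /= E => ->; rewrite mulrC.
Qed.

Lemma smooth_affine_comp (l lam : V -> R) (g : R -> R) :
  affine_with l lam -> smooth1 g -> smooth (fun x => g (l x)).
Proof.
move=> al [C Cg CP].
apply: (@smooth_class (fun f => exists (c : R) (g : R -> R), C g /\ f = fun x => c * g (l x))); last first.
  by exists 1, g; split => //; apply/funext => x; rewrite mul1r.
move=> _ [c [h [Ch ->]]]; have [h' Ch' hh] := CP _ Ch.
have D x v : is_derive x v (fun x => c * h (l x)) (c * (lam v * h' (l x))).
  exact: (is_deriveZ c (is_derive_affine_comp v al (hh (l x)))).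
split.
- move=> x; apply: cvgM; first exact: cvg_cst.
  apply: (cvg_comp l h (al.1 x)); exact: is_derive_continuous (hh _).
- by move=> x v; have [] := D x v.
- move=> v; exists (c * lam v), h'; split => //; apply/funext => x.
  by have [_ ->] := D x v; rewrite mulrA.
Qed.

Lemma derive_out (K : set V) f v : closed K -> (forall x, ~ K x -> f x = 0) ->
  forall x, ~ K x -> 'D_v f x = 0.
Proof.
move=> cK f0 x nK; rewrite (near_eq_derive (g := fun=> 0)) ?derive_cst//.
have : open (~` K) by exact: closed_openC.
rewrite openE => /(_ x nK); apply: filterS => y; exact: f0.
Qed.

Lemma test_derive O phi v : test_function O phi -> test_function O ('D_v phi).
Proof.
move=> [sp [K [cK KO K0]]]; split; first exact: smooth_derive.
exists K; split => //; apply: derive_out => //; exact: compact_closed.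
Qed.

Lemma test_mul O phi f : smooth f -> test_function O phi ->
  test_function O (fun x => f x * phi x).
Proof.
move=> sf [sp [K [cK KO K0]]]; split; first exact: smoothM.
by exists K; split => // x /K0 ->; rewrite mulr0.
Qed.

Lemma test_add O phi psi : test_function O phi -> test_function O psi ->
  test_function O (fun x => phi x + psi x).
Proof.
move=> [sp [K [cK KO K0]]] [sq [L [cL LO L0]]]; split; first exact: smoothD.
exists (K `|` L); split.
- exact: compactU.
- by move=> x [/KO|/LO].
- by move=> x /not_orP[/K0 -> /L0 ->]; rewrite addr0.
Qed.

Lemma test_bounded O phi : test_function O phi ->
  exists M, forall x, `|phi x| <= M.
Proof.
move=> [sp [K [cK KO K0]]].
have cphi : {within K, continuous phi}.
  by apply: continuous_subspaceT; exact: smooth_cont.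
have /compact_bounded : compact (phi @` K) by exact: continuous_compact.
move=> [M [Mr HM]]; exists (Num.max 0 (M + 1)) => x.
have [Kx|/K0 ->] := pselect (K x); last by rewrite normr0 le_max lexx.
rewrite le_max; apply/orP; right; apply: (HM (M + 1)); first by rewrite ltrDl.
by exists x.
Qed.

End smooth_space.

(** * Mollifying kernels on the line and on R^n *)

Section kernels.
Context {R : realType}.
Local Notation leb := (@lebesgue_measure R).

Lemma I_derive_compact (F f : R -> R) (a b : R) : a < b ->
  (forall x, is_derive x (1 : R) F (f x)) -> continuous f ->
  (forall x, x \notin `[a, b] -> f x = 0) ->
  intg leb f /\ \int[leb]_x f x = F b - F a.
Proof.
move=> ab Ff cf f0.
have cfw : {within `[a, b], continuous f} by exact: continuous_subspaceT.
have Iab : leb.-integrable `[a, b] (EFin \o f).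
  by apply: continuous_compact_integrable => //; exact: segment_compact.
have fE : f = f \_ `[a, b].
  apply/funext => x; rewrite patchE; case: ifPn => //.
  by rewrite mem_setE; exact: f0.
split.
  rewrite /intg fE -restrict_EFin.
  by apply/integrable_restrict => //; rewrite setTI.
rewrite fE -Rintegral_mkcond /Rintegral (@continuous_FTC2 _ f F a b)//.
  have cF x : {for x, continuous F} by exact: is_derive_continuous (Ff x).
  split.
  - by move=> x _; have [] := Ff x.
  - by apply: cvg_at_right_filter; exact: cF.
  - by apply: cvg_at_left_filter; exact: cF.
by move=> x _; rewrite derive1E; have [_ ->] := Ff x.
Qed.

Definition kap (k : nat) (s : R) : R := k.+1%:R * bumpf (k.+1%:R * s + 0).

Lemma is_derive_step_scale (k : nat) (s : R) :
  is_derive s (1 : R) (fun s => step (k.+1%:R * s + 0)) (kap k s).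
Proof.
have := @is_derive1_comp _ step (fun s => k.+1%:R * s + 0) s _ _
  (is_derive_step _) (is_derive_affine _ 0 s).
by move=> h; apply: is_derive_eq h _; rewrite mulrC.
Qed.

Lemma smooth1_kap k : smooth1 (kap k).
Proof.
by apply: smooth1M; [exact: smooth1_cst|apply: smooth1_affine; exact: smooth1_bump].
Qed.

Lemma kap_ge0 k s : 0 <= kap k s.
Proof. by rewrite mulr_ge0// bump_ge0. Qed.

Lemma kapN k s : kap k (- s) = kap k s.
Proof. by rewrite /kap !addr0 mulrN bumpN. Qed.

Lemma kap_out k s : k.+1%:R^-1 <= `|s| -> kap k s = 0.
Proof.
move=> h; rewrite /kap bump_out ?mulr0// addr0 normrM ger0_norm//.
by rewrite mulrC -ler_pdivrMr ?ltr0n// mul1r.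
Qed.

Lemma kap_loc k s : kap k s != 0 -> `|s| <= k.+1%:R^-1.
Proof.
by case: (ltP `|s| k.+1%:R^-1) => [/ltW //|/kap_out ->]; rewrite eqxx.
Qed.

Lemma kap_le k s : kap k s <= k.+1%:R * bump_mass^-1.
Proof. by rewrite ler_wpM2l// bump_le. Qed.

Lemma invS_le1 k : (k.+1%:R^-1 : R) <= 1.
Proof. by rewrite invf_le1 ?ltr0n// ler1n. Qed.

Lemma I_kap k (x : R) : intg leb (fun y => kap k (x - y)) /\
  \int[leb]_y kap k (x - y) = 1.
Proof.
have E : (fun y => kap k (x - y)) = (fun y => kap k (1 * y + (- x))).
  by apply/funext => y; rewrite -kapN; congr kap; ring.
rewrite E.
have sk := smooth1_affine 1 (- x) (smooth1_kap k).
have ab : x - 2 < x + 2 by lra.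
have D y : is_derive y (1 : R) (fun y => step (k.+1%:R * (1 * y - x) + 0)) (kap k (1 * y - x)).
  have := @is_derive1_comp _ _ (fun y => 1 * y - x) y _ _
    (is_derive_step_scale k (1 * y - x)) (is_derive_affine 1 (- x) y).
  by move=> h; apply: is_derive_eq h _; rewrite mulr1.
have [] := I_derive_compact ab D (smooth1_continuous sk).
  move=> y; rewrite in_itv /= => hy; apply: kap_out.
  apply: (le_trans (invS_le1 k)); rewrite ler_normr mul1r.
  move: hy; rewrite negb_and -!ltNge => /orP[h|h]; apply/orP; [right|left]; lra.
move=> I1 I2; split => //; rewrite I2.
(* At the two ends [step] is evaluated at 2 (k + 1) and - 2 (k + 1), beyond 1 and -1, where it is
   constant. *)
have k1 : (1 : R) <= k.+1%:R by rewrite ler1n.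
rewrite step1; last by nra.
by rewrite step0 ?subr0//; nra.
Qed.

Definition kerR n k (z : 'rV[R]_n * 'rV[R]_n) : R := \prod_i kap k (z.1 0 i - z.2 0 i).

Lemma measurable_rV_comp n d (T : measurableType d) (f : T -> 'rV[R]_n) i :
  measurable_fun setT f -> measurable_fun setT (fun x => f x 0 i).
Proof. by move=> mf; exact: (measurableT_comp (measurable_coord i) mf). Qed.

Lemma kerR_ge0 n k z : 0 <= @kerR n k z.
Proof. by apply: prodr_ge0 => i _; exact: kap_ge0. Qed.

Lemma kerRC n k x y : @kerR n k (x, y) = kerR k (y, x).
Proof. by apply: eq_bigr => i _; rewrite -kapN opprB. Qed.

Lemma I_kerR n k x : intg (lebesgue_rV n) (fun y => kerR k (x, y)) /\
  \int[lebesgue_rV n]_y kerR k (x, y) = 1.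
Proof.
have [I1 I2] := prod_rV (fun i : 'I_n => (I_kap k (x 0 i)).1).
split; first exact: I1.
by rewrite [LHS]I2 big1// => i _; exact: (I_kap k (x 0 i)).2.
Qed.

Lemma kerR_loc n k x y i : @kerR n k (x, y) != 0 -> `|x 0 i - y 0 i| <= k.+1%:R^-1.
Proof. by move=> /prodf_neq0 /(_ i isT) /kap_loc. Qed.

Definition boxn n (m : nat) : set 'rV[R]_n := box m%:R.

Lemma boxn_S n m : @boxn n m `<=` boxn m.+1.
Proof. by move=> y h i; rewrite (le_trans (h i))// ler_nat. Qed.

Lemma boxn_cover n (y : 'rV[R]_n) : exists m, boxn m y.
Proof.
exists (Num.bound (\sum_i `|y 0 i|)) => i.
apply: (@le_trans _ _ (\sum_i `|y 0 i|)).
  by rewrite (bigD1 i)//= lerDl sumr_ge0.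
by apply/ltW/archi_boundP; rewrite sumr_ge0.
Qed.

Lemma norm_shift (a b r e : R) : `|a| <= r -> `|a - b| <= e -> e <= 1 ->
  `|b| <= r + 1.
Proof.
move=> h1 h2 h3; have := ler_normB a (a - b).
rewrite (_ : a - (a - b) = b); last by ring.
by lra.
Qed.

Lemma boxn_loc n k m x y : boxn m x -> @kerR n k (x, y) != 0 -> boxn m.+1 y.
Proof.
move=> Ex h i; have := kerR_loc i h; have := Ex i; have := invS_le1 k.
rewrite -[m.+1%:R]natr1 => h1 h2 h3.
exact: norm_shift h2 h3 h1.
Qed.

(** The two indicators differ only if [c] separates [s] from [t], and then [s] is within [e] of
    [c]. *)
Lemma ray_diff (c e s t : R) : `|s - t| <= e ->
  `|(s < c)%R%:R - (t < c)%R%:R : R| <= \1_`[c - e, c + e] s.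
Proof.
move=> h; rewrite indic_le.
case: (ltP s c); case: (ltP t c) => tc sc; rewrite ?subrr ?normr0 ?ler0n//.
  rewrite subr0 normr1 (_ : `|s - c| <= e)//.
  by move: h; rewrite !ler_norml => /andP[? ?]; apply/andP; split; lra.
rewrite sub0r normrN normr1 (_ : `|s - c| <= e)//.
by move: h; rewrite !ler_norml => /andP[? ?]; apply/andP; split; lra.
Qed.

Lemma indic_ray T (f : T -> R) c x : \1_[set x | f x < c] x = (f x < c)%R%:R :> R.
Proof.
by rewrite indicE; congr (nat_of_bool _)%:R; apply/idP/idP; rewrite inE.
Qed.

Lemma cvg_invS (C : R) : C * k.+1%:R^-1 @[k --> \oo] --> (0 : R).
Proof.
rewrite -[X in _ --> X](mulr0 C); apply: cvgMr.
exact: (@cvg_harmonic R).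
Qed.

Lemma measurable_ray d (T : measurableType d) (f : T -> R) c :
  measurable_fun setT f -> measurable [set x | f x < c].
Proof.
move=> mf; have := mf measurableT _ (measurable_itv `]-oo, c[); rewrite setTI.
by rewrite (_ : _ @^-1` _ = [set x | f x < c])//; apply/seteqP; split=> x; rewrite /= in_itv.
Qed.

End kernels.

Section spacetime_measure_sigma_finite.
Context {R : realType} (n : nat).
Local Notation leb := (@lebesgue_measure R).
Local Notation X := (measurableTypeR R * 'rV[R]_n)%type.

(** The same measure as [spacetime_measure], with a sigma-finite structure, which its products with
    itself require. *)
Definition st_measure : set X -> \bar R := (leb \x lebesgue_rV n)%E.

HB.instance Definition _ := Measure.copy st_measure (leb \x lebesgue_rV n)%E.

Let st_measure_sigma_finite : sigma_finite setT st_measure.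
Proof.
have /sigma_finiteP[F [TF ndF Foo]] := sigma_finiteT leb.
have /sigma_finiteP[G [TG ndG Goo]] :
  sigma_finite setT (@lebesgue_rV R n) by exact: sigma_finiteT.
exists (fun k => F k `*` G k).
  rewrite -setXTT TF TG predeqE => -[x y]; split.
    move=> [/= [i _ Fix] [k _ Gky]]; exists (maxn i k) => //; split.
      by move: x Fix; exact/subsetPset/ndF/leq_maxl.
    by move: y Gky; exact/subsetPset/ndG/leq_maxr.
  by move=> [i _ []/= ? ?]; split; exists i.
move=> k; have [? ?] := Foo k; have [? ?] := Goo k.
split; first exact: measurableX.
by rewrite /st_measure product_measure1E// lte_mul_pinfty// ge0_fin_numE.
Qed.

HB.instance Definition _ := Measure_isSigmaFinite.Build _ _ _ st_measure
  st_measure_sigma_finite.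

Definition muX : {sigma_finite_measure set X -> \bar R} := st_measure.

Lemma I_muX (f : X -> R) : \int[muX]_z f z = \int[spacetime_measure n]_z f z.
Proof. by []. Qed.

Lemma fubX1 (f : X -> R) : intg muX f ->
  intg leb (fun t => \int[lebesgue_rV n]_y f (t, y)) /\
  \int[leb]_t (\int[lebesgue_rV n]_y f (t, y)) = \int[muX]_z f z.
Proof. by move=> If; exact: (@fub1 _ _ _ _ _ leb (lebesgue_rV n) f If). Qed.

End spacetime_measure_sigma_finite.

(** * Mollification in space-time *)

Section spacetime_kernels.
Context {R : realType} (n : nat).
Local Notation leb := (@lebesgue_measure R).
Local Notation X := (measurableTypeR R * 'rV[R]_n)%type.
Local Notation mu := (@muX R n).

Definition kerX k (z : X * X) : R :=
  kap k (z.1.1 - z.2.1) * kerR k (z.1.2, z.2.2).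

Definition boxX (m : nat) : set X := [set z | `|z.1| <= m%:R /\ boxn m z.2].

Lemma indic_boxX m (z : X) :
  \1_(boxX m) z = \1_`[0 - m%:R, 0 + m%:R] z.1 * \1_(boxn m) z.2 * 1 :> R.
Proof.
rewrite mulr1 indic_le subr0 !indicE -natrM mulnb; congr (nat_of_bool _)%:R.
by apply/idP/andP; rewrite !inE.
Qed.

Lemma intg_boxX m : intg mu (\1_(boxX m)).
Proof.
have n1 (z : X) : `|1 : R| <= 1 by rewrite normr1.
rewrite (_ : \1_(boxX m) = (fun z : X => \1_`[0 - m%:R, 0 + m%:R] z.1 * \1_(boxn m) z.2 * 1)).
  exact: (intg_tensor (C := 1) (I_indic_itv 0 (ler0n _ m)).1 (intg_box n (ler0n _ m)) (measurable_cst _) n1).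
by apply/funext => z; exact: indic_boxX.
Qed.

Lemma measurable_boxX m : measurable (boxX m).
Proof.
rewrite (_ : boxX m = `[0 - m%:R, 0 + m%:R]%classic `*` boxn m).
  by apply: measurableX; [exact: measurable_itv|exact: measurable_box].
by apply/seteqP; split=> z [h1 h2]; split => //;
  move: h1; rewrite /= in_itv /= sub0r add0r -ler_norml.
Qed.

Lemma measurable_kerX k : measurable_fun setT (kerX k).
Proof.
apply: measurable_funM.
  apply: (measurableT_comp (measurable_smooth1 (smooth1_kap k))).
  apply: measurable_funB.
    exact: (measurableT_comp measurable_fst measurable_fst).
  exact: (measurableT_comp measurable_fst measurable_snd).
apply: measurable_prod => i _.
apply: (measurableT_comp (measurable_smooth1 (smooth1_kap k))).
apply: measurable_funB; apply: measurable_rV_comp.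
  exact: (measurableT_comp measurable_snd measurable_fst).
exact: (measurableT_comp measurable_snd measurable_snd).
Qed.

Lemma kerX_ge0 k z : 0 <= kerX k z.
Proof. by rewrite mulr_ge0 ?kap_ge0 ?kerR_ge0. Qed.

Lemma kerXC k x y : kerX k (x, y) = kerX k (y, x).
Proof. by rewrite /kerX /= kerRC -kapN opprB. Qed.

Lemma I_kerX k (x : X) : intg mu (fun y => kerX k (x, y)) /\
  \int[mu]_y kerX k (x, y) = 1.
Proof.
have n1 (z : X) : `|1 : R| <= 1 by rewrite normr1.
have [I1 I1e] := I_kap k x.1; have [I2 I2e] := I_kerR k x.2.
have It := intg_tensor (C := 1) I1 I2 (measurable_cst _) n1.
have E : (fun y : X => kerX k (x, y)) =
    (fun y => kap k (x.1 - y.1) * kerR k (x.2, y.2) * 1).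
  by apply/funext => y; rewrite mulr1.
rewrite E; split => //.
rewrite -(fubX1 It).2 -[RHS]I1e; apply: I_eq => s /=.
rewrite -[RHS]mulr1 -[X in _ = _ * X]I2e -IZ//; apply: I_eq => y; exact: mulr1.
Qed.

Lemma kerX_loc k (x y : X) : kerX k (x, y) != 0 ->
  `|x.1 - y.1| <= k.+1%:R^-1 /\ kerR k (x.2, y.2) != 0.
Proof. by rewrite mulf_eq0 negb_or => /andP[/kap_loc h1 h2]. Qed.

Lemma boxX_loc k m (x y : X) : boxX m x -> kerX k (x, y) != 0 -> boxX m.+1 y.
Proof.
move=> [Et Ex] /kerX_loc[h1 h2]; split; last exact: boxn_loc Ex h2.
rewrite -[m.+1%:R]natr1; exact: norm_shift Et h1 (invS_le1 k).
Qed.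

Lemma boxX_S m : boxX m `<=` boxX m.+1.
Proof.
by move=> z [h1 h2]; split; [rewrite (le_trans h1)// ler_nat|exact: boxn_S].
Qed.

Lemma boxX_cover z : exists m, boxX m z.
Proof.
have [m hm] := boxn_cover z.2.
have mono k : (m <= k)%N -> boxn k z.2.
  elim: k => [|k IH]; first by rewrite leqn0 => /eqP m0; rewrite m0 in hm.
  by rewrite leq_eqVlt => /orP[/eqP <-//|]; rewrite ltnS => /IH; exact: boxn_S.
exists (maxn m (Num.bound `|z.1|)); split; last by apply: mono; exact: leq_maxl.
rewrite (le_trans (ltW (archi_boundP (normr_ge0 z.1))))// ler_nat; exact: leq_maxr.
Qed.

Let IK k x := (I_kerX k x).1.
Let K1 k x := (I_kerX k x).2.

(** On the support of the kernel [f] moves by at most 1 / (k + 1), so the indicator changes only in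
    a slab whose thickness is of that order; [f] will be time or a space coordinate. *)
Lemma osc0_slab (f : X -> R) (c : R) (C : nat -> R) : measurable_fun setT f ->
  (forall k x y, kerX k (x, y) != 0 -> `|f x - f y| <= k.+1%:R^-1) ->
  (forall m e, 0 <= e ->
    intg mu (fun z => \1_(boxX m) z * \1_`[c - e, c + e] (f z)) /\
    \int[mu]_z (\1_(boxX m) z * \1_`[c - e, c + e] (f z)) <= C m * e) ->
  osc0 mu boxX kerX (\1_[set z | f z < c]).
Proof.
move=> mf floc hC m.
have e0 k : (0 : R) <= k.+1%:R^-1 by rewrite invr_ge0.
apply: (@squeeze_cvgr _ _ _ _ (fun=> 0) (fun k => C m * k.+1%:R^-1)).
- near=> k; rewrite osc_ge0 /=; last exact: kerX_ge0.
  have [Is Is2] := hC m _ (e0 k).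
  have [Js Js2] := intgK1 measurable_kerX kerX_ge0 IK K1 k Is.
  apply: le_trans Is2; rewrite -Js2; apply: I_le => //.
    apply: (osc_intg measurable_boxX intg_boxX measurable_kerX kerX_ge0 IK K1).
      by apply: measurable_indic; exact: measurable_ray.
    by move=> x; exact: ind_norm.
  move=> [x y] /=.
  have [->|Kn] := eqVneq (kerX k (x, y)) 0; first by rewrite !mulr0.
  rewrite ler_wpM2r ?kerX_ge0// ler_wpM2l//.
  by rewrite !indic_ray; apply: ray_diff; exact: floc Kn.
- exact: cvg_cst.
- exact: cvg_invS.
Unshelve. all: by end_near. Qed.

(** Induction over measurable sets reduces the claim to half-spaces in time and in each coordinate,
    for which [osc0_slab] applies. *)
Lemma osc0_X (A : set X) : measurable A -> osc0 mu boxX kerX (\1_A).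
Proof.
have HC B : measurable B -> osc0 mu boxX kerX (\1_B) -> osc0 mu boxX kerX (\1_(~` B)).
  by move=> mB; exact: osc0C.
have HU (F : nat -> set X) : (forall k, measurable (F k)) ->
    (forall k, osc0 mu boxX kerX (\1_(F k))) -> osc0 mu boxX kerX (\1_(\bigcup_k F k)).
  move=> mF; apply: (osc0_bigcup measurable_boxX intg_boxX boxX_S measurable_kerX kerX_ge0 kerXC IK K1) => //.
  exact: boxX_loc.
have n1 (z : X) : `|1 : R| <= 1 by rewrite normr1.
move: A; apply: prod_sigma_ind.
- exact: osc0_set0.
- exact: HC.
- exact: HU.
- move=> A mA.
  suff [] : measurable A /\ osc0 mu boxX kerX (\1_(A `*` setT)) by [].
  move: A mA; apply: real_sigma_ind.
  + move=> A [mA hA]; split; first exact: measurableC.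
    rewrite (_ : ~` A `*` setT = ~` (A `*` setT)).
      by apply: HC => //; exact: measurableX.
    by apply/seteqP; split=> [z [/= h _] [/h]//|z /= h]; split => // Az; apply: h.
  + move=> F hF; split; first by apply: bigcupT_measurable => k; have [] := hF k.
    rewrite (_ : (\bigcup_n0 F n0) `*` setT = \bigcup_k (F k `*` setT)).
      by apply: HU => k; have [? ?] := hF k => //; exact: measurableX.
    by apply/seteqP; split=> [z [[k _ Fk] _]|z [k _ [Fk _]]]; [exists k|split => //; exists k].
  + move=> c; split; first by apply: measurable_ray; exact: measurable_id.
    rewrite (_ : _ `*` _ = [set z : X | z.1 < c]); last first.
      by apply/seteqP; split=> [z []|z].
    apply: (@osc0_slab _ _ (fun m => 2 * \int[lebesgue_rV n]_y \1_(boxn m) y)).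
    * exact: measurable_fst.
    * by move=> k x y /kerX_loc[].
    move=> m e e0.
    have I1 : intg leb (fun t => \1_`[0 - m%:R, 0 + m%:R] t * \1_`[c - e, c + e] t).
      apply: (intg_bdM (C := 1) (I_indic_itv 0 (ler0n _ m)).1).
        by apply: measurable_indic; exact: measurable_itv.
      by move=> x; exact: ind_norm.
    have It := intg_tensor (C := 1) I1 (intg_box n (ler0n _ m)) (measurable_cst _) n1.
    have E : (fun z : X => \1_(boxX m) z * \1_`[c - e, c + e] z.1 : R) =
      (fun z => \1_`[0 - m%:R, 0 + m%:R] z.1 * \1_`[c - e, c + e] z.1 * \1_(box m%:R) z.2 * 1).
      by apply/funext => z; rewrite indic_boxX /boxn; ring.
    rewrite E; split => //; rewrite -(fubX1 It).2 /=.
    have Eq : (fun x => \int[lebesgue_rV n]_y (\1_`[0 - m%:R, 0 + m%:R] x * \1_`[c - e, c + e] x * \1_(box m%:R) y * 1 : R)) =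
      (fun x => (\int[lebesgue_rV n]_y \1_(boxn m) y) * (\1_`[0 - m%:R, 0 + m%:R] x * \1_`[c - e, c + e] x)).
      apply/funext => x; rewrite [RHS]mulrC -IZ; last exact: intg_box.
      by apply: I_eq => y; rewrite mulr1.
    rewrite Eq IZ//.
    have b0 : 0 <= \int[lebesgue_rV n]_y \1_(boxn m) y :> R by apply: I_ge0.
    rewrite (_ : 2 * _ * e = (\int[lebesgue_rV n]_y \1_(boxn m) y) * (2 * e)); last by ring.
    apply: ler_wpM2l => //; rewrite -(I_indic_itv c e0).2.
    apply: I_le => //; first exact: (I_indic_itv c e0).1.
    by move=> x; rewrite ler_piMl// (le_trans (ler_norm _) (ind_norm _ _ _)).
- move=> B mB.
  suff [] : osc0 mu boxX kerX (\1_(setT `*` B)) /\ measurable B by [].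
  move: B mB; apply: rV_sigma_ind.
  + by split => //; rewrite setX0; exact: osc0_set0.
  + move=> A mA [hA _]; split; last exact: measurableC.
    rewrite (_ : setT `*` ~` A = ~` (setT `*` A)).
      by apply: HC => //; exact: measurableX.
    by apply/seteqP; split=> [z [/= _ h] [_ /h]//|z /= h]; split => // Az; apply: h.
  + move=> F mF hF; split; last exact: bigcupT_measurable.
    rewrite (_ : setT `*` (\bigcup_n0 F n0) = \bigcup_k (setT `*` F k)).
      by apply: HU => k; have [? ?] := hF k => //; exact: measurableX.
    by apply/seteqP; split=> [z [_ [k _ Fk]]|z [k _ [_ Fk]]]; [exists k|split => //; exists k].
  + move=> i c; split; last by apply: measurable_ray; exact: measurable_coord.
    rewrite (_ : _ `*` _ = [set z : X | z.2 0 i < c]); last first.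
      by apply/seteqP; split=> [z []|z].
    apply: (@osc0_slab _ _ (fun m => 2 * m%:R * ((1 + 2 * m%:R) ^+ n *+ 2))).
    * by apply: measurable_rV_comp; exact: measurable_snd.
    * by move=> k x y /kerX_loc[_]; exact: kerR_loc.
    move=> m e e0.
    have [I2 I2e] := slab_le i c (ler0n _ m) e0.
    have [I1 I1e] := I_indic_itv (0 : R) (ler0n _ m).
    have It := intg_tensor (C := 1) I1 I2 (measurable_cst _) n1.
    have E : (fun z : X => \1_(boxX m) z * \1_`[c - e, c + e] (z.2 0 i) : R) =
      (fun z => \1_`[0 - m%:R, 0 + m%:R] z.1 * (\1_(box m%:R) z.2 * \1_`[c - e, c + e] (z.2 0 i)) * 1).
      by apply/funext => z; rewrite indic_boxX /boxn; ring.
    rewrite E; split => //; rewrite -(fubX1 It).2 /=.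
    set J := \int[lebesgue_rV n]_y _ in I2e.
    have Eq : (fun x : R => \int[lebesgue_rV n]_y (\1_`[0 - m%:R, 0 + m%:R] x * (\1_(box m%:R) y * \1_`[c - e, c + e] (y 0 i)) * 1 : R)) =
      (fun x => J * \1_`[0 - m%:R, 0 + m%:R] x).
      apply/funext => x; rewrite [RHS]mulrC /J -IZ//.
      by apply: I_eq => y; rewrite mulr1.
    rewrite Eq IZ// I1e mulrC -mulrA; apply: ler_wpM2l; first by rewrite mulr_ge0.
    by apply: (le_trans I2e); rewrite [leRHS]mulrnAl.
Qed.

Theorem mollify_X (a b : X -> R) : L2 mu a -> L2 mu b ->
  bil mu (kerX k) a b @[k --> \oo] --> \int[mu]_x (a x * b x).
Proof.
apply: (mollify measurable_boxX intg_boxX boxX_S boxX_cover measurable_kerX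
  kerX_ge0 kerXC IK K1) => //.
exact: osc0_X.
Qed.

End spacetime_kernels.

(** * Weak derivatives and renormalisation *)

Section derivative_kernels.
Context {R : realType} (n : nat).
Local Notation X := (R * 'rV[R]_n)%type.
Local Notation mX := (measurableTypeR R * 'rV[R]_n)%type.

(** The derivative of [bumpf], given explicitly ([flat 2] is the derivative of [flat 0]) so that its
    oddness and its support can be read off. *)
Definition bumpd (x : R) : R := bump_mass^-1 *
  (flat 2 (1 * x + 1) * flat 0 ((-1) * x + 1) -
   flat 0 (1 * x + 1) * flat 2 ((-1) * x + 1)).

Lemma is_derive_bumpf (x : R) : is_derive x (1 : R) bumpf (bumpd x).
Proof.
have h1 := @is_derive1_comp _ (flat 0) (fun x => 1 * x + 1) x _ _
  (is_derive_flat 0 _) (is_derive_affine 1 1 x).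
have h2 := @is_derive1_comp _ (flat 0) (fun x => (-1) * x + 1) x _ _
  (is_derive_flat 0 _) (is_derive_affine (-1) 1 x).
have h3 : is_derive x (1 : R) bumpf _ := is_deriveZ bump_mass^-1 (is_deriveM h1 h2).
by apply: is_derive_eq h3 _; rewrite /bumpd /GRing.scale /=; ring.
Qed.

Lemma smooth1_bumpd : smooth1 bumpd.
Proof.
apply: smooth1M; first exact: smooth1_cst.
rewrite (_ : (fun x => _) = (fun x => flat 2 (1 * x + 1) * flat 0 ((-1) * x + 1) +
   (-1) * (flat 0 (1 * x + 1) * flat 2 ((-1) * x + 1)))); last first.
  by apply/funext => x; ring.
by apply: smooth1D; [|apply: smooth1M; first exact: smooth1_cst];
  apply: smooth1M; apply: smooth1_affine; exact: smooth1_flat.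
Qed.

Lemma bumpdN x : bumpd (- x) = - bumpd x.
Proof.
rewrite /bumpd.
have -> : 1 * - x + 1 = (-1) * x + 1 by ring.
have -> : (-1) * - x + 1 = 1 * x + 1 by ring.
ring.
Qed.

Lemma bumpd_out x : 1 <= `|x| -> bumpd x = 0.
Proof.
rewrite /bumpd /flat ler_normr => /orP[h|h].
  have -> : (0 < (-1) * x + 1) = false by apply/negbTE; rewrite -leNgt; lra.
  by rewrite !mulr0 subrr mulr0.
have -> : (0 < 1 * x + 1) = false by apply/negbTE; rewrite -leNgt; lra.
by rewrite !mul0r subrr mulr0.
Qed.

Definition kapd (k : nat) (s : R) : R := k.+1%:R ^+ 2 * bumpd (k.+1%:R * s + 0).

Lemma is_derive_kap k s : is_derive s (1 : R) (kap k) (kapd k s).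
Proof.
have h1 := @is_derive1_comp _ bumpf (fun s => k.+1%:R * s + 0) s _ _
  (is_derive_bumpf _) (is_derive_affine k.+1%:R 0 s).
have h2 : is_derive s (1 : R) (kap k) _ := is_deriveZ k.+1%:R h1.
by apply: is_derive_eq h2 _; rewrite /kapd /GRing.scale /=; ring.
Qed.

Lemma smooth1_kapd k : smooth1 (kapd k).
Proof.
by apply: smooth1M; [exact: smooth1_cst|apply: smooth1_affine; exact: smooth1_bumpd].
Qed.

Lemma kapdN k s : kapd k (- s) = - kapd k s.
Proof. by rewrite /kapd !addr0 mulrN bumpdN mulrN. Qed.

Lemma kapd_bounded k : exists C, forall s, `|kapd k s| <= C.
Proof.
have [C hC] := smooth1_bounded smooth1_bumpd bumpd_out.
exists (k.+1%:R ^+ 2 * C) => s; rewrite normrM ger0_norm ?exprn_ge0//.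
by rewrite ler_wpM2l ?exprn_ge0.
Qed.

Lemma kap_bounded k : exists C : R, forall s, `|kap k s| <= C.
Proof.
exists (k.+1%:R * bump_mass^-1) => s; rewrite ger0_norm ?kap_ge0//; exact: kap_le.
Qed.

(** The time derivative of [kerX] in its first point; [kyX] is its space derivative. Derivatives of
    an even kernel, they change sign when the two points are exchanged. *)
Definition ktX k (z : X * X) : R :=
  kapd k (z.1.1 - z.2.1) * kerR k (z.1.2, z.2.2).

Definition kyX (j : 'I_n) k (z : X * X) : R :=
  kap k (z.1.1 - z.2.1) * (kapd k (z.1.2 0 j - z.2.2 0 j) *
    \prod_(i < n | i != j) kap k (z.1.2 0 i - z.2.2 0 i)).

Lemma ktXN k x y : ktX k (x, y) = - ktX k (y, x).
Proof. by rewrite /ktX /= -mulNr -kapdN opprB kerRC. Qed.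

Lemma kyXN j k x y : kyX j k (x, y) = - kyX j k (y, x).
Proof.
rewrite /kyX /= -mulrN -mulNr -kapdN opprB -kapN opprB; congr (_ * (_ * _)).
by apply: eq_bigr => i _; rewrite -kapN opprB.
Qed.

Lemma prod_bounded (T : Type) (P : pred 'I_n) (F : 'I_n -> T -> R) :
  (forall i, exists C, forall x, `|F i x| <= C) ->
  exists C, forall x, `|\prod_(i < n | P i) F i x| <= C.
Proof.
move=> /choice[C hC]; exists (\prod_(i < n | P i) C i) => x.
by rewrite normr_prod; apply: ler_prod => i _; rewrite normr_ge0 hC.
Qed.

Lemma bounded_mul (T : Type) (f g : T -> R) :
  (exists C, forall x, `|f x| <= C) -> (exists C, forall x, `|g x| <= C) ->
  exists C, forall x, `|f x * g x| <= C.
Proof.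
move=> [C hC] [D hD]; exists (C * D) => x.
by rewrite normrM ler_pM.
Qed.

Lemma bounded_comp (T : Type) (f : R -> R) (g : T -> R) :
  (exists C, forall x, `|f x| <= C) -> exists C, forall x, `|f (g x)| <= C.
Proof. by move=> [C hC]; exists C. Qed.

Lemma kerX_bounded k : exists C, forall z : mX * mX, `|kerX k z| <= C.
Proof.
apply: bounded_mul; first exact: (bounded_comp (fun z : mX * mX => z.1.1 - z.2.1) (kap_bounded k)).
apply: (@prod_bounded (mX * mX) predT (fun i z => kap k (z.1.2 0 i - z.2.2 0 i))) => i.
exact: (bounded_comp (fun z : mX * mX => z.1.2 0 i - z.2.2 0 i) (kap_bounded k)).
Qed.

Lemma ktX_bounded k : exists C, forall z, `|ktX k z| <= C.
Proof.
apply: bounded_mul; first exact: (bounded_comp (fun z : X * X => z.1.1 - z.2.1) (kapd_bounded k)).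
apply: (@prod_bounded (X * X) predT (fun i z => kap k (z.1.2 0 i - z.2.2 0 i))) => i.
exact: (bounded_comp (fun z : X * X => z.1.2 0 i - z.2.2 0 i) (kap_bounded k)).
Qed.

Lemma kyX_bounded j k : exists C, forall z, `|kyX j k z| <= C.
Proof.
apply: bounded_mul; first exact: (bounded_comp (fun z : X * X => z.1.1 - z.2.1) (kap_bounded k)).
apply: bounded_mul.
  exact: (bounded_comp (fun z : X * X => z.1.2 0 j - z.2.2 0 j) (kapd_bounded k)).
apply: (@prod_bounded (X * X) (fun i => i != j) (fun i z => kap k (z.1.2 0 i - z.2.2 0 i))) => i.
exact: (bounded_comp (fun z : X * X => z.1.2 0 i - z.2.2 0 i) (kap_bounded k)).
Qed.

Lemma measurable_dt : measurable_fun setT (fun z : mX * mX => z.1.1 - z.2.1 : R).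
Proof.
apply: measurable_funB.
  exact: (measurableT_comp measurable_fst measurable_fst).
exact: (measurableT_comp measurable_fst measurable_snd).
Qed.

Lemma measurable_dy i : measurable_fun setT (fun z : mX * mX => z.1.2 0 i - z.2.2 0 i : R).
Proof.
apply: measurable_funB; apply: measurable_rV_comp.
  exact: (measurableT_comp measurable_snd measurable_fst).
exact: (measurableT_comp measurable_snd measurable_snd).
Qed.

Lemma measurable_ktX k : measurable_fun setT (ktX k : mX * mX -> R).
Proof.
apply: measurable_funM.
  exact: (measurableT_comp (measurable_smooth1 (smooth1_kapd k)) measurable_dt).
apply: measurable_prod => i _.
exact: (measurableT_comp (measurable_smooth1 (smooth1_kap k)) (measurable_dy i)).
Qed.

Lemma measurable_kyX j k : measurable_fun setT (kyX j k : mX * mX -> R).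
Proof.
apply: measurable_funM.
  exact: (measurableT_comp (measurable_smooth1 (smooth1_kap k)) measurable_dt).
apply: measurable_funM.
  exact: (measurableT_comp (measurable_smooth1 (smooth1_kapd k)) (measurable_dy j)).
under eq_fun do rewrite big_mkcond.
apply: measurable_prod => i _; case: (i != j); last exact: measurable_cst.
exact: (measurableT_comp (measurable_smooth1 (smooth1_kap k)) (measurable_dy i)).
Qed.

Lemma continuous_coord (V : normedModType R) (m : nat) (f : V -> 'rV[R]_m) i :
  continuous f -> continuous (fun x => f x 0 i).
Proof.
move=> cf x; apply: (cvg_comp f (fun y : 'rV[R]_m => y 0 i) (cf x)).
exact: coord_continuous.
Qed.

Lemma affine_time (c : R) : affine_with (fun z : X => z.1 - c) (fun v => v.1).
Proof.
split; last by move=> h v x /=; rewrite -addrA.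
by move=> z; apply: cvgB; [exact: cvg_fst|exact: cvg_cst].
Qed.

Lemma affine_coord (i : 'I_n) (c : R) :
  affine_with (fun z : X => z.2 0 i - c) (fun v => v.2 0 i).
Proof.
split; last by move=> h v x /=; rewrite !mxE -addrA.
move=> z; apply: cvgB; last exact: cvg_cst.
by apply: (continuous_coord (f := fun z : X => z.2)) => {}z; exact: cvg_snd.
Qed.

(** Disposes of the kernel factors that do not involve the direction of derivation. *)
Lemma is_derive_invariant (V : normedModType R) (f : V -> R) (x v : V) :
  (forall h, f (h *: v + x) = f x) -> is_derive x v f 0.
Proof.
move=> fE.
have E : (fun h => h^-1 *: ((f \o shift x) (h *: v) - f x)) = (fun=> 0).
  by apply/funext => h; rewrite /= fE subrr scaler0.
split; first by rewrite /derivable E; exact: is_cvg_cst.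
by rewrite /derive E; exact: lim_cst.
Qed.

Lemma is_derive_kerX_t k (x y : X) :
  is_derive x ((1, 0) : X) (fun x : X => kerX k (x, y)) (ktX k (x, y)).
Proof.
have h1 := is_derive_affine_comp ((1, 0) : X) (affine_time y.1) (is_derive_kap k (x.1 - y.1)).
have h2 : is_derive x ((1, 0) : X) (fun x : X => kerR k (x.2, y.2)) 0.
  by apply: is_derive_invariant => h; rewrite /= scaler0 add0r.
have h3 : is_derive x ((1, 0) : X) (fun x : X => kerX k (x, y)) _ := is_deriveM h1 h2.
by apply: is_derive_eq h3 _; rewrite /ktX /GRing.scale /=; ring.
Qed.

Lemma is_derive_kerX_y k j (x y : X) :
  is_derive x ((0, basis_vec j) : X) (fun x : X => kerX k (x, y)) (kyX j k (x, y)).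
Proof.
have h1 := is_derive_affine_comp ((0, basis_vec j) : X) (affine_coord j (y.2 0 j))
  (is_derive_kap k (x.2 0 j - y.2 0 j)).
have h2 : is_derive x ((0, basis_vec j) : X) (fun x : X => kap k (x.1 - y.1) *
    \prod_(i < n | i != j) kap k (x.2 0 i - y.2 0 i)) 0.
  apply: is_derive_invariant => h /=; rewrite scaler0 add0r; congr (_ * _).
  by apply: eq_bigr => i ij; rewrite !mxE (negbTE ij) andbF mulr0 add0r.
rewrite (_ : (fun x => kerX k (x, y)) = (fun x : X => kap k (x.2 0 j - y.2 0 j) *
  (kap k (x.1 - y.1) * \prod_(i < n | i != j) kap k (x.2 0 i - y.2 0 i)))); last first.
  by apply/funext => z; rewrite /kerX /kerR (bigD1 j)//= mulrCA.
have h3 : is_derive x ((0, basis_vec j) : X) (fun x : X => kap k (x.2 0 j - y.2 0 j) *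
  (kap k (x.1 - y.1) * \prod_(i < n | i != j) kap k (x.2 0 i - y.2 0 i))) _ := is_deriveM h1 h2.
apply: is_derive_eq h3 _; rewrite /kyX /GRing.scale /= !mxE !eqxx /=; ring.
Qed.

End derivative_kernels.

(** * Test functions of product form *)

Section test_support.
Context {R : realType} (n : nat).
Local Notation X := (R * 'rV[R]_n)%type.
Local Notation mX := (measurableTypeR R * 'rV[R]_n)%type.
Implicit Types phi : X -> R.

Lemma norm_coord_le m (y : 'rV[R]_m) i : `|y 0 i| <= `|y|.
Proof.
rewrite [leRHS]/normr /= mx_normrE.
by apply/bigmax_geP; right => /=; exists (0, i).
Qed.

Lemma compact_box (m : nat) (K : set 'rV[R]_m) : compact K ->
  exists k : nat, K `<=` boxn k.
Proof.
move=> /compact_bounded[M [Mr HM]].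
exists (Num.bound (`|M| + 1)) => y Ky i.
apply: (le_trans (norm_coord_le y i)); apply: (@le_trans _ _ (`|M| + 1)).
  by apply: (HM (`|M| + 1)) => //; rewrite (le_lt_trans (ler_norm M))// ltrDl.
by apply/ltW/archi_boundP; rewrite addr_ge0.
Qed.

Definition slabX (m : nat) : set mX := [set z | `|z.1| < m%:R].

Definition time_test (chi : R -> R) := smooth1 chi /\
  exists m : nat, forall t, m%:R <= `|t| -> chi t = 0.

(** Multiplication by a kernel with one point fixed stays in this class, as the kernels are
    themselves products. Sums leave it, which is why a polarisation argument is needed later. Times
    of either sign are allowed. *)
Definition ptest phi := exists chi (psi : 'rV[R]_n -> R),
  [/\ time_test chi, test_function setT psi &
      phi = fun z => chi z.1 * psi z.2].

Lemma time_testM f chi : smooth1 f -> time_test chi -> time_test (fun t => f t * chi t).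
Proof.
move=> sf [sc [m m0]]; split; first exact: smooth1M.
by exists m => t /m0 ->; rewrite mulr0.
Qed.

Lemma time_testD chi1 chi2 : time_test chi1 -> time_test chi2 ->
  time_test (fun t => chi1 t + chi2 t).
Proof.
move=> [s1 [m1 h1]] [s2 [m2 h2]]; split; first exact: smooth1D.
exists (m1 + m2)%N => t; rewrite natrD => mt.
by rewrite h1 ?h2 ?addr0// (le_trans _ mt)// ?lerDl ?lerDr.
Qed.

Lemma time_test_derive chi : time_test chi ->
  exists2 chi', time_test chi' & forall t, is_derive t (1 : R) chi (chi' t).
Proof.
move=> [/smooth1_derive[c' sc' hc] [m m0]]; exists c' => //; split => //.
(* At [|t| = m] the function need not vanish on a neighbourhood, hence the larger radius. *)
exists m.+1 => t mt; have [_ <-] := hc t.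
have /near_eq_derive -> : \forall s \near t, chi s = 0; rewrite ?derive_cst//.
have mt' : m%:R < `|t| by rewrite (lt_le_trans _ mt)// ltr_nat.
have h : \forall s \near t, m%:R < `|s|.
  have cn : `|s| @[s --> t] --> `|t| by apply: cvg_norm; exact: cvg_id.
  exact: (cvgr_gt _ cn).
by near=> s; apply: m0; apply/ltW; near: s.
Unshelve. all: by end_near.
Qed.

Lemma ptestE (chi chi' : R -> R) (psi : 'rV[R]_n -> R) : (forall t, is_derive t (1 : R) chi (chi' t)) ->
  test_function setT psi -> forall z : X,
  is_derive z ((1, 0) : X) (fun z : X => chi z.1 * psi z.2) (chi' z.1 * psi z.2) /\
  forall j, is_derive z ((0, basis_vec j) : X) (fun z : X => chi z.1 * psi z.2)
    (chi z.1 * 'D_(basis_vec j) psi z.2).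
Proof.
move=> hc [sp _] z; split.
  have h1 := is_derive_affine_comp ((1, 0) : X) (@affine_time R n 0) (hc (z.1 - 0)).
  have h2 : is_derive z ((1, 0) : X) (fun x : X => psi x.2) 0.
    by apply: is_derive_invariant => h; rewrite /= scaler0 add0r.
  have h3 : is_derive z ((1, 0) : X) (fun x : X => chi (x.1 - 0) * psi x.2) _ := is_deriveM h1 h2.
  rewrite (_ : (fun z => _) = (fun x : X => chi (x.1 - 0) * psi x.2)); last first.
    by apply/funext => x; rewrite subr0.
  by apply: is_derive_eq h3 _; rewrite /GRing.scale /= subr0; ring.
move=> j.
have dj : derivable psi z.2 (basis_vec j) by apply: smooth_derivable.
have E (h : R) : (psi \o snd) (h *: ((0, basis_vec j) : X) + z) = psi (h *: basis_vec j + z.2) by [].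
have h1 : is_derive z ((0, basis_vec j) : X) (psi \o snd) ('D_(basis_vec j) psi z.2).
  by split => //; exact: dj.
have h2 : is_derive z ((0, basis_vec j) : X) (fun x : X => chi x.1) 0.
  by apply: is_derive_invariant => h; rewrite /= scaler0 add0r.
have h3 : is_derive z ((0, basis_vec j) : X) (fun x : X => chi x.1 * psi x.2) _ := is_deriveM h2 h1.
by apply: is_derive_eq h3 _; rewrite /GRing.scale /=; ring.
Qed.

Definition pdir (v : X) := v = (1, 0) \/ exists j, v = (0, basis_vec j).

Lemma ptest_derivable phi v : pdir v -> ptest phi -> forall z, derivable phi z v.
Proof.
move=> pv [chi [psi [tc tp ->]]] z.
have [c' _ hc] := time_test_derive tc.
by have [[h1 _] h2] := ptestE hc tp z; case: pv => [->//|[j ->]]; have [] := h2 j.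
Qed.

Lemma ptest_derive phi v : pdir v -> ptest phi -> ptest ('D_v phi).
Proof.
move=> pv [chi [psi [tc tp ->]]].
have [c' tc' hc] := time_test_derive tc.
case: pv => [->|[j ->]].
  exists c', psi; split => //; apply/funext => z.
  by have [[_ ->]] := ptestE hc tp z.
exists chi, ('D_(basis_vec j) psi); split => //; first exact: test_derive.
by apply/funext => z; have [_ /(_ j)[_ ->]] := ptestE hc tp z.
Qed.

Lemma time_test_bounded chi : time_test chi -> exists M, forall t, `|chi t| <= M.
Proof.
move=> [sc [m m0]].
have sc' : smooth1 (fun x => chi (m.+1%:R * x + 0)) := smooth1_affine _ _ sc.
have [|M hM] := smooth1_bounded sc'.
  move=> x x1; apply: m0; rewrite addr0 normrM normr_nat.
  by rewrite (@le_trans _ _ m.+1%:R) ?ler_nat// ler_peMr.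
exists M => t; have := hM (m.+1%:R^-1 * t).
by rewrite mulrA mulfV ?mul1r ?addr0.
Qed.

Lemma measurable_ptest phi : ptest phi -> measurable_fun setT (phi : mX -> R).
Proof.
move=> [chi [psi [[sc _] [sp _] ->]]]; apply: measurable_funM.
  exact: (measurableT_comp (measurable_smooth1 sc) measurable_fst).
apply: (measurableT_comp _ measurable_snd).
by apply: continuous_measurable_rV; exact: smooth_cont.
Qed.

Lemma ptest_bounded phi : ptest phi -> exists M, forall z, `|phi z| <= M.
Proof.
move=> [chi [psi [tc tp ->]]].
have [M hM] := time_test_bounded tc; have [N hN] := test_bounded tp.
by exists (M * N) => z; rewrite normrM ler_pM.
Qed.

Lemma space_support (psi : 'rV[R]_n -> R) : test_function setT psi ->
  exists m : nat, forall y, psi y != 0 -> boxn m y.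
Proof.
move=> [_ [K [cK _ K0]]]; have [m Km] := compact_box cK.
by exists m => y py; apply: Km; apply: contrapT => /K0 p0; rewrite p0 eqxx in py.
Qed.

Lemma ptest_support phi : ptest phi ->
  exists m : nat, forall z, phi z != 0 -> slabX m z /\ boxX m z.
Proof.
move=> [chi [psi [[_ [m m0]] tp ->]]]; have [l hl] := space_support tp.
exists (m + l)%N => z; rewrite mulf_eq0 negb_or => /andP[c0 p0].
have h1 : `|z.1| < m%:R by rewrite ltNge; apply: contra c0 => /m0 ->.
have h2 : `|z.1| < (m + l)%:R by rewrite (lt_le_trans h1)// ler_nat leq_addr.
split => //; split; first exact: ltW.
by move=> i; rewrite (le_trans (hl _ p0 i))// ler_nat leq_addl.
Qed.

End test_support.

Section products.
Context {R : realType} (n : nat).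
Local Notation X := (R * 'rV[R]_n)%type.
Local Notation mX := (measurableTypeR R * 'rV[R]_n)%type.
Local Notation mu := (@muX R n).
Local Notation test := (@ptest R n).
Implicit Types phi : X -> R.

(** Local in time only: the square is integrable over all of space on bounded time slabs. This makes
    it possible to remove space cutoffs afterwards. *)
Definition L2loc (F : mX -> R) := measurable_fun setT F /\
  forall m, intg mu (fun z => F z ^+ 2 * \1_(slabX m) z).

Lemma measurable_slabX m : measurable (@slabX R n m).
Proof.
rewrite (_ : slabX m = `]- m%:R, m%:R[%classic `*` setT).
  by apply: measurableX => //; exact: measurable_itv.
by apply/seteqP; split=> z /=; rewrite /slabX /= in_itv /= ltr_norml //= => -[].
Qed.

Lemma L2loc_test F phi : L2loc F -> test phi -> L2 mu (fun z => F z * phi z).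
Proof.
move=> [mF IF] tphi; have mp := measurable_ptest tphi.
have [m hm] := ptest_support tphi; have [M hM] := ptest_bounded tphi.
split; first exact: measurable_funM.
apply: (@intg_le _ _ _ _ _ (fun z => M ^+ 2 * (F z ^+ 2 * \1_(slabX m) z))).
- by apply: measurable_funX; exact: measurable_funM.
- move=> z; rewrite ger0_norm ?sqr_ge0// exprMn.
  have [->|pz] := eqVneq (phi z) 0.
    by rewrite expr0n /= mulr0 mulr_ge0// ?sqr_ge0// mulr_ge0// sqr_ge0.
  rewrite indicE mem_set ?mulr1; last by have [] := hm z pz.
  rewrite mulrC ler_wpM2r ?sqr_ge0// -real_normK ?num_real//.
  by rewrite lerXn2r ?nnegrE ?(le_trans _ (hM z)).
- exact: intgZ.
Qed.

Lemma L2_indic_box m : L2 mu (\1_(@boxX R n m)).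
Proof.
split; first by apply: measurable_indic; exact: measurable_boxX.
rewrite (_ : (fun z => _) = \1_(boxX m)); first exact: intg_boxX.
by apply/funext => z; rewrite indicE; case: (_ \in _); rewrite ?expr1n ?expr0n.
Qed.

Lemma L2loc_intg F phi : L2loc F -> test phi -> intg mu (fun z => F z * phi z).
Proof.
move=> LF tphi; have [m hm] := ptest_support tphi.
have := L2_mul (L2loc_test LF tphi) (L2_indic_box m).
rewrite (_ : (fun z => F z * phi z * \1_(boxX m) z) = (fun z => F z * phi z))//.
apply/funext => z; have [->|pz] := eqVneq (phi z) 0; first by rewrite mulr0 mul0r.
by rewrite indicE mem_set ?mulr1//; have [] := hm z pz.
Qed.

Definition wder (v : X) (f g : mX -> R) := forall phi, test phi ->
  \int[mu]_z (g z * phi z) = - \int[mu]_z (f z * 'D_v phi z).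

(* [kv] is the derivative of the mollifier [K] in its first variable, in the
   direction [v]; [K] is even and [kv] odd. *)
Record kernel_pair (v : X) (K kv : mX * mX -> R) : Prop := KernelPair {
  kpK : measurable_fun setT K ;
  kpk : measurable_fun setT kv ;
  kpKb : exists C, forall z, `|K z| <= C ;
  kpkb : exists C, forall z, `|kv z| <= C ;
  kpdir : pdir v ;
  kptest : forall y phi, test phi -> test (fun x => K (x, y) * phi x) ;
  kpder : forall x y, is_derive (x : X) v (fun x : X => K (x, y)) (kv (x, y)) ;
  kpKC : forall x y, K (x, y) = K (y, x) ;
  kpkN : forall x y, kv (x, y) = - kv (y, x) }.

Section with_kernel.
Variables (v : X) (K kv : mX * mX -> R).
Hypothesis kp : kernel_pair v K kv.

Lemma bil_intg_bd (k : mX * mX -> R) a b : measurable_fun setT k ->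
  (exists C, forall z, `|k z| <= C) -> intg mu a -> intg mu b ->
  intg (mu \x mu)%E (fun z => a z.1 * b z.2 * k z).
Proof. by move=> mk [C hC] Ia Ib; exact: (intg_tensor Ia Ib mk hC). Qed.

Lemma derive_kernel phi y x : test phi ->
  'D_v (fun x => K (x, y) * phi x) x = kv (x, y) * phi x + K (x, y) * 'D_v phi x.
Proof.
move=> tp; have [d1 e1] := kpder kp x y.
have d2 : derivable phi x v by apply: ptest_derivable (kpdir kp) tp _.
rewrite (deriveMf d1 d2).
by rewrite e1 addrC; congr (_ + _); rewrite mulrC.
Qed.

Lemma I_sec2 (k : mX * mX -> R) (a b : mX -> R) : measurable_fun setT k ->
  (exists C, forall z, `|k z| <= C) -> intg mu a -> intg mu b ->
  bil mu k a b = \int[mu]_y (b y * \int[mu]_x (a x * k (x, y))).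
Proof.
move=> mk kC Ia Ib; have It := bil_intg_bd mk kC Ia Ib.
rewrite /bil -(fub2 It).2; apply: I_eq => y /=.
have [C hC] := kC.
rewrite -IZ; first by apply: I_eq => x; ring.
by apply: (intg_bdM Ia (measurable_sec2 y mk)) => x; exact: hC.
Qed.

Lemma I_sec1 (k : mX * mX -> R) (a b : mX -> R) : measurable_fun setT k ->
  (exists C, forall z, `|k z| <= C) -> intg mu a -> intg mu b ->
  bil mu k a b = \int[mu]_x (a x * \int[mu]_y (b y * k (x, y))).
Proof.
move=> mk kC Ia Ib; have It := bil_intg_bd mk kC Ia Ib.
rewrite /bil -(fub1 It).2; apply: I_eq => x /=.
have [C hC] := kC.
rewrite -IZ; first by apply: I_eq => y; ring.
by apply: (intg_bdM Ib (measurable_sec1 x mk)) => y; exact: hC.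
Qed.

(** Oddness turns the derivative of the kernel in x into minus its derivative in y. For fixed x this
    is the derivative of an admissible test function of y, to which the weak derivative of [f]
    applies. *)
Lemma bil_ibp f g phi a : L2loc f -> L2loc g -> wder v f g -> test phi ->
  intg mu a ->
  bil mu kv a (fun z => f z * phi z) =
  bil mu K a (fun z => g z * phi z + f z * 'D_v phi z).
Proof.
move=> Lf Lg wfg tphi Ia.
have tD := ptest_derive (kpdir kp) tphi.
have If := L2loc_intg Lf tphi; have Ig := L2loc_intg Lg tphi.
have IfD := L2loc_intg Lf tD.
have [mK mk Kb kb _ _ _ KC kN] := kp.
have [CK hK] := Kb; have [Ck hk] := kb.
rewrite (I_sec1 mk kb Ia If) (I_sec1 mK Kb Ia (intgD Ig IfD)).
apply: I_eq => x; congr (_ * _).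
have w := wfg _ (kptest kp x tphi).
have e1 : \int[mu]_y (f y * 'D_v (fun y => K (y, x) * phi y) y) =
   (- \int[mu]_y (f y * phi y * kv (x, y))) + \int[mu]_y (f y * 'D_v phi y * K (x, y)).
  rewrite -IN; last by apply: (intg_bdM If (measurable_sec1 x mk)) => y; exact: hk.
  rewrite -ID; last 2 first.
  - apply: intgN; by apply: (intg_bdM If (measurable_sec1 x mk)) => y; exact: hk.
  - by apply: (intg_bdM IfD (measurable_sec1 x mK)) => y; exact: hK.
  apply: I_eq => y; rewrite derive_kernel// kN KC; ring.
rewrite e1 opprD opprK in w.
have e2 : \int[mu]_y ((g y * phi y + f y * 'D_v phi y) * K (x, y)) =
  (\int[mu]_y (g y * (K (y, x) * phi y))) + \int[mu]_y (f y * 'D_v phi y * K (x, y)).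
  rewrite -ID.
  - by apply: I_eq => y; rewrite KC; ring.
  - rewrite (_ : (fun y => _) = (fun y => g y * phi y * K (x, y))).
      by apply: (intg_bdM Ig (measurable_sec1 x mK)) => y; exact: hK.
    by apply/funext => y; rewrite KC; ring.
  - by apply: (intg_bdM IfD (measurable_sec1 x mK)) => y; exact: hK.
by rewrite e2 w subrK.
Qed.

(* Testing the equation of [f] with [K (x, y) * phi x] and integrating against
   [b y]. *)
Lemma bil_wder f phi b : L2loc f -> test phi -> intg mu b ->
  intg mu (fun y => b y * \int[mu]_x (f x * 'D_v (fun x => K (x, y) * phi x) x)) /\
  \int[mu]_y (b y * \int[mu]_x (f x * 'D_v (fun x => K (x, y) * phi x) x)) =
  bil mu kv (fun z => f z * phi z) b + bil mu K (fun z => f z * 'D_v phi z) b.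
Proof.
move=> Lf tphi Ib.
have tD := ptest_derive (kpdir kp) tphi.
have If := L2loc_intg Lf tphi; have IfD := L2loc_intg Lf tD.
have [mK mk Kb kb _ _ _ KC kN] := kp.
have [CK hK] := Kb; have [Ck hk] := kb.
have I1 := bil_intg_bd mk kb If Ib; have I2 := bil_intg_bd mK Kb IfD Ib.
have [I12 E12] := fub2 (intgD I1 I2).
suff E y : b y * \int[mu]_x (f x * 'D_v (fun x => K (x, y) * phi x) x) =
    \int[mu]_x (f x * phi x * b y * kv (x, y) + f x * 'D_v phi x * b y * K (x, y)).
  rewrite /bil -ID// -E12; split; last by apply: I_eq => y; rewrite E.
  by move: I12; congr (intg _ _); apply/funext => y; rewrite E.
rewrite -IZ; last first.
  rewrite (_ : (fun x => _) = (fun x => f x * phi x * kv (x, y) + f x * 'D_v phi x * K (x, y))).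
    apply: intgD.
      by apply: (intg_bdM If (measurable_sec2 y mk)) => x; exact: hk.
    by apply: (intg_bdM IfD (measurable_sec2 y mK)) => x; exact: hK.
  by apply/funext => x; rewrite derive_kernel//; ring.
by apply: I_eq => x; rewrite derive_kernel//=; ring.
Qed.

Lemma bil_wder0 g phi b : L2loc g -> test phi -> intg mu b ->
  \int[mu]_y (b y * \int[mu]_x (g x * (K (x, y) * phi x))) =
  bil mu K (fun z => g z * phi z) b.
Proof.
move=> Lg tphi Ib; have Ig := L2loc_intg Lg tphi.
have [mK mk Kb kb _ _ _ KC kN] := kp.
rewrite (I_sec2 mK Kb Ig Ib); apply: I_eq => y; congr (_ * _).
by apply: I_eq => x; ring.
Qed.

(** Exchanging the points changes the sign of the kernel but not the product of equal factors. *)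
Lemma bil_odd a : intg mu a -> bil mu kv a a = 0.
Proof.
move=> Ia; have [mK mk Kb kb _ _ _ KC kN] := kp.
suff : bil mu kv a a = - bil mu kv a a by lra.
rewrite {1}(I_sec1 mk kb Ia Ia) (I_sec2 mk kb Ia Ia) -IN.
  apply: I_eq => x; rewrite -mulrN -IN; last first.
    by have [C hC] := kb; apply: (intg_bdM Ia (measurable_sec2 x mk)) => y; exact: hC.
  by congr (_ * _); apply: I_eq => y; rewrite kN mulrN.
have := (fub2 (bil_intg_bd mk kb Ia Ia)).1.
congr (intg _ _); apply/funext => y /=; rewrite -IZ; last first.
  by have [C hC] := kb; apply: (intg_bdM Ia (measurable_sec2 y mk)) => x; exact: hC.
by apply: I_eq => x; ring.
Qed.

End with_kernel.

Lemma ptest_kerX k (y : X) phi : test phi -> test (fun x => kerX k (x, y) * phi x).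
Proof.
move=> [chi [psi [tc tp ->]]].
exists (fun t => kap k (1 * t + - y.1) * chi t), (fun x => kerR k (x, y.2) * psi x); split.
- by apply: time_testM => //; apply: smooth1_affine; exact: smooth1_kap.
- apply: test_mul => //.
  apply: (@smooth_prod R _ _ _ (fun i (x : 'rV[R]_n) => kap k (x 0 i - y.2 0 i))) => i.
  apply: (@smooth_affine_comp R _ (fun x : 'rV[R]_n => x 0 i - y.2 0 i) (fun v => v 0 i) _ _ (smooth1_kap k)); split.
    move=> x; apply: (@continuousB _ _ _ (fun x : 'rV[R]_n => x 0 i) (fun=> y.2 0 i)); last exact: cst_continuous.
    exact: coord_continuous.
  by move=> h v x /=; rewrite !mxE -addrA.
- by apply/funext => z; rewrite /kerX /= mul1r mulrACA.
Qed.

Lemma kp_t k : kernel_pair (1, 0) (@kerX R n k) (@ktX R n k).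
Proof.
split.
- exact: measurable_kerX.
- exact: measurable_ktX.
- exact: kerX_bounded.
- exact: ktX_bounded.
- by left.
- by move=> y phi; exact: ptest_kerX.
- exact: is_derive_kerX_t.
- exact: kerXC.
- exact: ktXN.
Qed.

Lemma kp_y j k : kernel_pair (0, basis_vec j) (@kerX R n k) (@kyX R n j k).
Proof.
split.
- exact: measurable_kerX.
- exact: measurable_kyX.
- exact: kerX_bounded.
- exact: kyX_bounded.
- by right; exists j.
- by move=> y phi; exact: ptest_kerX.
- exact: is_derive_kerX_y.
- exact: kerXC.
- exact: kyXN.
Qed.

(** The product rule, tested with a square: each factor carries its own [phi], which makes it
    globally square-integrable, as [mollify_X] demands. *)
Lemma wder_prod_sq j (f g u w : mX -> R) phi : L2loc f -> L2loc g ->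
  L2loc u -> L2loc w ->
  wder (0, basis_vec j) f g -> wder (0, basis_vec j) u w -> test phi ->
  \int[mu]_z (g z * phi z * (u z * phi z)) =
  - (\int[mu]_z (f z * phi z * (w z * phi z + u z * dy j phi z)) +
     \int[mu]_z (f z * dy j phi z * (u z * phi z))).
Proof.
move=> Lf Lg Lu Lw wf wu tphi.
have tD : test (dy j phi) := ptest_derive (kpdir (kp_y j 0)) tphi.
have Lup := L2loc_test Lu tphi; have Iup := L2loc_intg Lu tphi.
have Lfp := L2loc_test Lf tphi; have Ifp := L2loc_intg Lf tphi.
have LfD := L2loc_test Lf tD.
have Lgp := L2loc_test Lg tphi.
have Lwu := L2D (L2loc_test Lw tphi) (L2loc_test Lu tD).
have c1 := mollify_X Lgp Lup.
have c2 := mollify_X Lfp Lwu.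
have c3 := mollify_X LfD Lup.
have c23 : (fun k => - (bil mu (kerX k) (fun z => f z * phi z) (fun z => w z * phi z + u z * dy j phi z) +
       bil mu (kerX k) (fun z => f z * dy j phi z) (fun z => u z * phi z))) @ \oo -->
  - (\int[mu]_z (f z * phi z * (w z * phi z + u z * dy j phi z)) +
     \int[mu]_z (f z * dy j phi z * (u z * phi z))).
  by apply: cvgN; apply: cvgD.
suff E : (fun k => bil mu (kerX k) (fun z => g z * phi z) (fun z => u z * phi z)) =
    (fun k => - (bil mu (kerX k) (fun z => f z * phi z) (fun z => w z * phi z + u z * dy j phi z) +
       bil mu (kerX k) (fun z => f z * dy j phi z) (fun z => u z * phi z))).
  by rewrite E in c1; rewrite -(cvg_lim (@Rhausdorff R) c1); apply: (cvg_lim (@Rhausdorff R) c23).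
apply/funext => k.
rewrite -(bil_wder0 (kp_y j k) Lg tphi Iup).
have [I1 E1] := bil_wder (kp_y j k) Lf tphi Iup.
under eq_Rintegral do rewrite (wf _ (kptest (kp_y j k) _ tphi)) mulrN.
by rewrite IN// E1 (bil_ibp (kp_y j k) Lu Lw wu tphi Ifp).
Qed.

Lemma L2loc_indic f m : L2loc f -> L2 mu (fun z => f z * \1_(slabX m) z).
Proof.
move=> [mf If]; split.
  by apply: measurable_funM => //; apply: measurable_indic; exact: measurable_slabX.
move: (If m); congr (intg _ _); apply/funext => z; rewrite indicE.
by case: (_ \in _); rewrite ?mulr1 ?mulr0 ?expr0n.
Qed.

Lemma L2loc_mul f g phi : L2loc f -> L2loc g -> test phi ->
  intg mu (fun z => f z * g z * phi z).
Proof.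
move=> Lf Lg tphi; have [m hm] := ptest_support tphi.
have := L2_mul (L2loc_indic m Lf) (L2loc_test Lg tphi).
congr (intg _ _); apply/funext => z.
have [->|pz] := eqVneq (phi z) 0; first by rewrite !mulr0.
by rewrite indicE mem_set ?mulr1 ?mulrA//; have [] := hm z pz.
Qed.

(* The weak equation [D_t u + sum_j D_j F_j = g], tested with [u phi ^ 2]. *)
Lemma renormalise_sq (u g : mX -> R) (F v : 'I_n -> mX -> R) phi :
  L2loc u -> L2loc g -> (forall j, L2loc (F j)) -> (forall j, L2loc (v j)) ->
  (forall j, wder (0, basis_vec j) u (v j)) ->
  (forall phi, test phi -> (- \int[mu]_z (u z * dt phi z))
      - \sum_j \int[mu]_z (F j z * dy j phi z) = \int[mu]_z (g z * phi z)) ->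
  test phi ->
  (- \int[mu]_z (u z * dt phi z * (u z * phi z)))
  - \sum_j ((\int[mu]_z (F j z * phi z * (v j z * phi z + u z * dy j phi z))) +
     \int[mu]_z (F j z * dy j phi z * (u z * phi z)))
  = \int[mu]_z (g z * phi z * (u z * phi z)).
Proof.
move=> Lu Lg LF Lv wu eu tphi.
have tt : test (dt phi) := ptest_derive (kpdir (kp_t 0)) tphi.
have tD j : test (dy j phi) := ptest_derive (kpdir (kp_y j 0)) tphi.
have Lup := L2loc_test Lu tphi; have Iup := L2loc_intg Lu tphi.
have Lgp := L2loc_test Lg tphi.
have LFp j := L2loc_test (LF j) tphi.
have LFD j := L2loc_test (LF j) (tD j).
have Lwu j := L2D (L2loc_test (Lv j) tphi) (L2loc_test Lu (tD j)).
pose A k := bil mu (kerX k) (fun z => u z * dt phi z) (fun z => u z * phi z).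
pose B k j := bil mu (kerX k) (fun z => F j z * phi z) (fun z => v j z * phi z + u z * dy j phi z)
  + bil mu (kerX k) (fun z => F j z * dy j phi z) (fun z => u z * phi z).
have cA : A k @[k --> \oo] --> \int[mu]_z (u z * dt phi z * (u z * phi z)).
  exact: mollify_X (L2loc_test Lu tt) Lup.
have cB j : B k j @[k --> \oo] -->
    (\int[mu]_z (F j z * phi z * (v j z * phi z + u z * dy j phi z))) +
     \int[mu]_z (F j z * dy j phi z * (u z * phi z)).
  by apply: cvgD; exact: mollify_X.
have cS : (- A k - \sum_j B k j) @[k --> \oo] -->
  (- \int[mu]_z (u z * dt phi z * (u z * phi z)))
  - \sum_j ((\int[mu]_z (F j z * phi z * (v j z * phi z + u z * dy j phi z))) +
     \int[mu]_z (F j z * dy j phi z * (u z * phi z))).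
  apply: cvgB; first exact: cvgN.
  by apply: cvg_big => //; exact: add_continuous.
rewrite -(cvg_lim (@Rhausdorff R) cS).
apply: cvg_lim; first exact: Rhausdorff.
suff -> : (fun k => - A k - \sum_j B k j) =
    (fun k => bil mu (kerX k) (fun z => g z * phi z) (fun z => u z * phi z)).
  exact: mollify_X.
apply/funext => k.
have [It Et] := bil_wder (kp_t k) Lu tphi Iup.
rewrite -(bil_wder0 (kp_t k) Lg tphi Iup).
under [RHS]eq_Rintegral do rewrite -(eu _ (kptest (kp_t k) _ tphi)) mulrBr mulrN mulr_sumr.
have Iy j := bil_wder (kp_y j k) (LF j) tphi Iup.
rewrite IB; last 2 first.
- exact: intgN.
- by apply: intg_sum => j; have [] := Iy j.
(* The only term in which a time derivative hits the kernel has [u phi] in both arguments, hence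
   vanishes; [u] needs no time derivative. *)
rewrite IN// Et (bil_odd (kp_t k) Iup) add0r; congr (_ - _).
rewrite I_sum; last by move=> j; have [] := Iy j.
apply: eq_bigr => j _; have [_ ->] := Iy j.
have e := bil_ibp (kp_y j k) Lu (Lv j) (wu j) tphi (L2loc_intg (LF j) tphi).
by congr (_ + _); symmetry; exact: e.
Qed.

End products.

(** * Cutoffs with derivatives bounded uniformly in their size *)

Section cutoffs.
Context {R : realType}.
Local Notation leb := (@lebesgue_measure R).

(** It falls from 1 to 0 between the radii m + 1 and m + 3. The width of the passage does not depend
    on m, so the derivative stays bounded while its support escapes to infinity. *)
Definition plateau (m : nat) (s : R) : R :=
  step ((-1) * s + m.+2%:R) * step (1 * s + m.+2%:R).

Lemma smooth1_plateau m : smooth1 (plateau m).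
Proof. by apply: smooth1M; apply: smooth1_affine; exact: smooth1_step. Qed.

Lemma plateau_ge0 m s : 0 <= plateau m s.
Proof. by rewrite mulr_ge0// step_ge0. Qed.

Lemma plateau_le1 m s : plateau m s <= 1.
Proof. by rewrite mulr_ile1// ?step_ge0 ?step_le1. Qed.

Lemma plateau1 m s : `|s| <= m.+1%:R -> plateau m s = 1.
Proof.
rewrite ler_norml => /andP[h1 h2]; have e : m.+2%:R = m.+1%:R + 1 :> R by rewrite natr1.
by rewrite /plateau !step1 ?mulr1// e; lra.
Qed.

Lemma plateau0 m s : m.+3%:R <= `|s| -> plateau m s = 0.
Proof.
rewrite -[m.+3]addn1 natrD ler_normr => /orP[h|h]; rewrite /plateau.
  by rewrite step0 ?mul0r//; lra.
by rewrite [X in _ * X]step0 ?mulr0//; lra.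
Qed.

Lemma time_test_plateau m : time_test (plateau m).
Proof. by split; [exact: smooth1_plateau|exists m.+3; exact: plateau0]. Qed.

Definition dcut (m : nat) (s : R) : R :=
  - (bumpf ((-1) * s + m.+2%:R) * step (1 * s + m.+2%:R)) +
  step ((-1) * s + m.+2%:R) * bumpf (1 * s + m.+2%:R).

Lemma is_derive_plateau m s : is_derive s (1 : R) (plateau m) (dcut m s).
Proof.
have h1 := @is_derive1_comp _ step (fun s => (-1) * s + m.+2%:R) s _ _
  (is_derive_step _) (is_derive_affine (-1) m.+2%:R s).
have h2 := @is_derive1_comp _ step (fun s => 1 * s + m.+2%:R) s _ _
  (is_derive_step _) (is_derive_affine 1 m.+2%:R s).
have h3 : is_derive s (1 : R) (plateau m) _ := is_deriveM h1 h2.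
by apply: is_derive_eq h3 _; rewrite /dcut /GRing.scale /=; ring.
Qed.

Lemma dcut_le m s : `|dcut m s| <= 2 * bump_mass^-1.
Proof.
have H (a b : R) : `|bumpf a * step b| <= bump_mass^-1.
  rewrite normrM (ger0_norm (bump_ge0 _)) (ger0_norm (step_ge0 _)).
  by rewrite (le_trans _ (bump_le a))// ler_piMr ?bump_ge0 ?step_le1.
rewrite mulr2n mulrDl mul1r (le_trans (ler_normD _ _))// lerD// ?normrN//.
by rewrite mulrC.
Qed.

Lemma dcut0 m s : `|s| <= m.+1%:R -> dcut m s = 0.
Proof.
rewrite ler_norml => /andP[h1 h2]; have e : m.+2%:R = m.+1%:R + 1 :> R by rewrite natr1.
rewrite /dcut e; by rewrite !bump_out ?mul0r ?mulr0 ?oppr0 ?addr0// ler_normr; apply/orP; left; lra.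
Qed.

End cutoffs.

(** * Products of one-variable functions *)

Section product_tests.
Context {R : realType} (n : nat).

Definition rprod (G : 'I_n -> R -> R) (y : 'rV[R]_n) : R := \prod_i G i (y 0 i).

Lemma smooth_coord_comp (g : R -> R) i : smooth1 g -> smooth (fun y : 'rV[R]_n => g (y 0 i)).
Proof.
move=> sg; apply: (@smooth_affine_comp R _ (fun x : 'rV[R]_n => x 0 i) (fun v => v 0 i) _ _ sg).
split; first by move=> x; exact: coord_continuous.
by move=> h v x /=; rewrite !mxE.
Qed.

Lemma smooth_rprod G : (forall i, smooth1 (G i)) -> smooth (rprod G).
Proof.
move=> sG; apply: (@smooth_prod R _ _ _ (fun i (y : 'rV[R]_n) => G i (y 0 i))) => i.
exact: smooth_coord_comp.
Qed.

Lemma test_rprod G : (forall i, time_test (G i)) -> test_function setT (rprod G).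
Proof.
move=> tG; split; first by apply: smooth_rprod => i; have [] := tG i.
have /choice[m hm] : forall i, exists m : nat, forall t, m%:R <= `|t| -> G i t = 0.
  by move=> i; have [] := tG i.
exists [set y : 'rV[R]_n | forall i, `[- (m i)%:R, (m i)%:R]%classic (y ord0 i)]; split => //.
  have := @rV_compact R n (fun i => `[- (m i)%:R, (m i)%:R]%classic) (fun i => @segment_compact R _ _).
  exact.
move=> y /existsNP[i yi]; rewrite /rprod (bigD1 i)//= hm ?mul0r// leNgt.
apply/negP => /ltW yi'; apply: yi; rewrite /= in_itv /=.
by move: yi'; rewrite ler_norml.
Qed.

Lemma derive_rprod G G' j y : (forall i t, is_derive t (1 : R) (G i) (G' i t)) ->
  'D_(basis_vec j) (rprod G) y = rprod (fun i => if i == j then G' i else G i) y.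
Proof.
move=> hG.
have aj : affine_with (fun x : 'rV[R]_n => x 0 j) (fun v => v 0 j).
  split; first by move=> x; exact: coord_continuous.
  by move=> h v x /=; rewrite !mxE.
have h1 := is_derive_affine_comp (basis_vec j) aj (hG j (y 0 j)).
have h2 : is_derive y (basis_vec j) (fun x : 'rV[R]_n =>
    \prod_(i < n | i != j) G i (x 0 i)) 0.
  apply: is_derive_invariant => h.
  by apply: eq_bigr => i ij; rewrite !mxE (negbTE ij) andbF mulr0 add0r.
have h3 : is_derive y (basis_vec j) (fun x : 'rV[R]_n => G j (x 0 j) *
    \prod_(i < n | i != j) G i (x 0 i)) _ := is_deriveM h1 h2.
have -> : rprod G = (fun x : 'rV[R]_n => G j (x 0 j) *
    \prod_(i < n | i != j) G i (x 0 i)) by apply/funext => x; rewrite /rprod (bigD1 j).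
have [_ ->] := h3; rewrite /rprod [in RHS](bigD1 j)//= eqxx.
have -> : basis_vec j 0 j = 1 :> R by rewrite !mxE !eqxx.
rewrite /GRing.scale /=.
rewrite mulr0 add0r mul1r mulrC; congr (_ * _).
by apply: eq_bigr => i /negbTE ->.
Qed.

Definition ycut m : 'rV[R]_n -> R := rprod (fun=> plateau m).

Lemma test_ycut m : test_function setT (ycut m).
Proof. by apply: test_rprod => i; exact: time_test_plateau. Qed.

Lemma ycut1 m y : boxn m.+1 y -> ycut m y = 1.
Proof. by move=> hy; rewrite /ycut /rprod big1// => i _; rewrite plateau1//; exact: hy. Qed.

Lemma ycut_ge0 m y : 0 <= ycut m y.
Proof. by apply: prodr_ge0 => i _; exact: plateau_ge0. Qed.

Lemma ycut_le1 m y : ycut m y <= 1.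
Proof. by apply: prodr_ile1 => i; rewrite plateau_ge0 plateau_le1. Qed.

Lemma dycut_le j m y : `|'D_(basis_vec j) (ycut m) y| <= 2 * bump_mass^-1.
Proof.
rewrite (derive_rprod _ _ (fun _ => is_derive_plateau m)) /rprod (bigD1 j)//= eqxx normrM.
rewrite -[leRHS]mulr1 ler_pM ?dcut_le// normr_prod.
by apply: prodr_ile1 => i; case: eqP => //; rewrite normr_ge0 ger0_norm ?plateau_ge0 ?plateau_le1.
Qed.

Lemma dycut0 j m y : boxn m.+1 y -> 'D_(basis_vec j) (ycut m) y = 0.
Proof.
move=> hy; rewrite (derive_rprod _ _ (fun _ => is_derive_plateau m)) /rprod (bigD1 j)//= eqxx.
by rewrite dcut0 ?mul0r//; exact: hy.
Qed.

Lemma ycut_near (y : 'rV[R]_n) : \forall m \near \oo, boxn m.+1 y.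
Proof.
have [k hk] := boxn_cover y; exists k => // m /= km i.
by rewrite (le_trans (hk i))// ler_nat ltnW.
Qed.

End product_tests.

(** * From squares of test functions to all test functions *)

Section polarisation.
Context {R : realType} (n : nat).
Local Notation X := (R * 'rV[R]_n)%type.
Local Notation mX := (measurableTypeR R * 'rV[R]_n)%type.
Local Notation mu := (@muX R n).
Local Notation test := (@ptest R n).
Implicit Types phi : X -> R.

Definition loc (G : mX -> R) := forall phi, test phi -> intg mu (fun z => G z * phi z).

Lemma pdir_t : pdir ((1, 0) : X). Proof. by left. Qed.
Lemma pdir_y j : pdir ((0, basis_vec j) : X). Proof. by right; exists j. Qed.

Section functional.
Variables (W : (X -> R) -> R) (good : (X -> R) -> Prop).
Hypothesis good_test : forall phi, test phi -> good phi.
Hypothesis WD : forall phi1 phi2, good phi1 -> good phi2 ->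
  good (fun z => phi1 z + phi2 z) /\ W (fun z => phi1 z + phi2 z) = W phi1 + W phi2.

(** Two time factors with a common space factor add up to a product, and so do two space factors
    with a common time factor; polarising in one variable after the other thus never squares
    anything but a product. The class [good], which contains sums, is where [W] is additive. *)
Lemma polarise_abs : (forall phi, test phi -> W (fun z => phi z * phi z) = 0) ->
  forall phi, test phi -> W phi = 0.
Proof.
have lin (a b c : R) : a = 0 -> b = 0 -> (a + b) + (c + c) = 0 -> c = 0 by lra.
move=> W0.
have B1 phi1 phi2 : test (fun z => phi1 z * phi1 z) -> test (fun z => phi2 z * phi2 z) ->
    test (fun z => phi1 z * phi2 z) ->
    W (fun z => phi1 z * phi1 z) = 0 -> W (fun z => phi2 z * phi2 z) = 0 ->
    W (fun z => (phi1 z + phi2 z) * (phi1 z + phi2 z)) = 0 ->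
    W (fun z => phi1 z * phi2 z) = 0.
  move=> /good_test g1 /good_test g2 /good_test g12 w1 w2.
  rewrite (_ : (fun z => (phi1 z + phi2 z) * (phi1 z + phi2 z)) = (fun z =>
     (phi1 z * phi1 z + phi2 z * phi2 z) + (phi1 z * phi2 z + phi1 z * phi2 z))); last first.
    by apply/funext => z; ring.
  have [ga ea] := WD g1 g2; have [gb eb] := WD g12 g12; have [_ ec] := WD ga gb.
  move=> w; exact: lin w1 w2 (etrans (congr2 +%R (esym ea) (esym eb)) (etrans (esym ec) w)).
have sT (chi1 chi2 : R -> R) (psi1 psi2 : 'rV[R]_n -> R) : time_test chi1 -> time_test chi2 ->
    test_function setT psi1 -> test_function setT psi2 ->
    test (fun z => (chi1 z.1 * chi2 z.1) * (psi1 z.2 * psi2 z.2)).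
  move=> t1 t2 p1 p2; exists (fun t => chi1 t * chi2 t), (fun y => psi1 y * psi2 y); split => //.
  - by apply: time_testM => //; have [] := t1.
  - by apply: test_mul => //; have [] := p1.
have S1 (chi : R -> R) (psi : 'rV[R]_n -> R) : time_test chi -> test_function setT psi ->
    W (fun z => (chi z.1 * chi z.1) * (psi z.2 * psi z.2)) = 0.
  move=> tc tp; rewrite (_ : (fun z => _) = (fun z : X => (chi z.1 * psi z.2) * (chi z.1 * psi z.2))).
    by apply: W0; exists chi, psi.
  by apply/funext => z; ring.
have S2 (chi1 chi2 : R -> R) (psi : 'rV[R]_n -> R) : time_test chi1 -> time_test chi2 ->
    test_function setT psi -> W (fun z => (chi1 z.1 * chi2 z.1) * (psi z.2 * psi z.2)) = 0.
  move=> t1 t2 tp.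
  pose f (chi : R -> R) (z : X) := chi z.1 * psi z.2.
  have E (c1 c2 : R -> R) : (fun z : X => (c1 z.1 * c2 z.1) * (psi z.2 * psi z.2)) =
     (fun z => f c1 z * f c2 z) by apply/funext => z; rewrite /f; ring.
  rewrite E; apply: B1; rewrite -?E; [exact: sT|exact: sT|exact: sT|exact: S1|exact: S1|].
  rewrite (_ : (fun z => _) = (fun z : X => ((chi1 z.1 + chi2 z.1) * (chi1 z.1 + chi2 z.1)) * (psi z.2 * psi z.2))).
    by apply: (S1 (fun t => chi1 t + chi2 t)) => //; exact: time_testD.
  by apply/funext => z; rewrite /f; ring.
have S3 (chi1 chi2 : R -> R) (psi1 psi2 : 'rV[R]_n -> R) : time_test chi1 -> time_test chi2 ->
    test_function setT psi1 -> test_function setT psi2 ->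
    W (fun z => (chi1 z.1 * chi2 z.1) * (psi1 z.2 * psi2 z.2)) = 0.
  move=> t1 t2 p1 p2.
  have H1 := S2 _ _ _ t1 t2 p1; have H2 := S2 _ _ _ t1 t2 p2.
  have H3 := S2 _ _ _ t1 t2 (test_add p1 p2).
  have g1 := good_test (sT _ _ _ _ t1 t2 p1 p1); have g2 := good_test (sT _ _ _ _ t1 t2 p2 p2).
  have g12 := good_test (sT _ _ _ _ t1 t2 p1 p2).
  have [ga ea] := WD g1 g2; have [gb eb] := WD g12 g12; have [_ e] := WD ga gb.
  apply: lin H1 H2 (etrans (congr2 +%R (esym ea) (esym eb)) (etrans (esym e) _)).
  by rewrite -H3; congr W; apply/funext => z; ring.
move=> _ [chi [psi [tc tp ->]]].
have [sc [m m0]] := tc; have [l hl] := space_support tp.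
(* A test function equals its product with a cutoff that is 1 on its support, and [S3] applies to
   such products. *)
rewrite (_ : (fun z => _) = (fun z : X => (chi z.1 * plateau m z.1) * (psi z.2 * ycut l z.2))).
  by apply: S3 => //; [exact: time_test_plateau|exact: test_ycut].
apply/funext => z; congr (_ * _).
  have [h|h] := leP m%:R `|z.1|; first by rewrite m0 ?mul0r.
  by rewrite plateau1 ?mulr1// (le_trans (ltW h))// ler_nat.
have [->|h] := eqVneq (psi z.2) 0; first by rewrite mul0r.
by rewrite ycut1 ?mulr1// => i; rewrite (le_trans (hl _ h i))// ler_nat.
Qed.

End functional.

Lemma polarise (G0 Gt : mX -> R) (G : 'I_n -> mX -> R) :
  loc G0 -> loc Gt -> (forall j, loc (G j)) ->
  let W phi := (\int[mu]_z (G0 z * phi z)) + (\int[mu]_z (Gt z * dt phi z)) +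
    \sum_j \int[mu]_z (G j z * dy j phi z) in
  (forall phi, test phi -> W (fun z => phi z * phi z) = 0) ->
  forall phi, test phi -> W phi = 0.
Proof.
move=> lG0 lGt lG W.
apply: (@polarise_abs W (fun phi => [/\ forall v z, pdir v -> derivable phi z v,
  intg mu (fun z => G0 z * phi z), intg mu (fun z => Gt z * dt phi z) &
  forall j, intg mu (fun z => G j z * dy j phi z)])).
  move=> phi tp; split.
  - by move=> v z pv; exact: ptest_derivable.
  - exact: lG0.
  - by apply: lGt; exact: ptest_derive pdir_t tp.
  - by move=> j; apply: lG; exact: ptest_derive (pdir_y j) tp.
move=> phi1 phi2 [d1 I1 t1 y1] [d2 I2 t2 y2].
have E0 : (fun z => G0 z * (phi1 z + phi2 z)) = (fun z => G0 z * phi1 z + G0 z * phi2 z).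
  by apply/funext => z; rewrite mulrDr.
have Et : (fun z => Gt z * dt (fun z => phi1 z + phi2 z) z) = (fun z => Gt z * dt phi1 z + Gt z * dt phi2 z).
  apply/funext => z; rewrite /dt deriveDf ?mulrDr//; [exact: d1 _ _ pdir_t|exact: d2 _ _ pdir_t].
have Ey j : (fun z => G j z * dy j (fun z => phi1 z + phi2 z) z) = (fun z => G j z * dy j phi1 z + G j z * dy j phi2 z).
  apply/funext => z; rewrite /dy deriveDf ?mulrDr//; [exact: d1 _ _ (pdir_y j)|exact: d2 _ _ (pdir_y j)].
split.
  split.
  - by move=> v z pv; apply: derivableD; [exact: d1|exact: d2].
  - by rewrite E0; exact: intgD.
  - by rewrite Et; exact: intgD.
  - by move=> j; rewrite Ey; exact: intgD (y1 j) (y2 j).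
have F0 := etrans (congr1 (Rintegral mu setT) E0) (ID I1 I2).
have Ft := etrans (congr1 (Rintegral mu setT) Et) (ID t1 t2).
have Fy j := etrans (congr1 (Rintegral mu setT) (Ey j)) (ID (y1 j) (y2 j)).
have comb (A B C a1 a2 b1 b2 c1 c2 : R) : A = a1 + a2 -> B = b1 + b2 -> C = c1 + c2 ->
    A + B + C = (a1 + b1 + c1) + (a2 + b2 + c2) by move=> -> -> ->; ring.
exact: comb F0 Ft (etrans (eq_bigr _ (fun j _ => Fy j)) (big_split _ _ _ _ _)).
Qed.

End polarisation.

Section renormalisation.
Context {R : realType} (n : nat).
Local Notation X := (R * 'rV[R]_n)%type.
Local Notation mX := (measurableTypeR R * 'rV[R]_n)%type.
Local Notation mu := (@muX R n).
Local Notation test := (@ptest R n).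
Implicit Types phi : X -> R.

Lemma ptest_mul phi1 phi2 : test phi1 -> test phi2 -> test (fun z => phi1 z * phi2 z).
Proof.
move=> [c1 [p1 [t1 h1 ->]]] [c2 [p2 [t2 h2 ->]]].
exists (fun t => c1 t * c2 t), (fun y => p1 y * p2 y); split.
- by apply: time_testM => //; have [] := t1.
- by apply: test_mul => //; have [] := h1.
- by apply/funext => z; rewrite mulrACA.
Qed.

Lemma derive_sq phi v z : pdir v -> test phi ->
  'D_v (fun z => phi z * phi z) z = 2 * (phi z * 'D_v phi z).
Proof.
move=> pv tp; have dp : derivable phi z v by apply: ptest_derivable pv tp _.
rewrite (deriveMf dp dp); ring.
Qed.

Lemma L2loc_loc f g : L2loc f -> L2loc g -> @loc R n (fun z => f z * g z).
Proof. by move=> Lf Lg phi tp; exact: L2loc_mul. Qed.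

Lemma loc0 : @loc R n (fun=> 0).
Proof. by move=> phi tp; under [X in intg _ X]eq_fun do rewrite mul0r; exact: intg0. Qed.

Let zero_mid (x a b c : R) : a = 0 -> b = c -> x + a + b = x + c.
Proof. by move=> -> ->; rewrite addr0. Qed.

Let zero_first (x b a : R) : a = 0 -> a + x + b = x + b.
Proof. by move=> ->; rewrite add0r. Qed.

Let addr0_eq' (a b : R) : a + b = 0 -> a = - b.
Proof. by move/eqP; rewrite addr_eq0 => /eqP. Qed.

(** [polarise] applied to [wder_prod_sq], with zero as the time component and a single nonzero space
    component. *)
Lemma wder_prod j (f g u w : mX -> R) phi : L2loc f -> L2loc g -> L2loc u -> L2loc w ->
  wder (0, basis_vec j) f g -> wder (0, basis_vec j) u w -> test phi ->
  \int[mu]_z ((g z * u z + f z * w z) * phi z) = - \int[mu]_z (f z * u z * dy j phi z).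
Proof.
move=> Lf Lg Lu Lw wf wu tphi.
have lgu := L2loc_loc Lg Lu; have lfw := L2loc_loc Lf Lw; have lfu := L2loc_loc Lf Lu.
have lG0 : loc (fun z : mX => g z * u z + f z * w z).
  move=> p tp; have := intgD (lgu _ tp) (lfw _ tp).
  by congr (intg _ _); apply/funext => z; ring.
have lG i : loc (fun z : mX => if i == j then f z * u z else 0).
  by case: (i == j) => //; exact: loc0.
have sumE p : \sum_i \int[mu]_z ((if i == j then f z * u z else 0) * dy i p z) =
    \int[mu]_z (f z * u z * dy j p z).
  rewrite (bigD1 j)//= eqxx big1 ?addr0// => i /negbTE ->.
  by under eq_Rintegral do rewrite mul0r; exact: I0.
have zE p : \int[mu]_z (0 * dt p z) = 0 :> R.
  by under eq_Rintegral do rewrite mul0r; exact: I0.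
have E p := zero_mid (\int[mu]_z ((g z * u z + f z * w z) * p z)) (zE p) (sumE p).
suff H p : test p -> (\int[mu]_z ((g z * u z + f z * w z) * (p z * p z))) +
    \int[mu]_z (f z * u z * dy j (fun z => p z * p z) z) = 0.
  apply: addr0_eq'; apply: etrans (esym (E phi)) _.
  exact: (polarise lG0 (@loc0) lG (fun p tp => etrans (E _) (H p tp)) tphi).
move=> {}tphi; move: p tphi => {}phi tphi.
have tD : test (dy j phi) := ptest_derive (pdir_y j) tphi.
have t2 := ptest_mul tphi tphi; have tpD := ptest_mul tphi tD.
have H := wder_prod_sq Lf Lg Lu Lw wf wu tphi.
have Ia := lgu _ t2; have Ib := lfw _ t2; have Ic := lfu _ tpD.
have e1 : \int[mu]_z ((g z * u z + f z * w z) * (phi z * phi z)) =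
  (\int[mu]_z (g z * phi z * (u z * phi z))) + \int[mu]_z (f z * w z * (phi z * phi z)).
  have -> : \int[mu]_z (g z * phi z * (u z * phi z)) = \int[mu]_z (g z * u z * (phi z * phi z)).
    by apply: I_eq => z; ring.
  by rewrite -ID//; apply: I_eq => z; ring.
have e2 : \int[mu]_z (f z * phi z * (w z * phi z + u z * dy j phi z)) =
  (\int[mu]_z (f z * w z * (phi z * phi z))) + \int[mu]_z (f z * u z * (phi z * dy j phi z)).
  by rewrite -ID//; apply: I_eq => z; ring.
have e3 : \int[mu]_z (f z * dy j phi z * (u z * phi z)) =
  \int[mu]_z (f z * u z * (phi z * dy j phi z)) by apply: I_eq => z; ring.
have e4 : \int[mu]_z (f z * u z * dy j (fun z => phi z * phi z) z) =
  2 * \int[mu]_z (f z * u z * (phi z * dy j phi z)).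
  rewrite -IZ//; apply: I_eq => z.
  by rewrite /dy (derive_sq _ (pdir_y j) tphi); ring.
rewrite e1 e4 H e2 e3; ring.
Qed.

(* With [F = tau^-2 q] and [g = (2 tau^2)^-1 tr TN], the term [g u] compensates
   [F . grad u], so that only the flux [F u] of [u ^ 2] remains. *)
Lemma renormalise (u g : mX -> R) (F v : 'I_n -> mX -> R) phi :
  L2loc u -> L2loc g -> (forall j, L2loc (F j)) -> (forall j, L2loc (v j)) ->
  (forall j, wder (0, basis_vec j) u (v j)) ->
  (forall phi, test phi -> (- \int[mu]_z (u z * dt phi z))
      - \sum_j \int[mu]_z (F j z * dy j phi z) = \int[mu]_z (g z * phi z)) ->
  (forall phi, test phi -> 2 * \int[mu]_z (g z * u z * phi z) =
     - (\sum_j ((\int[mu]_z (F j z * u z * dy j phi z)) +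
               2 * \int[mu]_z (F j z * v j z * phi z)))) ->
  test phi ->
  (\int[mu]_z (u z ^+ 2 * dt phi z)) +
  \sum_j \int[mu]_z (F j z * u z * dy j phi z) = 0.
Proof.
move=> Lu Lg LF Lv wu eu eg tphi.
have luu := L2loc_loc Lu Lu; have lFu j := L2loc_loc (LF j) Lu.
have zE p : \int[mu]_z (0 * p z) = 0 :> R.
  by under eq_Rintegral do rewrite mul0r; exact: I0.
have E0 p := zero_first (\int[mu]_z (u z * u z * dt p z))
  (\sum_j \int[mu]_z (F j z * u z * dy j p z)) (zE p).
have e0 : \int[mu]_z (u z ^+ 2 * dt phi z) = \int[mu]_z (u z * u z * dt phi z).
  by apply: I_eq => z; rewrite expr2.
suff H p : test p -> (\int[mu]_z (u z * u z * dt (fun z => p z * p z) z)) +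
    \sum_j \int[mu]_z (F j z * u z * dy j (fun z => p z * p z) z) = 0.
  have P := polarise (@loc0) luu lFu (fun p tp => etrans (E0 _) (H p tp)) tphi.
  exact: etrans (congr1 (fun a => a + _) e0) (etrans (esym (E0 phi)) P).
move=> {}tphi; move: p tphi => {e0}phi tphi.
have tt : test (dt phi) := ptest_derive (pdir_t n) tphi.
have tD j : test (dy j phi) := ptest_derive (pdir_y j) tphi.
have t2 := ptest_mul tphi tphi; have tpt := ptest_mul tphi tt.
have tpD j := ptest_mul tphi (tD j).
have H := renormalise_sq Lu Lg LF Lv wu eu tphi.
have E := eg _ t2.
have e1 : \int[mu]_z (u z * u z * dt (fun z => phi z * phi z) z) =
  2 * \int[mu]_z (u z * dt phi z * (u z * phi z)).
  have -> : \int[mu]_z (u z * dt phi z * (u z * phi z)) = \int[mu]_z (u z * u z * (phi z * dt phi z)).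
    by apply: I_eq => z; ring.
  rewrite -IZ; last exact: luu.
  by apply: I_eq => z; rewrite /dt (derive_sq _ (pdir_t n) tphi); ring.
have e2 j : \int[mu]_z (F j z * u z * dy j (fun z => phi z * phi z) z) =
  2 * \int[mu]_z (F j z * u z * (phi z * dy j phi z)).
  apply: etrans (IZ 2 (lFu j _ (tpD j))).
  by apply: I_eq => z; rewrite /dy (derive_sq _ (pdir_y j) tphi); ring.
have e3 j : (\int[mu]_z (F j z * phi z * (v j z * phi z + u z * dy j phi z))) +
     \int[mu]_z (F j z * dy j phi z * (u z * phi z)) =
   (\int[mu]_z (F j z * v j z * (phi z * phi z))) +
   2 * \int[mu]_z (F j z * u z * (phi z * dy j phi z)).
  have I1 := L2loc_loc (LF j) (Lv j) t2; have I2 := lFu j _ (tpD j).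
  rewrite mulr2n mulrDl mul1r addrA; congr (_ + _); last by apply: I_eq => z; ring.
  by rewrite -ID//; apply: I_eq => z; ring.
have e4 : \int[mu]_z (g z * phi z * (u z * phi z)) = \int[mu]_z (g z * u z * (phi z * phi z)).
  by apply: I_eq => z; ring.
have sum_split (a b : 'I_n -> R) : \sum_j (a j + b j) = (\sum_j a j) + \sum_j b j by exact: big_split.
have sumZ (c : R) (a : 'I_n -> R) : c * (\sum_j a j) = \sum_j (c * a j) by exact: mulr_sumr.
have S1 := etrans (eq_bigr _ (fun j _ => e3 j)) (sum_split _ _).
have S2 := etrans (eq_bigr (P := predT) (r := index_enum _) _ (fun j _ => e2 j)) (esym (sumZ 2 _)).
(* [V] collects the terms in F . grad u. They occur in the equation tested with [u phi ^ 2] and,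
   doubled, in the identity for [g u]; the two occurrences cancel. *)
have alg (A S G V B V' A1 Q B1 : R) : - A - S = G -> S = V + B1 -> 2 * G = - (Q + V') ->
  A1 = 2 * A -> Q = 2 * B -> B1 = 2 * B -> V' = 2 * V -> A1 + Q = 0 by lra.
have H' := etrans H e4.
have E' := etrans E (congr1 -%R (sum_split _ _)).
exact: (alg _ _ _ _ _ _ _ _ _ H' S1 E' e1 S2 (esym (sumZ 2 _)) (esym (sumZ 2 _))).
Qed.

End renormalisation.

(** * Logarithmic time *)

Section tau.
Context {R : realType}.
Variable tau : R -> R.
Hypothesis ht : is_tau tau.
Implicit Types s t x : R.
Local Notation dtau := (tau^`()%classic).

Lemma is_derive_tau t : 0 < t -> is_derive t (1 : R) tau (dtau t).
Proof.
by move=> t0; split; [exact: (@tau_smooth _ _ ht 0 t t0)|rewrite derive1E].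
Qed.

Lemma is_derive_dtau t : 0 < t -> is_derive t (1 : R) dtau (2 / tau t).
Proof.
move=> t0; split; first exact: (@tau_smooth _ _ ht 1 t t0).
by rewrite -(tau_ode ht t0) -derive1E.
Qed.

Lemma tau_pos t : 0 < t -> 0 < tau t.
Proof. by move=> t0; apply: tau_gt0 ht _ (ltW t0). Qed.

Lemma MVT_pos (f df : R -> R) s t : 0 < s -> s < t ->
  (forall x, 0 < x -> is_derive x (1 : R) f (df x)) ->
  exists2 x, s < x < t & f t - f s = df x * (t - s).
Proof.
move=> s0 st hf.
have hx x : x \in `]s, t[ -> is_derive x (1 : R) f (df x).
  by rewrite in_itv /= => /andP[sx _]; apply: hf; exact: lt_trans sx.
have [|x xst E] := MVT st hx; last by exists x => //; move: xst; rewrite in_itv.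
apply: continuous_in_subspaceT => x; rewrite inE /= in_itv /= => /andP[sx _].
by apply: is_derive_continuous (hf x _); exact: lt_le_trans sx.
Qed.

Lemma dtau_mono s t : 0 < s -> s < t -> dtau s < dtau t.
Proof.
move=> s0 st; have [x /andP[sx xt] E] := MVT_pos s0 st is_derive_dtau.
rewrite -subr_gt0 E mulr_gt0 ?subr_gt0// divr_gt0// tau_pos//.
exact: lt_trans sx.
Qed.

Lemma dtau_gt0 t : 0 < t -> 0 < dtau t.
Proof.
move=> t0; have h0 : 0 < t / 2 by lra.
apply: (@le_lt_trans _ _ (dtau (t / 2))); last by apply: dtau_mono => //; lra.
apply: (cvgr_to_le (dtau_cvg0 ht)).
near=> s; apply/ltW/dtau_mono.
  by near: s; exact: nbhs_right_gt.
by near: s; exact: nbhs_right_lt.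
Unshelve. all: by end_near.
Qed.

Lemma tau_mono s t : 0 < s -> s < t -> tau s < tau t.
Proof.
move=> s0 st; have [x /andP[sx xt] E] := MVT_pos s0 st is_derive_tau.
rewrite -subr_gt0 E mulr_gt0 ?subr_gt0// dtau_gt0//.
exact: lt_trans sx.
Qed.

Lemma tau_ge1 t : 0 < t -> 1 <= tau t.
Proof.
move=> t0; rewrite -(tau0 ht).
apply: (cvgr_to_le (tau_cvg0 ht)).
near=> s; apply/ltW/tau_mono.
  by near: s; exact: nbhs_right_gt.
by near: s; exact: nbhs_right_lt.
Unshelve. all: by end_near.
Qed.

(** The first integral of the equation: the difference of the two sides has zero derivative for t >
    0 and tends to 0 at 0, where tau = 1 and tau' = 0. *)
Lemma dtau_sq t : 0 < t -> dtau t ^+ 2 = 4 * ln (tau t).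
Proof.
move=> t0; apply/eqP; rewrite -subr_eq0; apply/eqP.
pose f t := dtau t * dtau t - 4 * ln (tau t).
have hf (x : R) : 0 < x -> is_derive x (1 : R) f ((fun=> 0) x).
  move=> x0; have px := tau_pos x0.
  have h1 := is_deriveM (is_derive_dtau x0) (is_derive_dtau x0).
  have h2 := @is_derive1_comp _ (@ln R) tau x _ _ (is_derive1_ln px) (is_derive_tau x0).
  have h3 : is_derive x (1 : R) f _ := is_deriveB h1 (is_deriveZ 4 h2).
  apply: is_derive_eq h3 _; rewrite /GRing.scale /=.
  by field; rewrite gt_eqF.
have cf : f s @[s --> (0:R)^'+] --> 0 * 0 - 4 * ln 1.
  apply: cvgB; first by apply: cvgM; exact: dtau_cvg0 ht.
  apply: cvgM; first exact: cvg_cst.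
  apply: continuous_cvg; first exact: continuous_ln.
  by have := tau_cvg0 ht; rewrite (tau0 ht).
have cf2 : f s @[s --> (0:R)^'+] --> f t.
  apply: cvg_near_cst; near=> s.
  have [s0 st] : 0 < s /\ s < t.
    by split; near: s; [exact: nbhs_right_gt|exact: nbhs_right_lt].
  have [x _ E] := MVT_pos s0 st hf.
  by apply/esym/eqP; rewrite -subr_eq0 E mul0r.
have E : f t = 0 * 0 - 4 * ln 1 by apply: (cvg_unique _ cf2 cf).
by move: E; rewrite /f ln1 !mulr0 subr0 expr2.
Unshelve. all: by end_near.
Qed.

Lemma tau_lin t : 1 < t -> tau t >= dtau 1 * (t - 1).
Proof.
move=> t1; have [x /andP[x1 _] E] := MVT_pos ltr01 t1 is_derive_tau.
have h : dtau 1 <= dtau x by apply/ltW/dtau_mono.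
have := tau_pos (@ltr01 R) => p1.
have : dtau 1 * (t - 1) <= dtau x * (t - 1) by rewrite ler_wpM2r// subr_ge0 ltW.
lra.
Qed.

Lemma dtau_large (A : R) : exists2 T, 1 < T & forall t, T < t -> A < dtau t.
Proof.
have d1 := dtau_gt0 (@ltr01 R).
(* Once tau exceeds [B], tau'^2 = 4 ln tau exceeds A^2; tau does so because it grows at least
   linearly. *)
pose B := expR (A ^+ 2 + 1).
have b0 : 0 <= B / dtau 1 by rewrite divr_ge0 ?expR_ge0// ltW.
exists (B / dtau 1 + 2); first by lra.
move=> t Tt.
have t1 : 1 < t by lra.
have t0 : 0 < t by lra.
have h : B < tau t.
  apply: lt_le_trans (tau_lin t1).
  by rewrite -ltr_pdivrMl// mulrC; lra.
have h2 : A ^+ 2 + 1 < ln (tau t).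
  by rewrite -(expRK (A ^+ 2 + 1)) ltr_ln ?posrE ?expR_gt0 ?tau_pos.
rewrite ltNge; apply/negP => hA; have d0 := dtau_gt0 t0.
have := dtau_sq t0.
have : dtau t ^+ 2 <= A ^+ 2 by rewrite !expr2 ler_pM// ltW.
by have := sqr_ge0 A; lra.
Qed.

(** From tau'^2 = 4 ln tau and ln tau <= tau - 1. As tau' is unbounded, this sends the coefficient
    of the viscous drift to 0. *)
Lemma dtau_tau t : 0 < t -> dtau t / tau t <= 4 / dtau t.
Proof.
move=> t0; have d0 := dtau_gt0 t0; have p0 := tau_pos t0.
rewrite ler_pdivrMr// mulrAC ler_pdivlMr// -expr2 dtau_sq//.
have := le_ln1Dx (x := tau t - 1).
have -> : 1 + (tau t - 1) = tau t by ring.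
move=> h; have /h : -1 < tau t - 1 by lra.
lra.
Qed.

Definition kappa t := 2^-1 * ln (dtau t).

Lemma is_derive_kappa t : 0 < t -> is_derive t (1 : R) kappa ((tau t * dtau t)^-1).
Proof.
move=> t0; have d0 := dtau_gt0 t0; have p0 := tau_pos t0.
have h2 := @is_derive1_comp _ (@ln R) dtau t _ _ (is_derive1_ln d0) (is_derive_dtau t0).
have h3 : is_derive t (1 : R) kappa _ := is_deriveZ 2^-1 h2.
apply: is_derive_eq h3 _; rewrite /GRing.scale /=.
by field; rewrite !gt_eqF.
Qed.

Lemma kappa_mono s t : 0 < s -> s < t -> kappa s < kappa t.
Proof.
move=> s0 st; rewrite ltr_pM2l// ltr_ln ?posrE ?dtau_gt0 ?dtau_mono//.
exact: lt_trans st.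
Qed.

Lemma kappa_large (A : R) : exists2 T, 1 < T & forall t, T < t -> A < kappa t.
Proof.
have [T T1 hT] := dtau_large (expR (2 * A)); exists T => // t Tt.
have t0 : 0 < t by lra.
have : 2 * A < ln (dtau t).
  by rewrite -(expRK (2 * A)) ltr_ln ?posrE ?expR_gt0 ?dtau_gt0// hT.
by rewrite /kappa; lra.
Qed.

Lemma kappa_small (A : R) : exists2 a, 0 < a & forall t, 0 < t -> t <= a -> kappa t < A.
Proof.
have h : \forall s \near (0 : R)^'+, dtau s < expR (2 * A).
  by apply: (cvgr_lt _ (dtau_cvg0 ht)); exact: expR_gt0.
have [a [a0 ha]] : exists a, 0 < a /\ dtau a < expR (2 * A).
  near (0 : R)^'+ => a; exists a; split; last by near: a.
  by near: a; exact: nbhs_right_gt.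
exists a => // t t0 ta.
have : dtau t < expR (2 * A).
  by move: ta; rewrite le_eqVlt => /orP[/eqP->//|ta]; apply: lt_trans ha; exact: dtau_mono.
move=> h2; have : ln (dtau t) < ln (expR (2 * A)) by rewrite ltr_ln ?posrE ?expR_gt0 ?dtau_gt0.
rewrite expRK /kappa; lra.
Unshelve. all: by end_near.
Qed.

(* Functions of [tau], [tau'] and [kappa], closed under derivation on t > 0 by
   the equation of [tau]. *)
Inductive tau_class : (R -> R) -> Prop :=
| tc_cst c : tau_class (fun=> c)
| tc_tau : tau_class tau
| tc_dtau : tau_class dtau
| tc_inv : tau_class (fun t => (tau t)^-1)
| tc_dinv : tau_class (fun t => (dtau t)^-1)
| tc_kappa b : smooth1 b -> tau_class (fun t => b (kappa t))
| tc_add f g : tau_class f -> tau_class g -> tau_class (fun t => f t + g t)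
| tc_mul f g : tau_class f -> tau_class g -> tau_class (fun t => f t * g t).

Lemma tau_class_derive f : tau_class f -> exists2 f', tau_class f' &
  forall t, 0 < t -> is_derive t (1 : R) f (f' t).
Proof.
elim=> {f}.
- by move=> c; exists (fun=> 0); [exact: tc_cst|move=> t _; exact: is_derive_cst].
- by exists dtau; [exact: tc_dtau|exact: is_derive_tau].
- exists (fun t => 2 / tau t); last exact: is_derive_dtau.
  by apply: tc_mul; [exact: tc_cst|exact: tc_inv].
- exists (fun t => (-1) * (dtau t * ((tau t)^-1 * (tau t)^-1))).
    apply: tc_mul; first exact: tc_cst.
    by apply: tc_mul; [exact: tc_dtau|apply: tc_mul; exact: tc_inv].
  move=> t t0; have p0 := tau_pos t0.
  have h := @is_deriveV R tau t _ _ (lt0r_neq0 p0) (is_derive_tau t0).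
  by apply: is_derive_eq h _; rewrite /GRing.scale /=; field; rewrite gt_eqF.
- exists (fun t => (-1) * ((2 / tau t) * ((dtau t)^-1 * (dtau t)^-1))).
    apply: tc_mul; first exact: tc_cst.
    apply: tc_mul; last by apply: tc_mul; exact: tc_dinv.
    by apply: tc_mul; [exact: tc_cst|exact: tc_inv].
  move=> t t0; have p0 := tau_pos t0; have d0 := dtau_gt0 t0.
  have h := @is_deriveV R dtau t _ _ (lt0r_neq0 d0) (is_derive_dtau t0).
  by apply: is_derive_eq h _; rewrite /GRing.scale /=; field; rewrite !gt_eqF.
- move=> b /smooth1_derive[b' sb' hb].
  exists (fun t => b' (kappa t) * ((tau t)^-1 * (dtau t)^-1)).
    by apply: tc_mul; [exact: tc_kappa|apply: tc_mul; [exact: tc_inv|exact: tc_dinv]].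
  move=> t t0; have p0 := tau_pos t0; have d0 := dtau_gt0 t0.
  have h := @is_derive1_comp _ b kappa t _ _ (hb _) (is_derive_kappa t0).
  by apply: is_derive_eq h _; rewrite /GRing.scale /= invfM; ring.
- move=> f g _ [f' cf' hf] _ [g' cg' hg]; exists (fun t => f' t + g' t); first exact: tc_add.
  by move=> t t0; exact: is_deriveD (hf t t0) (hg t t0).
- move=> f g cf [f' cf' hf] cg [g' cg' hg].
  exists (fun t => f t * g' t + g t * f' t); first by apply: tc_add; exact: tc_mul.
  by move=> t t0; exact: is_deriveM (hf t t0) (hg t t0).
Qed.

(** [smooth1] concerns the whole line, whereas tau is prescribed only for t >= 0. A smooth factor
    vanishing before a positive time hides the rest. *)
Inductive tau_cut (a : R) : (R -> R) -> Prop :=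
| tau_cut_mul z f : smooth1 z -> (forall t, t < a -> z t = 0) -> tau_class f ->
    tau_cut a (fun t => z t * f t)
| tau_cut_add f g : tau_cut a f -> tau_cut a g -> tau_cut a (fun t => f t + g t).

Lemma smooth1_tau_cut a f : 0 < a -> tau_cut a f -> smooth1 f.
Proof.
move=> a0 cf; exists (tau_cut a) => // {cf}f; elim=> {f}.
  move=> z f sz z0 cf.
  have [z' sz' hz] := smooth1_derive sz; have [f' cf' hf] := tau_class_derive cf.
  have z'0 t : t < a -> z' t = 0.
    move=> ta; have [_ <-] := hz t.
    have /near_eq_derive -> : \forall s \near t, z s = 0; rewrite ?derive_cst//.
    near=> s; apply: z0; near: s; exact: lt_nbhsl.
  exists (fun t => z t * f' t + z' t * f t).
    by apply: tau_cut_add; exact: tau_cut_mul.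
  move=> t; have [ta|ta] := ltP t a.
    rewrite z0// z'0// !mul0r addr0.
    have h0 : \forall s \near t, (fun=> 0 : R) s = z s * f s.
      by near=> s; rewrite z0 ?mul0r//; near: s; exact: lt_nbhsl.
    exact: near_eq_is_derive h0 (is_derive_cst _ _ _).
  have t0 : 0 < t by exact: lt_le_trans ta.
  have h : is_derive t (1 : R) (fun t => z t * f t) _ := is_deriveM (hz t) (hf t t0).
  by apply: is_derive_eq h _; rewrite /GRing.scale /=; ring.
move=> f g _ [f' cf' hf] _ [g' cg' hg]; exists (fun t => f' t + g' t); first exact: tau_cut_add.
by move=> t; exact: is_deriveD (hf t) (hg t).
Unshelve. all: by end_near.
Qed.

End tau.

(** * Integrals and test functions on the time line *)

Section time_line.
Context {R : realType}.
Local Notation leb := (@lebesgue_measure R).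
Implicit Types (a b s t x : R).

Lemma intgX_tensor n (a : R -> R) (b : 'rV[R]_n -> R) : intg leb a -> intg (lebesgue_rV n) b ->
  intg (@muX R n) (fun z => a z.1 * b z.2) /\
  \int[@muX R n]_z (a z.1 * b z.2) = (\int[leb]_t a t) * \int[lebesgue_rV n]_y b y.
Proof.
move=> Ia Ib.
have I1 : intg (@muX R n) (fun z => a z.1 * b z.2).
  have := @intg_tensor _ _ _ _ _ leb (lebesgue_rV n) a b (fun=> 1) 1 Ia Ib (measurable_cst _).
  rewrite (_ : (fun z => _) = (fun z => a z.1 * b z.2 : R)).
    by apply=> z; rewrite normr1.
  by apply/funext => z; rewrite mulr1.
split => //; rewrite -(fubX1 I1).2 /=.
under eq_Rintegral do rewrite IZ//.
by under eq_Rintegral do rewrite mulrC; rewrite IZ// mulrC.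
Qed.

(** The time line as the space-time with space R^0, a single point of mass 1; [mollify_X] then also
    serves functions of time. *)
Lemma I_line (g : R -> R) : intg leb g ->
  intg (@muX R 0) (fun z => g z.1) /\ \int[@muX R 0]_z g z.1 = \int[leb]_t g t.
Proof.
move=> Ig; have := intgX_tensor Ig (intg_rV0 (fun=> 1)).
rewrite I_rV0 mulr1.
by rewrite (_ : (fun z => g z.1 * 1) = (fun z => g z.1))//; apply/funext => z; rewrite mulr1.
Qed.

Lemma L2_line (g : R -> R) : L2 leb g -> L2 (@muX R 0) (fun z => g z.1).
Proof.
move=> [mg Ig]; split; first exact: (measurableT_comp mg measurable_fst).
exact: (I_line Ig).1.
Qed.

Lemma time_test_intg chi : time_test chi -> intg leb chi.
Proof.
move=> tc; have [[sc [m m0]] [M hM]] := (tc, time_test_bounded tc).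
have I1 := (@I_indic_itv R 0 m%:R (ler0n _ _)).1.
apply: (intg_le _ _ (intgZ M I1)); first exact: measurable_smooth1.
move=> t; rewrite indic_le subr0; case: (leP `|t| m%:R) => h; first by rewrite mulr1.
by rewrite mulr0 m0 ?normr0// ltW.
Qed.

Lemma time_test_kap k s chi : time_test chi -> time_test (fun t => chi t * kap k (t - s)).
Proof.
move=> tc; have := time_testM (smooth1_affine 1 (- s) (smooth1_kap k)) tc.
rewrite (_ : (fun t => _) = (fun t => chi t * kap k (t - s)))//.
by apply/funext => t; rewrite mul1r mulrC.
Qed.

Definition hat a b t := flat 0 (1 * t + - a) * flat 0 ((-1) * t + b).

Lemma hat_test a b : time_test (hat a b).
Proof.
split; first by apply: smooth1M; apply: smooth1_affine; exact: smooth1_flat.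
exists (Num.bound (`|a| + `|b|)) => t h.
have : `|a| + `|b| < `|t| by apply: lt_le_trans h; apply: archi_boundP; rewrite addr_ge0.
rewrite ltr_normr => /orP[h1|h1]; rewrite /hat /flat.
  rewrite [X in _ * X]ifF ?mulr0//; apply/negbTE; rewrite -leNgt.
  by have := ler_norm b; have := normr_ge0 a; lra.
rewrite [X in X * _]ifF ?mul0r//; apply/negbTE; rewrite -leNgt.
by have := ler_norm (- a); have := normr_ge0 b; rewrite normrN; lra.
Qed.

Lemma hat_ge0 a b t : 0 <= hat a b t.
Proof. by rewrite mulr_ge0// flat_ge0. Qed.

Lemma hat_gt0 a b t : a < t < b -> 0 < hat a b t.
Proof.
move=> /andP[h1 h2]; rewrite /hat /flat !ifT; [|lra|lra].
by rewrite !expr0 !mul1r mulr_gt0// expR_gt0.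
Qed.

Lemma hat_out a b t : ~ (a < t < b) -> hat a b t = 0.
Proof.
move=> /negP; rewrite negb_and -!leNgt => /orP[h|h]; rewrite /hat /flat.
  by rewrite ifF ?mul0r//; apply/negbTE; rewrite -leNgt; lra.
by rewrite [X in _ * X]ifF ?mulr0//; apply/negbTE; rewrite -leNgt; lra.
Qed.

(** Let A = f hat and let B be its positive part. Mollified, the integral of A B is an average over
    s of B(s) times the integral of f against the nonnegative test function hat(t) K(t - s), hence
    is not positive. As A B >= 0, it vanishes almost everywhere, and [hat] is positive exactly on
    ]a, b[. *)
Lemma ae_le_test (f : R -> R) a b : measurable_fun setT f ->
  intg leb (fun t => (f t * hat a b t) ^+ 2) ->
  (forall h, time_test h -> (forall t, 0 <= h t) ->
     (forall t, ~ (a < t < b) -> h t = 0) -> \int[leb]_t (f t * h t) <= 0) ->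
  {ae leb, forall t, a < t < b -> f t <= 0}.
Proof.
move=> mf If H.
have mh : measurable_fun setT (hat a b) by exact: measurable_smooth1 (hat_test a b).1.
have [M hM] := time_test_bounded (hat_test a b).
pose A t := f t * hat a b t; pose B t := Num.max (A t) 0.
have mA : measurable_fun setT A by exact: measurable_funM.
have mB : measurable_fun setT B by apply: measurable_maxr => //; exact: measurable_cst.
have LA : L2 leb A by split.
have LB : L2 leb B.
  split=> //; apply: (intg_le _ _ If); first exact: measurable_funX.
  move=> t; rewrite ger0_norm ?sqr_ge0// -/(A t) /B.
  by case: (leP (A t) 0) => h; rewrite ?expr0n ?sqr_ge0//= lexx.
have c := mollify_X (L2_line LA) (L2_line LB).
have ge0 : \int[@muX R 0]_z (A z.1 * B z.1) >= 0.
  apply: I_ge0 => z; rewrite /B; case: (leP (A z.1) 0) => h; first by rewrite mulr0.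
  by rewrite mulr_ge0// ltW.
have IAB : intg leb (fun t => A t * B t) by exact: L2_mul.
have IA : intg leb A.
  have [_ [m m0]] := hat_test a b.
  have Lc : L2 leb (plateau m).
    split; first exact: measurable_smooth1 (smooth1_plateau m).
    by apply: time_test_intg; apply: time_testM; [exact: smooth1_plateau|exact: time_test_plateau].
  have := L2_mul LA Lc; congr (intg _ _); apply/funext => t.
  rewrite /A; case: (leP m%:R `|t|) => h; first by rewrite m0// mulr0 mul0r.
  by rewrite plateau1 ?mulr1// (le_trans (ltW h))// ler_nat.
have IB : intg leb B.
  apply: (intg_le _ _ (intg_abs IA)); first exact: mB.
  move=> t; rewrite /B.
  by case: (leP (A t) 0) => h; rewrite ?normr0.
have E0 : \int[leb]_t (A t * B t) = 0.
  rewrite -(I_line IAB).2; apply/eqP; rewrite eq_le ge0 andbT.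
  apply: (cvgr_to_le c); apply: nearW => k.
  have kE (x y : measurableTypeR R * 'rV[R]_0) : kerX k (x, y) = kap k (x.1 - y.1).
    by rewrite /kerX /kerR big_ord0 mulr1.
  have IAB2 := bil_intg_bd (@measurable_kerX R 0 k) (@kerX_bounded R 0 k) (I_line IA).1 (I_line IB).1.
  rewrite /bil -(fub2 IAB2).2.
  suff H2 y : \int[@muX R 0]_x (A x.1 * B y.1 * kerX k (x, y)) <= 0.
    rewrite -oppr_ge0 -IN; last by case: (fub2 IAB2).
    by apply: I_ge0 => y; rewrite oppr_ge0; exact: H2.
  have tk := time_test_kap k y.1 (hat_test a b).
  have Bk : 0 <= B y.1 by rewrite /B le_max lexx orbT.
  have Ik : intg leb (fun t => f t * (hat a b t * kap k (t - y.1))).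
    have mk : measurable_fun setT (fun t => kap k (t - y.1)).
      have := measurable_smooth1 (smooth1_affine 1 (- y.1) (smooth1_kap k)).
      by congr measurable_fun; apply/funext => t; rewrite mul1r.
    have [C hC] := @kap_bounded R k.
    have := intg_bdM IA mk (fun t => hC (t - y.1)).
    by congr (intg _ _); apply/funext => t; rewrite /A mulrA.
  have h0 := H _ tk (fun t => mulr_ge0 (hat_ge0 _ _ _) (kap_ge0 _ _)) _.
  have e := etrans (I_line (intgZ (B y.1) Ik)).2 (IZ (B y.1) Ik).
  apply: (@le_trans _ _ (B y.1 * \int[leb]_t (f t * (hat a b t * kap k (t - y.1))))).
    by rewrite -e le_eqVlt; apply/orP; left; apply/eqP/I_eq => x; rewrite kE /A; ring.
  apply: mulr_ge0_le0 => //; apply: h0.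
  by move=> t /hat_out ->; rewrite mul0r.
have AB0 t : 0 <= A t * B t.
  rewrite /B; case: (leP (A t) 0) => h; first by rewrite mulr0.
  by rewrite mulr_ge0// ltW.
move: (I_eq0_ae IAB AB0 E0); apply: filterS => t h ab.
rewrite leNgt; apply/negP => ft.
have At : 0 < A t by rewrite mulr_gt0// hat_gt0.
move: h; rewrite /B; case: (leP (A t) 0) => [|_]; first by rewrite leNgt At.
by move/eqP; rewrite mulf_eq0 gt_eqF.
Qed.

(** The zero mean is what makes the primitive vanish again to the right of [b]. *)
Lemma time_test_prim h a b : time_test h -> a < b ->
  (forall t, ~ (a < t < b) -> h t = 0) -> \int[leb]_t h t = 0 ->
  exists chi, [/\ time_test chi, forall t, is_derive t (1 : R) chi (h t),
    forall t, ~ (a < t < b) -> chi t = 0 &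
    forall t, `|chi t| <= \int[leb]_t `|h t|].
Proof.
move=> th ab h0 Ih0; have Ih := time_test_intg th; have sh := th.1.
pose chi x := \int[leb]_(t in `]-oo, x]) h t.
have chiE x : chi x = \int[leb]_t (h t * \1_`]-oo, x] t).
  rewrite /chi Rintegral_mkcond; apply: I_eq => t.
  by rewrite patchE indicE; case: (_ \in _); rewrite ?mulr1 ?mulr0.
have dchi x : is_derive x (1 : R) chi (h x).
  have xu : x < x + 1 by lra.
  have Ib : leb.-integrable `]-oo, (x + 1)] (EFin \o h) by apply: integrableS Ih.
  have [] := @continuous_FTC1 _ h -oo%O x _ xu Ib (ltNyr _).
    exact: smooth1_continuous sh _.
  by move=> h1; rewrite derive1E => h2; split.
have out t : ~ (a < t < b) -> chi t = 0.
  move=> /negP; rewrite negb_and -!leNgt chiE => /orP[l|l].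
    rewrite -[RHS](I0 leb); apply: I_eq => s.
    rewrite indicE mem_setE in_itv /=; case: (leP s t) => ts; rewrite ?mulr0//.
    by rewrite h0 ?mul0r// => /andP[]; lra.
  rewrite -Ih0; apply: I_eq => s.
  rewrite indicE mem_setE in_itv /=; case: (leP s t) => ts; rewrite ?mulr1//.
  by rewrite h0 ?mul0r// => /andP[]; lra.
exists chi; split => //.
  split; first exact: smooth1_primitive sh dchi.
  exists (Num.bound (`|a| + `|b|)) => t ht; apply: out => /andP[h1 h2].
  have : `|a| + `|b| < `|t| by apply: lt_le_trans ht; apply: archi_boundP; rewrite addr_ge0.
  rewrite ltr_normr => /orP[h3|h3].
    by have := ler_norm b; have := normr_ge0 a; lra.
  by have := ler_norm (- a); have := normr_ge0 b; rewrite normrN; lra.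
move=> t; rewrite chiE.
have Iind : intg leb (fun s => h s * \1_`]-oo, t] s).
  apply: (intg_bdM (C := 1) Ih); first by apply: measurable_indic; exact: measurable_itv.
  by move=> s; rewrite indicE; case: (_ \in _); rewrite ?normr0 ?normr1.
apply: I_norm_le => //; first exact: intg_abs.
by move=> s; rewrite indicE; case: (_ \in _); rewrite ?mulr1 ?mulr0 ?normr0.
Qed.

(** Switches on between the times 1 / (n + 1) and 3 / (n + 1). It makes a test function admissible
    for positive times, and its derivative is a unit mass that samples the solution near t = 0. *)
Definition onset (n : nat) t := step (n.+1%:R * t + (- 2)).

Lemma smooth1_onset n : smooth1 (onset n).
Proof. by apply: smooth1_affine; exact: smooth1_step. Qed.

Lemma is_derive_onset n t : is_derive t (1 : R) (onset n) (n.+1%:R * bumpf (n.+1%:R * t + (- 2))).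
Proof.
have := @is_derive1_comp _ step (fun s => n.+1%:R * s + (- 2)) t _ _
  (is_derive_step _) (is_derive_affine _ (- 2) t).
by move=> h; apply: is_derive_eq h _; rewrite mulrC.
Qed.

Lemma onset0 n t : n.+1%:R * t <= 1 -> onset n t = 0.
Proof. by move=> h; rewrite /onset step0//; lra. Qed.

Lemma onset1 n t : 3 <= n.+1%:R * t -> onset n t = 1.
Proof. by move=> h; rewrite /onset step1//; lra. Qed.

Lemma onset_neg n t : t <= 0 -> onset n t = 0.
Proof. by move=> h; rewrite onset0// (le_trans _ ler01)// mulr_ge0_le0. Qed.

Lemma onset_bd n t : `|onset n t| <= 1.
Proof. by rewrite ger0_norm ?step_ge0// step_le1. Qed.

Lemma onset_cvg t : 0 < t -> onset n t @[n --> \oo] --> (1 : R).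
Proof.
move=> t0; apply: cvg_near_cst.
exists (Num.bound (3 / t)) => // n /= hn; apply: onset1.
rewrite -ler_pdivrMr//; apply/ltW; apply: (lt_le_trans (archi_boundP _)).
  by rewrite divr_ge0// ltW.
by rewrite ler_nat (leq_trans hn).
Qed.

End time_line.

(** * Windows of logarithmic time *)

Section window.
Context {R : realType}.
Local Notation leb := (@lebesgue_measure R).
Variable tau : R -> R.
Hypothesis ht : is_tau tau.
Local Notation dtau := (tau^`()%classic).
Local Notation kappa := (kappa tau).

(** A bump in the variable kappa, centred at n, times kappa'; hence its integral is 1. For t <= 0 it
    is set to 0, since tau is not prescribed there. *)
Definition window (n : nat) (t : R) : R :=
  if 0 < t then bumpf (kappa t - n%:R) / (tau t * dtau t) else 0.

Lemma window_start n : exists2 a : R, 0 < a &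
  forall t, t <= a -> t <= 0 \/ kappa t <= n%:R - 1.
Proof.
have [a a0 ha] := kappa_small ht (n%:R - 1); exists a => // t ta.
by have [t0|t0] := leP t 0; [left|right; apply/ltW/ha].
Qed.

Lemma window_stop n : exists2 T : R, 1 < T & forall t, T < t -> n%:R + 1 < kappa t.
Proof. exact: kappa_large ht _. Qed.

Lemma window_test n : time_test (window n).
Proof.
have [a a0 ha] := window_start n; have [T T1 hT] := window_stop n.
split; last first.
  exists (Num.bound T) => t h.
  have : T < `|t| by apply: lt_le_trans h; apply: archi_boundP; lra.
  rewrite ltr_normr => /orP[h1|h1]; rewrite /window.
    by have := hT _ h1 => h2; rewrite bump_out ?mul0r ?if_same// ler_normr; apply/orP; left; lra.
  by rewrite ifF//; apply/negbTE; rewrite -leNgt; lra.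
(* 0 for t <= a / 2 and 1 for t >= a. The window vanishes before [a], so the factor changes nothing
   but gives the form that [tau_cut] asks for. *)
pose z t := step (4 / a * t + - 3).
have E : window n = fun t => z t * ((fun t => bumpf (kappa t - n%:R)) t *
    ((tau t)^-1 * (dtau t)^-1)).
  apply/funext => t; rewrite /window.
  have [ta|ta] := leP t a.
    have [t0|h] := ha t ta.
      rewrite ltNge t0 /= /z step0 ?mul0r//.
      have w0 : 0 <= 4 / a by rewrite divr_ge0// ltW.
      by have := mulr_ge0_le0 w0 t0; lra.
    by rewrite bump_out ?mul0r ?mulr0 ?if_same// ler_normr; apply/orP; right; lra.
  rewrite (lt_trans a0 ta) /z step1 ?mul1r ?invfM//.
  have : 4 < 4 / a * t by rewrite mulrAC ltr_pdivlMr// ltr_pM2l.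
  by lra.
rewrite E; apply: (smooth1_tau_cut ht (a := a / 2)); first by lra.
apply: tau_cut_mul.
- by apply: smooth1_affine; exact: smooth1_step.
- move=> t ta; rewrite /z step0//.
  have : 4 / a * t < 2 by rewrite mulrAC ltr_pdivrMr//; lra.
  by lra.
- apply: tc_mul; last by apply: tc_mul; [exact: tc_inv|exact: tc_dinv].
  apply: (@tc_kappa _ _ (fun x => bumpf (x - n%:R))).
  have := smooth1_affine 1 (- n%:R) (@smooth1_bump R).
  by congr smooth1; apply/funext => x; rewrite mul1r.
Qed.

Lemma window_ge0 n t : 0 <= window n t.
Proof.
rewrite /window; case: ifPn => // t0.
by rewrite divr_ge0 ?bump_ge0// mulr_ge0 ?ltW ?(tau_pos ht) ?(dtau_gt0 ht).
Qed.

Lemma window_out n t : ~ (0 < t /\ `|kappa t - n%:R| < 1) -> window n t = 0.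
Proof.
rewrite /window; case: ifPn => // t0 h.
by rewrite bump_out ?mul0r// leNgt; apply/negP => h'; apply: h.
Qed.

Lemma window_le n t : 0 < t -> window n t <= bump_mass^-1 / (tau t * dtau t).
Proof.
move=> t0; rewrite /window t0 ler_wpM2r ?bump_le// invr_ge0 mulr_ge0//.
  by rewrite ltW ?(tau_pos ht).
by rewrite ltW ?(dtau_gt0 ht).
Qed.

Lemma I_window n : \int[leb]_t window n t = 1.
Proof.
have [a a0 ha] := window_start n; have [T T1 hT] := window_stop n.
pose S t := if 0 < t then step (kappa t - n%:R) else 0.
have S0 t : t <= a -> S t = 0.
  rewrite /S => /ha[t0|h]; first by rewrite ltNge t0.
  by rewrite step0 ?if_same//; lra.
have dS t : is_derive t (1 : R) S (window n t).
  have [t0|t0] := ltP 0 t.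
    have h1 := @is_derive1_comp _ step (fun t => kappa t - n%:R) t _ _
      (is_derive_step _) (is_deriveB (is_derive_kappa ht t0) (is_derive_cst (n%:R : R) t (1 : R))).
    have h2 : \forall s \near t, step (kappa s - n%:R) = S s.
      by near=> s; rewrite /S ifT//; near: s; exact: lt_nbhsr.
    apply: (near_eq_is_derive h2); apply: is_derive_eq h1 _.
    by rewrite /window t0 subr0 mulrC.
  have h2 : \forall s \near t, (fun=> 0 : R) s = S s.
    by near=> s; rewrite S0//; apply/ltW; near: s; apply: lt_nbhsl; lra.
  rewrite /window ltNge t0 /=; exact: near_eq_is_derive h2 (is_derive_cst _ _ _).
have T0 : 0 < T + 1 by lra.
have [||_ ->] := @I_derive_compact R S (window n) 0 (T + 1) T0 dS; first 2 last.
- rewrite [S 0]S0 ?ltW// subr0 /S ifT; last by lra.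
  by rewrite step1//; have := hT (T + 1) _; lra.
- exact: smooth1_continuous (window_test n).1.
- move=> t; rewrite in_itv /= negb_and -!ltNge => /orP[h|h]; apply: window_out => -[t0].
    by lra.
  have : n%:R + 1 < kappa t by apply: hT; lra.
  by rewrite ltr_norml => h1 /andP[]; lra.
Unshelve. all: by end_near.
Qed.

Lemma window_deriveE n w' t : (forall t, is_derive t (1 : R) (window n) (w' t)) -> 0 < t ->
  w' t = (bumpd (kappa t - n%:R) / dtau t ^+ 2 -
    bumpf (kappa t - n%:R) * (1 + 2 / dtau t ^+ 2)) / tau t ^+ 2.
Proof.
move=> hw t0; have d0 := dtau_gt0 ht t0; have p0 := tau_pos ht t0.
have h1 := @is_derive1_comp _ bumpf (fun t => kappa t - n%:R) t _ _
  (is_derive_bumpf _) (is_deriveB (is_derive_kappa ht t0) (is_derive_cst (n%:R : R) t (1 : R))).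
have h2 := is_deriveM (is_derive_tau ht t0) (is_derive_dtau ht t0).
have nz : tau t * dtau t != 0 by rewrite mulf_neq0// gt_eqF.
have h3 := @is_deriveV R (fun t => tau t * dtau t) t _ _ nz h2.
have h4 : is_derive t (1 : R) (fun t => bumpf (kappa t - n%:R) * (tau t * dtau t)^-1) _ :=
  is_deriveM h1 h3.
have h5 : \forall s \near t, bumpf (kappa s - n%:R) * (tau s * dtau s)^-1 = window n s.
  by near=> s; rewrite /window ifT//; near: s; exact: lt_nbhsr.
have [_ E1] := near_eq_is_derive h5 h4; have [_ E2] := hw t.
rewrite -E2 E1 /GRing.scale /= subr0.
by field; rewrite !gt_eqF.
Unshelve. all: by end_near.
Qed.

Lemma window_derive_out n w' t : (forall t, is_derive t (1 : R) (window n) (w' t)) ->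
  ~ (0 < t /\ `|kappa t - n%:R| < 1) -> w' t = 0.
Proof.
move=> hw; have [t0|t0] := ltP 0 t.
  move=> h; rewrite (window_deriveE hw t0) bump_out ?bumpd_out ?mul0r ?subrr ?mul0r//.
    by rewrite leNgt; apply/negP => h'; apply: h.
  by rewrite leNgt; apply/negP => h'; apply: h.
move=> _; have [a a0 ha] := window_start n; have [_ <-] := hw t.
have /near_eq_derive -> : \forall s \near t, window n s = 0; rewrite ?derive_cst//.
have ta : t < a by exact: le_lt_trans a0.
near=> s; have sa : s <= a by apply/ltW; near: s; exact: lt_nbhsl.
apply: window_out => -[s0]; have [|] := ha s sa; first by rewrite leNgt s0.
by move=> h /ltr_normlP[]; lra.
Unshelve. all: by end_near.
Qed.

(** The order tau^-2 is the weight of the fluxes: the term in which the time derivative hits the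
    window is estimated like transport. The constant does not depend on the window. *)
Lemma window_derive_le : exists2 C : R, 0 < C & forall n w',
  (forall t, is_derive t (1 : R) (window n) (w' t)) ->
  forall t, 0 < t -> 1 <= dtau t -> `|w' t| <= C / tau t ^+ 2.
Proof.
have [C hC] := smooth1_bounded (@smooth1_bumpd R) bumpd_out.
have m0 : 0 < bump_mass^-1 :> R by rewrite invr_gt0 bump_mass_gt0.
have C0 : 0 <= C by apply: le_trans (hC 0).
exists (C + 3 * bump_mass^-1); first by lra.
move=> n w' hw t t0 d1.
rewrite (window_deriveE hw t0) normrM [X in _ * X]ger0_norm ?invr_ge0 ?sqr_ge0//.
rewrite ler_wpM2r ?invr_ge0 ?sqr_ge0//.
have i1 : 0 <= (dtau t ^+ 2)^-1 <= 1.
  have d0 := dtau_gt0 ht t0.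
  by rewrite invr_ge0 sqr_ge0 invf_le1 ?exprn_gt0// expr_ge1// ltW.
apply: (le_trans (ler_normB _ _)); apply: lerD.
  rewrite normrM -[leRHS]mulr1 ler_pM// ger0_norm; by case/andP: i1.
rewrite mulrC normrM ler_pM//.
  rewrite ger0_norm; by case/andP: i1; lra.
by rewrite ger0_norm ?bump_ge0// bump_le.
Qed.

(** A boolean, so that it can serve as an indicator in integrands. *)
Definition in_window n t := (0 < t) && (`|kappa t - n%:R| < 1).

Lemma in_windowP n t : reflect (0 < t /\ `|kappa t - n%:R| < 1) (in_window n t).
Proof. exact: andP. Qed.

Lemma window_interval n : exists t1 t2 : R, [/\ 0 < t1, t1 < t2 &
  forall t, in_window n t = (t1 < t < t2)].
Proof.
have [a a0 ha] := kappa_small ht (n%:R - 1); have [T T1 hT] := window_stop n.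
have ka : kappa a < n%:R - 1 by exact: ha.
have T0 : 0 < T + 1 by apply: addr_gt0 => //; exact: lt_trans ltr01 T1.
have kT : n%:R + 1 < kappa (T + 1) by apply: hT; rewrite ltrDl.
have n11 : n%:R - 1 < n%:R + 1 :> R by rewrite ltrBlDr -addrA ltrDl addr_gt0.
clear ha hT.
have mono s t : 0 < s -> 0 < t -> (s < t) = (kappa s < kappa t).
  move=> s0 t0; apply/idP/idP; first exact: kappa_mono.
  move=> h; rewrite ltNge le_eqVlt; apply/negP => /orP[/eqP e|/(kappa_mono ht t0) h'].
    by rewrite e ltxx in h.
  by have := lt_trans h h'; rewrite ltxx.
have aT : a < T + 1 by rewrite mono// (lt_trans ka)// (lt_trans n11).
have ck : {within `[a, T + 1], continuous kappa}.
  apply: continuous_in_subspaceT => x; rewrite inE /= in_itv /= => /andP[ax _].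
  by apply: is_derive_continuous (is_derive_kappa ht _); exact: lt_le_trans ax.
have ivt v : n%:R - 1 <= v <= n%:R + 1 -> exists2 t, a <= t <= T + 1 & kappa t = v.
  move=> /andP[v1 v2]; have [|t] := @IVT _ kappa a (T + 1) v (ltW aT) ck.
    by rewrite ge_min le_max (le_trans (ltW ka) v1) (le_trans v2 (ltW kT)) orbT.
  by rewrite in_itv /=; exists t.
have [|t1 /andP[at1 _] k1] := ivt (n%:R - 1); first by rewrite lexx ltW.
have [|t2 /andP[at2 _] k2] := ivt (n%:R + 1); first by rewrite lexx ltW.
have p1 : 0 < t1 by exact: lt_le_trans at1.
have p2 : 0 < t2 by exact: lt_le_trans at2.
exists t1, t2; split => //; first by rewrite mono// k1 k2.
move=> t; rewrite /in_window; have [t0|t0] := ltP 0 t; last first.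
  by apply/esym/negbTE; rewrite negb_and -leNgt (le_trans t0)// ltW.
by rewrite (mono t1 t)// (mono t t2)// k1 k2 ltr_distl.
Qed.

End window.

(** * Consequences of the equations *)

Section ae_toolkit.
Context {R : realType} d (T : measurableType d) (mu : {measure set T -> \bar R}).
Implicit Types f g : T -> R.

Lemma ae_imp (P Q : T -> Prop) : {ae mu, forall x, P x} -> (forall x, P x -> Q x) ->
  {ae mu, forall x, Q x}.
Proof. by move=> hP PQ; apply: filterS hP. Qed.

Lemma ae_and (P Q : T -> Prop) : {ae mu, forall x, P x} -> {ae mu, forall x, Q x} ->
  {ae mu, forall x, P x /\ Q x}.
Proof. by move=> hP hQ; exact: filterI. Qed.

(** The minimum of [f] and [g] is below [g] everywhere and equals [f] almost everywhere. *)
Lemma I_le_ae f g : intg mu f -> intg mu g -> {ae mu, forall x, f x <= g x} ->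
  \int[mu]_x f x <= \int[mu]_x g x.
Proof.
move=> If Ig fg; have mf := intg_meas If; have mg := intg_meas Ig.
have mm : measurable_fun setT (fun x => Num.min (f x) (g x)) by exact: measurable_minr.
rewrite (I_ae mf mm); last by move: fg; apply: filterS => x /min_idPl ->.
apply: I_le => //; last by move=> x; rewrite ge_min lexx orbT.
apply: (intg_le mm _ (intgD (intg_abs If) (intg_abs Ig))) => x.
by rewrite /Num.min; case: ifP => _; rewrite ?lerDl ?lerDr.
Qed.

Lemma I_norm_le_ae f g : intg mu f -> intg mu g -> {ae mu, forall x, `|f x| <= g x} ->
  `|\int[mu]_x f x| <= \int[mu]_x g x.
Proof.
move=> If Ig fg; apply: (le_trans (I_norm If)); apply: I_le_ae => //.
exact: intg_abs.
Qed.

Lemma Lnorm2_le (f : T -> R) (M : R) :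
  ('N[mu]_2%:E [EFin \o f] <= M%:E)%E ->
  (\int[mu]_x (f x ^+ 2)%:E <= (M ^+ 2)%:E)%E.
Proof.
move=> h; have M0 : 0 <= M by rewrite -lee_fin (le_trans _ h)// Lnorm_ge0.
have := @poweR_Lnorm _ _ _ mu (EFin \o f) 2 (lt0r_neq0 (@ltr0n R 2)).
rewrite (eq_integral (fun x => (f x ^+ 2)%:E)) => [<-|x _]; last first.
  have -> : (`|(EFin \o f) x| = `|f x|%:E)%E by [].
  by rewrite poweR_EFin powR_mulrn ?normr_ge0// real_normK ?num_real.
rewrite -(powR_mulrn 2 M0) -poweR_EFin.
by apply: gt0_ler_poweR; rewrite ?in_itv/= ?leey ?andbT ?Lnorm_ge0 ?lee_fin.
Qed.

End ae_toolkit.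

(** * Extension of the solution to all times *)

Section extension.
Context {R : realType} (n : nat).
Local Notation leb := (@lebesgue_measure R).
Local Notation X := (R * 'rV[R]_n)%type.
Local Notation mX := (measurableTypeR R * 'rV[R]_n)%type.
Local Notation mu := (@muX R n).
Local Notation space := 'rV[R]_n.
Local Notation test := (@ptest R n).
Implicit Types (phi : X -> R) (f : R -> space -> R).

(* The solution is extended to all times, by [f] for t > 0 ([pos f]) and by
   its initial value [f0] for t <= 0 ([neg f0]). *)
Definition pos f (z : mX) : R := if 0 < z.1 then f z.1 z.2 else 0.

Definition neg (f0 : space -> R) (z : mX) : R := \1_`]-oo, 0%R]%classic z.1 * f0 z.2.

Lemma measurable_positive_times : measurable (@positive_times R n : set mX).
Proof.
rewrite (_ : @positive_times R n = `]0%R, +oo[%classic `*` setT).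
  by apply: measurableX => //; exact: measurable_itv.
by apply/seteqP; split=> z /=; rewrite /positive_times /= in_itv /= andbT // => -[].
Qed.

Lemma pos_patch f : pos f = (fun z => f z.1 z.2) \_ (@positive_times R n).
Proof.
apply/funext => z; rewrite patchE /pos; case: ifPn => h; first by rewrite mem_set.
by case: ifPn => // /set_mem; rewrite /positive_times /= (negbTE h).
Qed.

Lemma measurable_pos f : st_measurable f -> measurable_fun setT (pos f).
Proof.
move=> mf; rewrite pos_patch; apply/measurable_restrict => //.
- exact: measurable_positive_times.
- by rewrite setTI.
Qed.

Lemma measurable_initial (f0 : space -> R) : measurable_fun setT f0 -> measurable_fun setT (neg f0).
Proof.
move=> mf; apply: measurable_funM.
  apply: (measurableT_comp _ measurable_fst); apply: measurable_indic; exact: measurable_itv.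
exact: (measurableT_comp mf measurable_snd).
Qed.

Lemma pairing_pos f phi : pairing f phi = \int[mu]_z (pos f z * phi z).
Proof.
rewrite /pairing Rintegral_mkcond -I_muX; apply: I_eq => z.
by rewrite patchE pos_patch patchE; case: ifPn => //; rewrite mul0r.
Qed.

Lemma posM f g z : pos (fun t y => f t y * g t y) z = pos f z * pos g z.
Proof. by rewrite /pos; case: ifP; rewrite ?mulr0. Qed.

Lemma measurable_sec_pos f t : st_measurable f -> 0 < t -> measurable_fun setT (f t).
Proof.
move=> /measurable_pos mf t0; have := measurable_sec1 t mf.
by congr measurable_fun; apply/funext => y; rewrite /pos /= t0.
Qed.

Lemma L2locD (F G : mX -> R) : L2loc F -> L2loc G -> L2loc (fun z => F z + G z).
Proof.
move=> [mF IF] [mG IG]; split; first exact: measurable_funD.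
move=> m; apply: (intg_le _ _ (intgZ 2 (intgD (IF m) (IG m)))).
  apply: measurable_funM; first by apply: measurable_funX; exact: measurable_funD.
  by apply: measurable_indic; exact: measurable_slabX.
move=> z; rewrite indicE; case: (_ \in _); rewrite ?mulr1 ?mulr0 ?normr0 ?addr0 ?mulr0//.
by rewrite ger0_norm ?sqr_ge0//; have := sqr_ge0 (F z - G z); rewrite sqrrB sqrrD; lra.
Qed.

Lemma L2loc_le (F G : mX -> R) C : measurable_fun setT F -> L2loc G ->
  {ae mu, forall z, `|F z| <= C * `|G z|} -> L2loc F.
Proof.
move=> mF [mG IG] FG; split => // m.
have mi : measurable_fun setT (\1_(@slabX R n m) : mX -> R).
  by apply: measurable_indic; exact: measurable_slabX.
pose H z := Num.min (F z ^+ 2) (C ^+ 2 * G z ^+ 2) * \1_(@slabX R n m) z.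
have mH : measurable_fun setT H.
  apply: measurable_funM => //; apply: measurable_minr; first exact: measurable_funX.
  by apply: measurable_funM => //; exact: measurable_funX.
have IH : intg mu H.
  apply: (intg_le mH _ (intgZ (C ^+ 2) (IG m))) => z; rewrite /H indicE.
  have m0 : 0 <= Num.min (F z ^+ 2) (C ^+ 2 * G z ^+ 2).
    by rewrite le_min sqr_ge0 mulr_ge0 ?sqr_ge0.
  case: (_ \in _); rewrite ?mulr1 ?mulr0 ?normr0// ger0_norm//.
  by rewrite ge_min lexx orbT.
apply: (intg_ae_eq _ _ IH); first by apply: measurable_funM => //; exact: measurable_funX.
move: FG; apply: filterS => z h; rewrite /H (min_idPl _)//.
rewrite -real_normK ?num_real// -[G z ^+ 2]real_normK ?num_real// -exprMn.
by rewrite lerXn2r ?nnegrE// (le_trans _ h).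
Qed.

Lemma L2loc_bd (F k : mX -> R) C : L2loc F -> measurable_fun setT k ->
  (forall z, `|k z| <= C) -> L2loc (fun z => k z * F z).
Proof.
move=> LF mk kC; apply: (L2loc_le (C := C) _ LF); first exact: measurable_funM mk LF.1.
by apply: aeW => z; rewrite normrM ler_wpM2r.
Qed.

Lemma L2loc_sum (I : Type) (s : seq I) (F : I -> mX -> R) :
  (forall i, L2loc (F i)) -> L2loc (fun z => \sum_(i <- s) F i z).
Proof.
move=> LF; elim: s => [|i s IH].
  under [X in L2loc X]eq_fun do rewrite big_nil.
  split=> [|m]; first exact: measurable_cst.
  by under [X in intg _ X]eq_fun do rewrite expr0n mul0r; exact: intg0.
by under [X in L2loc X]eq_fun do rewrite big_cons; exact: L2locD.
Qed.

Lemma L2loc_neg (f0 : space -> R) : L2 (lebesgue_rV n) f0 -> L2loc (neg f0).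
Proof.
move=> [mf If]; split; first exact: measurable_initial.
move=> m; have := (intgX_tensor (I_indic_itv 0 (ler0n R m)).1 If).1.
apply: intg_le.
  apply: measurable_funM; first by apply: measurable_funX; exact: measurable_initial.
  by apply: measurable_indic; exact: measurable_slabX.
move=> z; rewrite /neg indic_le subr0 !indicE.
rewrite ger0_norm; last by apply: mulr_ge0; [exact: sqr_ge0|].
have [/set_mem zm|_] := boolP (z \in slabX m); last first.
  by rewrite mulr0; apply: mulr_ge0; [|exact: sqr_ge0].
rewrite mulr1 (ltW (zm : `|z.1| < m%:R)) mul1r; case: (_ \in _); first by rewrite mul1r.
by rewrite mul0r expr0n sqr_ge0.
Qed.

Lemma tonelliX (F : mX -> R) : measurable_fun setT F -> (forall z, 0 <= F z) ->
  (\int[mu]_z (F z)%:E = \int[leb]_t \int[lebesgue_rV n]_y (F (t, y))%:E)%E.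
Proof.
move=> mF F0; rewrite (_ : (\int[mu]_z _)%E = (\int[(leb \x lebesgue_rV n)%E]_z (F z)%:E)%E)//.
rewrite (@fubini_tonelli1 _ _ _ _ _ leb (lebesgue_rV n) (EFin \o F))//.
exact/measurable_EFinP.
Qed.

Lemma measurable_tonelli (F : mX -> R) : measurable_fun setT F -> (forall z, 0 <= F z) ->
  measurable_fun setT (fun t => \int[lebesgue_rV n]_y (F (t, y))%:E)%E.
Proof.
move=> mF F0.
apply: (@measurable_fun_fubini_tonelli_F _ _ _ _ _ (lebesgue_rV n) (EFin \o F)) => //.
exact/measurable_EFinP.
Qed.

Lemma Loo_L2_bound f : Loo_loc_L2 f -> forall T, exists B : R,
  {ae leb, forall t : R, 0 < t < T -> (\int[lebesgue_rV n]_y (f t y ^+ 2)%:E <= B%:E)%E}.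
Proof.
move=> Lf T; have [T0|T0] := leP T 0.
  by exists 0; apply: aeW => t /andP[t0 tT]; have := lt_trans t0 tT; rewrite ltNge T0.
have [M hM] := Lf T T0; exists (M ^+ 2); apply: (ae_imp hM) => t h tT.
by apply: Lnorm2_le; exact: h.
Qed.

Lemma L2loc_Loo f : st_measurable f -> Loo_loc_L2 f -> L2loc (pos f).
Proof.
move=> mf Lf; have mp := measurable_pos mf; split => // m.
have [B hB] := Loo_L2_bound Lf m%:R.
have mF : measurable_fun setT (fun z => pos f z ^+ 2 * \1_(@slabX R n m) z).
  apply: measurable_funM; first exact: measurable_funX.
  by apply: measurable_indic; exact: measurable_slabX.
have F0 z : 0 <= pos f z ^+ 2 * \1_(@slabX R n m) z by rewrite mulr_ge0 ?sqr_ge0.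
apply: intg_lty => //; rewrite tonelliX//.
have II := (I_indic_itv 0 (ler0n R m)).1.
have II2 := intgZ `|B| II.
apply: (@le_lt_trans _ _ (\int[leb]_t (`|B| * \1_`[0 - m%:R, 0 + m%:R] t)%:E)%E); last exact: intg_fin.
apply: ae_ge0_le_integral => //.
- by move=> t _; apply: integral_ge0 => y _; rewrite lee_fin.
- exact: (measurable_tonelli mF F0).
- by apply/measurable_EFinP; exact: intg_meas II2.
apply: (ae_imp hB) => t h _.
have [tm|tm] := boolP (0 < t < m%:R); last first.
  rewrite integral0_eq ?lee_fin ?mulr_ge0// => y _.
  rewrite /pos /slabX indicE; move: tm; rewrite negb_and => /orP[/negbTE ->|tm]; first by rewrite expr0n mul0r.
  rewrite memNset ?mulr0//= => h2; move: tm; rewrite -leNgt; have := ler_norm t; lra.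
rewrite indic_le subr0 (ger0_norm (ltW (andP tm).1)) (ltW (andP tm).2) mulr1.
apply: (le_trans _ (le_trans (h tm) _)); last by rewrite lee_fin ler_norm.
apply: ge0_le_integral => //.
- by move=> y _; rewrite lee_fin; exact: F0.
- by apply/measurable_EFinP; exact: (measurable_sec1 t mF).
- by apply/measurable_EFinP; apply: measurable_funX; apply: measurable_sec_pos mf _; case/andP: tm.
move=> y _; rewrite lee_fin /pos (andP tm).1 indicE; case: (_ \in _); rewrite ?mulr1 ?mulr0 ?sqr_ge0//=.
Qed.

Lemma L2loc_Lp f : st_measurable f -> Lp_loc_Lp 2 f -> L2loc (pos f).
Proof.
move=> mf Lf; have mp := measurable_pos mf; split => // m.
have mF : measurable_fun setT (fun z => pos f z ^+ 2 * \1_(@slabX R n m) z).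
  apply: measurable_funM; first exact: measurable_funX.
  by apply: measurable_indic; exact: measurable_slabX.
apply: intg_lty => //; first by move=> z; rewrite mulr_ge0 ?sqr_ge0.
(* The time horizon must be positive, also for m = 0; hence m + 1. *)
have := Lf m.+1%:R (ltr0n _ _); apply: le_lt_trans.
change ((\int[mu]_z (pos f z ^+ 2 * \1_(slabX m) z)%:E <=
  \int[mu]_(z in [set z : mX | (0 < z.1 < m.+1%:R)%R]) (`|f z.1 z.2| ^+ 2)%:E)%E).
rewrite [leRHS]integral_mkcond; apply: ge0_le_integral => //.
- by move=> z _; rewrite lee_fin mulr_ge0 ?sqr_ge0.
- exact/measurable_EFinP.
- rewrite [X in measurable_fun _ X](_ : _ =
    EFin \o (fun z => pos f z ^+ 2 * \1_[set z : mX | z.1 < m.+1%:R] z)); last first.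
    apply/funext => z; rewrite patchE /pos /= indicE.
    case: ifPn => [/set_mem /= /andP[-> zm]|/negP h].
      by rewrite mem_set// mulr1 real_normK ?num_real.
    case: ifPn => z0; last by rewrite expr0n mul0r.
    by rewrite memNset ?mulr0// => zm; apply: h; rewrite inE /= z0.
  apply/measurable_EFinP; apply: measurable_funM; first exact: measurable_funX.
  apply: measurable_indic; rewrite (_ : [set z | _] = `]-oo, m.+1%:R[%classic `*` setT).
    by apply: measurableX => //; exact: measurable_itv.
  by apply/seteqP; split=> z /=; rewrite in_itv //= => -[].
move=> z _; rewrite patchE /pos indicE.
have [z0|z0] := boolP (0 < z.1); last first.
  by rewrite expr0n mul0r; case: ifP => // _; rewrite lee_fin exprn_ge0.
have [/set_mem zm|_] := boolP (z \in slabX m); last first.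
  by rewrite mulr0; case: ifP => // _; rewrite lee_fin exprn_ge0.
rewrite mem_set ?mulr1 ?lee_fin ?real_normK ?num_real//=.
by rewrite z0 /=; move: zm; rewrite /slabX /= ltr_norml => /andP[_ h]; rewrite (lt_trans h)// ltr_nat.
Qed.

End extension.

(** * Test functions near the initial time *)

Section positive_tests.
Context {R : realType} (n : nat).
Local Notation leb := (@lebesgue_measure R).
Local Notation X := (R * 'rV[R]_n)%type.
Local Notation mX := (measurableTypeR R * 'rV[R]_n)%type.
Local Notation mu := (@muX R n).
Local Notation space := 'rV[R]_n.
Local Notation test := (@ptest R n).
Implicit Types (phi : X -> R) (f : R -> space -> R).

(** The contribution of the negative times, on which the extended solution is constant in time. *)
Lemma I_derive_left (chi chi' : R -> R) : time_test chi ->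
  (forall t, is_derive t (1 : R) chi (chi' t)) -> continuous chi' ->
  \int[leb]_t (\1_`]-oo, 0%R]%classic t * chi' t) = chi 0.
Proof.
move=> [sc [m m0]] hc cc.
have c'0 t : m%:R < `|t| -> chi' t = 0.
  move=> mt; have [_ <-] := hc t.
  have /near_eq_derive -> : \forall s \near t, chi s = 0; rewrite ?derive_cst//.
  have h : \forall s \near t, m%:R < `|s|.
    have cn : `|s| @[s --> t] --> `|t| by apply: cvg_norm; exact: cvg_id.
    exact: (cvgr_gt _ cn).
  by near=> s; apply: m0; apply/ltW; near: s.
have a0 : - m.+1%:R < 0 :> R by rewrite oppr_lt0.
have am : chi (- m.+1%:R) = 0 by rewrite m0// normrN normr_nat ler_nat.
transitivity (\int[leb]_t (chi' \_ `[- m.+1%:R, 0]) t).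
  apply: I_eq => t; rewrite patchE indicE !mem_setE !in_itv /=.
  have [t0|t0] := leP t 0; last by rewrite andbF mul0r.
  rewrite andbT mul1r; case: leP => // tm; rewrite c'0//.
  rewrite ltr0_norm; last by apply: lt_trans tm _.
  rewrite ltrNr (lt_le_trans tm)// lerN2 ler_nat//.
rewrite -Rintegral_mkcond /Rintegral (@continuous_FTC2 _ chi' chi (- m.+1%:R) 0)//.
- by rewrite am /= subr0.
- exact: continuous_subspaceT.
- have cF x : {for x, continuous chi} by exact: is_derive_continuous (hc x).
  split.
  - by move=> x _; have [] := hc x.
  - by apply: cvg_at_right_filter; exact: cF.
  - by apply: cvg_at_left_filter; exact: cF.
- by move=> x _; rewrite derive1E; have [_ ->] := hc x.
Unshelve. all: by end_near.
Qed.

Lemma dtE (chi chi' : R -> R) (psi : space -> R) z : (forall t, is_derive t (1 : R) chi (chi' t)) ->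
  test_function setT psi -> dt (fun z : X => chi z.1 * psi z.2) z = chi' z.1 * psi z.2.
Proof. by move=> hc tp; rewrite /dt; have [[_ ->]] := ptestE hc tp z. Qed.

Lemma dyE (chi : R -> R) (psi : space -> R) z j : time_test chi ->
  test_function setT psi ->
  dy j (fun z : X => chi z.1 * psi z.2) z = chi z.1 * 'D_(basis_vec j) psi z.2.
Proof.
move=> /time_test_derive[c' _ hc] tp.
by rewrite /dy; have [_ /(_ j)[_ ->]] := ptestE hc tp z.
Qed.

Lemma smooth_snd (psi : space -> R) : smooth psi -> smooth (fun z : X => psi z.2).
Proof.
move=> sp; apply: (@smooth_class R _ (fun f : X -> R => exists2 g : space -> R, smooth g & f = fun z : X => g z.2)); last by exists psi.
move=> _ [g sg ->]; split.
- move=> z; apply: (continuous_comp (f := snd) (g := g)); first exact: cvg_snd.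
  exact: (smooth_cont sg).
- by move=> x v; have dg : derivable g x.2 v.2 by apply: smooth_derivable.
- by move=> v; exists ('D_(v.2) g) => //; exact: smooth_derive.
Qed.

Lemma ptest_positive (chi : R -> R) (psi : space -> R) (a : R) : 0 < a ->
  (forall t, t < a -> chi t = 0) -> time_test chi -> test_function setT psi ->
  test_function (@positive_times R n) (fun z : X => chi z.1 * psi z.2).
Proof.
move=> a0 ca [sc [m m0]] [sp [K [cK _ K0]]]; split.
  apply: smoothM; last exact: smooth_snd.
  rewrite (_ : (fun z : X => chi z.1) = (fun z : X => chi (z.1 - 0))).
    exact: smooth_affine_comp (@affine_time R n 0) sc.
  by apply/funext => z; rewrite subr0.
exists (`[a, m%:R]%classic `*` K); split.
- by apply: compact_setX => //; exact: segment_compact.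
- by move=> z [/=]; rewrite in_itv /= => /andP[h _] _; exact: lt_le_trans h.
move=> z zK; have [ha|ha] := ltP z.1 a; first by rewrite ca ?mul0r.
have [hm|hm] := leP z.1 m%:R; last by rewrite m0 ?mul0r// (le_trans (ltW hm))// ler_norm.
have [Kz|Kz] := pselect (K z.2); last by rewrite K0 ?mulr0.
by exfalso; apply: zK; split => //=; rewrite in_itv /= ha.
Qed.

Lemma onset_test k (chi : R -> R) : time_test chi -> time_test (fun t => onset k t * chi t).
Proof. by move=> tc; apply: time_testM => //; exact: smooth1_onset. Qed.

Lemma onset_before k (t : R) : t < k.+1%:R^-1 -> onset k t = 0.
Proof. by move=> h; rewrite onset0// mulrC -ler_pdivlMr// div1r ltW. Qed.

Lemma onset_lim (H : mX -> R) : intg mu H -> (forall z, z.1 <= 0 -> H z = 0) ->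
  \int[mu]_z (H z * onset k z.1) @[k --> \oo] --> \int[mu]_z H z.
Proof.
move=> IH H0; have mH := intg_meas IH.
apply: (dct (g := fun z => `|H z|)) => //.
- move=> k; apply: measurable_funM => //.
  exact: (measurableT_comp (measurable_smooth1 (smooth1_onset k)) measurable_fst).
- apply: aeW => z; have [z0|z0] := leP z.1 0.
    by rewrite H0//; under eq_fun do rewrite mul0r; exact: cvg_cst.
  by rewrite -[X in _ --> X]mulr1; apply: cvgM; [exact: cvg_cst|exact: onset_cvg].
- exact: intg_abs.
- by move=> k z; rewrite normrM ler_piMr// onset_bd.
Qed.

Lemma I_neg (f0 : space -> R) (chi : R -> R) (psi : space -> R) : L2 (lebesgue_rV n) f0 ->
  time_test chi -> test_function setT psi ->
  \int[mu]_z (neg f0 z * (chi z.1 * psi z.2)) =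
  (\int[leb]_t (\1_`]-oo, 0%R]%classic t * chi t)) * \int[lebesgue_rV n]_y (f0 y * psi y).
Proof.
move=> Lf tc tp.
have Ic : intg leb (fun t => \1_`]-oo, 0%R]%classic t * chi t).
  have := intg_bdM (g := fun t : measurableTypeR R => \1_`]-oo, 0%R]%classic t : R) (C := 1) (time_test_intg tc).
  rewrite (_ : (fun t => chi t * _) = (fun t => \1_`]-oo, 0%R]%classic t * chi t)).
    apply; first by apply: measurable_indic; exact: measurable_itv.
    by move=> t; rewrite indicE; case: (_ \in _); rewrite ?normr0 ?normr1.
  by apply/funext => t; rewrite mulrC.
have Ip : intg (lebesgue_rV n) (fun y => f0 y * psi y).
  have [m hm] := space_support tp.
  have [M hM] := test_bounded tp.
  have mp : measurable_fun setT psi.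
    by apply: continuous_measurable_rV; apply: smooth_cont; case: tp.
  apply: L2_mul => //; split => //.
  apply: (intg_le _ _ (intgZ (M ^+ 2) (intg_box n (ler0n R m)))).
    exact: measurable_funX.
  move=> y; rewrite ger0_norm ?sqr_ge0// indicE.
  have [->|py] := eqVneq (psi y) 0; first by rewrite expr0n mulr_ge0 ?sqr_ge0.
  rewrite mem_set ?mulr1; last exact: hm.
  by rewrite -real_normK ?num_real// lerXn2r ?nnegrE ?(le_trans _ (hM y)).
rewrite -(intgX_tensor Ic Ip).2; apply: I_eq => z; rewrite /neg; ring.
Qed.

End positive_tests.

(** * Local integrability of the solution *)

Section solution.
Context {R : realType} (d : nat).
Local Notation leb := (@lebesgue_measure R).
Local Notation X := (R * 'rV[R]_d)%type.
Local Notation mX := (measurableTypeR R * 'rV[R]_d)%type.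
Local Notation mu := (@muX R d).
Local Notation space := 'rV[R]_d.
Local Notation test := (@ptest R d).
Variables (tau : R -> R) (eps : R) (c : collection R d) (r0 : space -> R) (G0 : space -> space).
Hypothesis ht : is_tau tau.
Hypothesis reg : regularity eps c.
Hypothesis Lr0 : L2 (lebesgue_rV d) r0.
Hypothesis LG0 : forall i, L2 (lebesgue_rV d) (fun y => G0 y 0 i).

Lemma sqnorm_row m (v : 'rV[R]_m) : sqnorm v = \sum_j v 0 j ^+ 2.
Proof. by rewrite /sqnorm big_ord1. Qed.

Lemma sqnorm_ge0 m m' (A : 'M[R]_(m, m')) : 0 <= sqnorm A.
Proof. by apply: sumr_ge0 => i _; apply: sumr_ge0 => j _; exact: sqr_ge0. Qed.

Lemma entry_le_enorm m m' (A : 'M[R]_(m, m')) i j : `|A i j| <= enorm A.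
Proof.
rewrite /enorm -sqrtr_sqr ler_sqrt ?sqnorm_ge0// /sqnorm (bigD1 i)//= (bigD1 j)//=.
rewrite -addrA lerDl addr_ge0// sumr_ge0// => k _; first exact: sqr_ge0.
by apply: sumr_ge0 => l _; exact: sqr_ge0.
Qed.

Lemma measurable_sqrt : measurable_fun setT (@Num.sqrt R).
Proof. by apply: continuous_measurable_fun; exact: sqrt_continuous. Qed.

Lemma st_measurable_pos (f : R -> space -> R) : measurable_fun setT (pos f) -> st_measurable f.
Proof.
rewrite pos_patch => h.
have mT : measurable (setT : set mX) := measurableT.
have mP : measurable (@positive_times R d : set mX) := @measurable_positive_times R d.
have := (measurable_restrict (fun z : mX => f z.1 z.2) mP mT).2 h.
by rewrite setTI.
Qed.

Lemma st_measurable_enorm m m' (A : R -> space -> 'M[R]_(m, m')) :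
  (forall i j, st_measurable (fun t y => A t y i j)) -> st_measurable (fun t y => enorm (A t y)).
Proof.
move=> mA; apply: st_measurable_pos.
rewrite (_ : pos _ = fun z => Num.sqrt (\sum_i \sum_j pos (fun t y => A t y i j) z ^+ 2)).
  apply: (measurableT_comp measurable_sqrt); apply: measurable_sum => i.
  by apply: measurable_sum => j; apply: measurable_funX; exact: measurable_pos.
apply/funext => z; rewrite /pos; case: ifP => // _.
by rewrite big1 ?sqrtr0// => i _; rewrite big1// => j _; rewrite expr0n.
Qed.

(** The extension is at rest for t <= 0: [u_] and its gradient [v_] keep their initial values there,
    whereas [q_] and [T_] are 0. The equation then holds trivially for negative times. *)
Definition u_ z := pos (sqrtR c) z + neg r0 z.
Definition v_ j z := pos (fun t y => grad_sqrtR c t y 0 j) z + neg (fun y => G0 y 0 j) z.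
Definition q_ j := pos (fun t y => sqrtRU c t y 0 j).
Definition T_ i j := pos (fun t y => TN c t y i j).
Definition timef (k : R -> R) : mX -> R := pos (fun t _ => k t).

Lemma measurable_timef k : tau_class tau k -> measurable_fun setT (timef k).
Proof.
move=> /(tau_class_derive ht)[k' _ hk].
have mk : measurable_fun (`]0%R, +oo[%classic : set R) k.
  apply: open_continuous_measurable_fun; first exact: interval_open.
  move=> t; rewrite inE /= in_itv /= andbT => t0.
  exact: is_derive_continuous (hk t t0).
rewrite /timef (_ : pos _ = (k \_ `]0%R, +oo[%classic) \o fst).
  apply: (measurableT_comp _ measurable_fst).
  by apply/measurable_restrict => //; rewrite setTI.
apply/funext => z; rewrite /pos /= patchE mem_setE in_itv /= andbT.
by case: ifP.
Qed.

Lemma enormZ m (a : R) (q : 'rV[R]_m) : enorm (a *: q) = `|a| * enorm q.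
Proof.
rewrite /enorm !sqnorm_row -sqrtr_sqr -sqrtrM ?sqr_ge0// mulr_sumr.
by congr Num.sqrt; apply: eq_bigr => i _; rewrite mxE exprMn.
Qed.

Lemma strength_ge t y : (japanese y + enorm (velocity c t y)) * sqrtR c t y =
  japanese y * sqrtR c t y + (if 0 < sqrtR c t y then enorm (sqrtRU c t y) else 0).
Proof.
rewrite mulrDl /velocity; congr (_ + _); case: ifPn => u0.
  rewrite enormZ ger0_norm ?invr_ge0 ?(ltW u0)//.
  by rewrite mulrAC mulVf ?gt_eqF// mul1r.
rewrite /enorm sqnorm_row big1 ?sqrtr0 ?mul0r// => i _.
by rewrite mxE expr0n.
Qed.

Lemma japanese_ge1 n (y : 'rV[R]_n) : 1 <= japanese y.
Proof. by rewrite -[leLHS]sqrtr1 ler_sqrt ?addr_ge0 ?sqnorm_ge0// lerDl sqnorm_ge0. Qed.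

Lemma measurable_u : measurable_fun setT u_.
Proof.
apply: measurable_funD; first exact: measurable_pos (mes_sqrtR reg).
by apply: measurable_initial; exact: Lr0.1.
Qed.

Lemma measurable_q j : measurable_fun setT (q_ j).
Proof. exact: measurable_pos (mes_sqrtRU reg j). Qed.

(** The quantity of the first regularity bound. It dominates [sqrtR], as the bracket of y is at
    least 1, and [sqrtRU] off the vacuum. *)
Definition strength t y := (japanese y + enorm (velocity c t y)) * sqrtR c t y.

Lemma st_measurable_strength : st_measurable strength.
Proof.
apply: st_measurable_pos.
have -> : pos strength = fun z => japanese z.2 * pos (sqrtR c) z +
   (if 0 < pos (sqrtR c) z then pos (fun t y => enorm (sqrtRU c t y)) z else 0).
  apply/funext => z; rewrite /pos /strength; case: ifP => _; first exact: strength_ge.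
  by rewrite mulr0 ltxx addr0.
have mu0 := measurable_pos (mes_sqrtR reg).
apply: measurable_funD.
  apply: measurable_funM => //.
  apply: (measurableT_comp measurable_sqrt); apply: measurable_funD; first exact: measurable_cst.
  under eq_fun do rewrite sqnorm_row.
  apply: measurable_sum => j; apply: measurable_funX.
  exact: (measurableT_comp (measurable_coord j) measurable_snd).
apply: measurable_fun_ifT => //.
- by apply: measurable_fun_ltr => //; exact: measurable_cst.
- apply: measurable_pos; apply: st_measurable_enorm => i j.
  by rewrite ord1; exact: mes_sqrtRU reg j.
Qed.

Let L2loc_strength : L2loc (pos strength).
Proof. by apply: L2loc_Loo; [exact: st_measurable_strength|exact: sqrtR_Loo_L2 reg]. Qed.

Lemma u_le_strength t y : `|sqrtR c t y| <= `|strength t y|.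
Proof.
have j1 := japanese_ge1 y.
rewrite /strength normrM ler_peMl// ger0_norm; last by rewrite addr_ge0 ?sqrtr_ge0.
by rewrite (le_trans j1)// lerDl sqrtr_ge0.
Qed.

Let ae_uq : {ae mu, forall z, 0 < z.1 ->
  0 <= sqrtR c z.1 z.2 /\ (sqrtR c z.1 z.2 = 0 -> sqrtRU c z.1 z.2 = 0)}.
Proof.
apply: (ae_imp (ae_and (sqrtR_ge0 reg) (sqrtRU_vacuum reg))) => z [h1 h2] z0.
by split; [exact: h1|exact: h2].
Qed.

Lemma L2loc_u0 : L2loc (pos (sqrtR c)).
Proof.
apply: (L2loc_le (C := 1) _ L2loc_strength); first exact: measurable_pos (mes_sqrtR reg).
by apply: aeW => z; rewrite /pos mul1r; case: ifP => // _; exact: u_le_strength.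
Qed.

Lemma L2loc_u : L2loc u_.
Proof. by apply: L2locD; [exact: L2loc_u0|exact: L2loc_neg]. Qed.

Lemma L2loc_q j : L2loc (q_ j).
Proof.
apply: (L2loc_le (C := 1) _ L2loc_strength); first exact: measurable_q.
apply: (ae_imp ae_uq) => z; rewrite /q_ /pos mul1r; case: ifP => // z0 /(_ isT)[u0 uq].
(* On the vacuum the velocity is 0 by definition and bounds nothing; there [sqrtRU] vanishes by the
   vacuum condition. *)
rewrite /strength strength_ge; have [ug|] := ltP 0 (sqrtR c z.1 z.2); last first.
  by move=> u1; rewrite uq ?mxE ?normr0//; apply/eqP; rewrite eq_le u0 u1.
rewrite (le_trans (entry_le_enorm _ _ _))// ger0_norm ?lerDr ?mulr_ge0 ?sqrtr_ge0//.
by rewrite addr_ge0 ?mulr_ge0 ?sqrtr_ge0.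
Qed.

Lemma L2loc_v0 j : L2loc (pos (fun t y => grad_sqrtR c t y 0 j)).
Proof.
have m1 : st_measurable (fun t y => enorm (grad_sqrtR c t y)).
  by apply: st_measurable_enorm => i k; rewrite ord1; exact: mes_grad_sqrtR reg k.
apply: (L2loc_le (C := 1) _ (L2loc_Loo m1 (grad_sqrtR_Loo_L2 reg))).
- exact: measurable_pos (mes_grad_sqrtR reg j).
- by apply: aeW => z; rewrite mul1r /pos; case: ifP => // _; rewrite (le_trans (entry_le_enorm _ _ _))// ler_norm.
Qed.

Lemma L2loc_v j : L2loc (v_ j).
Proof. by apply: L2locD; [exact: L2loc_v0|exact: L2loc_neg]. Qed.

Lemma L2loc_T i j : L2loc (T_ i j).
Proof.
have m1 := st_measurable_enorm (mes_TN reg).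
apply: (L2loc_le (C := 1) _ (L2loc_Lp m1 (TN_L2_L2 reg))).
- exact: measurable_pos (mes_TN reg i j).
- by apply: aeW => z; rewrite mul1r /T_ /pos; case: ifP => // _; rewrite (le_trans (entry_le_enorm _ _ _))// ler_norm.
Qed.

(** tau^-2, written as a product of inverses in order to lie in [tau_class]. *)
Definition ktau t := (tau t)^-1 * (tau t)^-1.

Lemma tc_ktau : tau_class tau ktau.
Proof. by apply: tc_mul; exact: tc_inv. Qed.

Lemma ktau_bd z : `|timef ktau z| <= 1.
Proof.
rewrite /timef /pos; case: ifP => [z0|_]; last by rewrite normr0.
have := tau_ge1 ht z0 => h; have p0 := tau_pos ht z0.
have i0 : 0 <= (tau z.1)^-1 by rewrite invr_ge0 ltW.
have i1 : (tau z.1)^-1 <= 1 by rewrite invf_le1.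
by rewrite /ktau ger0_norm ?mulr_ge0// mulr_ile1.
Qed.

Definition F_ j z := timef ktau z * q_ j z.
Definition g_ z := 2^-1 * (timef ktau z * \sum_i T_ i i z).

Lemma L2loc_F j : L2loc (F_ j).
Proof. exact: L2loc_bd (L2loc_q j) (measurable_timef tc_ktau) ktau_bd. Qed.

Lemma L2loc_g : L2loc g_.
Proof.
have h : L2loc (fun z => timef ktau z * \sum_i T_ i i z).
  apply: L2loc_bd (measurable_timef tc_ktau) ktau_bd.
  by apply: L2loc_sum => i; exact: L2loc_T.
by apply: (@L2loc_bd _ _ _ (fun=> 2^-1) 2^-1 h (measurable_cst _)) => z; rewrite ger0_norm.
Qed.

End solution.

(** * The equations on all times *)

Section equations.
Context {R : realType} (d : nat).
Local Notation leb := (@lebesgue_measure R).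
Local Notation X := (R * 'rV[R]_d)%type.
Local Notation mX := (measurableTypeR R * 'rV[R]_d)%type.
Local Notation mu := (@muX R d).
Local Notation space := 'rV[R]_d.
Local Notation test := (@ptest R d).
Variables (tau : R -> R) (eps : R) (c : collection R d) (r0 : space -> R) (G0 : space -> space).
Hypothesis ht : is_tau tau.
Hypothesis reg : regularity eps c.
Hypothesis Lr0 : L2 (lebesgue_rV d) r0.
Hypothesis LG0 : forall i, L2 (lebesgue_rV d) (fun y => G0 y 0 i).
Hypothesis wg0 : weak_gradient_space r0 G0.
Hypothesis ce : continuity_equation tau c.
Hypothesis te : TN_equation c.
Hypothesis ini : forall psi : space -> R, test_function setT psi ->
  ess_cvg 0^'+ (fun t => \int[lebesgue_rV d]_y (sqrtR c t y * psi y))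
    (\int[lebesgue_rV d]_y (r0 y * psi y)).
Local Notation u := (u_ c r0).
Local Notation v := (v_ c G0).
Local Notation q := (q_ c).
Local Notation F := (F_ tau c).
Local Notation g := (g_ tau c).

Lemma cvg_seq_eq (f1 f2 : nat -> R) (a b : R) : f1 k @[k --> \oo] --> a -> f2 k @[k --> \oo] --> b ->
  (forall k, f1 k = f2 k) -> a = b.
Proof.
by move=> ha hb /funext E; rewrite E in ha; rewrite -(cvg_lim (@Rhausdorff R) ha) (cvg_lim (@Rhausdorff R) hb).
Qed.

Lemma ae_notin (N : set R) : leb.-negligible N -> {ae leb, forall t : R, ~ N t}.
Proof. by move=> [A [mA A0 NA]]; exists A; split => // t /= /contrapT; exact: NA. Qed.

Lemma at_right0 (P : R -> Prop) : (\forall t \near (0 : R)^'+, P t) ->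
  exists2 e : R, 0 < e & forall t, 0 < t < e -> P t.
Proof.
rewrite /at_right /within => /nbhs_ballP[e /= e0 he]; exists e => // t /andP[t0 te'].
by apply: he => //; rewrite /ball /= sub0r normrN gtr0_norm.
Qed.

Definition impulse (k : nat) (t : R) : R := k.+1%:R * bumpf (k.+1%:R * t + (- 2)).

Lemma impulse_kap k t : impulse k t = kap k (2 / k.+1%:R - t).
Proof.
rewrite -kapN /kap /impulse addr0; congr (_ * bumpf _).
by rewrite opprB mulrBr mulrCA mulfV ?pnatr_eq0// mulr1.
Qed.

Lemma impulse_ge0 k t : 0 <= impulse k t.
Proof. by rewrite impulse_kap kap_ge0. Qed.

Lemma smooth1_impulse k : smooth1 (impulse k).
Proof. by apply: smooth1M; [exact: smooth1_cst|apply: smooth1_affine; exact: smooth1_bump]. Qed.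

Lemma impulse_lim (f chi : R -> R) (l : R) : continuous chi ->
  (forall k, intg leb (fun t => impulse k t * (chi t * f t))) ->
  ess_cvg 0^'+ f l ->
  \int[leb]_t (impulse k t * (chi t * f t)) @[k --> \oo] --> chi 0 * l.
Proof.
move=> cc If [N N0 fl].
have cl : chi t @[t --> within (~` N) (0 : R)^'+] --> chi 0.
  apply: cvg_trans (cvg_app chi (cvg_within _)) _.
  by apply: cvg_at_right_filter; exact: cc.
have ccl : (chi t * f t) @[t --> within (~` N) (0 : R)^'+] --> chi 0 * l by apply: cvgM.
apply/cvgrPdist_le => e e0.
have hcc : \forall t \near (0 : R)^'+, ~ N t -> `|chi t * f t - chi 0 * l| <= e by apply: (cvg_distF ccl e0).
have [del del0 hd] := at_right0 hcc.
(* [impulse k] is supported between 1 / (k + 1) and 3 / (k + 1), so its support lies in ]0, del[ as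
   soon as 3 / (k + 1) < del. *)
exists (Num.bound (3 / del)) => // k /= hk.
have kd : 3 / k.+1%:R < del.
  rewrite ltr_pdivrMr// mulrC -ltr_pdivrMr//; apply: (lt_le_trans (archi_boundP _)).
    by rewrite divr_ge0// ltW.
  by rewrite ler_nat (leq_trans hk).
have [Ii Ei] := @I_kap R k (2 / k.+1%:R).
have Ii' : intg leb (impulse k).
  by move: Ii; congr (intg _ _); apply/funext => t; rewrite impulse_kap.
have Ei' : \int[leb]_t impulse k t = 1 by rewrite -Ei; apply: I_eq => t; exact: impulse_kap.
have -> : chi 0 * l - \int[leb]_t (impulse k t * (chi t * f t)) =
    \int[leb]_t (chi 0 * l * impulse k t - impulse k t * (chi t * f t)).
  rewrite IB//; last exact: intgZ.
  by rewrite IZ// Ei' mulr1.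
rewrite -[leRHS]mulr1 -Ei' -IZ//.
apply: I_norm_le_ae.
- by apply: intgB => //; exact: intgZ.
- exact: intgZ.
apply: (ae_imp (ae_notin N0)) => t Nt.
have [->|i0] := eqVneq (impulse k t) 0; first by rewrite !(mulr0, mul0r) subrr normr0.
rewrite [_ * impulse k t]mulrC -mulrBr normrM ger0_norm ?impulse_ge0// mulrC.
rewrite ler_wpM2r ?impulse_ge0// distrC.
have k0 : 0 < k.+1%:R :> R by rewrite ltr0n.
have : `|k.+1%:R * t + - 2| < 1.
  by rewrite ltNge; apply: contra i0 => h; rewrite /impulse bump_out ?mulr0.
rewrite ltr_norml => /andP[h1 h2].
apply: hd => //; apply/andP; split.
  by rewrite -(pmulr_rgt0 _ k0); lra.
by apply: lt_trans kd; rewrite ltr_pdivlMr// mulrC; lra.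
Qed.

Lemma ptest_of chi (psi : space -> R) : time_test chi -> test_function setT psi ->
  test (fun z => chi z.1 * psi z.2).
Proof. by move=> tc tp; exists chi, psi. Qed.

Lemma pos_out (f : R -> space -> R) z : z.1 <= 0 -> pos f z = 0.
Proof. by rewrite /pos leNgt => /negbTE ->. Qed.

Lemma onset_intg k (H : mX -> R) : intg mu H -> intg mu (fun z => H z * onset k z.1).
Proof.
move=> IH; apply: (intg_bdM (C := 1) IH); last by move=> z; exact: onset_bd.
exact: (measurableT_comp (measurable_smooth1 (smooth1_onset k)) measurable_fst).
Qed.

Lemma FE j z : pos (fun t y => (tau t ^+ 2)^-1 * sqrtRU c t y 0 j) z = F j z.
Proof. by rewrite /F_ /timef /q_ -posM /pos /ktau; case: ifP => //; rewrite expr2 invfM. Qed.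

Lemma gE z : pos (fun t y => (2 * tau t ^+ 2)^-1 * \tr (TN c t y)) z = g z.
Proof.
rewrite /g_ /timef /T_ /pos /ktau; case: ifP => _; last by rewrite mul0r mulr0.
by rewrite /mxtrace expr2 !invfM -[LHS]mulrA.
Qed.

(** The equation is tested with [onset k] times [phi]. As k grows, the derivative of [onset k]
    samples the initial datum, and the resulting term chi(0) times the integral of r0 psi is what
    the constant extension contributes from t <= 0. *)
Lemma u_equation phi : test phi ->
  (- \int[mu]_z (u z * dt phi z)) - \sum_j \int[mu]_z (F j z * dy j phi z)
  = \int[mu]_z (g z * phi z).
Proof.
move=> [chi [psi [tc tp ->]]].
have [chi' tc' hc] := time_test_derive tc.
have tD j : test_function setT ('D_(basis_vec j) psi) := test_derive _ tp.
have Lu0 := L2loc_u0 reg; have LF j := L2loc_F ht reg j; have Lg := L2loc_g ht reg.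
pose l := \int[lebesgue_rV d]_y (r0 y * psi y).
pose A := \int[mu]_z (pos (sqrtR c) z * (chi' z.1 * psi z.2)).
have IA := L2loc_intg Lu0 (ptest_of tc' tp).
have IF j := L2loc_intg (LF j) (ptest_of tc (tD j)).
have Ig := L2loc_intg Lg (ptest_of tc tp).
have EA : \int[mu]_z (u z * dt (fun z => chi z.1 * psi z.2) z) = A + chi 0 * l.
  transitivity (\int[mu]_z (pos (sqrtR c) z * (chi' z.1 * psi z.2) + neg r0 z * (chi' z.1 * psi z.2))).
    by apply: I_eq => z; rewrite (dtE _ hc tp) /u_ mulrDl.
  rewrite ID//; last exact: L2loc_intg (L2loc_neg Lr0) (ptest_of tc' tp).
  rewrite (I_neg Lr0 tc' tp) (I_derive_left tc hc)//.
  exact: smooth1_continuous tc'.1.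
have EF j : \int[mu]_z (F j z * dy j (fun z => chi z.1 * psi z.2) z) =
    \int[mu]_z (F j z * (chi z.1 * 'D_(basis_vec j) psi z.2)).
  by apply: I_eq => z; rewrite (dyE _ _ tc tp).
pose B k := \int[mu]_z (pos (sqrtR c) z * (impulse k z.1 * chi z.1 * psi z.2)).
have tik k : time_test (fun t => impulse k t * chi t).
  by apply: time_testM => //; exact: smooth1_impulse.
have IB' k := L2loc_intg Lu0 (ptest_of (tik k) tp).
have step k : - (\int[mu]_z (pos (sqrtR c) z * (chi' z.1 * psi z.2) * onset k z.1) + B k)
   - \sum_j \int[mu]_z (F j z * (chi z.1 * 'D_(basis_vec j) psi z.2) * onset k z.1)
   = \int[mu]_z (g z * (chi z.1 * psi z.2) * onset k z.1).
  have tk := onset_test k tc.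
  have hk t : is_derive t (1 : R) (fun t => onset k t * chi t) (onset k t * chi' t + impulse k t * chi t).
    have h : is_derive t (1 : R) (fun t => onset k t * chi t) _ := is_deriveM (is_derive_onset k t) (hc t).
    by apply: is_derive_eq h _; rewrite /GRing.scale /= /impulse; ring.
  have kpos : (0 : R) < k.+1%:R^-1 by rewrite invr_gt0.
  have ok t : t < k.+1%:R^-1 -> onset k t * chi t = 0.
    by move=> h; rewrite onset_before ?mul0r.
  have := ce (ptest_positive kpos ok tk tp); rewrite !pairing_pos.
  have -> : \int[mu]_z (pos (sqrtR c) z * dt (fun z => onset k z.1 * chi z.1 * psi z.2) z) =
      (\int[mu]_z (pos (sqrtR c) z * (chi' z.1 * psi z.2) * onset k z.1)) + B k.
    rewrite -ID//; last exact: (onset_intg k IA).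
    by apply: I_eq => z; rewrite (dtE _ hk tp); ring.
  have -> : \int[mu]_z (pos (fun t y => (2 * tau t ^+ 2)^-1 * \tr (TN c t y)) z *
      (onset k z.1 * chi z.1 * psi z.2)) = \int[mu]_z (g z * (chi z.1 * psi z.2) * onset k z.1).
    by apply: I_eq => z; rewrite gE; ring.
  under eq_bigr => j _.
    rewrite pairing_pos.
    have -> : \int[mu]_z (pos (fun t y => (tau t ^+ 2)^-1 * sqrtRU c t y 0 j) z *
        dy j (fun z => onset k z.1 * chi z.1 * psi z.2) z) =
        \int[mu]_z (F j z * (chi z.1 * 'D_(basis_vec j) psi z.2) * onset k z.1).
      by apply: I_eq => z; rewrite FE (dyE _ _ tk tp); ring.
    over.
  exact.
have limA := onset_lim IA (fun z h => etrans (congr1 ( *%R^~ _) (pos_out _ h)) (mul0r _)).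
have limF j : \int[mu]_z (F j z * (chi z.1 * 'D_(basis_vec j) psi z.2) * onset k z.1) @[k --> \oo] -->
   \int[mu]_z (F j z * dy j (fun z => chi z.1 * psi z.2) z).
  rewrite EF; apply: onset_lim => // z h.
  by rewrite /F_ /q_ (pos_out _ h) mulr0 mul0r.
have limg := onset_lim Ig (fun z h => etrans (congr1 (fun a => 2^-1 * (a * _) * _) (pos_out _ h)) _).
have limB : B k @[k --> \oo] --> chi 0 * l.
  pose f t := \int[lebesgue_rV d]_y (pos (sqrtR c) (t, y) * psi y).
  have mp : measurable_fun setT psi.
    by apply: continuous_measurable_rV; apply: smooth_cont; case: tp.
  have mf : measurable_fun setT f.
    apply: (@measurable_I2 _ _ _ _ _ (lebesgue_rV d) (fun z : mX => pos (sqrtR c) z * psi z.2)).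
    by apply: measurable_funM; [exact: Lu0.1|exact: (measurableT_comp mp measurable_snd)].
  have mi k : measurable_fun setT (fun t => impulse k t * (chi t * f t)).
    apply: measurable_funM; first exact: measurable_smooth1 (smooth1_impulse k).
    by apply: measurable_funM => //; exact: measurable_smooth1 tc.1.
  have aeE k : {ae leb, forall t, impulse k t * (chi t * f t) =
      \int[lebesgue_rV d]_y (pos (sqrtR c) (t, y) * (impulse k t * chi t * psi y))}.
    apply: (ae_imp (ae_intg1 (m2 := lebesgue_rV d) (IB' k))) => t /= It.
    (* Where the time factor is nonzero, dividing by it shows that the slice is integrable;
       elsewhere both sides are 0. *)
    have [i0|i0] := eqVneq (impulse k t * chi t) 0.
      rewrite mulrA i0 mul0r -[LHS](I0 (lebesgue_rV d)); apply: I_eq => y.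
      by rewrite mul0r mulr0.
    rewrite mulrA /f -IZ; first by apply: I_eq => y; ring.
    have := intgZ (impulse k t * chi t)^-1 It; congr (intg _ _).
    by apply/funext => y; rewrite mulrCA (mulrA _^-1) mulVf// mul1r.
  have Ii k : intg leb (fun t => impulse k t * (chi t * f t)).
    by apply: (intg_ae_eq _ _ (fubX1 (IB' k)).1); [exact: mi|exact: aeE].
  have E k : B k = \int[leb]_t (impulse k t * (chi t * f t)).
    rewrite /B -(fubX1 (IB' k)).2; symmetry.
    by apply: I_ae; [exact: mi|exact: intg_meas (fubX1 (IB' k)).1|exact: aeE].
  under eq_fun do rewrite E.
  apply: impulse_lim => //; first exact: smooth1_continuous tc.1.
  have [N N0 hN] := ini tp; exists N => //.
  apply: cvg_trans hN; apply: near_eq_cvg; rewrite near_withinE.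
  have : \forall t \near (0 : R)^'+, 0 < t by exact: nbhs_right_gt.
  by apply: filterS => t t0 _; apply: I_eq => y; rewrite /pos /= t0.
have cL : (- (\int[mu]_z (pos (sqrtR c) z * (chi' z.1 * psi z.2) * onset k z.1) + B k)
   - \sum_j \int[mu]_z (F j z * (chi z.1 * 'D_(basis_vec j) psi z.2) * onset k z.1)) @[k --> \oo] -->
   (- (A + chi 0 * l)) - \sum_j \int[mu]_z (F j z * dy j (fun z => chi z.1 * psi z.2) z).
  apply: cvgB; first by apply: cvgN; exact: cvgD.
  by apply: cvg_big => //; exact: add_continuous.
have E0 := cvg_seq_eq cL (limg (fun z => etrans (congr1 (fun a => 2^-1 * a * _) (mul0r _))
  (etrans (congr1 ( *%R^~ _) (mulr0 _)) (mul0r _)))) step.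
exact: etrans (congr1 (fun a => - a - _) EA) E0.
Qed.

Lemma u_wder j : wder (0, basis_vec j) u (v j).
Proof.
move=> _ [chi [psi [tc tp ->]]].
have tD : test_function setT ('D_(basis_vec j) psi) := test_derive _ tp.
have Lu0 := L2loc_u0 reg.
have Lv0 := L2loc_v0 reg j.
have Iv := L2loc_intg Lv0 (ptest_of tc tp); have Iu := L2loc_intg Lu0 (ptest_of tc tD).
have E k : \int[mu]_z (pos (fun t y => grad_sqrtR c t y 0 j) z * (chi z.1 * psi z.2) * onset k z.1) =
    - \int[mu]_z (pos (sqrtR c) z * (chi z.1 * 'D_(basis_vec j) psi z.2) * onset k z.1).
  have tk := onset_test k tc.
  have kpos : (0 : R) < k.+1%:R^-1 by rewrite invr_gt0.
  have ok t : t < k.+1%:R^-1 -> onset k t * chi t = 0.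
    by move=> h; rewrite onset_before ?mul0r.
  have := grad_sqrtRP reg (ptest_positive kpos ok tk tp) j; rewrite !pairing_pos => h.
  transitivity (\int[mu]_z (pos (fun t y => grad_sqrtR c t y 0 j) z * (onset k z.1 * chi z.1 * psi z.2))).
    by apply: I_eq => z; ring.
  rewrite h; congr (- _); apply: I_eq => z; rewrite (dyE _ _ tk tp); ring.
have l1 := onset_lim Iv (fun z h => etrans (congr1 ( *%R^~ _) (pos_out _ h)) (mul0r _)).
have l2 := onset_lim Iu (fun z h => etrans (congr1 ( *%R^~ _) (pos_out _ h)) (mul0r _)).
have E0 : \int[mu]_z (pos (fun t y => grad_sqrtR c t y 0 j) z * (chi z.1 * psi z.2)) =
   - \int[mu]_z (pos (sqrtR c) z * (chi z.1 * 'D_(basis_vec j) psi z.2)).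
  rewrite -(cvg_lim (@Rhausdorff R) l1); apply: cvg_lim; first exact: Rhausdorff.
  by under eq_fun do rewrite E; exact: cvgN.
transitivity (\int[mu]_z (pos (fun t y => grad_sqrtR c t y 0 j) z * (chi z.1 * psi z.2)
    + neg (fun y => G0 y 0 j) z * (chi z.1 * psi z.2))).
  by apply: I_eq => z; rewrite /v_ mulrDl.
have Lr := L2loc_neg Lr0.
rewrite ID//; last exact: L2loc_intg (L2loc_neg (LG0 j)) (ptest_of tc tp).
transitivity (- \int[mu]_z (pos (sqrtR c) z * (chi z.1 * 'D_(basis_vec j) psi z.2)
    + neg r0 z * (chi z.1 * 'D_(basis_vec j) psi z.2))); last first.
  by congr (- _); apply: I_eq => z; have := dyE z j tc tp; rewrite /dy => ->; rewrite /u_ mulrDl.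
rewrite ID//; last exact: L2loc_intg Lr (ptest_of tc tD).
by rewrite E0 (I_neg (LG0 j) tc tp) (I_neg Lr0 tc tD) wg0// mulrN opprD.
Qed.

Lemma pos_u (f : R -> space -> R) z : pos f z * u z = pos f z * pos (sqrtR c) z.
Proof.
rewrite /u_ /pos; case: ifPn => z0; last by rewrite !mul0r.
by rewrite /neg indicE memNset ?mul0r ?addr0//= in_itv /= => h; move: z0; rewrite ltNge h.
Qed.

Lemma pos_v (f : R -> space -> R) j z : pos f z * v j z = pos f z * pos (fun t y => grad_sqrtR c t y 0 j) z.
Proof.
rewrite /v_ /pos; case: ifPn => z0; last by rewrite !mul0r.
by rewrite /neg indicE memNset ?mul0r ?addr0//= in_itv /= => h; move: z0; rewrite ltNge h.
Qed.

Lemma timefE (k : R -> R) (z : mX) : 0 < z.1 -> timef k z = k z.1 :> R.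
Proof. by rewrite /timef /pos => ->. Qed.

(** The equation of sqrtR TN carries no factor of tau. The factor tau^-2 enters through the test
    function, which [onset] keeps away from t <= 0; all extended terms vanish there, so the limit
    needs no initial datum. *)
Lemma T_equation j phi : test phi ->
  \int[mu]_z (timef (ktau tau) z * (T_ c j j z * u z) * phi z) =
  - ((\int[mu]_z (F j z * u z * dy j phi z)) + 2 * \int[mu]_z (F j z * v j z * phi z)).
Proof.
move=> [chi [psi [tc tp ->]]].
have tD : test_function setT ('D_(basis_vec j) psi) := test_derive _ tp.
have Lu := L2loc_u reg Lr0; have Lv := L2loc_v reg LG0 j.
have LF := L2loc_F ht reg j; have LT := L2loc_T reg j j.
have LkT := L2loc_bd LT (measurable_timef ht (tc_ktau tau)) (ktau_bd ht).
have IT := L2loc_mul LkT Lu (ptest_of tc tp).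
have IFu := L2loc_mul LF Lu (ptest_of tc tD).
have IFv := L2loc_mul LF Lv (ptest_of tc tp).
have E k : \int[mu]_z (timef (ktau tau) z * T_ c j j z * u z * (chi z.1 * psi z.2) * onset k z.1) =
   - ((\int[mu]_z (F j z * u z * (chi z.1 * 'D_(basis_vec j) psi z.2) * onset k z.1)) +
      2 * \int[mu]_z (F j z * v j z * (chi z.1 * psi z.2) * onset k z.1)).
  have kpos : (0 : R) < k.+1%:R^-1 by rewrite invr_gt0.
  have ok t : t < k.+1%:R^-1 -> onset k t * chi t * ktau tau t = 0.
    by move=> h; rewrite onset_before ?mul0r.
  have tk : time_test (fun t => onset k t * chi t * ktau tau t).
    split.
      apply: (smooth1_tau_cut ht kpos); apply: tau_cut_mul.
      - exact: (onset_test k tc).1.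
      - by move=> t h; rewrite onset_before ?mul0r.
      - exact: tc_ktau.
    by have [_ [m m0]] := tc; exists m => t /m0 ->; rewrite mulr0 mul0r.
  have := te (ptest_positive kpos ok tk tp) j j; rewrite !pairing_pos => h.
  have kE (z : mX) : timef (ktau tau) z * onset k z.1 = ktau tau z.1 * onset k z.1.
    by have [z0|z0] := leP z.1 0; [rewrite onset_neg// !mulr0|rewrite timefE].
  transitivity (\int[mu]_z (pos (fun t y => sqrtR c t y * TN c t y j j) z *
      (onset k z.1 * chi z.1 * ktau tau z.1 * psi z.2))).
    apply: I_eq => z; have e := pos_u (fun t y => TN c t y j j) z; rewrite -/(T_ c j j z) in e.
    transitivity (timef (ktau tau) z * onset k z.1 * (T_ c j j z * u z * (chi z.1 * psi z.2))); first by ring.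
    by rewrite kE e posM -/(T_ c j j z); ring.
  rewrite h opprD; congr (_ + _).
    congr (- _); apply: I_eq => z; rewrite (dyE _ _ tk tp) posM -/(q_ c j z) /F_.
    have e := pos_u (fun t y => sqrtRU c t y 0 j) z; rewrite -/(q_ c j z) in e.
    transitivity (ktau tau z.1 * onset k z.1 * (q_ c j z * pos (sqrtR c) z * (chi z.1 * 'D_(basis_vec j) psi z.2))); first by ring.
    by rewrite -kE -e; ring.
  congr (- _); rewrite -IZ; last exact: onset_intg.
  apply: I_eq => z; rewrite /F_ -/(q_ c j z).
  have -> : pos (fun t y => 2 * outer (sqrtRU c t y) (grad_sqrtR c t y) j j) z = 2 * (q_ c j z * v j z).
    rewrite /q_ pos_v -posM /pos; case: ifP; rewrite ?mulr0// => _.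
    by rewrite /outer mxE big_ord1 mxE.
  transitivity (ktau tau z.1 * onset k z.1 * (2 * (q_ c j z * v j z) * (chi z.1 * psi z.2))); first by ring.
  by rewrite -kE; ring.
have z0 (f : R -> R) (G H : mX -> R) z : z.1 <= 0 -> timef f z * G z * H z = 0.
  by move=> h; rewrite /timef (pos_out _ h) !mul0r.
have l1 := onset_lim IT (fun z h => etrans (congr1 ( *%R^~ _) (z0 _ _ _ z h)) (mul0r _)).
have l2 := onset_lim IFu (fun z h => etrans (congr1 ( *%R^~ _) (z0 _ _ _ z h)) (mul0r _)).
have l3 := onset_lim IFv (fun z h => etrans (congr1 ( *%R^~ _) (z0 _ _ _ z h)) (mul0r _)).
transitivity (\int[mu]_z (timef (ktau tau) z * T_ c j j z * u z * (chi z.1 * psi z.2))).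
  by apply: I_eq => z; ring.
have -> : \int[mu]_z (F j z * u z * dy j (fun z => chi z.1 * psi z.2) z) =
    \int[mu]_z (F j z * u z * (chi z.1 * 'D_(basis_vec j) psi z.2)).
  by apply: I_eq => z; rewrite (dyE _ _ tc tp).
rewrite -(cvg_lim (@Rhausdorff R) l1); apply: cvg_lim; first exact: Rhausdorff.
under eq_fun do rewrite E.
apply: cvgN; apply: cvgD => //; apply: cvgM => //; exact: cvg_cst.
Qed.

Lemma density_equation phi : test phi ->
  (\int[mu]_z (u z ^+ 2 * dt phi z)) +
  \sum_j \int[mu]_z (F j z * u z * dy j phi z) = 0.
Proof.
apply: (renormalise (v := v) (L2loc_u reg Lr0) (L2loc_g ht reg)).
- exact: L2loc_F ht reg.
- exact: L2loc_v reg LG0.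
- exact: u_wder.
- exact: u_equation.
move=> {}phi tphi.
(* The compensating identity is the trace of [T_equation]; the factor 2 undoes the half in [g_]. *)
rewrite -sumrN -IZ; last exact: L2loc_mul (L2loc_g ht reg) (L2loc_u reg Lr0) tphi.
under [RHS]eq_bigr do rewrite -(T_equation _ tphi).
rewrite -I_sum.
  by apply: I_eq => z; rewrite /g_ -mulr_suml -mulr_sumr -mulr_suml; field.
move=> j; have LT := L2loc_T reg j j.
have LkT := L2loc_bd LT (measurable_timef ht (tc_ktau tau)) (ktau_bd ht).
have := L2loc_mul LkT (L2loc_u reg Lr0) tphi; congr (intg _ _).
by apply/funext => z; ring.
Qed.

End equations.

(** * Conservation of mass *)

Section mass.
Context {R : realType} (d : nat).
Local Notation leb := (@lebesgue_measure R).
Local Notation X := (R * 'rV[R]_d)%type.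
Local Notation mX := (measurableTypeR R * 'rV[R]_d)%type.
Local Notation mu := (@muX R d).
Local Notation space := 'rV[R]_d.
Local Notation test := (@ptest R d).
Variables (tau : R -> R) (eps : R) (c : collection R d) (r0 : space -> R) (G0 : space -> space).
Hypothesis ht : is_tau tau.
Hypothesis reg : regularity eps c.
Hypothesis Lr0 : L2 (lebesgue_rV d) r0.
Hypothesis LG0 : forall i, L2 (lebesgue_rV d) (fun y => G0 y 0 i).
Local Notation u := (u_ c r0).
Local Notation F := (F_ tau c).
Hypothesis eqR : forall phi, test phi ->
  (\int[mu]_z (u z ^+ 2 * dt phi z)) +
  \sum_j \int[mu]_z (F j z * u z * dy j phi z) = 0.

Lemma intg_le_ae dd (T : measurableType dd) (m : {measure set T -> \bar R}) (f g : T -> R) :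
  measurable_fun setT f -> {ae m, forall x, `|f x| <= g x} -> intg m g -> intg m f.
Proof.
move=> mf fg Ig; have mg := intg_meas Ig.
have mm : measurable_fun setT (fun x => Num.max (- `|g x|) (Num.min (f x) `|g x|)).
  apply: measurable_maxr.
    by apply: measurableT_comp => //; apply: measurableT_comp.
  by apply: measurable_minr => //; apply: measurableT_comp.
apply: (intg_ae_eq mf (g := fun x => Num.max (- `|g x|) (Num.min (f x) `|g x|))).
  apply: (ae_imp fg) => x h.
  have : `|f x| <= `|g x| by rewrite (le_trans h)// ler_norm.
  by rewrite ler_norml => /andP[h1 h2]; rewrite (min_idPl h2) (max_idPr h1).
apply: (intg_le mm _ (intg_abs Ig)) => x.
rewrite ler_norml le_max lexx /= ge_max ge_min lexx orbT andbT.
by rewrite (le_trans _ (normr_ge0 _))// oppr_le0.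
Qed.

Lemma L2loc_time f g chi : L2loc f -> L2loc g -> time_test chi ->
  intg mu (fun z : mX => f z * g z * chi z.1).
Proof.
move=> Lf Lg tc; have [sc [m m0]] := tc; have [M hM] := time_test_bounded tc.
have mc : measurable_fun setT (fun z : mX => chi z.1).
  exact: (measurableT_comp (measurable_smooth1 sc) measurable_fst).
have := intg_bdM (L2_mul (L2loc_indic m Lf) (L2loc_indic m Lg)) mc (fun z => hM z.1).
congr (intg _ _); apply/funext => z; rewrite !indicE.
have [h|h] := boolP (z \in slabX m); first by rewrite !mulr1.
rewrite [chi z.1]m0 ?mulr0// leNgt; apply: contra h => h; by rewrite inE.
Qed.

(** The space cutoff is removed by dominated convergence. The flux F u is integrable over the whole
    space, and the derivative of the cutoff is bounded and tends to 0 at each point. *)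
Lemma density_time chi chi' : time_test chi -> time_test chi' ->
  (forall t, is_derive t (1 : R) chi (chi' t)) -> \int[mu]_z (u z * u z * chi' z.1) = 0.
Proof.
move=> tc tc' hc.
have Lu := L2loc_u reg Lr0; have LF j := L2loc_F ht reg j.
have Iu := L2loc_time Lu Lu tc'; have IF j := L2loc_time (LF j) Lu tc.
have mu' := intg_meas Iu; have mF j := intg_meas (IF j).
have l1 : \int[mu]_z (u z * u z * chi' z.1 * ycut k z.2) @[k --> \oo] --> \int[mu]_z (u z * u z * chi' z.1).
  apply: (dct (g := fun z => `|u z * u z * chi' z.1|)) => //.
  - move=> k; apply: measurable_funM => //; apply: (measurableT_comp _ measurable_snd).
    by apply: continuous_measurable_rV; apply: smooth_cont; case: (@test_ycut R d k).
  - apply: aeW => z; apply: cvg_near_cst; apply: filterS (ycut_near z.2) => k hk.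
    by rewrite ycut1// mulr1.
  - exact: intg_abs.
  - by move=> k z; rewrite normrM ler_piMr// ger0_norm ?ycut_ge0 ?ycut_le1.
have l2 j : \int[mu]_z (F j z * u z * chi z.1 * 'D_(basis_vec j) (ycut k) z.2) @[k --> \oo] --> (0 : R).
  rewrite -[X in _ --> X](I0 mu).
  apply: (dct (g := fun z => 2 * bump_mass^-1 * `|F j z * u z * chi z.1|)) => //.
  - move=> k; apply: measurable_funM => //.
    have mD : measurable_fun setT ('D_(basis_vec j) (@ycut R d k)).
      by apply: continuous_measurable_rV; apply: smooth_cont; apply: smooth_derive; case: (@test_ycut R d k).
    exact: (measurableT_comp mD measurable_snd).
  - apply: aeW => z; apply: cvg_near_cst; apply: filterS (ycut_near z.2) => k hk.
    by rewrite dycut0// mulr0.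
  - exact/intgZ/intg_abs.
  - by move=> k z; rewrite normrM mulrC ler_wpM2r// dycut_le.
have cL : \int[mu]_z (u z * u z * chi' z.1 * ycut k z.2) +
   (\sum_j \int[mu]_z (F j z * u z * chi z.1 * 'D_(basis_vec j) (ycut k) z.2)) @[k --> \oo] -->
   \int[mu]_z (u z * u z * chi' z.1) + \sum_(j < d) (0 : R).
  apply: cvgD => //; apply: cvg_big => //; exact: add_continuous.
have E k : \int[mu]_z (u z * u z * chi' z.1 * ycut k z.2) +
   (\sum_j \int[mu]_z (F j z * u z * chi z.1 * 'D_(basis_vec j) (ycut k) z.2)) = 0.
  pose p := fun z : X => chi z.1 * ycut k z.2.
  have e1 : \int[mu]_z (u z * u z * chi' z.1 * ycut k z.2) = \int[mu]_z (u z ^+ 2 * dt p z).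
    by apply: I_eq => z; rewrite (dtE _ hc (@test_ycut R d k)) expr2 !mulrA.
  have e2 j : \int[mu]_z (F j z * u z * chi z.1 * 'D_(basis_vec j) (ycut k) z.2) =
      \int[mu]_z (F j z * u z * dy j p z).
    by apply: I_eq => z; rewrite (dyE _ _ tc (@test_ycut R d k)) !mulrA.
  have e3 := eqR (ptest_of tc (@test_ycut R d k)).
  exact: etrans (congr2 +%R e1 (eq_bigr _ (fun j _ => e2 j))) e3.
have c0 : (fun=> 0 : R) k @[k --> \oo] --> (0 : R) by exact: cvg_cst.
have := cvg_seq_eq cL c0 E.
by rewrite big1 ?addr0.
Qed.

Let M0 := \int[lebesgue_rV d]_y (r0 y ^+ 2).

(** The bump [b] sits at times between -3 and -1, where the mass is that of the initial datum.
    Subtracting from [h] the multiple of [b] with the same integral leaves the derivative of a test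
    function, to which [density_time] applies. *)
Lemma density_mass h : time_test h ->
  \int[mu]_z (u z * u z * h z.1) = (\int[leb]_t h t) * M0.
Proof.
move=> th; have Lu := L2loc_u reg Lr0.
pose b t := bumpf (1 * t + 2) : R.
have tb : time_test b.
  split; first by apply: smooth1_affine; exact: smooth1_bump.
  exists 3 => t; rewrite ler_normr => /orP[ht3|ht3]; rewrite /b bump_out// ler_normr; apply/orP.
    by left; lra.
  by right; lra.
have Ib : \int[leb]_t b t = 1.
  rewrite -(I_kap 0 (-2)).2; apply: I_eq => t.
  by rewrite -kapN /kap mul1r mul1r addr0 /b mul1r; congr bumpf; lra.
have Iub : \int[mu]_z (u z * u z * b z.1) = M0.
  transitivity (\int[mu]_z (b z.1 * r0 z.2 ^+ 2)).
    apply: I_eq => z; have [z0|z0] := leP z.1 (-1).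
      rewrite /u_ pos_out; last by lra.
      rewrite /neg indicE mem_set ?mul1r ?add0r ?expr2 1?mulrC//= in_itv /=; lra.
    by rewrite /b bump_out ?mulr0 ?mul0r// ler_normr; apply/orP; left; lra.
  by rewrite (intgX_tensor (time_test_intg tb) Lr0.2).2 Ib mul1r.
have [sh [m m0]] := th; have Ih := time_test_intg th; have Ibb := time_test_intg tb.
pose s := \int[leb]_t h t.
pose h' t := h t + (- s) * b t.
have th' : time_test h' by apply: time_testD => //; apply: time_testM => //; exact: smooth1_cst.
(* m + 4 exceeds both m and 3, the radii that contain the supports of [h] and [b]. *)
have [|||chi [tchi hchi _ _]] := time_test_prim (a := - (m + 4)%:R) (b := (m + 4)%:R) th'.
- by have := ler0n R (m + 4); rewrite natrD; have := ler0n R m; lra.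
- move=> t ht4; rewrite /h' m0; last first.
    rewrite leNgt; apply/negP; rewrite ltr_norml natrD in ht4 * => /andP[h1 h2]; apply: ht4.
    by apply/andP; split; lra.
  rewrite /b bump_out ?mulr0 ?addr0// leNgt; apply/negP; rewrite ltr_norml natrD in ht4 * => /andP[h1 h2]; apply: ht4.
  by have := ler0n R m; move=> ?; apply/andP; split; lra.
- have Isb : \int[leb]_t ((- s) * b t) = - s by rewrite IZ// Ib mulr1.
  by rewrite ID//; [rewrite Isb subrr|exact: intgZ].
have := density_time tchi th' hchi.
have I1 := L2loc_time Lu Lu th; have I2 := L2loc_time Lu Lu tb.
rewrite (_ : \int[mu]_z (u z * u z * h' z.1) = (\int[mu]_z (u z * u z * h z.1)) + (- s) * \int[mu]_z (u z * u z * b z.1)).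
  by rewrite Iub /s; lra.
rewrite -IZ// -ID//; last exact: intgZ.
by apply: I_eq => z; rewrite /h'; ring.
Qed.

Lemma u_bound T : exists B : R, {ae leb, forall t : R, 0 < t < T ->
  (\int[lebesgue_rV d]_y (sqrtR c t y ^+ 2)%:E <= B%:E)%E}.
Proof.
have [B hB] := Loo_L2_bound (sqrtR_Loo_L2 reg) T; exists B.
apply: (ae_imp hB) => t h t0T; apply: (le_trans _ (h t0T)).
have t0 : 0 < t by case/andP: t0T.
apply: ge0_le_integral => //.
- by move=> y _; rewrite lee_fin sqr_ge0.
- by apply/measurable_EFinP; apply: measurable_funX; exact: measurable_sec_pos (mes_sqrtR reg) t0.
- by apply/measurable_EFinP; apply: measurable_funX; exact: measurable_sec_pos (st_measurable_strength reg) t0.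
move=> y _; rewrite lee_fin -real_normK ?num_real// -[leRHS]real_normK ?num_real//.
by rewrite lerXn2r ?nnegrE// u_le_strength.
Qed.

(** [density_mass] says that M - M0 integrates to 0 against every time test; [ae_le_test] for both
    signs, on each interval ]-k, k[, turns this into equality almost everywhere. Its integrability
    hypothesis comes from the local bound on M. *)
Lemma mass_conservation : {ae leb, forall t : R, 0 < t ->
  intg (lebesgue_rV d) (fun y => sqrtR c t y ^+ 2) /\
  \int[lebesgue_rV d]_y (sqrtR c t y ^+ 2) = M0}.
Proof.
have Lu := L2loc_u reg Lr0; have mu' := measurable_u reg Lr0.
pose M t := \int[lebesgue_rV d]_y (u (t, y) * u (t, y)).
have mM : measurable_fun setT M.
  by apply: (@measurable_I2 _ _ _ _ _ (lebesgue_rV d) (fun z : mX => u z * u z)); exact: measurable_funM.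
have Mpos t : 0 < t -> M t = \int[lebesgue_rV d]_y (sqrtR c t y ^+ 2).
  move=> t0; apply: I_eq => y; have := pos_u c r0 (sqrtR c) (t, y).
  rewrite /u_ /pos /= t0 /neg indicE memNset /= ?mul0r ?addr0 ?expr2//.
  by rewrite in_itv /= => h; move: t0; rewrite ltNge h.
have Mneg t : t <= 0 -> M t = M0.
  move=> t0; apply: I_eq => y.
  by rewrite /u_ pos_out// /neg indicE mem_set /= ?in_itv//= mul1r add0r expr2.
have M00 : 0 <= M0 by apply: I_ge0 => y; exact: sqr_ge0.
have Mb (k : nat) : exists B, {ae leb, forall t, `|t| < k%:R -> `|M t - M0| <= B}.
  have [B hB] := u_bound k%:R; exists (`|B| + M0).
  apply: (ae_imp hB) => t h tk.
  have [t0|t0] := leP t 0; first by rewrite Mneg// subrr normr0 addr_ge0.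
  have {}h := h _; rewrite Mpos//.
  have {}h : (\int[lebesgue_rV d]_y (sqrtR c t y ^+ 2)%:E <= B%:E)%E.
    by apply: h; rewrite t0 /= (le_lt_trans (ler_norm t)).
  have h1 : \int[lebesgue_rV d]_y (sqrtR c t y ^+ 2) <= B.
    rewrite -lee_fin /Rintegral fineK// fin_real// (lt_le_trans _ (integral_ge0 _ _))//=.
      by rewrite (le_lt_trans h)// ltry.
    by move=> y _; rewrite lee_fin sqr_ge0.
  have h0 : 0 <= \int[lebesgue_rV d]_y (sqrtR c t y ^+ 2) by apply: I_ge0 => y; exact: sqr_ge0.
  by apply: (le_trans (ler_normB _ _)); rewrite (ger0_norm h0) (ger0_norm M00) lerD2r (le_trans h1)// ler_norm.
have If (k : nat) (s : R) : s ^+ 2 = 1 -> intg leb (fun t => (s * (M t - M0) * hat (- k%:R) k%:R t) ^+ 2).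
  move=> s1; have [B hB] := Mb k.
  have th := hat_test (- k%:R) (k%:R : R).
  apply: (intg_le_ae (g := fun t : measurableTypeR R => B ^+ 2 * (hat (- k%:R) k%:R t * hat (- k%:R) k%:R t))).
  - apply: measurable_funX; apply: measurable_funM; last exact: measurable_smooth1 th.1.
    by apply: measurable_funM => //; apply: measurable_funB.
  - apply: (ae_imp hB) => t h; rewrite ger0_norm ?sqr_ge0// exprMn exprMn s1 mul1r -expr2.
    have [tk|tk] := ltP `|t| k%:R.
      rewrite ler_wpM2r ?sqr_ge0// -real_normK ?num_real// lerXn2r ?nnegrE//; last exact: h.
      exact: le_trans (h tk).
    by rewrite hat_out ?expr0n ?mulr0// => /andP[h1 h2]; move: tk; rewrite leNgt ltr_norml h1 h2.
  - by apply: intgZ; apply: time_test_intg; apply: time_testM => //; exact: th.1.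
have Z h : time_test h -> intg leb (fun t => (M t - M0) * h t) /\ \int[leb]_t ((M t - M0) * h t) = 0.
  move=> th; have I1 := L2loc_time Lu Lu th; have Ih := time_test_intg th.
  have [J1 E1] := fubX1 I1.
  have aeE : {ae leb, forall t, M t * h t = \int[lebesgue_rV d]_y (u (t, y) * u (t, y) * h t)}.
    apply: (ae_imp (ae_intg1 (m2 := lebesgue_rV d) I1)) => t /= It.
    have [h0|h0] := eqVneq (h t) 0.
      by rewrite h0 mulr0 -[LHS](I0 (lebesgue_rV d)); apply: I_eq => y; rewrite mulr0.
    rewrite mulrC /M -IZ; first by apply: I_eq => y; ring.
    have := intgZ (h t)^-1 It; congr (intg _ _).
    by apply/funext => y; rewrite mulrCA mulVf// mulr1.
  have mMh : measurable_fun setT (fun t => M t * h t).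
    by apply: measurable_funM => //; exact: measurable_smooth1 th.1.
  have IMh : intg leb (fun t => M t * h t).
    by apply: (intg_ae_eq _ _ J1); [exact: mMh|exact: aeE].
  have E : \int[leb]_t (M t * h t) = (\int[leb]_t h t) * M0.
    rewrite -(density_mass th) -E1; apply: I_ae; [exact: mMh|exact: intg_meas J1|exact: aeE].
  have e t : (M t - M0) * h t = M t * h t - M0 * h t by ring.
  split; first by under [X in intg _ X]eq_fun do rewrite e; apply: intgB => //; exact: intgZ.
  by under eq_Rintegral do rewrite e; rewrite IB ?IZ// ?E; [ring|exact: intgZ].
have H (k : nat) (s : R) : s ^+ 2 = 1 -> {ae leb, forall t, - k%:R < t < k%:R -> s * (M t - M0) <= 0}.
  move=> s1; apply: ae_le_test.
  - by apply: measurable_funM => //; apply: measurable_funB.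
  - exact: If.
  - move=> h th _ _; have [J E] := Z h th.
    under eq_Rintegral do rewrite -mulrA.
    by rewrite IZ// E mulr0.
have A : {ae leb, forall t, forall k : nat, (0 < t < k%:R -> (\int[lebesgue_rV d]_y (sqrtR c t y ^+ 2)%:E < +oo)%E)
    /\ (- k%:R < t < k%:R -> M t = M0)}.
  apply: ae_foralln => k; have [B hB] := u_bound k%:R.
  have s1 : 1 ^+ 2 = 1 :> R by rewrite expr1n.
  have s2 : (-1) ^+ 2 = 1 :> R by rewrite sqrrN expr1n.
  apply: (ae_imp (ae_and hB (ae_and (H k 1 s1) (H k (-1) s2)))) => t [h1 [h2 h3]]; split.
    by move=> /h1 h; rewrite (le_lt_trans h)// ltry.
  by move=> tk; apply/eqP; rewrite -subr_eq0 eq_le; move: (h2 tk) (h3 tk); rewrite mul1r mulN1r oppr_le0 => -> ->.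
apply: (ae_imp A) => t h t0.
have tk : t < (Num.bound t)%:R by apply: archi_boundP; exact: ltW.
have [h1 h2] := h (Num.bound t); split.
  apply: intg_lty; last by apply: h1; rewrite t0.
    by apply: measurable_funX; exact: measurable_sec_pos (mes_sqrtR reg) t0.
  by move=> y; exact: sqr_ge0.
by rewrite -Mpos// h2// tk andbT (lt_trans _ t0)// oppr_lt0 (lt_trans t0).
Qed.

End mass.

(** * The Gaussian and the relative entropy *)

Section gaussian.
Context {R : realType}.

Lemma Gamma_prod d (y : 'rV[R]_d) : Gamma y = \prod_i expR (- (y 0 i ^+ 2)).
Proof. by rewrite /Gamma sqnorm_row -sumrN expR_sum. Qed.

Lemma intg_gauss : intg (@lebesgue_measure R) (fun x : R => expR (- (x ^+ 2))).
Proof. exact: integrableT_gauss. Qed.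

Lemma Gamma_gt0 d (y : 'rV[R]_d) : 0 < Gamma y.
Proof. exact: expR_gt0. Qed.

Lemma intg_Gamma d : intg (lebesgue_rV d) (@Gamma R d).
Proof.
have := (prod_rV (fun _ : 'I_d => intg_gauss)).1.
by congr (intg _ _); apply/funext => y; rewrite Gamma_prod.
Qed.

(** For x = r^2 > 0 this is ln (Gamma / x) <= Gamma / x - 1, multiplied by x: the relative entropy
    with respect to Gamma has a nonnegative density once Gamma - x is added. *)
Lemma potential_ge d (r : 'rV[R]_d -> R) y :
  r y ^+ 2 - Gamma y <= potential_density r y.
Proof.
rewrite /potential_density; set x := r y ^+ 2.
have x0 : 0 <= x by exact: sqr_ge0.
have G0 := Gamma_gt0 y.
have [->|xn] := eqVneq x 0; first by rewrite !mul0r addr0 sub0r oppr_le0 ltW.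
have xp : 0 < x by rewrite lt_neqAle eq_sym xn.
have e : ln (1 + (Gamma y / x - 1)) = - (sqnorm y + ln x).
  have -> : 1 + (Gamma y / x - 1) = Gamma y / x by ring.
  by rewrite ln_div ?posrE// /Gamma expRK; ring.
have q0 : 0 < Gamma y / x by rewrite divr_gt0.
have h : -1 < Gamma y / x - 1 by lra.
have := le_ln1Dx h; rewrite e => {}h.
have : x * - (sqnorm y + ln x) <= x * (Gamma y / x - 1) by rewrite ler_wpM2l.
have -> : x * (Gamma y / x - 1) = Gamma y - x by field.
lra.
Qed.

End gaussian.

(** * Bounds from the energy inequality *)

Section energy_bounds.
Context {R : realType} (d : nat).
Local Notation leb := (@lebesgue_measure R).
Local Notation X := (R * 'rV[R]_d)%type.
Local Notation mX := (measurableTypeR R * 'rV[R]_d)%type.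
Local Notation mu := (@muX R d).
Local Notation lebd := (lebesgue_rV d).
Local Notation space := 'rV[R]_d.
Variables (tau : R -> R) (nu eps C : R) (c : collection R d) (M0 : R).
Local Notation dtau := (tau^`()%classic).
Hypothesis ht : is_tau tau.
Hypothesis nu0 : 0 < nu.
Hypothesis reg : regularity eps c.
Hypothesis en : energy_inequality tau nu eps c C.
Hypothesis massG : M0 = \int[lebd]_y Gamma y.
Hypothesis mass : {ae leb, forall t : R, 0 < t ->
  intg lebd (fun y => sqrtR c t y ^+ 2) /\ \int[lebd]_y (sqrtR c t y ^+ 2) = M0}.

Lemma ae_gt (P : R -> Prop) (k : R) : {ae leb, forall t : R, P t} -> exists2 t, k < t & P t.
Proof.
move=> [N [mN N0 sN]]; apply: contrapT => h.
have hN : (leb (`]k, (k + 1)%R[%classic : set R) <= leb N)%E.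
  apply: le_measure; rewrite ?inE//.
  move=> x /=; rewrite in_itv /= => /andP[kx _]; apply: sN => /= Px.
  by apply: h; exists x.
move: hN; rewrite N0 lebesgue_measure_itv /= lte_fin ifT; last by lra.
by rewrite -EFinB lee_fin; lra.
Qed.

Definition kin_ (z : mX) : R := (\sum_j q_ c j z ^+ 2) +
  eps ^+ 2 * \sum_j pos (fun t y => grad_sqrtR c t y 0 j) z ^+ 2.
Definition SN_ i j (z : mX) : R := 2^-1 * (T_ c i j z + T_ c j i z).
Definition k3 t := dtau t * ((tau t)^-1 * ((tau t)^-1 * (tau t)^-1)).
Definition k4 t := ktau tau t * ktau tau t.
Definition ediss (z : mX) : R := timef k3 z * kin_ z + nu * timef k4 z * \sum_i \sum_j SN_ i j z ^+ 2.

Lemma tc_k3 : tau_class tau k3.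
Proof. by apply: tc_mul; [exact: tc_dtau|apply: tc_mul; [exact: tc_inv|apply: tc_mul; exact: tc_inv]]. Qed.

Lemma tc_k4 : tau_class tau k4.
Proof. by apply: tc_mul; exact: tc_ktau. Qed.

Lemma k3_ge0 t : 0 < t -> 0 <= k3 t.
Proof. by move=> t0; rewrite !mulr_ge0 ?invr_ge0 ?ltW ?(tau_pos ht) ?(dtau_gt0 ht). Qed.

Lemma k4_ge0 t : 0 <= k4 t.
Proof. by rewrite /k4 -expr2 sqr_ge0. Qed.

Lemma timef_ge0 (k : R -> R) (z : mX) : (forall t, 0 < t -> 0 <= k t) -> 0 <= timef k z.
Proof. by rewrite /timef /pos; case: ifP => // z0; apply. Qed.

Lemma kin_ge0 z : 0 <= kin_ z.
Proof.
apply: addr_ge0; first by apply: sumr_ge0 => j _; exact: sqr_ge0.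
by apply: mulr_ge0; [exact: sqr_ge0|apply: sumr_ge0 => j _; exact: sqr_ge0].
Qed.

Lemma SN_ge0 z : 0 <= \sum_i \sum_j SN_ i j z ^+ 2.
Proof. by apply: sumr_ge0 => i _; apply: sumr_ge0 => j _; exact: sqr_ge0. Qed.

Lemma ediss_ge0 z : 0 <= ediss z.
Proof.
rewrite addr_ge0// mulr_ge0 ?kin_ge0 ?SN_ge0//; first by apply: timef_ge0; exact: k3_ge0.
by apply: mulr_ge0; [exact: ltW|apply: timef_ge0 => t _; exact: k4_ge0].
Qed.

Lemma measurable_kin : measurable_fun setT kin_.
Proof.
apply: measurable_funD.
  by apply: measurable_sum => j; apply: measurable_funX; exact: measurable_q reg j.
apply: measurable_funM => //; apply: measurable_sum => j; apply: measurable_funX.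
exact: measurable_pos (mes_grad_sqrtR reg j).
Qed.

Lemma measurable_SN i j : measurable_fun setT (SN_ i j).
Proof.
apply: measurable_funM => //; apply: measurable_funD; apply: measurable_pos; exact: mes_TN reg _ _.
Qed.

Lemma measurable_SN2 : measurable_fun setT (fun z => \sum_i \sum_j SN_ i j z ^+ 2).
Proof.
apply: measurable_sum => i; apply: measurable_sum => j.
by apply: measurable_funX; exact: measurable_SN.
Qed.

Lemma measurable_ediss : measurable_fun setT ediss.
Proof.
apply: measurable_funD; apply: measurable_funM.
- by apply: (measurable_timef ht); exact: tc_k3.
- exact: measurable_kin.
- by apply: measurable_funM => //; by apply: (measurable_timef ht); exact: tc_k4.
- exact: measurable_SN2.
Qed.

Lemma dissipationE t : 0 < t ->
  dissipation tau nu eps c t = (\int[lebd]_y (ediss (t, y))%:E)%E.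
Proof.
move=> t0.
have mk := measurable_sec1 t measurable_kin; have mS := measurable_sec1 t measurable_SN2.
have kE y : kinetic_density eps (sqrtRU c t) (grad_sqrtR c t) y = kin_ (t, y).
  by rewrite /kinetic_density /kin_ /q_ /pos /= t0 !sqnorm_row.
have SE y : sqnorm (SN c t y) = \sum_i \sum_j SN_ i j (t, y) ^+ 2.
  rewrite /sqnorm /SN_ /T_ /pos /= t0; apply: eq_bigr => i _; apply: eq_bigr => j _.
  by rewrite /SN /symmetric_part !mxE.
rewrite /dissipation (eq_integral (fun y => (kin_ (t, y))%:E)) => [|y _]; last by rewrite kE.
rewrite (eq_integral (fun y => (\sum_i \sum_j SN_ i j (t, y) ^+ 2)%:E) (fun y => (sqnorm (SN c t y))%:E)) => [|y _]; last by rewrite SE.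
have e1 : dtau t / tau t ^+ 3 = k3 t by rewrite /k3 -exprVn !exprS expr0 mulr1.
have e2 : nu / tau t ^+ 4 = nu * k4 t by rewrite /k4 /ktau -exprVn !exprS expr0 mulr1 !mulrA.
rewrite e1 e2 -ge0_integralZl//; first last.
- by rewrite lee_fin k3_ge0.
- by move=> y _; rewrite lee_fin kin_ge0.
- exact/measurable_EFinP.
rewrite -ge0_integralZl//; first last.
- by rewrite lee_fin mulr_ge0 ?k4_ge0 ?ltW.
- by move=> y _; rewrite lee_fin SN_ge0.
- exact/measurable_EFinP.
rewrite -ge0_integralD//; first last.
- by apply/measurable_EFinP; apply: measurable_funM.
- by move=> y _; rewrite lee_fin mulr_ge0 ?SN_ge0// mulr_ge0 ?k4_ge0 ?ltW.
- by apply/measurable_EFinP; apply: measurable_funM.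
- by move=> y _; rewrite lee_fin mulr_ge0 ?kin_ge0 ?k3_ge0.
by apply: eq_integral => y _; rewrite /ediss !timefE.
Qed.

Lemma dissipation_ge0 t : 0 < t -> (0 <= dissipation tau nu eps c t)%E.
Proof. by move=> t0; rewrite dissipationE//; apply: integral_ge0 => y _; rewrite lee_fin ediss_ge0. Qed.

Lemma measurable_potential t : 0 < t -> measurable_fun setT (potential_density (sqrtR c t)).
Proof.
move=> t0; have mu0 := measurable_sec_pos (mes_sqrtR reg) t0.
apply: measurable_funD; apply: measurable_funM; [exact: measurable_funX| |exact: measurable_funX|].
  rewrite (_ : @sqnorm R 1 d = fun y => \sum_j y 0 j ^+ 2); last by apply/funext => y; rewrite sqnorm_row.
  by apply: measurable_sum => j; apply: measurable_funX; exact: measurable_coord.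
by apply: measurableT_comp; [exact: measurable_ln|exact: measurable_funX].
Qed.

(** The energy inequality is about extended integrals and does not say that the potential density is
    integrable. Its negative part is integrable by [potential_ge], and then the upper bound on the
    energy makes the positive part integrable as well. *)
Lemma energy_bounds : {ae leb, forall t : R, 0 < t ->
  [/\ intg lebd (potential_density (sqrtR c t)),
      \int[lebd]_y potential_density (sqrtR c t) y <= C &
      (\int[leb]_(s in [set s : R | (0 < s < t)%R]) dissipation tau nu eps c s <= C%:E)%E]}.
Proof.
apply: (ae_imp (ae_and en mass)) => t [e m] t0; have {e}e := e (ltW t0).
have [Iu Eu] := m t0; have mp := measurable_potential t0.
set P := potential_density (sqrtR c t) in mp *.
have D0 : (0 <= \int[leb]_(s in [set s : R | (0 < s < t)%R]) dissipation tau nu eps c s)%E.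
  by apply: integral_ge0 => s /= /andP[s0 _]; exact: dissipation_ge0.
have K0 : (0 <= ((2 * tau t ^+ 2)^-1)%:E * \int[lebd]_y (kinetic_density eps (sqrtRU c t) (grad_sqrtR c t) y)%:E)%E.
  apply: mule_ge0; first by rewrite lee_fin invr_ge0 mulr_ge0 ?sqr_ge0.
  apply: integral_ge0 => y _; rewrite lee_fin addr_ge0 ?sqnorm_ge0//.
  by rewrite mulr_ge0 ?sqr_ge0 ?sqnorm_ge0.
have Ig : intg lebd (fun y => sqrtR c t y ^+ 2 - Gamma y) by apply: intgB => //; exact: intg_Gamma.
have PC : (\int[lebd]_y (P y)%:E <= C%:E)%E.
  apply: le_trans e; rewrite /energy; apply: (le_trans _ (leeDl _ D0)).
  exact: leeDr.
have IP : intg lebd P.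
  have Ineg : (\int[lebd]_y ((fun y => (P y)%:E)^\- y) < +oo)%E.
    apply: le_lt_trans (intg_fin (intg_abs Ig)); apply: ge0_le_integral => //.
    - by apply: measurable_funeneg; exact/measurable_EFinP.
    - by apply/measurable_EFinP; apply: measurableT_comp => //; exact: intg_meas Ig.
    move=> y _; rewrite funenegE ge_max; apply/andP; split; last by rewrite lee_fin.
    rewrite -EFinN lee_fin; have := potential_ge (sqrtR c t) y; rewrite -/P => h.
    by rewrite (@le_trans _ _ (- (sqrtR c t y ^+ 2 - Gamma y)))// ?lerN2// -normrN ler_norm.
  apply/integrableP; split; first exact/measurable_EFinP.
  have Ipos : (\int[lebd]_y ((fun y => (P y)%:E)^\+ y) < +oo)%E.
    move: PC; rewrite integralE.
    have : (0 <= \int[lebd]_y ((fun y => (P y)%:E)^\- y))%E by apply: integral_ge0.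
    move: Ineg; case: (\int[lebd]_y ((fun y => (P y)%:E)^\- y))%E => [a| |]//.
    by case: (\int[lebd]_y ((fun y => (P y)%:E)^\+ y))%E => [b| |]//= *; rewrite ltry.
  under eq_integral do rewrite -/((abse \o (fun y => (P y)%:E)) _) fune_abse.
  rewrite ge0_integralD//; first exact: lte_add_pinfty.
  - by apply: measurable_funepos; exact/measurable_EFinP.
  - by apply: measurable_funeneg; exact/measurable_EFinP.
have PC' : \int[lebd]_y P y <= C by rewrite -lee_fin -I_EFin.
split => //.
(* The lower bound R - Gamma has integral 0 because the masses agree; the potential energy can then
   be dropped, and [C] alone bounds the dissipation. *)
have P0 : 0 <= \int[lebd]_y P y.
  apply: le_trans (I_le Ig IP (potential_ge _)).
  by rewrite IB//; [rewrite Eu massG subrr|exact: intg_Gamma].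
apply: le_trans e; rewrite /energy -/P; apply: leeDr; apply: adde_ge0 => //.
by rewrite (I_EFin IP) lee_fin.
Qed.

Let upto (t : R) : mX -> R := \1_[set z : mX | z.1 < t].

Let measurable_upto t : measurable_fun setT (upto t).
Proof.
apply: measurable_indic; rewrite (_ : [set z | _] = `]-oo, t[%classic `*` setT).
  by apply: measurableX => //; exact: measurable_itv.
by apply/seteqP; split=> z /=; rewrite in_itv //= => -[].
Qed.

Lemma ediss_bound (k : nat) : (\int[mu]_z (ediss z * upto k%:R z)%:E <= C%:E)%E.
Proof.
have me := measurable_ediss.
have mk t : measurable_fun setT (fun z => ediss z * upto t z) by exact: measurable_funM.
have p0 t z : 0 <= ediss z * upto t z by rewrite mulr_ge0 ?ediss_ge0.
(* The energy inequality may fail at time k itself; it is used at some later time, which is enough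
   as the dissipation is nonnegative. *)
have [t kt /(_ _)h] := ae_gt (Num.max k%:R 1) energy_bounds.
have [k1 t1] : k%:R < t /\ 1 < t by move: kt; rewrite gt_max => /andP.
have {h}[_ _ h] := h (lt_trans ltr01 t1).
apply: (@le_trans _ _ (\int[mu]_z (ediss z * upto t z)%:E)%E).
  apply: ge0_le_integral => //.
  - by move=> z _; rewrite lee_fin.
  - exact/measurable_EFinP.
  - exact/measurable_EFinP.
  move=> z _; rewrite lee_fin ler_wpM2l ?ediss_ge0// /upto !indicE.
  have [/set_mem /= zk|_] := boolP (z \in [set z | z.1 < k%:R]) => //.
  by rewrite mem_set//= (lt_trans zk).
rewrite (tonelliX (mk t) (p0 t)).
apply: le_trans h; rewrite [leRHS]integral_mkcond le_eqVlt; apply/orP; left; apply/eqP.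
apply: eq_integral => s _; rewrite patchE.
case: ifPn => [/set_mem /= /andP[s0 st]|/negP st].
  rewrite dissipationE//; apply: eq_integral => y _.
  by rewrite /upto indicE mem_set ?mulr1.
apply: integral0_eq => y _; have [s0|s0] := leP s 0.
  by rewrite /ediss /timef !pos_out// mulr0 !mul0r addr0 mul0r.
rewrite /upto indicE memNset ?mulr0//= => st'; apply: st.
by rewrite inE /= s0.
Qed.

Lemma intg_ediss : intg mu ediss.
Proof.
have me := measurable_ediss.
apply: intg_lty => //; first exact: ediss_ge0.
pose G (k : nat) (z : mX) := (ediss z * upto k%:R z)%:E.
have mG k : measurable_fun setT (G k).
  by apply/measurable_EFinP; exact: measurable_funM.
have G0 k z : setT z -> (0 <= G k z)%E by rewrite lee_fin mulr_ge0 ?ediss_ge0.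
have ndG z : setT z -> nondecreasing_seq (G ^~ z).
  move=> _ k l kl; rewrite lee_fin ler_wpM2l ?ediss_ge0// /upto !indicE.
  have [/set_mem /= zk|_] := boolP (z \in [set z | z.1 < k%:R]) => //.
  by rewrite mem_set//= (lt_le_trans zk)// ler_nat.
have cG := @cvg_monotone_convergence _ _ _ mu _ measurableT G mG G0 ndG.
have E z : (ediss z)%:E = limn (G ^~ z).
  apply/esym/cvg_lim => //; apply: cvg_near_cst.
  exists (Num.bound `|z.1|) => // k /= hk; rewrite /G /upto indicE mem_set ?mulr1//=.
  rewrite (le_lt_trans (ler_norm _))// (lt_le_trans (archi_boundP (normr_ge0 _)))//.
  by rewrite ler_nat.
rewrite (eq_integral (fun z => limn (G ^~ z))) => [|z _]; last exact: E.
apply: (@le_lt_trans _ _ C%:E); last exact: ltry.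
rewrite -(cvg_lim _ cG)//; apply: lime_le; first by apply/cvg_ex; eexists; exact: cG.
by apply: nearW => k; exact: ediss_bound.
Qed.

End energy_bounds.

(** * The momentum equation with first derivatives only *)

Section momentum.
Context {R : realType} (d : nat).
Local Notation leb := (@lebesgue_measure R).
Local Notation X := (R * 'rV[R]_d)%type.
Local Notation mX := (measurableTypeR R * 'rV[R]_d)%type.
Local Notation mu := (@muX R d).
Local Notation space := 'rV[R]_d.
Local Notation test := (@ptest R d).
Variables (tau : R -> R) (nu eps : R) (c : collection R d).
Local Notation dtau := (tau^`()%classic).
Hypothesis ht : is_tau tau.
Hypothesis eps0 : 0 <= eps.
Hypothesis reg : regularity eps c.
Hypothesis me : momentum_equation tau nu eps c.
Hypothesis sk : 0 < eps -> SK_equation c.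
Local Notation u := (pos (sqrtR c)).
Local Notation v j := (pos (fun t y => grad_sqrtR c t y 0 j)).
Local Notation q := (q_ c).
Local Notation H i j := (pos (fun t y => hess_sqrtR c t y i j)).
Local Notation k := (@timef R d (ktau tau)).
Local Notation SN := (SN_ c).

(** Vanishing before a positive time makes products with [psi] admissible in the equations and
    allows multiplication by functions of tau. *)
Definition delayed (chi : R -> R) := time_test chi /\ exists2 a : R, 0 < a & forall t, t < a -> chi t = 0.

Lemma delayed_test (chi : R -> R) (psi : space -> R) : delayed chi -> test_function setT psi ->
  test_function (@positive_times R d) (fun z : X => chi z.1 * psi z.2).
Proof. by move=> [tc [a a0 ca]] tp; exact: ptest_positive a0 ca tc tp. Qed.

Lemma delayed_tau (chi f : R -> R) : delayed chi -> tau_class tau f -> delayed (fun t => chi t * f t).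
Proof.
move=> [[sc [m m0]] [a a0 ca]] cf; split; last by exists a => // t /ca ->; rewrite mul0r.
split; last by exists m => t /m0 ->; rewrite mul0r.
by apply: (smooth1_tau_cut ht a0); apply: tau_cut_mul.
Qed.

Lemma ramp (a : R) : 0 < a -> exists z : R -> R, [/\ smooth1 z, forall t, `|z t| <= 1,
  forall t, t < a / 2 -> z t = 0 & forall t, a <= t -> z t = 1].
Proof.
move=> a0; exists (fun t => step (4 / a * t + - 3)); split.
- by apply: smooth1_affine; exact: smooth1_step.
- by move=> t; rewrite ger0_norm ?step_ge0 ?step_le1.
- move=> t ta; rewrite step0//.
  have : 4 / a * t < 2 by rewrite mulrAC ltr_pdivrMr//; lra.
  by lra.
- move=> t ta; rewrite step1//.
  have : 4 <= 4 / a * t by rewrite mulrAC ler_pdivlMr// ler_pM2l.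
  by lra.
Qed.

(** The weak derivative is known for t > 0 only. A smooth factor of time vanishing before [a] yields
    functions on all times, to which [wder_prod] applies. *)
Lemma wder_ramp (f g : R -> space -> R) (z : R -> R) a j : 0 < a -> smooth1 z ->
  (forall t, t < a -> z t = 0) ->
  (forall phi, test_function (@positive_times R d) phi -> pairing g phi = - pairing f (dy j phi)) ->
  wder (0, basis_vec j) (fun x : mX => z x.1 * pos f x) (fun x => z x.1 * pos g x).
Proof.
move=> a0 sz z0 fg _ [chi [psi [tc tp ->]]].
have dz : delayed (fun t => z t * chi t).
  by split; [exact: time_testM|exists a => // t /z0 ->; rewrite mul0r].
have := fg _ (delayed_test dz tp); rewrite !pairing_pos => h.
transitivity (\int[mu]_x (pos g x * (z x.1 * chi x.1 * psi x.2))).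
  by apply: I_eq => x; ring.
have e1 x := dyE x j dz.1 tp; have e2 x := dyE x j tc tp; rewrite /dy in e1 e2.
apply: (etrans h).
apply: (congr1 (fun a : R => - a)).
apply: I_eq => x.
rewrite /dy e1 e2; ring.
Qed.

Lemma L2loc_H i j : 0 < eps -> L2loc (H i j).
Proof.
move=> e0; have [m1 _ l2 _] := quantum_regularity reg e0.
have mH : st_measurable (fun t y => eps * enorm (hess_sqrtR c t y)).
  have mh : st_measurable (fun t y => enorm (hess_sqrtR c t y)).
    by apply: st_measurable_enorm => i' j'; exact: (m1 i' j').2.
  apply: st_measurable_pos.
  rewrite (_ : pos _ = fun z => eps * pos (fun t y => enorm (hess_sqrtR c t y)) z).
    by apply: measurable_funM => //; exact: measurable_pos.
  by apply/funext => z; rewrite /pos; case: ifP => //; rewrite mulr0.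
apply: (L2loc_le (C := eps^-1) _ (L2loc_Lp mH l2)); first exact: measurable_pos (m1 i j).2.
apply: aeW => z; rewrite /pos; case: ifP => _; last by rewrite normr0 mulr0.
rewrite normrM mulrA (gtr0_norm e0) mulVf ?gt_eqF// mul1r.
by rewrite (le_trans (entry_le_enorm _ _ _))// ler_norm.
Qed.

Lemma L2loc_SN i j : L2loc (SN i j).
Proof.
have h : L2loc (fun z => T_ c i j z + T_ c j i z) by apply: L2locD; exact: L2loc_T reg _ _.
by apply: (@L2loc_bd _ _ _ (fun=> 2^-1) 2^-1 h (measurable_cst _)) => z; rewrite ger0_norm.
Qed.

Let tk := measurable_timef (d := d) ht (tc_ktau tau).

(** With u = sqrtR and v its gradient, SK_ij = u d_j v_i - v_i v_j = d_j (u v_i) - 2 v_i v_j. The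
    second derivatives, absent from the dissipation, pass to the test function. *)
Lemma SK_identity chi (psi : space -> R) i j : 0 < eps -> delayed chi -> test_function setT psi ->
  intg mu (fun z => pos (fun t y => SK c t y i j) z * (chi z.1 * psi z.2)) /\
  \int[mu]_z (pos (fun t y => SK c t y i j) z * (chi z.1 * psi z.2)) =
  - ((\int[mu]_z (v i z * u z * (chi z.1 * 'D_(basis_vec j) psi z.2))) +
     2 * \int[mu]_z (v i z * v j z * (chi z.1 * psi z.2))).
Proof.
move=> e0 dc tp; have [tc [a a0 ca]] := dc.
have [z [sz z1 z0 za]] := ramp a0; have a20 : 0 < a / 2 by lra.
have [m1 wH _ _] := quantum_regularity reg e0.
have tD : test_function setT ('D_(basis_vec j) psi) := test_derive _ tp.
have mz : measurable_fun setT (fun x : mX => z x.1).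
  exact: (measurableT_comp (measurable_smooth1 sz) measurable_fst).
have Lz (f : mX -> R) : L2loc f -> L2loc (fun x => z x.1 * f x).
  by move=> Lf; apply: (L2loc_bd Lf mz) => x; exact: z1.
have Lu := L2loc_u0 reg; have Lv i := L2loc_v0 reg i; have LH := L2loc_H i j e0.
have wv : wder (0, basis_vec j) (fun x : mX => z x.1 * v i x) (fun x => z x.1 * H i j x).
  apply: (wder_ramp a20 sz z0) => phi tphi.
  have := wH i phi tphi j; rewrite (_ : (fun t y => row i (hess_sqrtR c t y) 0 j) = (fun t y => hess_sqrtR c t y i j))//.
  by apply/funext => t; apply/funext => y; rewrite mxE.
have wu : wder (0, basis_vec j) (fun x : mX => z x.1 * u x) (fun x => z x.1 * v j x).
  by apply: (wder_ramp a20 sz z0) => phi tphi; have := grad_sqrtRP reg tphi j.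
have W := wder_prod (Lz _ (Lv i)) (Lz _ LH) (Lz _ Lu) (Lz _ (Lv j)) wv wu (ptest_of tc tp).
have zc t : z t * chi t = chi t.
  by have [h|h] := ltP t a; [rewrite ca// mulr0|rewrite za// mul1r].
have IHu := L2loc_mul LH Lu (ptest_of tc tp).
have Ivv := L2loc_mul (Lv i) (Lv j) (ptest_of tc tp).
have Ivu := L2loc_mul (Lv i) Lu (ptest_of tc tD).
have W' : \int[mu]_x ((H i j x * u x + v i x * v j x) * (chi x.1 * psi x.2)) =
   - \int[mu]_x (v i x * u x * (chi x.1 * 'D_(basis_vec j) psi x.2)).
  transitivity (\int[mu]_x ((z x.1 * H i j x * (z x.1 * u x) + z x.1 * v i x * (z x.1 * v j x)) * (chi x.1 * psi x.2))).
    apply: I_eq => x; rewrite -[in LHS](zc x.1) -[in LHS](zc x.1); ring.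
  rewrite W; congr (- _); apply: I_eq => x; rewrite (dyE _ _ tc tp).
  by rewrite -[in RHS](zc x.1) -[in RHS](zc x.1); ring.
have aeSK : {ae mu, forall x, pos (fun t y => SK c t y i j) x * (chi x.1 * psi x.2) =
    (H i j x * u x) * (chi x.1 * psi x.2) - v i x * v j x * (chi x.1 * psi x.2)}.
  apply: (ae_imp (sk e0)) => x h; rewrite -mulrBl; congr (_ * _).
  rewrite /pos; case: ifP => x0; last by rewrite !mul0r subrr.
  rewrite h// !mxE big_ord1 !mxE; ring.
have mSK : measurable_fun setT (fun x => pos (fun t y => SK c t y i j) x * (chi x.1 * psi x.2)).
  apply: measurable_funM; first exact: measurable_pos (m1 i j).1.
  exact: measurable_ptest (ptest_of tc tp).
have I0 : intg mu (fun x => (H i j x * u x) * (chi x.1 * psi x.2) - v i x * v j x * (chi x.1 * psi x.2)).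
  exact: intgB.
split; first exact: intg_ae_eq mSK aeSK I0.
rewrite (I_ae mSK (intg_meas I0) aeSK) IB//.
have : \int[mu]_x ((H i j x * u x + v i x * v j x) * (chi x.1 * psi x.2)) =
  (\int[mu]_x (H i j x * u x * (chi x.1 * psi x.2))) + \int[mu]_x (v i x * v j x * (chi x.1 * psi x.2)).
  by rewrite -ID//; apply: I_eq => x; ring.
rewrite W'; lra.
Qed.

Let comb (a a' b b' p p' q0 q' s s' t t' : R) : a = a' -> b = b' -> p = p' -> q0 = q' ->
    s = s' -> t = t' -> - a - b + p - q0 = - s - t -> - a' - b' + p' - q' = - s' - t'.
Proof. by move=> -> -> -> -> -> ->. Qed.

Let alg (A B P Q S T D : R) : - A - B + P - Q = - S - T -> D = B - S -> P - Q = A + D - T.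
Proof. lra. Qed.

Let sub3 (A B D : 'I_d -> R) :
  \sum_j (A j - B j + D j) = \sum_j A j - \sum_j (B j - D j).
Proof. by rewrite -sumrB; apply: eq_bigr => j _; ring. Qed.

(** The equation solved for the one term without a decaying weight; each term on the right involves
    a velocity, a stress, a gradient, or the vanishing coefficient tau' / tau. *)
Lemma momentum_identity chi chi' (psi : space -> R) i : delayed chi ->
  (forall t, is_derive t (1 : R) chi (chi' t)) -> time_test chi' -> test_function setT psi ->
  \int[mu]_z (u z * u z * (chi z.1 * (2 * z.2 0 i * psi z.2 - 'D_(basis_vec i) psi z.2))) =
  (\int[mu]_z (u z * q i z * (chi' z.1 * psi z.2))) +
  (\sum_j ((\int[mu]_z (k z * q i z * q j z * (chi z.1 * 'D_(basis_vec j) psi z.2))) -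
     nu * (\int[mu]_z (k z * u z * SN i j z * (chi z.1 * 'D_(basis_vec j) psi z.2))) +
     eps ^+ 2 / 2 * ((\int[mu]_z (k z * v i z * u z * (chi z.1 * 'D_(basis_vec j) ('D_(basis_vec j) psi) z.2))) +
        2 * \int[mu]_z (k z * v i z * v j z * (chi z.1 * 'D_(basis_vec j) psi z.2))))) -
  nu * \int[mu]_z (timef (fun t => dtau t * (tau t)^-1) z * (u z * u z) * (chi z.1 * 'D_(basis_vec i) psi z.2)).
Proof.
move=> dc hc tc' tp; have tc := dc.1.
have tD j : test_function setT ('D_(basis_vec j) psi) := test_derive _ tp.
have Lu := L2loc_u0 reg; have Lv j := L2loc_v0 reg j; have Lq j := L2loc_q reg j.
have LS j := L2loc_SN i j.
have Lk (f : mX -> R) : L2loc f -> L2loc (fun x => k x * f x).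
  by move=> Lf; exact: L2loc_bd Lf tk (ktau_bd ht).
have ty : test_function setT (fun y : space => 2 * y 0 i * psi y).
  apply: test_mul => //; apply: (@smooth_coord_comp R d (fun x => 2 * x)).
  by apply: smooth1M; [exact: smooth1_cst|exact: smooth1_id].
have e1 : pairing (fun t y => sqrtR c t y * sqrtRU c t y 0 i) (dt (fun z => chi z.1 * psi z.2)) =
   \int[mu]_z (u z * q i z * (chi' z.1 * psi z.2)).
  by rewrite pairing_pos; apply: I_eq => z; rewrite posM (dtE _ hc tp).
have e2 j : pairing (fun t y => (tau t ^+ 2)^-1 * outer (sqrtRU c t y) (sqrtRU c t y) i j) (dy j (fun z => chi z.1 * psi z.2)) =
   \int[mu]_z (k z * q i z * q j z * (chi z.1 * 'D_(basis_vec j) psi z.2)).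
  rewrite pairing_pos; apply: I_eq => z; rewrite (dyE _ _ tc tp); congr (_ * _).
  rewrite /timef /q_ -!posM /pos; case: ifP => // _.
  by rewrite /outer mxE big_ord1 mxE /ktau expr2 invfM; ring.
have e3 : pairing (fun t y => 2 * y 0 i * sqrtR c t y ^+ 2) (fun z => chi z.1 * psi z.2) =
   \int[mu]_z (u z * u z * (chi z.1 * (2 * z.2 0 i * psi z.2))).
  by rewrite pairing_pos; apply: I_eq => z; rewrite -posM /pos; case: ifP => _; [ring|rewrite !mul0r].
have e4 : pairing (fun t y => sqrtR c t y ^+ 2) (dy i (fun z => chi z.1 * psi z.2)) =
   \int[mu]_z (u z * u z * (chi z.1 * 'D_(basis_vec i) psi z.2)).
  by rewrite pairing_pos; apply: I_eq => z; rewrite (dyE _ _ tc tp) -posM /pos; case: ifP => _; [ring|rewrite !mul0r].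
have e5 : pairing (fun t y => nu * dtau t / tau t * sqrtR c t y ^+ 2) (dy i (fun z => chi z.1 * psi z.2)) =
   nu * \int[mu]_z (timef (fun t => dtau t * (tau t)^-1) z * (u z * u z) * (chi z.1 * 'D_(basis_vec i) psi z.2)).
  have I1 := L2loc_mul Lu Lu (ptest_of (delayed_tau dc (tc_mul (tc_dtau _) (tc_inv _))).1 (tD i)).
  rewrite pairing_pos -IZ; last first.
    move: I1; congr (intg _ _); apply/funext => z.
    by rewrite /timef /pos; case: ifP => _; [ring|rewrite !(mul0r, mulr0)].
  by apply: I_eq => z; rewrite (dyE _ _ tc tp) /timef /pos; case: ifP => _; [ring|rewrite !(mul0r, mulr0)].
have e6 j : pairing (fun t y => nu / tau t ^+ 2 * (sqrtR c t y * Defs.SN c t y i j) +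
      eps ^+ 2 / (2 * tau t ^+ 2) * SK c t y i j) (dy j (fun z => chi z.1 * psi z.2)) =
   nu * (\int[mu]_z (k z * u z * SN i j z * (chi z.1 * 'D_(basis_vec j) psi z.2))) -
   eps ^+ 2 / 2 * ((\int[mu]_z (k z * v i z * u z * (chi z.1 * 'D_(basis_vec j) ('D_(basis_vec j) psi) z.2))) +
        2 * \int[mu]_z (k z * v i z * v j z * (chi z.1 * 'D_(basis_vec j) psi z.2))).
  have Ia := L2loc_mul (Lk _ Lu) (LS j) (ptest_of tc (tD j)).
  rewrite pairing_pos.
  (* For eps = 0 the function [SK] is not tied to [sqrtR], but its coefficient is 0. *)
  have [e0|e0] := leP eps 0.
    have -> : eps = 0 by apply/eqP; rewrite eq_le e0 eps0.
    rewrite expr0n /= !mul0r subr0 -IZ//; apply: I_eq => z; rewrite (dyE _ _ tc tp).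
    rewrite /timef /SN_ /T_ /pos; case: ifP => _; last by rewrite !(mul0r, mulr0).
    by rewrite /Defs.SN /symmetric_part !mxE /ktau expr2 invfM; ring.
  have dk := delayed_tau dc (tc_ktau tau).
  have [Ib Eb] := SK_identity i j e0 dk (tD j).
  have Ib' : intg mu (fun z => eps ^+ 2 / 2 * (pos (fun t y => SK c t y i j) z * (chi z.1 * ktau tau z.1 * 'D_(basis_vec j) psi z.2))).
    exact: intgZ.
  transitivity (\int[mu]_z (nu * (k z * u z * SN i j z * (chi z.1 * 'D_(basis_vec j) psi z.2)) +
     eps ^+ 2 / 2 * (pos (fun t y => SK c t y i j) z * (chi z.1 * ktau tau z.1 * 'D_(basis_vec j) psi z.2)))).
    apply: I_eq => z; rewrite (dyE _ _ tc tp).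
    rewrite /timef /SN_ /T_ /pos; case: ifP => _; last by rewrite !(mul0r, mulr0) addr0.
    by rewrite /Defs.SN /symmetric_part !mxE /ktau expr2 !invfM; ring.
  rewrite ID ?IZ ?Eb//; [|exact: intgZ].
  rewrite mulrN.
  have f1 : \int[mu]_z (v i z * u z * (chi z.1 * ktau tau z.1 * 'D_(basis_vec j) ('D_(basis_vec j) psi) z.2)) =
      \int[mu]_z (k z * v i z * u z * (chi z.1 * 'D_(basis_vec j) ('D_(basis_vec j) psi) z.2)).
    by apply: I_eq => z; rewrite /timef /pos; case: ifP => _; [ring|rewrite !(mul0r, mulr0)].
  have f2 : \int[mu]_z (v i z * v j z * (chi z.1 * ktau tau z.1 * 'D_(basis_vec j) psi z.2)) =
      \int[mu]_z (k z * v i z * v j z * (chi z.1 * 'D_(basis_vec j) psi z.2)).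
    by apply: I_eq => z; rewrite /timef /pos; case: ifP => _; [ring|rewrite !(mul0r, mulr0)].
  by rewrite f1 f2.
have E := comb e1 (eq_bigr _ (fun j _ => e2 j)) e3 e4
  (eq_bigr _ (fun j _ => e6 j)) e5 (me (delayed_test dc tp) i).
have e7 : \int[mu]_z (u z * u z * (chi z.1 * (2 * z.2 0 i * psi z.2 - 'D_(basis_vec i) psi z.2))) =
  (\int[mu]_z (u z * u z * (chi z.1 * (2 * z.2 0 i * psi z.2)))) -
  \int[mu]_z (u z * u z * (chi z.1 * 'D_(basis_vec i) psi z.2)).
  rewrite -IB; [by apply: I_eq => z; ring| |].
    exact: (L2loc_mul Lu Lu (ptest_of tc ty)).
  exact: (L2loc_mul Lu Lu (ptest_of tc (tD i))).
exact: etrans e7 (alg E (sub3 _ _ _)).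
Qed.

End momentum.

(** * The window argument *)

Section pointwise.
Context {R : realType}.
Implicit Types (a D s : R).

Let inv_ge1 D : 1 <= D -> 0 < D /\ 0 < D^-1 <= 1.
Proof.
move=> D1; have D0 : 0 < D by exact: lt_le_trans D1.
by rewrite invr_gt0 invf_le1 ?D0.
Qed.

(** Here a = 1 / tau and D = tau', so a / D is kappa' and D a^3 is the weight of the kinetic
    dissipation. The weight a^2 of the fluxes is exactly their geometric mean. *)
Lemma transport_le (a D s U Q : R) : 0 < a -> 1 <= D -> 0 < s ->
  a * a * `|U * Q| <= s * (a * D^-1 * (U * U)) + s^-1 * (D * (a * (a * a)) * Q ^+ 2).
Proof.
move=> a0 /[dup] D1 /inv_ge1[D0 /andP[b0 b1]] s0.
have h := young U (D * a * Q) s0.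
have p0 : 0 < a * D^-1 by exact: mulr_gt0.
have E : a * a * `|U * Q| = a * D^-1 * `|U * (D * a * Q)|.
  rewrite !normrM (gtr0_norm a0) (gtr0_norm D0); field; exact: lt0r_neq0.
have F : s * (a * D^-1 * (U * U)) + s^-1 * (D * (a * (a * a)) * Q ^+ 2) =
    a * D^-1 * (s * U ^+ 2 + s^-1 * (D * a * Q) ^+ 2).
  by field; rewrite !lt0r_neq0.
rewrite E F (ler_wpM2l (ltW p0))//; apply: (le_trans h).
rewrite ler_piMl ?invf_le1 ?ler1n//.
by rewrite addr_ge0// mulr_ge0 ?sqr_ge0 ?invr_ge0// ltW.
Qed.

Lemma stress_le (a D P Q : R) : 0 < a -> 1 <= D ->
  a * a * `|P * Q| * (a * D^-1) <= D * (a * (a * a)) * (P ^+ 2 + Q ^+ 2).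
Proof.
move=> a0 /[dup] D1 /inv_ge1[D0 /andP[b0 b1]].
have h := norm_mul_le P Q.
have -> : a * a * `|P * Q| * (a * D^-1) = a * (a * a) * (D^-1 * `|P * Q|) by ring.
have a3 : 0 <= a * (a * a) by rewrite !mulr_ge0// ltW.
rewrite [D * _]mulrC -[leRHS]mulrA (ler_wpM2l a3)//; apply: ler_pM => //.
- by rewrite ltW.
- exact: le_trans D1.
- by apply: (le_trans h); rewrite ler_piMl ?invf_le1 ?ler1n// addr_ge0 ?sqr_ge0.
Qed.

(** The viscous stress is dissipated with the smaller weight a^4, so kappa' = a / D is given to the
    density; as a / D <= 1, its square is at most a / D. *)
Lemma viscous_le (a D s U S : R) : 0 < a <= 1 -> 1 <= D -> 0 < s ->
  a * a * `|U * S| * (a * D^-1) <=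
  s * (a * D^-1 * (U * U)) + s^-1 * (a * a * (a * a) * S ^+ 2).
Proof.
move=> /andP[a0 a1] /[dup] D1 /inv_ge1[D0 /andP[b0 b1]] s0.
have h := young (a * D^-1 * U) (a * a * S) s0.
have p0 : 0 < a * D^-1 by exact: mulr_gt0.
have p1 : a * D^-1 <= 1 by rewrite mulr_ile1// ltW.
have -> : a * a * `|U * S| * (a * D^-1) = `|a * D^-1 * U * (a * a * S)|.
  rewrite !normrM (gtr0_norm a0) (gtr0_norm b0); ring.
apply: (le_trans h); set Z := _ + _.
have Z0 : 0 <= Z by rewrite addr_ge0// mulr_ge0 ?sqr_ge0 ?invr_ge0// ltW.
apply: (@le_trans _ _ Z); first by rewrite ler_piMl ?invf_le1 ?ler1n.
apply: lerD; last by rewrite exprMn expr2.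
rewrite (ler_wpM2l (ltW s0))// exprMn -expr2 (ler_wpM2r (sqr_ge0 U))//.
by rewrite expr2 ler_piMl// ltW.
Qed.

End pointwise.

Section wide_window.
Context {R : realType}.
Local Notation leb := (@lebesgue_measure R).
Variable tau : R -> R.
Hypothesis ht : is_tau tau.
Local Notation dtau := (tau^`()%classic).

Lemma bump_lower : exists2 m : R, 0 < m & forall x, `|x| <= 2^-1 -> m <= bumpf x.
Proof.
have m0 : 0 < bump_mass^-1 :> R by rewrite invr_gt0 bump_mass_gt0.
have fl (s : R) : 2^-1 <= s -> expR (- 2) <= flat 0 s.
  move=> s2; have s0 : 0 < s by apply: lt_le_trans s2; rewrite invr_gt0.
  rewrite /flat s0 expr0 mul1r ler_expR lerN2 -[2]invrK lef_pV2// posrE invr_gt0//.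
exists (bump_mass^-1 * (expR (- 2) * expR (- 2))).
  by rewrite !mulr_gt0 ?expR_gt0.
move=> x; rewrite ler_norml => /andP[x1 x2].
rewrite /bumpf /bump0 (ler_wpM2l (ltW m0))// ler_pM ?expR_ge0//; apply: fl; lra.
Qed.

(** A smooth majorant, up to a constant, of kappa' on the window n + 1; its integral is 3 for every
    n. *)
Definition wide n t := window tau n t + window tau n.+1 t + window tau n.+2 t.

(** A value of kappa within 1 of n + 1 is within 1/2 of n, n + 1 or n + 2, and there the
    corresponding bump is bounded below. *)
Lemma kappa_wide : exists2 B : R, 0 < B & forall n t, in_window tau n.+1 t ->
  (tau t)^-1 * (dtau t)^-1 <= B * wide n t.
Proof.
have [m m0 hm] := bump_lower; exists m^-1; first by rewrite invr_gt0.
move=> n t /in_windowP[t0]; rewrite ltr_norml => /andP[x1 x2].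
have d0 := dtau_gt0 ht t0; have p0 := tau_pos ht t0.
have i0 : 0 <= (tau t)^-1 * (dtau t)^-1 by rewrite -invfM invr_ge0 ltW// mulr_gt0.
rewrite [leRHS]mulrC ler_pdivlMr// /wide /window t0 !invfM -!mulrDl mulrC (ler_wpM2r i0)//.
move: x1 x2; rewrite -!natr1; set x := kappa tau t; set k := n%:R => x1 x2.
have b0 y : 0 <= bumpf (x - y) := bump_ge0 _.
have [h|h] := leP (x - k) 2^-1.
  apply: (le_trans (hm (x - k) _)); first by rewrite ler_norml; apply/andP; split; lra.
  by rewrite -addrA lerDl addr_ge0.
have [h'|h'] := leP (x - (k + 1)) 2^-1.
  apply: (le_trans (hm (x - (k + 1)) _)); first by rewrite ler_norml; apply/andP; split; lra.
  by rewrite addrAC lerDr addr_ge0.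
apply: (le_trans (hm (x - (k + 1 + 1)) _)); first by rewrite ler_norml; apply/andP; split; lra.
by rewrite lerDr addr_ge0.
Qed.

Lemma wide_test n : time_test (wide n).
Proof. by do 2?apply: time_testD; exact: window_test. Qed.

Lemma I_wide n : \int[leb]_t wide n t = 3.
Proof.
have h m := time_test_intg (window_test ht m).
rewrite ID; [|exact: intgD|exact: h]; rewrite ID// !I_window//; ring.
Qed.

Lemma wide_ge0 n t : 0 <= wide n t.
Proof. by rewrite !addr_ge0// window_ge0. Qed.

Lemma wide_out n t : t <= 0 -> wide n t = 0.
Proof. by move=> t0; rewrite /wide !window_out ?addr0// => -[]; rewrite ltNge t0. Qed.

Lemma delayed_window n : delayed (window tau n).
Proof.
split; first exact: window_test.
have [a a0 h] := window_start ht n; exists a => // t /ltW /h ta.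
apply: window_out => -[t0]; case: ta => [|k1]; first by rewrite leNgt t0.
by move=> /ltr_normlP[]; rewrite opprB ltNge lerBrDr addrC -lerBrDr k1.
Qed.

Lemma measurable_in_window d n :
  measurable_fun setT (fun z : (measurableTypeR R * 'rV[R]_d)%type => (in_window tau n z.1)%:R : R).
Proof.
have [t1 [t2 [_ _ E]]] := window_interval ht n.
have -> : (fun z : (measurableTypeR R * 'rV[R]_d)%type => (in_window tau n z.1)%:R : R) =
    (\1_`]t1, t2[%classic : measurableTypeR R -> R) \o fst.
  by apply/funext => z; rewrite /= indicE mem_setE in_itv /= E.
exact: (measurableT_comp (measurable_indicR _) measurable_fst).
Qed.

End wide_window.

Section budget.
Context {R : realType}.
Implicit Types (K s B e : R).

Lemma budget_mass K s B e : 0 < s -> s * (2 * (K * B + 1)) <= e -> K * (s * B) <= e / 2.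
Proof. by nra. Qed.

Lemma budget_energy K s e : 0 < e * s -> K * (e * s) <= e / 2 * s * (2 * (K + 1)).
Proof. by nra. Qed.

End budget.

Section window_argument.
Context {R : realType} (d : nat).
Local Notation leb := (@lebesgue_measure R).
Local Notation X := (R * 'rV[R]_d)%type.
Local Notation mX := (measurableTypeR R * 'rV[R]_d)%type.
Local Notation mu := (@muX R d).
Local Notation lebd := (lebesgue_rV d).
Local Notation space := 'rV[R]_d.
Variables (tau : R -> R) (nu eps M0 : R) (c : collection R d).
Local Notation dtau := (tau^`()%classic).
Hypothesis ht : is_tau tau.
Hypothesis nu0 : 0 < nu.
Hypothesis eps0 : 0 <= eps.
Hypothesis reg : regularity eps c.
Hypothesis me : momentum_equation tau nu eps c.
Hypothesis sk : 0 < eps -> SK_equation c.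
Local Notation u := (pos (sqrtR c)).
Local Notation v j := (pos (fun t y => grad_sqrtR c t y 0 j)).
Local Notation q := (q_ c).
Local Notation k := (@timef R d (ktau tau)).
Local Notation SN := (SN_ c).
Local Notation E := (ediss tau nu eps c).
Hypothesis iE : intg mu E.
Hypothesis hmass : forall h, time_test h -> (forall t, t <= 0 -> h t = 0) ->
  \int[mu]_z (u z * u z * h z.1) = (\int[leb]_t h t) * M0.
Hypothesis hdens : forall chi chi' (psi : space -> R), delayed chi ->
  (forall t, is_derive t (1 : R) chi (chi' t)) -> test_function setT psi ->
  \int[mu]_z (u z * u z * (chi' z.1 * psi z.2)) =
  - \sum_j \int[mu]_z (k z * q j z * u z * (chi z.1 * 'D_(basis_vec j) psi z.2)).
Hypothesis mass : {ae leb, forall t : R, 0 < t ->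
  intg lebd (fun y => sqrtR c t y ^+ 2) /\ \int[lebd]_y (sqrtR c t y ^+ 2) = M0}.

Definition kdot : mX -> R := timef (fun t => (tau t)^-1 * (dtau t)^-1).

(* Dominates, up to a constant, every term of the momentum and continuity
   equations at the times where [1 <= tau'] and [tau' / tau <= s]. *)
Definition young_density s z := s * (kdot z * (u z * u z)) + s^-1 * E z.

Definition late s n := forall t, in_window tau n t ->
  1 <= dtau t /\ dtau t * (tau t)^-1 <= s.

Lemma kdot_ge0 z : 0 <= kdot z.
Proof.
apply: timef_ge0 => t t0.
by rewrite mulr_ge0// invr_ge0 ltW//; [exact: tau_pos|exact: dtau_gt0].
Qed.

Lemma young_density_ge0 s z : 0 < s -> 0 <= young_density s z.
Proof.
move=> s0; rewrite addr_ge0// mulr_ge0 ?(ltW s0) ?invr_ge0 ?(ltW s0) ?ediss_ge0//.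
by rewrite mulr_ge0 ?kdot_ge0// -expr2 sqr_ge0.
Qed.

Lemma sum_sqr_ge (F : 'I_d -> R) i : F i ^+ 2 <= \sum_j F j ^+ 2.
Proof. by rewrite (bigD1 i)//= lerDl sumr_ge0// => j _; exact: sqr_ge0. Qed.

Lemma sum_sqr_ge2 (F : 'I_d -> 'I_d -> R) i j : F i j ^+ 2 <= \sum_i \sum_j F i j ^+ 2.
Proof.
apply: (le_trans (sum_sqr_ge (F i) j)); rewrite [leRHS](bigD1 i)//= lerDl.
by apply: sumr_ge0 => l _; apply: sumr_ge0 => m _; exact: sqr_ge0.
Qed.

Section at_point.
Variables (s : R) (z : mX).
Hypotheses (s0 : 0 < s) (s1 : s <= 1) (z0 : 0 < z.1) (D1 : 1 <= dtau z.1).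
Local Notation Q := (young_density s z).
Local Notation a := (tau z.1)^-1.
Local Notation D := (dtau z.1).

Let a0 : 0 < a. Proof. by rewrite invr_gt0; exact: tau_pos. Qed.
Let a1 : a <= 1.
Proof. by rewrite invf_le1 ?tau_ge1//; exact: tau_pos. Qed.
Let kE : k z = a * a. Proof. by rewrite timefE. Qed.
Let kdE : kdot z = a * D^-1. Proof. by rewrite /kdot timefE. Qed.
Let k3E : timef (k3 tau) z = D * (a * (a * a)) :> R. Proof. by rewrite timefE. Qed.
Let k30 : 0 <= D * (a * (a * a)).
Proof. by rewrite !mulr_ge0// ?(ltW a0)// (le_trans ler01). Qed.
Let k4E : timef (k4 tau) z = a * a * (a * a) :> R. Proof. by rewrite timefE. Qed.
Let sV1 : 1 <= s^-1. Proof. by rewrite invf_ge1. Qed.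

Let E_kin : D * (a * (a * a)) * kin_ eps c z <= E z.
Proof.
rewrite /ediss k3E lerDl !mulr_ge0 ?SN_ge0 ?(ltW nu0)//.
by rewrite k4E !mulr_ge0 ?(ltW a0).
Qed.

Let E_SN i j : nu * (a * a * (a * a) * SN i j z ^+ 2) <= E z.
Proof.
rewrite /ediss k4E; apply: (@le_trans _ _ (nu * (a * a * (a * a)) * \sum_i \sum_j SN i j z ^+ 2)).
  rewrite [leLHS]mulrA ler_wpM2l ?(sum_sqr_ge2 (fun i j => SN i j z))// !mulr_ge0 ?(ltW nu0) ?(ltW a0)//.
by rewrite lerDr mulr_ge0 ?kin_ge0// k3E.
Qed.

Let E_Q : E z <= Q.
Proof.
apply: (@le_trans _ _ (s^-1 * E z)); first by rewrite ler_peMl// ediss_ge0.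
by rewrite /young_density lerDr mulr_ge0 ?(ltW s0)// mulr_ge0 ?kdot_ge0// -expr2 sqr_ge0.
Qed.

Let kin_Q (w : R) : w <= kin_ eps c z ->
  s * (a * D^-1 * (u z * u z)) + s^-1 * (D * (a * (a * a)) * w) <= Q.
Proof.
move=> h; rewrite /young_density kdE lerD2l ler_wpM2l ?invr_ge0 ?(ltW s0)//.
by apply: le_trans E_kin; rewrite ler_wpM2l.
Qed.

Let q_kin i : q i z ^+ 2 <= kin_ eps c z.
Proof.
apply: (le_trans (sum_sqr_ge (fun i => q i z) i)).
rewrite /kin_ lerDl mulr_ge0 ?sqr_ge0// sumr_ge0// => l _; exact: sqr_ge0.
Qed.

Let qq_kin i j : q i z ^+ 2 + q j z ^+ 2 <= 2 * kin_ eps c z.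
Proof. by rewrite mulr_natl mulr2n lerD. Qed.

Let v_kin i : (eps * v i z) ^+ 2 <= kin_ eps c z.
Proof.
rewrite exprMn /kin_ -[leLHS]add0r lerD//.
  by rewrite sumr_ge0// => l _; exact: sqr_ge0.
by rewrite ler_wpM2l ?sqr_ge0//; exact: (sum_sqr_ge (fun i => v i z) i).
Qed.

Lemma transport_q i : `|k z * (u z * q i z)| <= Q.
Proof.
rewrite kE normrM ger0_norm ?mulr_ge0 ?(ltW a0)//.
exact: (le_trans (transport_le _ _ a0 D1 s0) (kin_Q (q_kin i))).
Qed.

(** The dissipation contains eps^2 |grad sqrtR|^2, so a factor eps stays attached to each
    gradient. *)
Lemma transport_v i : `|k z * (u z * (eps * v i z))| <= Q.
Proof.
rewrite kE normrM ger0_norm ?mulr_ge0 ?(ltW a0)//.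
exact: (le_trans (transport_le _ _ a0 D1 s0) (kin_Q (v_kin i))).
Qed.

Let stress_Q (x y : R) : x ^+ 2 + y ^+ 2 <= 2 * kin_ eps c z ->
  `|k z * (x * y) * kdot z| <= 2 * Q.
Proof.
move=> h; rewrite normrM [X in _ * X]ger0_norm ?kdot_ge0// kE kdE normrM ger0_norm ?mulr_ge0 ?(ltW a0)//.
apply: (le_trans (stress_le _ _ a0 D1)).
apply: (@le_trans _ _ (2 * E z)); last by rewrite ler_wpM2l.
apply: (@le_trans _ _ (2 * (D * (a * (a * a)) * kin_ eps c z))); last by rewrite ler_wpM2l.
by rewrite [leRHS]mulrCA ler_wpM2l.
Qed.

Lemma stress_q i j : `|k z * (q i z * q j z) * kdot z| <= 2 * Q.
Proof. exact: stress_Q. Qed.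

Lemma stress_v i j : `|k z * ((eps * v i z) * (eps * v j z)) * kdot z| <= 2 * Q.
Proof. by apply: stress_Q; rewrite mulr_natl mulr2n lerD. Qed.

(** The dissipation controls nu times the square of the stress, hence the constant. *)
Lemma viscous_SN i j : `|k z * (u z * SN i j z) * kdot z| <= (1 + nu^-1) * Q.
Proof.
rewrite normrM [X in _ * X]ger0_norm ?kdot_ge0// kE kdE normrM ger0_norm ?mulr_ge0 ?(ltW a0)//.
have a01 : 0 < a <= 1 by rewrite a0.
apply: (le_trans (viscous_le _ _ a01 D1 s0)).
rewrite mulrDl mul1r {2}/young_density; apply: lerD.
  by rewrite /young_density kdE lerDl mulr_ge0 ?ediss_ge0// invr_ge0 ltW.
rewrite mulrDr -[leLHS]add0r; apply: lerD.
  rewrite mulr_ge0 ?invr_ge0 ?(ltW nu0)// mulr_ge0 ?(ltW s0)// mulr_ge0 ?kdot_ge0//.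
  by rewrite -expr2 sqr_ge0.
rewrite [leRHS]mulrCA ler_wpM2l ?invr_ge0 ?(ltW s0)//.
by rewrite [leRHS]mulrC ler_pdivlMr// mulrC.
Qed.

Lemma pressure_u : D * a <= s -> `|timef (fun t => dtau t * (tau t)^-1) z * (u z * u z) * kdot z| <= Q.
Proof.
move=> h; rewrite timefE// normrM [X in _ * X]ger0_norm ?kdot_ge0// ger0_norm; last first.
  apply: mulr_ge0; last by rewrite -expr2 sqr_ge0.
  by rewrite mulr_ge0 ?(ltW a0)// (le_trans ler01).
rewrite -mulrA [_ * kdot z]mulrC.
apply: (@le_trans _ _ (s * (kdot z * (u z * u z)))).
  by rewrite ler_wpM2r// mulr_ge0 ?kdot_ge0// -expr2 sqr_ge0.
by rewrite /young_density lerDl mulr_ge0 ?ediss_ge0// invr_ge0 ltW.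
Qed.

End at_point.

Definition windowed n s z := young_density s z * (in_window tau n z.1)%:R.

Let measurable_kdot : measurable_fun setT kdot.
Proof. exact: (measurable_timef (d := d) ht (tc_mul (tc_inv tau) (tc_dinv tau))). Qed.

Let Lu : L2loc u := L2loc_u0 reg.
Let mu_ : measurable_fun setT u. Proof. exact: (L2loc_u0 reg).1. Qed.
Let mq_ j : measurable_fun setT (q j). Proof. exact: (L2loc_q reg j).1. Qed.
Let mv_ j : measurable_fun setT (v j). Proof. exact: (L2loc_v0 reg j).1. Qed.
Let mS_ i j : measurable_fun setT (SN i j). Proof. exact: (measurable_SN reg). Qed.
Let mk_ : measurable_fun setT k. Proof. exact: (measurable_timef (d := d) ht (tc_ktau tau)). Qed.

Lemma windowed_ge0 n s z : 0 < s -> 0 <= windowed n s z.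
Proof. by move=> s0; rewrite mulr_ge0// young_density_ge0. Qed.

Let inw_bd n (z : mX) : `|(in_window tau n z.1)%:R : R| <= 1.
Proof. by case: in_window; rewrite ?normr1// normr0 ler01. Qed.

Let intg_E n : intg mu (fun z => E z * (in_window tau n z.1)%:R).
Proof. exact: (intg_bdM iE (measurable_in_window ht n) (@inw_bd n)). Qed.

(** The mass part is bounded through [wide], whose integral is the same for all windows; therefore
    [B] depends neither on [n] nor on [s]. *)
Lemma I_windowed : exists2 B : R, 0 <= B & forall n s, 0 < s ->
  intg mu (windowed n.+1 s) /\
  \int[mu]_z windowed n.+1 s z <=
    s * B + s^-1 * \int[mu]_z (E z * (in_window tau n.+1 z.1)%:R).
Proof.
have [B B0 hB] := kappa_wide ht.
exists (`|B * (3 * M0)|); first exact: normr_ge0.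
move=> n s s0; have mW := measurable_in_window ht (d := d) n.+1.
have ig : intg mu (fun z => u z * u z * wide tau n z.1).
  exact: L2loc_time Lu Lu (wide_test ht n).
have le z : `|kdot z * (u z * u z) * (in_window tau n.+1 z.1)%:R| <= B * (u z * u z * wide tau n z.1).
  have uu : 0 <= u z * u z by rewrite -expr2 sqr_ge0.
  have [h|_] := boolP (in_window tau n.+1 z.1); last first.
    by rewrite mulr0 normr0 mulr_ge0 ?(ltW B0)// mulr_ge0// (wide_ge0 ht).
  rewrite mulr1 ger0_norm; last by rewrite mulr_ge0// kdot_ge0.
  rewrite [leRHS]mulrCA mulrC ler_wpM2l// /kdot timefE; first exact: hB.
  by case/in_windowP: h.
have ik : intg mu (fun z => kdot z * (u z * u z) * (in_window tau n.+1 z.1)%:R).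
  apply: intg_le le (intgZ B ig).
  by do 2?apply: measurable_funM => //; apply: measurable_funM.
have WE z : windowed n.+1 s z = s * (kdot z * (u z * u z) * (in_window tau n.+1 z.1)%:R) +
    s^-1 * (E z * (in_window tau n.+1 z.1)%:R).
  by rewrite /windowed mulrDl !mulrA.
have iW := intgD (intgZ s ik) (intgZ s^-1 (intg_E n.+1)).
split.
  by move: iW; congr (intg _ _); apply/funext => z; rewrite WE.
have -> := I_eq mu WE.
rewrite ID; [|exact: intgZ|exact: intgZ (intg_E _)].
rewrite !IZ//; apply: lerD => //; rewrite ler_wpM2l ?(ltW s0)//.
apply: (le_trans (ler_norm _)); apply: (le_trans (I_norm_le ik (intgZ B ig) le)).
rewrite IZ// hmass ?I_wide//; first exact: ler_norm.
  exact: wide_test.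
by move=> t; exact: wide_out.
Qed.

(** The dissipation is integrable over all times, and each time belongs to no window of large
    number. *)
Lemma E_tail e : 0 < e -> \forall n \near \oo, \int[mu]_z (E z * (in_window tau n z.1)%:R) <= e.
Proof.
move=> e0; have mE := intg_meas iE.
have l : \int[mu]_z (E z * (in_window tau n z.1)%:R) @[n --> \oo] --> \int[mu]_z (0 : R).
  apply: (dct (g := E)) => //.
  - by move=> n; apply: measurable_funM => //; exact: measurable_in_window.
  - apply: aeW => z; apply/cvgrPdist_lt => r r0.
    have [N hN] : exists N : nat, kappa tau z.1 + 1 <= N%:R.
      by exists (truncn `|kappa tau z.1 + 1|).+1; rewrite (le_trans (ler_norm _))// ltW// truncnS_gt.
    exists N => // n /= Nn.
    suff -> : in_window tau n z.1 = false by rewrite mulr0 subrr normr0.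
    apply/negbTE/negP => /in_windowP[_ /ltr_normlP[h _]]; move: h.
    rewrite opprB ltrBlDr addrC ltNge => /negP; apply.
    by rewrite (le_trans hN)// ler_nat.
  - move=> n z; rewrite normrM ger0_norm ?ediss_ge0// ler_piMr ?ediss_ge0//.
rewrite I0 in l; have := cvg_dist l e0.
by apply: filterS => n; rewrite subr0; apply: le_trans; exact: ler_norm.
Qed.

Lemma late_near s : 0 < s -> \forall n \near \oo, late s n.
Proof.
move=> s0; pose A := Num.max 1 (4 / s).
have A0 : 0 < A by rewrite lt_max ltr01.
(* In the window kappa exceeds n - 1, which costs one unit; the other comes from rounding ln A / 2
   up. *)
exists (truncn `|2^-1 * ln A|).+2 => // n /= hn t /in_windowP[t0 /ltr_normlP[h _]].
have d0 := dtau_gt0 ht t0.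
have Ad : A <= dtau t.
  rewrite -ler_ln ?posrE// -(ler_pM2l (_ : 0 < 2^-1))// ?invr_gt0//.
  have h1 : 2^-1 * ln A < (truncn `|2^-1 * ln A|).+1%:R.
    by rewrite (le_lt_trans (ler_norm _))// truncnS_gt.
  apply/ltW/(lt_trans h1); rewrite -/(kappa tau t).
  move: h; rewrite opprB ltrBlDr addrC -ltrBlDr; apply: le_lt_trans.
  by rewrite lerBrDr natr1 ler_nat.
split; first by apply: le_trans Ad; rewrite le_max lexx.
apply: (le_trans (dtau_tau ht t0)); rewrite ler_pdivrMr// mulrC -ler_pdivrMr//.
by apply: le_trans Ad; rewrite le_max lexx orbT.
Qed.

Lemma windowed_dom n s (f : mX -> R) K : 0 < s -> 0 <= K -> measurable_fun setT f ->
  (forall z, ~~ in_window tau n.+1 z.1 -> f z = 0) ->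
  (forall z, in_window tau n.+1 z.1 -> `|f z| <= K * young_density s z) ->
  intg mu f /\ `|\int[mu]_z f z| <= K * \int[mu]_z windowed n.+1 s z.
Proof.
move=> s0 K0 mf f0 fK; have [_ _ /(_ n s s0)[iW _]] := I_windowed.
have le z : `|f z| <= K * windowed n.+1 s z.
  have [h|h] := boolP (in_window tau n.+1 z.1); first by rewrite /windowed h mulr1 fK.
  by rewrite f0// normr0 mulr_ge0// windowed_ge0.
split; first exact: intg_le mf le (intgZ K iW).
apply: (le_trans (I_norm_le _ (intgZ K iW) le)); first exact: intg_le mf le (intgZ K iW).
by rewrite IZ.
Qed.

Let young_test (A w th c0 M B Q : R) : `|A| <= c0 * Q -> `|w| <= B -> `|th| <= M -> 0 <= Q -> 0 <= c0 ->
  `|A * (w * th)| <= c0 * (B * M) * Q.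
Proof.
move=> h1 h2 h3 Q0 c00; rewrite mulrAC !normrM; apply: ler_pM; rewrite ?mulr_ge0//.
by apply: ler_pM.
Qed.

(** The time factor [w] is at most [B kd]; its weight [kd] is handed over to [A], whose estimate
    needs it. *)
Let young_window (A w kd th c0 M B Q : R) : `|A * kd| <= c0 * Q -> 0 <= kd -> `|w| <= B * kd ->
  `|th| <= M -> 0 <= Q -> 0 <= c0 -> 0 <= B -> `|A * (w * th)| <= c0 * (B * M) * Q.
Proof.
move=> h1 k0 h2 h3 Q0 c00 B0.
apply: (@le_trans _ _ (`|A * kd| * (B * M))); last first.
  by rewrite mulrAC ler_wpM2r// mulr_ge0// (le_trans _ h3).
rewrite !normrM (ger0_norm k0) -!mulrA ler_wpM2l// mulrA.
by apply: ler_pM => //; rewrite mulrC.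
Qed.

Lemma bound_all (T : Type) (F : 'I_d -> T -> R) : (forall j, exists M, forall x, `|F j x| <= M) ->
  exists2 M, 0 <= M & forall j x, `|F j x| <= M.
Proof.
move=> h; have /(_ _)/cid-/all_sig[M hM] := h.
exists (\sum_j `|M j|) => [|j x]; first exact: sumr_ge0.
apply: (le_trans (hM j x)); apply: (le_trans (ler_norm _)).
by rewrite (bigD1 j)//= lerDl sumr_ge0.
Qed.

Let kdot_le1 z : 0 < z.1 -> 1 <= dtau z.1 -> kdot z <= 1.
Proof.
move=> z0 D1; rewrite /kdot timefE// mulr_ile1 ?invr_ge0 ?(le_trans ler01 D1)//.
- by rewrite ltW// tau_pos.
- by rewrite invf_le1 ?tau_ge1// tau_pos.
- by rewrite invf_le1// dtau_gt0.
Qed.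

Let window_kdot n (z : mX) : 0 < z.1 -> `|window tau n z.1| <= bump_mass^-1 * kdot z.
Proof.
move=> z0; rewrite ger0_norm ?window_ge0// /kdot timefE// -invfM.
exact: window_le.
Qed.

Let mtest (chi : R -> R) (psi : space -> R) : time_test chi -> test_function setT psi ->
  measurable_fun setT (fun z : mX => chi z.1 * psi z.2).
Proof. by move=> tc tp; apply: measurable_ptest; exact: ptest_of. Qed.

Let I_scale (a : R) (f g : mX -> R) : a != 0 -> (forall z, g z = a * f z) -> intg mu g ->
  a * (\int[mu]_z f z) = \int[mu]_z g z.
Proof.
move=> a0 h ig; have e z : f z = a^-1 * g z by rewrite h mulKf.
by rewrite (I_eq mu e) IZ// mulVKf.
Qed.

Let collect (A : R) (B C D F : 'I_d -> R) (G a b c0 dd f g P : R) :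
  `|A| <= a * P -> (forall j, `|B j| <= b * P) -> (forall j, `|C j| <= c0 * P) ->
  (forall j, `|eps ^+ 2 * D j| <= dd * P) -> (forall j, `|eps ^+ 2 * F j| <= f * P) ->
  `|G| <= g * P ->
  `|A + (\sum_j (B j - nu * C j + eps ^+ 2 / 2 * (D j + 2 * F j))) - nu * G| <=
  (a + d%:R * (b + nu * c0 + 2^-1 * (dd + 2 * f)) + nu * g) * P.
Proof.
move=> hA hB hC hD hF hG.
rewrite [leRHS]mulrDl; apply: (le_trans (ler_normB _ _)); apply: lerD; last first.
  by rewrite normrM (gtr0_norm nu0) -mulrA (ler_wpM2l (ltW nu0)).
rewrite [leRHS]mulrDl; apply: (le_trans (ler_normD _ _)); apply: lerD => //.
apply: (le_trans (ler_norm_sum _ _ _)).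
have -> : d%:R * (b + nu * c0 + 2^-1 * (dd + 2 * f)) * P =
    \sum_(j < d) ((b + nu * c0 + 2^-1 * (dd + 2 * f)) * P).
  by rewrite sumr_const card_ord -mulrA mulr_natl.
apply: ler_sum => j _; rewrite [leRHS]mulrDl; apply: (le_trans (ler_normD _ _)); apply: lerD.
  rewrite [leRHS]mulrDl; apply: (le_trans (ler_normB _ _)); apply: lerD => //.
  by rewrite normrM (gtr0_norm nu0) -mulrA (ler_wpM2l (ltW nu0)).
have -> : eps ^+ 2 / 2 * (D j + 2 * F j) = 2^-1 * (eps ^+ 2 * D j + 2 * (eps ^+ 2 * F j)) by ring.
rewrite normrM ger0_norm ?invr_ge0// -[leRHS]mulrA ler_wpM2l ?invr_ge0//.
apply: (le_trans (ler_normD _ _)); rewrite [leRHS]mulrDl; apply: lerD => //.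
by rewrite normrM ger0_norm// -[leRHS]mulrA ler_wpM2l.
Qed.

Lemma momentum_bound (psi : space -> R) i : test_function setT psi ->
  exists2 K : R, 0 <= K & forall n s, 0 < s -> s <= 1 -> late s n.+1 ->
  `|\int[mu]_z (u z * u z * (window tau n.+1 z.1 *
      (2 * z.2 0 i * psi z.2 - 'D_(basis_vec i) psi z.2)))| <=
  K * \int[mu]_z windowed n.+1 s z.
Proof.
move=> tp; have tD j := test_derive (basis_vec j) tp.
have tDD j := test_derive (basis_vec j) (tD j).
have [M0' M00] := test_bounded tp.
have [M1 M10 hM1] := bound_all (fun j => test_bounded (tD j)).
have [M2 M20 hM2] := bound_all (fun j => test_bounded (tDD j)).
have [M3 M30 hM3] : exists2 M, 0 <= M & forall y, `|psi y| <= M.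
  by exists M0' => //; apply: le_trans (M00 0).
have [C2 C20 hC2] := window_derive_le ht.
have [B B0 BE] : exists2 B : R, 0 <= B & B = bump_mass^-1.
  by exists bump_mass^-1; rewrite ?invr_ge0 ?ltW ?bump_mass_gt0.
have [N2 N20 NE] : exists2 N2 : R, 0 <= N2 & N2 = 1 + nu^-1.
  by exists (1 + nu^-1); rewrite ?addr_ge0 ?invr_ge0 ?(ltW nu0).
(* One summand for each term of [momentum_identity], in the form in which [collect] adds them up. *)
pose K := 1 * (C2 * M3) + d%:R * (2 * (B * M1) + nu * (N2 * (B * M1)) +
  2^-1 * (eps * (B * M2) + 2 * (2 * (B * M1)))) + nu * (1 * (B * M1)).
have K0 : 0 <= K.
  by rewrite /K; do !(apply: addr_ge0 || apply: mulr_ge0); rewrite ?ler01 ?(ltW C20) ?(ltW nu0) ?invr_ge0 ?ler01.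
exists K => // n s s0 s1 hl.
have [w' tw' hw'] := time_test_derive (window_test ht n.+1).
have wo (z : mX) : ~~ in_window tau n.+1 z.1 -> window tau n.+1 z.1 = 0.
  by move=> /in_windowP; exact: window_out.
have w'o (z : mX) : ~~ in_window tau n.+1 z.1 -> w' z.1 = 0.
  by move=> /in_windowP; exact: window_derive_out hw'.
have inw (z : mX) : in_window tau n.+1 z.1 -> [/\ 0 < z.1, 1 <= dtau z.1, dtau z.1 * (tau z.1)^-1 <= s &
    `|window tau n.+1 z.1| <= B * kdot z /\ `|window tau n.+1 z.1| <= B].
  move=> h; have [z0 _] := in_windowP _ _ _ h; have [D1 Ds] := hl _ h; split => //.
  have hb := window_kdot n.+1 z0; rewrite -BE in hb; split => //; apply: (le_trans hb).
  by rewrite ler_piMr// kdot_le1.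
have Q0 z : 0 <= young_density s z by exact: young_density_ge0.
set P := \int[mu]_z windowed n.+1 s z.
have wt := window_test ht n.+1.
have bA : `|\int[mu]_z (u z * q i z * (w' z.1 * psi z.2))| <= 1 * (C2 * M3) * P.
  apply: (windowed_dom s0 _ _ _ _).2 => [|||z /inw[z0 D1 Ds _]].
  - by rewrite !mulr_ge0// ltW.
  - by apply: measurable_funM; [apply: measurable_funM|apply: mtest].
  - by move=> z /w'o ->; rewrite mul0r mulr0.
  (* The derivative of the window is of order tau^-2, so here the weight handed over is [k], not
     [kdot]. *)
  apply: (young_window (kd := k z)) => //; last exact: ltW.
  - by rewrite mulrC mul1r; exact: transport_q.
  - by rewrite timefE// mulr_ge0// invr_ge0 ltW// tau_pos.
  - by rewrite timefE// /ktau -invfM -expr2; exact: hC2.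
have bB j : `|\int[mu]_z (k z * q i z * q j z * (window tau n.+1 z.1 * 'D_(basis_vec j) psi z.2))| <=
    2 * (B * M1) * P.
  apply: (windowed_dom s0 _ _ _ _).2 => [|||z /inw[z0 D1 Ds [w1 w2]]].
  - by rewrite !mulr_ge0.
  - exact: (measurable_funM (measurable_funM (measurable_funM mk_ (mq_ i)) (mq_ j)) (mtest wt (tD j))).
  - by move=> z /wo ->; rewrite mul0r mulr0.
  apply: (young_window (kd := kdot z)) => //; last exact: kdot_ge0.
  by rewrite -[k z * q i z * _]mulrA; exact: stress_q.
have bC j : `|\int[mu]_z (k z * u z * SN i j z * (window tau n.+1 z.1 * 'D_(basis_vec j) psi z.2))| <=
    N2 * (B * M1) * P.
  apply: (windowed_dom s0 _ _ _ _).2 => [|||z /inw[z0 D1 Ds [w1 w2]]].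
  - by rewrite !mulr_ge0.
  - exact: (measurable_funM (measurable_funM (measurable_funM mk_ mu_) (mS_ i j)) (mtest wt (tD j))).
  - by move=> z /wo ->; rewrite mul0r mulr0.
  apply: (young_window (kd := kdot z)) => //; last exact: kdot_ge0.
  by rewrite NE -[k z * u z * _]mulrA; exact: viscous_SN.
have bD j : `|eps ^+ 2 * \int[mu]_z (k z * v i z * u z * (window tau n.+1 z.1 * 'D_(basis_vec j) ('D_(basis_vec j) psi) z.2))| <=
    eps * (B * M2) * P.
  have [-> |e1] := eqVneq eps 0; first by rewrite expr0n !mul0r normr0.
  have [ib hb] : intg mu (fun z => k z * (u z * (eps * v i z)) * (window tau n.+1 z.1 * 'D_(basis_vec j) ('D_(basis_vec j) psi) z.2)) /\
     `|\int[mu]_z (k z * (u z * (eps * v i z)) * (window tau n.+1 z.1 * 'D_(basis_vec j) ('D_(basis_vec j) psi) z.2))| <= 1 * (B * M2) * P.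
    apply: (windowed_dom s0 _ _ _ _) => [|||z /inw[z0 D1 Ds [w1 w2]]].
    - by rewrite !mulr_ge0.
    - apply: measurable_funM; last exact: (mtest wt (tDD j)).
      by apply: measurable_funM => //; apply: measurable_funM => //; apply: measurable_funM.
    - by move=> z /wo ->; rewrite mul0r mulr0.
    by apply: young_test => //; rewrite mul1r; exact: transport_v.
  (* One factor eps goes with the gradient into [transport_v]; the other remains in the constant. *)
  rewrite expr2 -mulrA (I_scale e1 _ ib); last by move=> z; ring.
  by rewrite normrM (ger0_norm eps0) -[leRHS]mulrA ler_wpM2l//; rewrite mul1r in hb.
have bE j : `|eps ^+ 2 * \int[mu]_z (k z * v i z * v j z * (window tau n.+1 z.1 * 'D_(basis_vec j) psi z.2))| <=
    2 * (B * M1) * P.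
  have [E0|e1] := eqVneq (eps ^+ 2) 0.
    rewrite E0 mul0r normr0 !mulr_ge0//; apply: I_ge0 => z; exact: windowed_ge0.
  have [ib hb] : intg mu (fun z => k z * ((eps * v i z) * (eps * v j z)) * (window tau n.+1 z.1 * 'D_(basis_vec j) psi z.2)) /\
     `|\int[mu]_z (k z * ((eps * v i z) * (eps * v j z)) * (window tau n.+1 z.1 * 'D_(basis_vec j) psi z.2))| <= 2 * (B * M1) * P.
    apply: (windowed_dom s0 _ _ _ _) => [|||z /inw[z0 D1 Ds [w1 w2]]].
    - by rewrite !mulr_ge0.
    - apply: measurable_funM; last exact: (mtest wt (tD j)).
      by apply: measurable_funM => //; apply: measurable_funM; apply: measurable_funM.
    - by move=> z /wo ->; rewrite mul0r mulr0.
    apply: (young_window (kd := kdot z)) => //; last exact: kdot_ge0.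
    exact: stress_v.
  by rewrite (I_scale e1 _ ib)//; move=> z; ring.
have bF : `|\int[mu]_z (timef (fun t => dtau t * (tau t)^-1) z * (u z * u z) * (window tau n.+1 z.1 * 'D_(basis_vec i) psi z.2))| <=
    1 * (B * M1) * P.
  apply: (windowed_dom s0 _ _ _ _).2 => [|||z /inw[z0 D1 Ds [w1 w2]]].
  - by rewrite !mulr_ge0.
  - apply: measurable_funM; last exact: (mtest wt (tD i)).
    apply: measurable_funM; last exact: measurable_funM.
    exact: (measurable_timef (d := d) ht (tc_mul (tc_dtau tau) (tc_inv tau))).
  - by move=> z /wo ->; rewrite mul0r mulr0.
  apply: (young_window (kd := kdot z)) => //; last exact: kdot_ge0.
  by rewrite mul1r; exact: pressure_u.
rewrite (momentum_identity ht eps0 reg me sk i (delayed_window ht n.+1) hw' tw' tp).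
exact: (collect bA bB bC bD bE bF).
Qed.

Lemma density_bound (psi : space -> R) : test_function setT psi ->
  exists2 K : R, 0 <= K & forall n s (chi : R -> R) m, 0 < s -> s <= 1 -> late s n.+1 ->
  time_test chi -> (forall t, ~~ in_window tau n.+1 t -> chi t = 0) ->
  (forall t, `|chi t| <= m) ->
  `|\sum_j \int[mu]_z (k z * q j z * u z * (chi z.1 * 'D_(basis_vec j) psi z.2))| <=
  m * K * \int[mu]_z windowed n.+1 s z.
Proof.
move=> tp; have tD j := test_derive (basis_vec j) tp.
have [M M0_ hM] := bound_all (fun j => test_bounded (tD j)).
exists (d%:R * M) => [|n s chi m s0 s1 hl tc co cm]; first by rewrite mulr_ge0.
have m0 : 0 <= m by apply: le_trans (cm 0).
set P := \int[mu]_z windowed n.+1 s z.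
have -> : m * (d%:R * M) * P = \sum_(j < d) (1 * (m * M) * P).
  by rewrite sumr_const card_ord mul1r -[RHS]mulr_natl; ring.
apply: (le_trans (ler_norm_sum _ _ _)); apply: ler_sum => j _.
apply: (windowed_dom s0 _ _ _ _).2 => [|||z h].
- by rewrite !mulr_ge0.
- exact: (measurable_funM (measurable_funM (measurable_funM mk_ (mq_ j)) mu_) (mtest tc (tD j))).
- by move=> z /co ->; rewrite mul0r mulr0.
have [z0 _] := in_windowP _ _ _ h; have [D1 _] := hl _ h.
apply: young_test => //; last exact: young_density_ge0.
rewrite mul1r -mulrA [q j z * _]mulrC; exact: transport_q.
Qed.

Let slice : {ae leb, forall t, intg lebd (fun y => u (t, y) * u (t, y)) /\
  \int[lebd]_y (u (t, y) * u (t, y)) <= `|M0|}.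
Proof.
apply: (ae_imp mass) => t h; have [t0|t0] := ltP 0 t; last first.
  have -> : (fun y => u (t, y) * u (t, y)) = fun=> 0.
    by apply/funext => y; rewrite pos_out// mulr0.
  by rewrite I0; split=> //; exact: intg0.
have [i <-] := h t0.
have e : (fun y => u (t, y) * u (t, y)) = (fun y => sqrtR c t y ^+ 2).
  by apply/funext => y; rewrite /pos t0 expr2.
by rewrite e; split => //; exact: ler_norm.
Qed.

Lemma test_position (psi : space -> R) i : test_function setT psi ->
  test_function setT (fun y : space => 2 * y 0 i * psi y - 'D_(basis_vec i) psi y).
Proof.
move=> tp; have s1 : smooth (fun y : space => 2 * y 0 i).
  by apply: smoothM; [exact: smooth_cst|exact: (smooth_coord_comp i (@smooth1_id R))].
have := test_add (test_mul s1 tp) (test_mul (@smooth_cst _ _ (-1)) (test_derive (basis_vec i) tp)).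
by congr test_function; apply/funext => y; rewrite mulN1r.
Qed.

Section one_test.
Variables (psi : space -> R) (i : 'I_d) (e : R).
Hypothesis tp : test_function setT psi.
Hypothesis e0 : 0 < e.

(** This is - d_i (Gamma psi) / Gamma, the adjoint of d_i in L^2 with weight Gamma, applied to
    [psi]; in particular its Gaussian integral is 0. *)
Definition position_test (y : space) := 2 * y 0 i * psi y - 'D_(basis_vec i) psi y.
Local Notation eta := position_test.
Let te : test_function setT eta := test_position i tp.
Let l t := \int[lebd]_y (u (t, y) * u (t, y) * eta y).

Let me_ : measurable_fun setT eta.
Proof. by apply: continuous_measurable_rV; apply: smooth_cont; exact: te.1. Qed.

Let ml : measurable_fun setT l.
Proof.
have mf : measurable_fun setT (fun z : mX => u z * u z * eta z.2).
  by apply: measurable_funM; [exact: measurable_funM|exact: measurableT_comp].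
exact: (measurable_I2 (lebesgue_rV d) mf).
Qed.

Let intg_slice t : intg lebd (fun y => u (t, y) * u (t, y)) ->
  intg lebd (fun y => u (t, y) * u (t, y) * eta y).
Proof. by have [M hM] := test_bounded te; move=> h; exact: intg_bdM h me_ hM. Qed.

Let l_bound : exists L, {ae leb, forall t, `|l t| <= L}.
Proof.
have [M hM] := test_bounded te; have M0_ : 0 <= M by apply: le_trans (hM 0).
exists (M * `|M0|); apply: (ae_imp slice) => t [h hb].
have le y : `|u (t, y) * u (t, y) * eta y| <= M * (u (t, y) * u (t, y)).
  by rewrite normrM [X in X * _]ger0_norm -?expr2 ?sqr_ge0// mulrC ler_wpM2r ?sqr_ge0.
apply: (le_trans (I_norm_le (intg_slice h) (intgZ M h) le)).
by rewrite IZ// ler_wpM2l.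
Qed.

Let l_test h : time_test h -> intg leb (fun t => l t * h t) /\
  \int[leb]_t (l t * h t) = \int[mu]_z (u z * u z * (h z.1 * eta z.2)).
Proof.
move=> th; have iz := L2loc_mul Lu Lu (ptest_of th te); have [h1 <-] := fubX1 iz.
have eq : {ae leb, forall t, l t * h t = \int[lebd]_y (u (t, y) * u (t, y) * (h t * eta y))}.
  apply: (ae_imp slice) => t [hs _]; rewrite mulrC -IZ; last exact: intg_slice.
  by apply: I_eq => y; rewrite mulrCA.
have mlh : measurable_fun setT (fun t => l t * h t).
  exact: measurable_funM ml (measurable_smooth1 th.1).
split; first exact: intg_ae_eq mlh eq h1.
by apply: I_ae => //; exact: intg_meas h1.
Qed.

(** [h] minus its integral times the window has zero mean, so it is the derivative of some chi
    supported in the window, of size at most twice the integral of [h]. The density equation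
    controls this difference, and the momentum bound controls the average over the window. A bound
    linear in the integral of [h] is what [ae_le_test] can use. *)
Let l_pair n s K1 K2 P t1 t2 : 0 < s -> s <= 1 -> late s n.+1 -> 0 <= K1 -> 0 <= K2 ->
  P = \int[mu]_z windowed n.+1 s z ->
  `|\int[mu]_z (u z * u z * (window tau n.+1 z.1 * eta z.2))| <= K1 * P ->
  (forall (chi : R -> R) m, time_test chi -> (forall t, ~~ in_window tau n.+1 t -> chi t = 0) ->
    (forall t, `|chi t| <= m) ->
    `|\sum_j \int[mu]_z (k z * q j z * u z * (chi z.1 * 'D_(basis_vec j) eta z.2))| <= m * K2 * P) ->
  (K1 + 2 * K2) * P <= e ->
  0 < t1 -> t1 < t2 -> (forall t, in_window tau n.+1 t = (t1 < t < t2)) ->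
  forall h, time_test h -> (forall t, 0 <= h t) -> (forall t, ~ (t1 < t < t2) -> h t = 0) ->
  `|\int[leb]_t (l t * h t)| <= (\int[leb]_t h t) * e.
Proof.
move=> s0 s1 hl K10 K20 _ b1 b2 Pe t10 t12 hw h th h0 hs.
set H := \int[leb]_t h t; have H0 : 0 <= H by exact: I_ge0.
have wt := window_test ht n.+1; have iw := time_test_intg wt; have ih := time_test_intg th.
have out t : ~ (t1 < t < t2) -> window tau n.+1 t = 0.
  by move=> ht'; apply: window_out => /in_windowP; rewrite hw.
pose g t := h t + (- H) * window tau n.+1 t.
have tg : time_test g by apply: time_testD => //; apply: time_testM => //; exact: smooth1_cst.
have g0 t : ~ (t1 < t < t2) -> g t = 0 by move=> ot; rewrite /g hs// out// mulr0 addr0.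
have Ig : \int[leb]_t g t = 0.
  by rewrite ID//; [rewrite IZ// I_window// mulr1 subrr|exact: intgZ].
have [chi [tc dc co cb]] := time_test_prim tg t12 g0 Ig.
have cb2 t : `|chi t| <= 2 * H.
  apply: (le_trans (cb t)).
  have -> : 2 * H = \int[leb]_t (h t + H * window tau n.+1 t).
    by rewrite ID//; [rewrite IZ// I_window// -/H; ring|exact: intgZ].
  apply: I_le => [||r].
  - by apply: intg_abs; exact: time_test_intg.
  - by apply: intgD => //; exact: intgZ.
  apply: (le_trans (ler_normD _ _)); apply: lerD; first by rewrite ger0_norm.
  by rewrite mulNr normrN ger0_norm// mulr_ge0// window_ge0.
have del : delayed chi.
  by split => //; exists t1 => // t tt; apply: co => /andP[]; rewrite ltNge ltW.
have := b2 chi (2 * H) tc _ cb2; have := hdens del dc te.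
set S := \sum_j _ => E1 /(_ _)b2'.
have {}b2' : `|S| <= 2 * H * K2 * P by apply: b2' => t; rewrite hw => /negP; exact: co.
have [_ ->] := l_test th.
have ig (x : R -> R) (tx : time_test x) := L2loc_mul Lu Lu (ptest_of tx te).
have E2 : \int[mu]_z (u z * u z * (h z.1 * eta z.2)) = - S + H * \int[mu]_z (u z * u z * (window tau n.+1 z.1 * eta z.2)).
  rewrite -E1 -IZ; last exact: ig.
  rewrite -ID; [|exact: ig|by apply: intgZ; exact: ig].
  by apply: I_eq => z; rewrite /g; ring.
rewrite E2; apply: (le_trans (ler_normD _ _)); rewrite normrN normrM (ger0_norm H0).
apply: (@le_trans _ _ (H * ((K1 + 2 * K2) * P))); last by rewrite ler_wpM2l.
have -> : H * ((K1 + 2 * K2) * P) = 2 * H * K2 * P + H * (K1 * P) by ring.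
by apply: lerD => //; rewrite ler_wpM2l.
Qed.

(** [ae_le_test] applied to l - e and to - l - e, the squares being integrable because [l] is
    essentially bounded. *)
Let l_ae t1 t2 : (forall h, time_test h -> (forall t, 0 <= h t) ->
    (forall t, ~ (t1 < t < t2) -> h t = 0) ->
    `|\int[leb]_t (l t * h t)| <= (\int[leb]_t h t) * e) ->
  {ae leb, forall t, t1 < t < t2 -> `|l t| <= e}.
Proof.
move=> hl; have [L hL] := l_bound.
have one (r : R) : `|r| = 1 -> {ae leb, forall t, t1 < t < t2 -> r * l t - e <= 0}.
  move=> r1; have mf : measurable_fun setT (fun t => r * l t - e).
    by apply: measurable_funB => //; exact: measurable_funM (measurable_cst r) ml.
  have th := @hat_test R t1 t2; have mh := measurable_smooth1 th.1.
  apply: ae_le_test => //.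
    apply: (intg_le_ae (g := fun t : measurableTypeR R => (L + e) ^+ 2 * (hat t1 t2 t * hat t1 t2 t))).
    - by apply: measurable_funX; exact: measurable_funM.
    - apply: (ae_imp hL) => t lt; rewrite ger0_norm ?sqr_ge0// exprMn -[in leRHS]expr2.
      rewrite ler_wpM2r ?sqr_ge0// -real_normK ?num_real// lerXn2r ?nnegrE//.
        by rewrite addr_ge0 ?(ltW e0)// (le_trans _ lt).
      apply: (le_trans (ler_normB _ _)).
      by rewrite normrM r1 mul1r (gtr0_norm e0) lerD2r.
    - by apply: intgZ; apply: time_test_intg; apply: time_testM => //; exact: th.1.
  move=> h tt h0 ho; have [il _] := l_test tt; have ih := time_test_intg tt.
  have -> : \int[leb]_t ((r * l t - e) * h t) = r * (\int[leb]_t (l t * h t)) - e * \int[leb]_t h t.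
    rewrite -!IZ// -IB; [|exact: intgZ|exact: intgZ].
    by apply: I_eq => t; ring.
  rewrite subr_le0; apply: (le_trans (ler_norm _)); rewrite normrM r1 mul1r mulrC [leRHS]mulrC.
  by rewrite mulrC; exact: hl.
have h1 := one 1 (normr1 _); have h2 := one (-1) (normrN1 _).
apply: (ae_imp (ae_and h1 h2)) => t [a b] tt.
move: (a tt) (b tt); rewrite mul1r mulN1r !subr_le0 ler_norml lerNl => -> ->//.
Qed.

Lemma window_vanish : exists N : nat, forall n, (N <= n)%N ->
  {ae leb, forall t, in_window tau n.+1 t -> `|l t| <= e}.
Proof.
have [K1 K10 h1] := momentum_bound i tp; have [K2 K20 h2] := density_bound te.
have [B B0 hB] := I_windowed; pose K := K1 + 2 * K2.
have K0 : 0 <= K by rewrite addr_ge0// mulr_ge0.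
(* With [s] fixed first, the mass takes at most e / 2 in every window; the dissipation, divided by
   this [s], is brought below e / 2 by going to late windows. The added 1 keeps the divisor
   positive. *)
pose s := Num.min 1 (e / (2 * (K * B + 1))).
have q0 : 0 < K * B + 1 by rewrite ltr_wpDl// mulr_ge0.
have s0 : 0 < s by rewrite lt_min ltr01 divr_gt0// mulr_gt0.
have s1 : s <= 1 by rewrite ge_min lexx.
have sB : K * (s * B) <= e / 2.
  have : s * (2 * (K * B + 1)) <= e by rewrite -ler_pdivlMr ?mulr_gt0// ge_min lexx orbT.
  exact: budget_mass.
have r0 : 0 < e * s / (2 * (K + 1)) by rewrite divr_gt0 ?mulr_gt0// ltr_wpDl.
have [N1 _ hN1] := late_near s0; have [N2 _ hN2] := E_tail r0.
exists (maxn N1 N2) => n; rewrite geq_max => /andP[n1 n2].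
have [t1 [t2 [t10 t12 hw]]] := window_interval ht n.+1.
have hl : late s n.+1 by apply: hN1 => /=; exact: leqW.
suff h : {ae leb, forall t, t1 < t < t2 -> `|l t| <= e}.
  by apply: (ae_imp h) => t lt; rewrite hw.
have [_ hP] := hB n s s0.
apply: l_ae; apply: (l_pair s0 s1 hl K10 K20 erefl) t10 t12 hw.
- exact: h1.
- by move=> chi m tc co cm; exact: h2.
have hE : \int[mu]_z (E z * (in_window tau n.+1 z.1)%:R) <= e * s / (2 * (K + 1)).
  by apply: hN2 => /=; exact: leqW.
rewrite -/K; apply: (le_trans (ler_wpM2l K0 hP)); rewrite mulrDr.
have -> : e = e / 2 + e / 2 by field.
apply: lerD => //; rewrite mulrCA mulrC ler_pdivrMr//.
apply: (le_trans (ler_wpM2l K0 hE)).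
have K1' : 0 < K + 1 by rewrite ltr_wpDl.
rewrite mulrA ler_pdivrMr ?mulr_gt0//.
by apply: budget_energy; rewrite mulr_gt0.
Qed.

Lemma position_vanish : exists2 T : R, 0 < T & {ae leb, forall t : R, T < t ->
  `|\int[lebd]_y (sqrtR c t y ^+ 2 * eta y)| <= e}.
Proof.
have [N hN] := window_vanish; have [T T1 hT] := kappa_large ht N.+1%:R.
exists T; first exact: lt_trans T1.
have h : {ae leb, forall t, forall n, (N <= n)%N -> in_window tau n.+1 t -> `|l t| <= e}.
  by apply/ae_foralln => n; have [Nn|nN] := leqP N n; [apply: (ae_imp (hN _ Nn))|apply: aeW].
apply: (ae_imp h) => t lt Tt; have t0 : 0 < t by apply: lt_trans Tt; exact: lt_trans T1.
have kt := hT _ Tt; have k0 : 0 <= kappa tau t by apply: le_trans (ltW kt).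
have le : (N < truncn (kappa tau t))%N by rewrite truncn_ge_nat// ltW.
have -> : \int[lebd]_y (sqrtR c t y ^+ 2 * eta y) = l t.
  by apply: I_eq => y; rewrite /pos t0 expr2.
(* Every late time lies in the window numbered by the integer part of kappa; the predecessor appears
   because windows are indexed by n + 1. *)
apply: (lt (truncn (kappa tau t)).-1); first by rewrite -ltnS prednK// (leq_ltn_trans _ le).
rewrite prednK ?(leq_ltn_trans _ le)//; apply/in_windowP; split => //.
have /andP[a b] := truncn_itv k0.
by rewrite ger0_norm ?subr_ge0// ltrBlDr addrC natr1.
Qed.

End one_test.

End window_argument.

(** * Convergence to the Gaussian *)

Section uniform_integrability.
Context {R : realType} (d : nat).
Local Notation lebd := (lebesgue_rV d).
Local Notation space := 'rV[R]_d.
Implicit Types (r g h : space -> R) (C K B e : R).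

(* For [r^2 > K Gamma], [ln (r^2) + |y|^2 > ln K]. *)
Lemma Gamma_split r y K : 1 < ln K -> 0 < K ->
  r y ^+ 2 <= K * Gamma y +
    (ln K - 1)^-1 * (potential_density r y - r y ^+ 2 + Gamma y).
Proof.
move=> lK K0; have G0 := Gamma_gt0 y; have l0 : 0 < ln K - 1 by rewrite subr_gt0.
have h := potential_ge r y.
have [le|lt] := leP (r y ^+ 2) (K * Gamma y).
  apply: (le_trans le); rewrite lerDl mulr_ge0 ?invr_ge0 ?(ltW l0)//; lra.
have x0 : 0 < r y ^+ 2 by apply: lt_trans lt; rewrite mulr_gt0.
have : ln (K * Gamma y) <= ln (r y ^+ 2) by rewrite ler_ln ?(ltW lt)// posrE// mulr_gt0.
rewrite lnM ?posrE// /Gamma expRK => le.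
rewrite -[leLHS]add0r; apply: lerD; first by rewrite mulr_ge0// ltW.
rewrite mulrC ler_pdivlMr// /potential_density.
have : r y ^+ 2 * (ln K - sqnorm y) <= r y ^+ 2 * ln (r y ^+ 2) by rewrite ler_wpM2l// ltW.
move: G0; rewrite /Gamma; lra.
Qed.

(** What the energy inequality and conservation of mass give for [sqrtR] at almost every positive
    time. *)
Record moderate C r : Prop := Moderate {
  md_meas : measurable_fun setT r ;
  md_intg : intg lebd (fun y => r y ^+ 2) ;
  md_mass : \int[lebd]_y (r y ^+ 2) = \int[lebd]_y Gamma y ;
  md_pot : intg lebd (potential_density r) ;
  md_le : \int[lebd]_y potential_density r y <= C }.

Definition bounded_by B g := measurable_fun setT g /\ forall y, `|g y| <= B.

Lemma bounded_by_lim B (g_ : nat -> space -> R) g : (forall n, bounded_by B (g_ n)) ->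
  (forall y, g_ n y @[n --> \oo] --> g y) -> bounded_by B g.
Proof.
move=> bg cg; split=> [|y].
  by apply: (measurable_fun_cvg (h := g_)) => // n; exact: (bg n).1.
have /cvg_norm h := cg y.
by apply: (cvgr_to_le h); apply: nearW => n; exact: (bg n).2.
Qed.

Lemma moderate_intg C r g B : moderate C r -> bounded_by B g ->
  intg lebd (fun y => r y ^+ 2 * g y).
Proof. by move=> md [mg hg]; exact: intg_bdM (md_intg md) mg hg. Qed.

Lemma Gamma_intg g B : bounded_by B g -> intg lebd (fun y => Gamma y * g y).
Proof. by move=> [mg hg]; exact: intg_bdM (@intg_Gamma R d) mg hg. Qed.

Lemma moderate_le C r g B : moderate C r -> bounded_by B g ->
  `|\int[lebd]_y (r y ^+ 2 * g y)| <= B * \int[lebd]_y (Gamma y : R).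
Proof.
move=> md bg; have [mg hg] := bg.
have le y : `|r y ^+ 2 * g y| <= B * r y ^+ 2.
  by rewrite normrM ger0_norm ?sqr_ge0// mulrC ler_wpM2r// sqr_ge0.
apply: (le_trans (I_norm_le (moderate_intg md bg) (intgZ B (md_intg md)) le)).
by rewrite IZ ?(md_mass md)//; exact: md_intg md.
Qed.

(** [Gamma_split] integrated against |g|; the masses of r^2 and Gamma cancel in the entropy part and
    leave [C]. *)
Lemma moderate_split C r g B K : moderate C r -> bounded_by B g -> 1 < ln K -> 0 < K ->
  `|\int[lebd]_y (r y ^+ 2 * g y)| <=
  K * \int[lebd]_y (Gamma y * `|g y|) + (ln K - 1)^-1 * (B * C).
Proof.
move=> md bg lK K0; have [mg hg] := bg; have B0 : 0 <= B by apply: le_trans (hg 0).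
have l0 : 0 < ln K - 1 by rewrite subr_gt0.
have bn : bounded_by B (fun y => `|g y|).
  by split=> [|y]; [exact: measurableT_comp|rewrite normr_id].
have iG := @intg_Gamma R d.
have iD := intgD (intgB (md_pot md) (md_intg md)) iG.
have iK := intgZ K (Gamma_intg bn).
have iP := intgZ ((ln K - 1)^-1) (intgZ B iD).
have le y : `|r y ^+ 2 * g y| <= K * (Gamma y * `|g y|) +
    (ln K - 1)^-1 * (B * (potential_density r y - r y ^+ 2 + Gamma y)).
  have h := potential_ge r y.
  have p0 : 0 <= potential_density r y - r y ^+ 2 + Gamma y by lra.
  rewrite normrM ger0_norm ?sqr_ge0//.
  apply: (le_trans (ler_wpM2r (normr_ge0 (g y)) (Gamma_split r y lK K0))).
  rewrite mulrDl -mulrA lerD2l -mulrA ler_wpM2l ?invr_ge0 ?(ltW l0)//.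
  by rewrite mulrC ler_wpM2r.
apply: (le_trans (I_norm_le (moderate_intg md bg) (intgD iK iP) le)).
rewrite ID// IZ; last exact: Gamma_intg bn.
rewrite lerD2l IZ; last exact: intgZ.
rewrite ler_wpM2l ?invr_ge0 ?(ltW l0)// IZ// ler_wpM2l//.
rewrite ID//; last exact: intgB (md_pot md) (md_intg md).
rewrite IB ?(md_mass md) ?subrK; [exact: md_le md|exact: md_pot md|exact: md_intg md].
Qed.

(** Uniform integrability relative to Gamma. The level K = exp (1 + L) is chosen first, to make the
    entropy part small, and then [s] makes K times the Gaussian part small. *)
Lemma moderate_small C B e : 0 <= B -> 0 < e -> exists2 s, 0 < s & forall r g,
  moderate C r -> bounded_by B g -> \int[lebd]_y (Gamma y * `|g y|) <= s ->
  `|\int[lebd]_y (r y ^+ 2 * g y)| <= e.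
Proof.
move=> B0 e0; pose L := 2 * (B * `|C| + 1) / e.
have q0 : 0 < B * `|C| + 1 by rewrite ltr_wpDl// mulr_ge0.
have L0 : 0 < L by rewrite divr_gt0// mulr_gt0.
have lK : 1 < ln (expR (1 + L)) :> R by rewrite expRK ltrDl.
exists (e / (2 * expR (1 + L))); first by rewrite divr_gt0// mulr_gt0// expR_gt0.
move=> r g md bg hs; apply: (le_trans (moderate_split md bg lK (expR_gt0 _))).
rewrite expRK [1 + L]addrC addrK.
have -> : e = e / 2 + e / 2 by field.
apply: lerD.
  apply: (le_trans (ler_wpM2l (expR_ge0 _) hs)); rewrite [1 + L]addrC.
  have E0 : expR (L + 1) != 0 :> R by rewrite gt_eqF// expR_gt0.
  by rewrite le_eqVlt; apply/orP; left; apply/eqP; field.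
rewrite mulrC ler_pdivrMr//.
have -> : e / 2 * L = B * `|C| + 1 by rewrite /L; field; rewrite gt_eqF.
apply: (@le_trans _ _ (B * `|C|)); last by rewrite lerDl.
by rewrite ler_wpM2l// ler_norm.
Qed.

Section limits.
Variables (F : set_system R) (r : R -> space -> R) (kap : R -> R) (C Kk : R).
Hypothesis FF : Filter F.
Hypothesis Fr : F (fun t => moderate C (r t)).
Hypothesis Fk : F (fun t => `|kap t| <= Kk).

(** The filter is abstract because it is used twice: for late times up to a null set depending on
    the test, and for late times outside one fixed null set. *)
Definition limit_is g := forall e, 0 < e -> F (fun t =>
  `|\int[lebd]_y (r t y ^+ 2 * g y) - kap t * \int[lebd]_y (Gamma y * g y)| <= e).

Lemma limit_lin a f g B : bounded_by B f -> bounded_by B g -> limit_is f -> limit_is g ->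
  limit_is (fun y => a * f y + g y).
Proof.
move=> bf bg lf lg e e0; pose e1 := e / (`|a| + 1).
have a0 : 0 < `|a| + 1 by rewrite ltr_wpDl.
have e1_gt0 : 0 < e1 by rewrite divr_gt0.
apply: filterS (filterI Fr (filterI (lf _ e1_gt0) (lg _ e1_gt0))) => t [md [h1 h2]].
have i1 := moderate_intg md bf; have i2 := moderate_intg md bg.
have j1 := Gamma_intg bf; have j2 := Gamma_intg bg.
have -> : \int[lebd]_y (r t y ^+ 2 * (a * f y + g y)) =
    a * \int[lebd]_y (r t y ^+ 2 * f y) + \int[lebd]_y (r t y ^+ 2 * g y).
  by rewrite -IZ// -ID//; [apply: I_eq => y; ring|exact: intgZ].
have -> : \int[lebd]_y (Gamma y * (a * f y + g y)) =
    a * \int[lebd]_y (Gamma y * f y) + \int[lebd]_y (Gamma y * g y).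
  by rewrite -IZ// -ID//; [apply: I_eq => y; ring|exact: intgZ].
move: h1 h2; set A := \int[_]_y _; set A' := \int[_]_y _; set D := \int[_]_y _; set D' := \int[_]_y _ => h1 h2.
have -> : a * A + D - kap t * (a * A' + D') = a * (A - kap t * A') + (D - kap t * D') by ring.
have -> : e = `|a| * e1 + e1 by rewrite /e1; field; rewrite gt_eqF.
apply: (le_trans (ler_normD _ _)); apply: lerD => //.
by rewrite normrM ler_wpM2l.
Qed.

(** Dominated convergence makes g - g_n small in L^1 with weight Gamma, and [moderate_small]
    transfers this to the weight r(t)^2, uniformly in t. Hence one [n] serves all times. *)
Lemma limit_lim (g_ : nat -> space -> R) g B : (forall n, bounded_by B (g_ n)) ->
  (forall y, g_ n y @[n --> \oo] --> g y) -> (forall n, limit_is (g_ n)) -> limit_is g.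
Proof.
move=> bg cg lg e e0; have B0 : 0 <= B by apply: le_trans ((bg 0%N).2 0).
have bgl := bounded_by_lim bg cg; have mg := bgl.1.
have e3 : 0 < e / 3 by rewrite divr_gt0.
have [s s0 hs] := moderate_small C (mulr_ge0 (ler0n R 2) B0) e3.
pose D n y := g y - g_ n y.
have bD n : bounded_by (2 * B) (D n).
  split=> [|y]; first by apply: measurable_funB => //; exact: (bg n).1.
  apply: (le_trans (ler_normB _ _)); rewrite mulr_natl mulr2n lerD//; first exact: bgl.2.
  exact: (bg n).2.
have bDn n : bounded_by (2 * B) (fun y => `|D n y|).
  split=> [|y]; last by rewrite normr_id; exact: (bD n).2.
  by apply: measurableT_comp => //; exact: (bD n).1.
have c0 : \int[lebd]_y (Gamma y * `|D n y|) @[n --> \oo] --> \int[lebd]_y (0 : R).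
  apply: (dct (g := fun y => 2 * B * Gamma y)) => //.
  - by move=> n; exact: intg_meas (Gamma_intg (bDn n)).
  - apply: aeW => y; rewrite -(mulr0 (Gamma y)); apply: cvgMr.
    rewrite -(normr0 R) -(subrr (g y)); apply: cvg_norm; apply: cvgB => //; exact: cvg_cst.
  - by apply: intgZ; exact: intg_Gamma.
  - move=> n y; rewrite normrM normr_id ger0_norm ?(ltW (Gamma_gt0 y))// mulrC.
    by rewrite ler_wpM2r ?(ltW (Gamma_gt0 y))//; exact: (bD n).2.
rewrite I0 in c0.
pose s1 := Num.min s (e / (3 * (`|Kk| + 1))).
have k0 : 0 < `|Kk| + 1 by rewrite ltr_wpDl.
have s10 : 0 < s1 by rewrite lt_min s0 divr_gt0// mulr_gt0.
have [n _ hn] := cvg_dist c0 s10; have {}hn := hn n (leqnn n).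
rewrite /= subr0 in hn.
have Dn : \int[lebd]_y (Gamma y * `|D n y|) <= s1 by apply: le_trans hn; exact: ler_norm.
have Ds : \int[lebd]_y (Gamma y * `|D n y|) <= s.
  by apply: (le_trans Dn); rewrite ge_min lexx.
have De : \int[lebd]_y (Gamma y * `|D n y|) <= e / (3 * (`|Kk| + 1)).
  by apply: (le_trans Dn); rewrite ge_min lexx orbT.
apply: filterS (filterI Fr (filterI Fk (lg n _ e3))) => t [md [hk h1]].
have h2 := hs _ _ md (bD n) Ds.
have h3 : `|kap t * \int[lebd]_y (Gamma y * D n y)| <= e / 3.
  have -> : e / 3 = (`|Kk| + 1) * (e / (3 * (`|Kk| + 1))) by field; rewrite gt_eqF.
  rewrite normrM ler_pM//; first by rewrite (le_trans hk)// (le_trans (ler_norm _))// lerDl.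
  apply: le_trans De; apply: I_norm_le; first exact: Gamma_intg (bD n).
    exact: Gamma_intg (bDn n).
  by move=> y; rewrite normrM ger0_norm// ltW// Gamma_gt0.
have e1 : \int[lebd]_y (r t y ^+ 2 * g y) =
    \int[lebd]_y (r t y ^+ 2 * D n y) + \int[lebd]_y (r t y ^+ 2 * g_ n y).
  rewrite -ID; [|exact: moderate_intg md (bD n)|exact: moderate_intg md (bg n)].
  by apply: I_eq => y; rewrite /D; ring.
have e2 : \int[lebd]_y (Gamma y * g y) =
    \int[lebd]_y (Gamma y * D n y) + \int[lebd]_y (Gamma y * g_ n y).
  rewrite -ID; [|exact: Gamma_intg (bD n)|exact: Gamma_intg (bg n)].
  by apply: I_eq => y; rewrite /D; ring.
rewrite e1 e2; move: h1 h2 h3; clear.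
set A := \int[_]_y _; set A' := \int[_]_y _; set Q := \int[_]_y _; set Q' := \int[_]_y _ => h1 h2 h3.
have -> : Q + A - kap t * (Q' + A') = (A - kap t * A') + Q - kap t * Q' by ring.
have -> : e = e / 3 + e / 3 + e / 3 by field.
apply: (le_trans (ler_normB _ _)); apply: lerD => //.
by apply: (le_trans (ler_normD _ _)); apply: lerD.
Qed.

End limits.

(** Lists make the family countable and stable under intersection; the empty list gives the whole
    space, hence the constants. *)
Definition under (s : seq ('I_d * rat)) : set space :=
  [set y | forall p, p \in s -> y 0 p.1 < ratr p.2].

Lemma under_cons p s : under (p :: s) = [set y : space | y 0 p.1 < ratr p.2] `&` under s.
Proof.
apply/seteqP; split => [x /= h|x [/= xa h] q].
  by split=> [|q qs]; [apply: h; rewrite mem_head|apply: h; rewrite in_cons qs orbT].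
by rewrite in_cons => /orP[/eqP ->|/h].
Qed.

(** The least class containing these indicators and stable under linear combinations and bounded
    pointwise limits, operations that preserve convergence along a fixed filter. *)
Inductive mono_class : (space -> R) -> Prop :=
| mono_under s : mono_class (\1_(under s))
| mono_lin a f g : mono_class f -> mono_class g -> mono_class (fun y => a * f y + g y)
| mono_lim (g_ : nat -> space -> R) g B : (forall n, mono_class (g_ n)) ->
    (forall n y, `|g_ n y| <= B) -> (forall y, g_ n y @[n --> \oo] --> g y) -> mono_class g.

(** Sets that multiply the class into itself are visibly stable under intersection, so they form a
    sigma-algebra and plain induction over measurable sets replaces a pi-lambda argument. *)
Definition multiplier (A : set space) := forall g, mono_class g -> mono_class (fun y => \1_A y * g y).

Let mono_eq f g : mono_class f -> (forall y, f y = g y) -> mono_class g.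
Proof. by move=> mf e; have <- : f = g by apply/funext. Qed.

Lemma mono0 : mono_class (fun=> 0).
Proof. by apply: (mono_eq (mono_lin (-1) (mono_under [::]) (mono_under [::]))) => y; ring. Qed.

Lemma mono1 : mono_class (fun=> 1).
Proof. by apply: (mono_eq (mono_under [::])) => y; rewrite indicE mem_set. Qed.

Lemma multiplierC A : multiplier A -> multiplier (~` A).
Proof.
move=> hA g mg; apply: (mono_eq (mono_lin (-1) (hA _ mg) mg)) => y.
by rewrite !indicE in_setC; case: (y \in A); rewrite /= ?mul1r ?mul0r ?mulr0 ?mulN1r ?add0r ?addNr.
Qed.

Lemma multiplierI (A A' : set space) : multiplier A -> multiplier A' -> multiplier (A `&` A').
Proof.
by move=> hA hB g mg; apply: (mono_eq (hA _ (hB _ mg))) => y; rewrite indicI mulrA.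
Qed.

Lemma mono_bounded g : mono_class g -> exists B, forall y, `|g y| <= B.
Proof.
elim=> [s|a f h _ [B1 h1] _ [B2 h2]|g_ h B _ _ hb hc].
- by exists 1 => y; rewrite indicE; case: (_ \in _); rewrite ?normr1// normr0.
- exists (`|a| * B1 + B2) => y; apply: (le_trans (ler_normD _ _)); apply: lerD => //.
  by rewrite normrM ler_wpM2l.
- exists B => y; have /cvg_norm hn := hc y.
  by apply: (cvgr_to_le hn); apply: nearW => n.
Qed.

Lemma multiplier_lim (A_ : nat -> set space) A : (forall n, multiplier (A_ n)) ->
  (forall y, (\1_(A_ n) y : R) @[n --> \oo] --> (\1_A y : R)) -> multiplier A.
Proof.
move=> hA hc g mg; have [B hB] := mono_bounded mg.
apply: (@mono_lim (fun n y => \1_(A_ n) y * g y) _ B) => [n|n y|y].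
- exact: hA.
- rewrite normrM -[leRHS]mul1r ler_pM// indicE.
  by case: (_ \in _); rewrite ?normr1// normr0.
- by apply: cvgMl; exact: hc.
Qed.

Lemma eventually_eq_cvg (a : nat -> R) (l : R) N : (forall n, (N <= n)%N -> a n = l) -> a n @[n --> \oo] --> l.
Proof. by move=> h; apply: cvg_near_cst; exists N => // n /=; exact: h. Qed.

Lemma multiplier_rat i (a : rat) : multiplier [set y | y 0 i < ratr a].
Proof.
move=> g; elim=> [s|b f h _ mf _ mh|g_ h B _ mg hb hc].
- by apply: (mono_eq (mono_under ((i, a) :: s))) => y; rewrite under_cons indicI.
- by apply: (mono_eq (mono_lin b mf mh)) => y; ring.
- apply: (mono_lim mg (B := B)) => [n y|y]; last by apply: cvgMr; exact: hc.
  rewrite normrM -[leRHS]mul1r ler_pM// indicE.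
  by case: (_ \in _); rewrite ?normr1// normr0.
Qed.

Lemma multiplier_half i (b : R) : multiplier [set y | y 0 i < b].
Proof.
(* Approximation from below, because the half-spaces are open: a point with coordinate [b] must stay
   outside all of them. *)
have /(_ _)/cid-/all_sig[a ha] : forall n : nat, exists a : rat, b - n.+1%:R^-1 < ratr a < b.
  move=> n; have [|q] := @rat_in_itvoo R (b - n.+1%:R^-1) b.
    by rewrite ltrBlDr ltrDl invr_gt0.
  by rewrite in_itv /=; exists q.
apply: (@multiplier_lim (fun n => [set y | y 0 i < ratr (a n)])) => [n|y].
  exact: multiplier_rat.
have [yb|yb] := ltP (y 0 i) b; last first.
  apply: (eventually_eq_cvg (N := 0)) => n _; rewrite !indicE !memNset//=.
    by rewrite ltNge yb.
  by rewrite ltNge (le_trans _ yb)// ltW//; case/andP: (ha n).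
have e0 : 0 < b - y 0 i by rewrite subr_gt0.
apply: (eventually_eq_cvg (N := truncn (b - y 0 i)^-1)) => n hn.
rewrite !indicE !mem_set//=; case/andP: (ha n) => h _.
apply: le_lt_trans h; rewrite lerBrDr addrC -lerBrDr invf_ple ?posrE//.
by apply/ltW/(lt_le_trans (truncnS_gt _)); rewrite ler_nat.
Qed.

Lemma measurable_multiplier (A : set space) : measurable A -> multiplier A.
Proof.
apply: rV_sigma_ind => [|B _|G _ hG|i b].
- by move=> g _; apply: (mono_eq mono0) => y; rewrite indic0 mul0r.
- exact: multiplierC.
- have hU n : multiplier (\bigcup_(k < n) G k).
    elim: n => [|n IH].
      rewrite bigcup_mkord big_ord0 => g _; apply: (mono_eq mono0) => y.
      by rewrite indic0 mul0r.
    rewrite bigcup_mkord big_ord_recr /= -bigcup_mkord -[X in multiplier X]setCK setCU.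
    by apply: multiplierC; apply: multiplierI; apply: multiplierC.
  apply: (@multiplier_lim (fun n => \bigcup_(k < n) G k)) => // y.
  have [[k _ Gk]|yG] := pselect ((\bigcup_n G n) y).
    apply: (eventually_eq_cvg (N := k.+1)) => n kn; rewrite !indicE !mem_set//.
      by exists k.
    by exists k.
  apply: (eventually_eq_cvg (N := 0)) => n _; rewrite !indicE !memNset//.
  by move=> [k _ Gk]; apply: yG; exists k.
- exact: multiplier_half.
Qed.

Lemma mono_indic (A : set space) : measurable A -> mono_class (\1_A).
Proof.
by move=> mA; apply: (mono_eq (measurable_multiplier mA mono1)) => y; rewrite mulr1.
Qed.

Lemma mono_sum n (G : nat -> space -> R) : (forall j, mono_class (G j)) ->
  mono_class (fun y => \sum_(j < n) G j y).
Proof.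
move=> mG; elim: n => [|n IH].
  by apply: (mono_eq mono0) => y; rewrite big_ord0.
apply: (mono_eq (mono_lin 1 (mG n) IH)) => y; rewrite big_ord_recr /=; ring.
Qed.

Lemma sum_lt n m : \sum_(j < n) ((j < m)%N : nat) = minn m n.
Proof.
elim: n => [|n IH]; first by rewrite big_ord0 minn0.
rewrite big_ord_recr /= IH; case: leqP => h; lia.
Qed.

(** On [0, 1], the rounding of x down to a multiple of 1 / (n + 1), written as a sum of indicators
    of superlevel sets. *)
Definition staircase n (x : R) : R := n.+1%:R^-1 * \sum_(j < n.+1) ((j.+1%:R <= n.+1%:R * x)%R%:R : R).

Lemma staircase_near n x : 0 <= x <= 1 -> `|staircase n x - x| <= n.+1%:R^-1.
Proof.
move=> /andP[x0 x1]; have y0 : 0 <= n.+1%:R * x by rewrite mulr_ge0.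
have -> : staircase n x = n.+1%:R^-1 * (truncn (n.+1%:R * x))%:R.
  rewrite /staircase; congr (_ * _).
  under eq_bigr => j _ do rewrite -truncn_ge_nat//.
  rewrite -natr_sum sum_lt; congr (_%:R); apply/minn_idPl.
  by rewrite -(ler_nat R) (le_trans _ (_ : n.+1%:R * x <= _))// ?truncn_le// ler_piMr.
have /andP[a b] := truncn_itv y0.
have {2}-> : x = n.+1%:R^-1 * (n.+1%:R * x) by rewrite mulKf.
rewrite -mulrBr normrM ger0_norm ?invr_ge0// ler_piMr ?invr_ge0// ler_norml.
rewrite -[X in _ < X]natr1 in b; apply/andP; split; lra.
Qed.

Lemma mono_measurable B g : bounded_by B g -> mono_class g.
Proof.
move=> [mg hg]; have B0 : 0 <= B by apply: le_trans (hg 0).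
have B1 : 0 < 2 * B + 1 by rewrite ltr_wpDl// mulr_ge0.
pose f y := (g y + B) / (2 * B + 1).
have mf : measurable_fun setT f by apply: measurable_funM => //; apply: measurable_funD.
have f01 y : 0 <= f y <= 1.
  have := hg y; rewrite ler_norml => /andP[h1 h2]; rewrite divr_ge0 ?(ltW B1)//=.
    by rewrite ler_pdivrMr// mul1r; move: h2 B0; clear; lra.
  by move: h1; clear; lra.
have Mf : mono_class f.
  apply: (@mono_lim (fun n y => staircase n (f y)) f 2) => [n|n y|y].
  - have /(_ (fun j y => \1_[set y | j.+1%:R <= n.+1%:R * f y] y)) := @mono_sum n.+1.
    move=> /(_ _)h; apply: (mono_eq (mono_lin n.+1%:R^-1 (h _) mono0)) => [j|y].
      apply: mono_indic; rewrite -[X in measurable X]setTI.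
      have mh : measurable_fun setT (fun y => n.+1%:R * f y) by exact: measurable_funM.
      by have := mh measurableT `[j.+1%:R, +oo[%classic (measurable_itv _); congr (measurable (_ `&` _)); apply/seteqP; split => x /=; rewrite in_itv /= andbT.
    rewrite addr0 /staircase; congr (_ * _); apply: eq_bigr => j _.
    by rewrite indicE; congr ((nat_of_bool _)%:R); apply/idP/idP; rewrite inE.
  - have h := staircase_near n (f01 y).
    have -> : staircase n (f y) = staircase n (f y) - f y + f y by rewrite subrK.
    apply: (le_trans (ler_normD _ _)); rewrite -[2]/(1 + 1); apply: lerD.
      by apply: (le_trans h); rewrite invf_le1// ler1n.
    by have /andP[a b] := f01 y; rewrite ger0_norm.
  - apply/cvgrPdist_le => e e0; exists (truncn e^-1) => // n /= hn.
    rewrite distrC; apply: (le_trans (staircase_near n (f01 y))).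
    rewrite invf_ple ?posrE//; apply/ltW/(lt_le_trans (truncnS_gt _)).
    by rewrite ler_nat.
have := mono_lin (2 * B + 1) Mf (mono_lin (- B) mono1 mono0).
by move=> /mono_eq; apply => y; rewrite /f; field; rewrite gt_eqF.
Qed.

End uniform_integrability.

(** * Gaussian moments on the line *)

Section gaussian_line.
Context {R : realType}.
Local Notation leb := (@lebesgue_measure R).

Lemma is_derive_sqr (k x : R) : is_derive x (1 : R) (fun x => k * x ^+ 2) (2 * k * x).
Proof.
have h := is_deriveM (is_derive_cst k x (1 : R)) (is_deriveM (is_derive_id x (1 : R)) (is_derive_id x (1 : R))).
have -> : (fun x => k * x ^+ 2) = (cst k * (id * id)) by apply/funext => z; rewrite expr2.
by apply: is_derive_eq h _; rewrite /GRing.scale /=; ring.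
Qed.

Lemma smooth1_exp_sqr (k : R) : smooth1 (fun x : R => expR (k * x ^+ 2)).
Proof.
exists (fun f => exists2 q, smooth1 q & f = fun x => q x * expR (k * x ^+ 2)).
  by exists (fun=> 1); [exact: smooth1_cst|apply/funext => x; rewrite mul1r].
move=> _ [q sq ->]; have [q' sq' hq] := smooth1_derive sq.
exists (fun x => (q' x + q x * (2 * k * x)) * expR (k * x ^+ 2)).
  eexists; last by reflexivity.
  apply: smooth1D => //; apply: smooth1M => //; apply: smooth1M; [exact: smooth1_cst|exact: smooth1_id].
move=> x; have := hq x => hqx.
have h1 := is_derive_sqr k x.
have h2 := @is_derive1_comp _ expR (fun x => k * x ^+ 2) x _ _ (is_derive_expR _) h1.
apply: is_derive_eq (is_deriveM hqx h2) _; rewrite /GRing.scale /=; ring.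
Qed.

Definition gauss_moment (g : R -> R) := \int[leb]_x (expR (- (x ^+ 2)) * g x).

Lemma time_test_gauss (g : R -> R) : time_test g -> time_test (fun x => expR (- (x ^+ 2)) * g x).
Proof.
move=> tg; have -> : (fun x => expR (- (x ^+ 2)) * g x) = (fun x => expR (-1 * x ^+ 2) * g x).
  by apply/funext => x; rewrite mulN1r.
by apply: time_testM => //; exact: smooth1_exp_sqr.
Qed.

(* [p = - e^(x^2) int_(-oo)^x e^(-s^2) g(s) ds] *)
Lemma gauss_primitive (g : R -> R) : time_test g -> gauss_moment g = 0 ->
  exists p p', [/\ time_test p, smooth1 p', forall x, is_derive x (1 : R) p (p' x) &
    forall x, g x = 2 * x * p x - p' x].
Proof.
move=> tg g0; have th := time_test_gauss tg; have [_ [m hm]] := tg.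
have [||chi [tc dc _ _]] := @time_test_prim R _ (- m.+1%:R) m.+1%:R th _ _ g0.
- by rewrite (@lt_trans _ _ 0)// oppr_lt0.
- move=> t ot; rewrite hm ?mulr0// leNgt; apply/negP => h; apply: ot.
  move: h; rewrite ltr_norml => /andP[a b]; apply/andP; split.
    by apply: le_lt_trans a; rewrite lerN2 ler_nat.
  by apply: (lt_le_trans b); rewrite ler_nat.
pose e x : R := expR (1 * x ^+ 2); have se : smooth1 e := smooth1_exp_sqr 1.
have [e' se' he] := smooth1_derive se.
have e'E x : e' x = 2 * x * e x.
  have [_ <-] := he x.
  have h1 := is_derive_sqr 1 x.
  have [_ ->] := @is_derive1_comp _ expR (fun x => 1 * x ^+ 2) x _ _ (is_derive_expR _) h1.
  by rewrite mulr1 mulrC.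
have eN x : e x * expR (- (x ^+ 2)) = 1 by rewrite /e mul1r -expRD subrr expR0.
exists (fun x => (-1 * e x) * chi x), (fun x => 2 * x * ((-1 * e x) * chi x) - g x).
have sp : time_test (fun x => (-1 * e x) * chi x).
  by apply: time_testM => //; apply: smooth1M => //; exact: smooth1_cst.
have dp x : is_derive x (1 : R) (fun x => (-1 * e x) * chi x) (2 * x * ((-1 * e x) * chi x) - g x).
  have h1 := is_deriveM (is_derive_cst (-1 : R) x (1 : R)) (he x).
  apply: is_derive_eq (is_deriveM h1 (dc x)) _; rewrite /GRing.scale /= e'E mulr0 addr0.
  have E : g x = e x * expR (- (x ^+ 2)) * g x by rewrite eN mul1r.
  have alg (X a b' w z : R) : -1 * a * (w * z) + b' * (-1 * (2 * X * a)) =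
    2 * X * (-1 * a * b') - a * w * z by ring.
  rewrite [in RHS]E; exact: alg.
split => //; last by move=> x; rewrite opprB addrC subrK.
have [p' sp' hp'] := smooth1_derive sp.1.
suff <- : p' = (fun x => 2 * x * ((-1 * e x) * chi x) - g x) by [].
by apply/funext => x; have [_ <-] := hp' x; have [_ <-] := dp x.
Qed.

Lemma gauss_moment_bump : 0 < gauss_moment bumpf.
Proof.
have tb : time_test (@bumpf R).
  by split; [exact: smooth1_bump|exists 1%N => t; exact: bump_out].
have h : \int[leb]_x (expR (-1) * bumpf x) <= gauss_moment bumpf.
  apply: I_le => [||x]; [exact: intgZ intg_bump|exact: time_test_intg (time_test_gauss tb)|].
  have [h|h] := leP 1 `|x|; first by rewrite bump_out// !mulr0.
  rewrite ler_wpM2r ?bump_ge0// ler_expR lerN2 -real_normK ?num_real//.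
  by rewrite expr_le1// ltW.
by apply: lt_le_trans h; rewrite IZ ?I_bump ?mulr1 ?expR_gt0//; exact: intg_bump.
Qed.

End gaussian_line.

(** * Limits for product test functions *)

Section smooth_products.
Context {R : realType} (d : nat).
Local Notation lebd := (lebesgue_rV d).
Local Notation space := 'rV[R]_d.
Variables (F : set_system R) (r : R -> space -> R) (C : R).
Hypothesis FF : Filter F.
Hypothesis Fr : F (fun t => moderate C (r t)).
Hypothesis vanish : forall (psi : space -> R) i e, test_function setT psi -> 0 < e ->
  F (fun t => `|\int[lebd]_y (r t y ^+ 2 * (2 * y 0 i * psi y - 'D_(basis_vec i) psi y))| <= e).

Implicit Types g : 'I_d -> R -> R.

Lemma rprod_bounded g : (forall i, time_test (g i)) -> exists B, bounded_by B (rprod g).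
Proof.
move=> tg; have tp := test_rprod tg; have [B hB] := test_bounded tp; exists B; split => //.
by apply: continuous_measurable_rV; apply: smooth_cont; exact: tp.1.
Qed.

Lemma Gamma_rprod g : (forall i, time_test (g i)) ->
  \int[lebd]_y (Gamma y * rprod g y) = \prod_i gauss_moment (g i).
Proof.
move=> tg; rewrite -(prod_rV (fun i => time_test_intg (time_test_gauss (tg i)))).2.
by apply: I_eq => y; rewrite Gamma_prod /rprod -big_split.
Qed.

Let b : R -> R := bumpf.
Let tb : time_test b.
Proof. by split; [exact: smooth1_bump|exists 1%N => t; exact: bump_out]. Qed.

(** The unknown proportionality factor, read off from one product whose Gaussian integral is
    nonzero. *)
Let kap t := (\int[lebd]_y (r t y ^+ 2 * rprod (fun=> b) y)) / \prod_(i < d) gauss_moment b.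

Let mb0 : \prod_(i < d) gauss_moment b != 0.
Proof. by apply/prodf_neq0 => i _; rewrite gt_eqF// gauss_moment_bump. Qed.

Definition set_factor g (i : 'I_d) (f : R -> R) j := if j == i then f else g j.

Lemma rprod_set g i f y : rprod (set_factor g i f) y =
  f (y 0 i) * \prod_(j | j != i) g j (y 0 j).
Proof.
rewrite /rprod (bigD1 i)//= /set_factor eqxx; congr (_ * _).
by apply: eq_bigr => j /negbTE ->.
Qed.

Lemma set_factor_id g i y : rprod g y = rprod (set_factor g i (g i)) y.
Proof.
by apply: eq_bigr => j _; rewrite /set_factor; case: eqP => // ->.
Qed.

Lemma set_factor_test g i f : (forall i, time_test (g i)) -> time_test f ->
  forall j, time_test (set_factor g i f j).
Proof. by move=> tg tf j; rewrite /set_factor; case: eqP. Qed.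

(** With 2 x p - p' equal to the centred factor, replacing that factor by p gives a [psi] for which
    the whole product is 2 y_i psi - d_i psi. *)
Lemma centred_vanish g i e : (forall i, time_test (g i)) -> gauss_moment (g i) = 0 -> 0 < e ->
  F (fun t => `|\int[lebd]_y (r t y ^+ 2 * rprod g y)| <= e).
Proof.
move=> tg g0 e0; have [p [p' [tp sp' dp gE]]] := gauss_primitive (tg i) g0.
have := vanish i (test_rprod (set_factor_test i tg tp)) e0.
apply: filterS => t; congr (`|_| <= e); apply: I_eq => y; congr (_ * _).
have dg j : exists2 f', smooth1 f' & forall t, is_derive t (1 : R) (g j) (f' t) := smooth1_derive (tg j).1.
have /(_ _)/cid2-/all_sig2[g' _ hg'] := dg.
have dd j t' : is_derive t' (1 : R) (set_factor g i p j) (set_factor g' i p' j t').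
  by rewrite /set_factor; case: eqP.
rewrite (derive_rprod i y dd) (set_factor_id g i) !rprod_set gE.
have -> : rprod (fun j => if j == i then set_factor g' i p' j else set_factor g i p j) y =
    p' (y 0 i) * \prod_(j | j != i) g j (y 0 j).
  rewrite /rprod (bigD1 i)//= eqxx /set_factor eqxx; congr (_ * _).
  by apply: eq_bigr => j /negbTE ->.
ring.
Qed.

Let Gmass := \int[lebd]_y (Gamma y : R).

Let kap_bound : exists Kk, F (fun t => `|kap t| <= Kk).
Proof.
have [B bB] := @rprod_bounded (fun=> b) (fun=> tb).
exists ((B * Gmass) / `|\prod_(i < d) gauss_moment b|); apply: filterS Fr => t md.
by rewrite normrM normfV ler_wpM2r ?invr_ge0//; exact: moderate_le md bB.
Qed.

(** The factors are exchanged for the bump one at a time: g_i is the multiple of the bump with the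
    same Gaussian moment plus a centred remainder, which [centred_vanish] removes. *)
Lemma product_limit_kap g : (forall i, time_test (g i)) -> limit_is F r kap (rprod g).
Proof.
(* The first k factors are bumps. At k = d the claim is the definition of [kap], and the induction
   descends to k = 0, where the product is that of [g]. *)
move=> tg; pose gk (k : nat) (i : 'I_d) := if (i < k)%N then b else g i.
have tgk k i : time_test (gk k i) by rewrite /gk; case: ifP.
suff h k : (k <= d)%N -> limit_is F r kap (rprod (gk (d - k)%N)).
  by have := h d (leqnn d); rewrite subnn; congr limit_is; apply/funext => y; apply: eq_bigr.
elim: k => [_|k IH kd].
  move=> e e0; apply: filterS filterT => t _; rewrite subn0.
  have -> : rprod (gk d) = rprod (fun=> b).
    by apply/funext => y; apply: eq_bigr => i _; rewrite /gk ltn_ord.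
  by rewrite (Gamma_rprod (fun=> tb)) /kap divfK// subrr normr0 ltW.
have lt : (d - k.+1 < d)%N by rewrite ltn_subrL (leq_trans _ kd).
pose i := Ordinal lt; pose la := gauss_moment (g i) / gauss_moment b.
pose h0 x := g i x + (- la) * b x.
have th0 : time_test h0 by apply: time_testD => //; apply: time_testM => //; exact: smooth1_cst.
have mb : gauss_moment b != 0 by rewrite gt_eqF// gauss_moment_bump.
have m0 : gauss_moment h0 = 0.
  have i1 := time_test_intg (time_test_gauss (tg i)).
  have i2 := time_test_intg (time_test_gauss tb).
  have -> : gauss_moment h0 = gauss_moment (g i) + (- la) * gauss_moment b.
    rewrite /gauss_moment -IZ// -ID//; last exact: intgZ.
    by apply: I_eq => x; rewrite /h0; ring.
  by rewrite /la; field.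
have E y : rprod (gk (d - k.+1)%N) y = la * rprod (gk (d - k)%N) y +
    rprod (set_factor (gk (d - k.+1)%N) i h0) y.
  have dk : (d - k = (d - k.+1).+1)%N by rewrite -subSn.
  rewrite (set_factor_id (gk (d - k.+1)%N) i) (set_factor_id (gk (d - k)%N) i) !rprod_set.
  have -> : \prod_(j | j != i) gk (d - k)%N j (y 0 j) = \prod_(j | j != i) gk (d - k.+1)%N j (y 0 j).
    apply: eq_bigr => j ji; rewrite /gk dk ltnS leq_eqVlt -[(_ == _)%N]/(j == i) (negbTE ji)//.
  rewrite /gk dk ltnn ltnSn /h0; ring.
have [B1 b1] := rprod_bounded (tgk (d - k)%N).
have [B2 b2] := rprod_bounded (set_factor_test i (tgk (d - k.+1)%N) th0).
pose B := Num.max B1 B2.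
have bb1 : bounded_by B (rprod (gk (d - k)%N)).
  by split=> [|y]; [exact: b1.1|rewrite le_max b1.2].
have bb2 : bounded_by B (rprod (set_factor (gk (d - k.+1)%N) i h0)).
  by split=> [|y]; [exact: b2.1|rewrite le_max b2.2 orbT].
have -> : rprod (gk (d - k.+1)%N) = (fun y => la * rprod (gk (d - k)%N) y +
    rprod (set_factor (gk (d - k.+1)%N) i h0) y) by apply/funext.
apply: (limit_lin FF Fr la bb1 bb2); first exact: IH (ltnW kd).
move=> e e0; have ts := set_factor_test i (tgk (d - k.+1)%N) th0.
have si : gauss_moment (set_factor (gk (d - k.+1)%N) i h0 i) = 0 by rewrite /set_factor eqxx.
apply: filterS (centred_vanish ts si e0) => t.
by rewrite (Gamma_rprod ts) [\prod_j _](bigD1 i)//= si mul0r mulr0 subr0.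
Qed.

Lemma mass_Gamma_gt0 : 0 < Gmass.
Proof.
have [B bB] := @rprod_bounded (fun=> b) (fun=> tb).
have h : \prod_(i < d) gauss_moment b <= B * Gmass.
  rewrite -(Gamma_rprod (fun=> tb)) -IZ; last exact: intg_Gamma.
  apply: I_le => [||y]; [exact: Gamma_intg bB|apply: intgZ; exact: intg_Gamma|].
  rewrite mulrC ler_wpM2r ?(ltW (Gamma_gt0 y))//.
  exact: le_trans (ler_norm _) (bB.2 y).
have p0 : 0 < \prod_(i < d) gauss_moment b by apply: prodr_gt0 => i _; exact: gauss_moment_bump.
have G0 : 0 <= Gmass by apply: I_ge0 => y; exact: ltW (Gamma_gt0 y).
rewrite lt_neqAle G0 andbT eq_sym; apply/negP => /eqP E.
by move: h; rewrite E mulr0 leNgt p0.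
Qed.

(** Product cutoffs tend to 1, so [limit_is] holds for the constant 1. There both integrals equal
    the Gaussian mass, which is positive, and this forces [kap] to 1. *)
Let kap_lim e : 0 < e -> F (fun t => `|kap t - 1| <= e).
Proof.
move=> e0; have [Kk hk] := kap_bound.
have l1 : limit_is F r kap (fun=> 1).
  apply: (limit_lim FF Fr hk (g_ := fun n => ycut n) (B := 1)) => [n|y|n].
  - have [B bB] := @rprod_bounded (fun=> plateau n) (fun=> time_test_plateau n).
    by split=> [|y]; [exact: bB.1|rewrite ger0_norm ?ycut_ge0// ycut_le1].
  - have [N _ hN] := ycut_near y; apply: (eventually_eq_cvg (N := N)) => n Nn.
    by apply: ycut1; exact: hN.
  - by apply: product_limit_kap => i; exact: time_test_plateau.
have G0 := mass_Gamma_gt0.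
apply: filterS (filterI Fr (l1 _ (mulr_gt0 e0 G0))) => t [md].
have -> : \int[lebd]_y (r t y ^+ 2 * 1) = Gmass.
  by rewrite /Gmass -(md_mass md); apply: I_eq => y; rewrite mulr1.
have -> : \int[lebd]_y (Gamma y * 1) = Gmass by apply: I_eq => y; rewrite mulr1.
have -> : Gmass - kap t * Gmass = - ((kap t - 1) * Gmass) by ring.
by rewrite normrN normrM (gtr0_norm G0) ler_pM2r.
Qed.

Lemma product_limit g : (forall i, time_test (g i)) -> limit_is F r (fun=> 1) (rprod g).
Proof.
move=> tg e e0; set A := \int[lebd]_y (Gamma y * rprod g y).
have e2 : 0 < e / 2 by rewrite divr_gt0.
have a0 : 0 < `|A| + 1 by rewrite ltr_wpDl.
have e3 : 0 < (e / 2) / (`|A| + 1) by rewrite divr_gt0.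
apply: filterS (filterI (product_limit_kap tg e2) (kap_lim e3)) => t [].
rewrite -/A; set J := \int[_]_y _ => h1 h2.
have -> : J - 1 * A = (J - kap t * A) + (kap t - 1) * A by ring.
have -> : e = e / 2 + e / 2 by field.
apply: (le_trans (ler_normD _ _)); apply: lerD => //.
rewrite normrM; apply: (le_trans (ler_wpM2r (normr_ge0 _) h2)).
rewrite mulrAC ler_pdivrMr// ler_wpM2l ?(ltW e2)//.
by rewrite lerDl.
Qed.

Let one_bound : F (fun t => `|(1 : R)| <= 1).
Proof. by apply: filterS filterT => t _; rewrite normr1. Qed.

(** The shift by 1 makes the ramp vanish for all x >= a, so the limit is the indicator of the open
    half-line at every point. *)
Definition ramp_below (n : nat) (a x : R) := step (- n.+1%:R * x + (n.+1%:R * a - 1)).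

Lemma ramp_below_cvg (a x : R) : ramp_below n a x @[n --> \oo] --> ((x < a)%R%:R : R).
Proof.
have [xa|xa] := ltP x a; last first.
  apply: (eventually_eq_cvg (N := 0)) => n _; rewrite /ramp_below step0//.
  have : n.+1%:R * a <= n.+1%:R * x by rewrite ler_wpM2l.
  lra.
have e0 : 0 < a - x by rewrite subr_gt0.
apply: (eventually_eq_cvg (N := truncn (2 / (a - x)))) => n hn; rewrite /ramp_below step1//.
have : 2 / (a - x) <= n.+1%:R by apply/ltW/(lt_le_trans (truncnS_gt _)); rewrite ler_nat.
rewrite ler_pdivrMr//; lra.
Qed.

Lemma measurable_under s : measurable (under s : set space).
Proof.
elim: s => [|p s IH].
  by rewrite (_ : under [::] = setT)//; apply/seteqP; split.
rewrite under_cons; apply: measurableI => //; rewrite -[X in measurable X]setTI.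
have := @measurable_coord R d p.1 measurableT `]-oo, ratr p.2[%classic (measurable_itv _).
by congr (measurable (_ `&` _)); apply/seteqP; split => x /=; rewrite in_itv.
Qed.

(** Each half-line of the list is approximated by a ramp absorbed into one factor, which keeps the
    compact support that [rprod] tests need. *)
Let under_product s : forall g, (forall i, time_test (g i)) ->
  limit_is F r (fun=> 1) (fun y => \1_(under s) y * rprod g y).
Proof.
have bd s' (h : space -> R) B : bounded_by B h -> bounded_by B (fun y => \1_(under s') y * h y).
  move=> [mh hh]; split=> [|y].
    by apply: measurable_funM => //; exact: measurable_indicR (measurable_under s').
  rewrite normrM -[leRHS]mul1r ler_pM// indicE.
  by case: (_ \in _); rewrite ?normr1// normr0.
elim: s => [|p s IH] g tg.
  have -> : (fun y => \1_(under [::]) y * rprod g y) = rprod g.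
    by apply/funext => y; rewrite indicE mem_set// mul1r.
  exact: product_limit.
pose gn n := set_factor g p.1 (fun x => ramp_below n (ratr p.2) x * g p.1 x).
have tgn n i : time_test (gn n i).
  apply: set_factor_test => //; apply: time_testM => //.
  exact: smooth1_affine (@smooth1_step R).
have gnE n y : rprod (gn n) y = ramp_below n (ratr p.2) (y 0 p.1) * rprod g y.
  by rewrite (set_factor_id g p.1) !rprod_set mulrA.
have [B bB] := rprod_bounded tg.
have bgn n : bounded_by B (rprod (gn n)).
  have [B' [m' _]] := rprod_bounded (tgn n); split => // y.
  rewrite gnE normrM -[leRHS]mul1r ler_pM//; last exact: bB.2.
  by rewrite ger0_norm ?step_ge0// step_le1.
apply: (limit_lim FF Fr one_bound (g_ := fun n y => \1_(under s) y * rprod (gn n) y) (B := B)) => [n|y|n].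
- exact: bd.
- have -> : \1_(under (p :: s)) y * rprod g y =
      \1_(under s) y * ((y 0 p.1 < ratr p.2)%R%:R * rprod g y).
    rewrite mulrA; congr (_ * _); rewrite under_cons indicI /= mulrC; congr (_ * _).
    by rewrite indicE; congr ((nat_of_bool _)%:R); apply/idP/idP; rewrite inE.
  apply: cvgMr.
  have -> : (fun n => rprod (gn n) y) = (fun n => ramp_below n (ratr p.2) (y 0 p.1) * rprod g y).
    by apply/funext => n.
  by apply: cvgMl; exact: ramp_below_cvg.
- exact: IH.
Qed.

Lemma under_limit s : limit_is F r (fun=> 1) (\1_(under s)).
Proof.
apply: (limit_lim FF Fr one_bound (g_ := fun n y => \1_(under s) y * ycut n y) (B := 1)) => [n|y|n].
- have [B bB] := @rprod_bounded (fun=> plateau n) (fun=> time_test_plateau n).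
  split=> [|y]; first by apply: measurable_funM; [exact: measurable_indicR (measurable_under s)|exact: bB.1].
  rewrite normrM -[leRHS]mul1r ler_pM//; last by rewrite ger0_norm ?ycut_ge0// ycut_le1.
  by rewrite indicE; case: (_ \in _); rewrite ?normr1// normr0.
- have [N _ hN] := ycut_near y; apply: (eventually_eq_cvg (N := N)) => n Nn.
  by rewrite ycut1 ?mulr1//; exact: hN.
- by apply: under_product => i; exact: time_test_plateau.
Qed.

End smooth_products.

(** * Late times outside a null set *)

Section essential_limits.
Context {R : realType}.
Local Notation leb := (@lebesgue_measure R).

(** Each property has its own null set; these properties form a filter, but only countably many can
    share one null set. *)
Definition ess_infty (P : set R) := exists T : R, {ae leb, forall t : R, T < t -> P t}.

Lemma ess_infty_filter : Filter ess_infty.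
Proof.
split.
- by exists 0; apply: aeW.
- move=> P Q [S hS] [T hT]; exists (Num.max S T); apply: (ae_imp (ae_and hS hT)) => t [h1 h2].
  by rewrite gt_max => /andP[/h1 ? /h2].
- by move=> P Q PQ [T hT]; exists T; apply: (ae_imp hT) => t h /h; exact: PQ.
Qed.

Lemma ess_infty_countable (K : countType) (Q : K -> R -> Prop) : (forall k, ess_infty (Q k)) ->
  exists2 N : set R, leb.-negligible N &
    forall k, \forall t \near within (~` N) (pinfty_nbhs R), Q k t.
Proof.
move=> /(_ _)/cid-/all_sig[T hT].
have h : {ae leb, forall t : R, forall n : nat, forall k, unpickle n = Some k -> T k < t -> Q k t}.
  apply/ae_foralln => n; case E : (unpickle n) => [k|]; last by apply: aeW.
  by apply: (ae_imp (hT k)) => t ht k' [<-].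
exists (~` [set t | forall n k, unpickle n = Some k -> T k < t -> Q k t]); first exact: h.
move=> k; exists (T k); split; first exact: num_real.
by move=> t Tt /contrapT /(_ (pickle k) k (pickleK k) Tt).
Qed.

End essential_limits.

(** * Convergence against bounded measurable functions *)

Section weak_limit.
Context {R : realType} (d : nat).
Local Notation leb := (@lebesgue_measure R).
Local Notation lebd := (lebesgue_rV d).
Local Notation space := 'rV[R]_d.
Variables (r : R -> space -> R) (C : R).
Hypothesis mod_ : {ae leb, forall t : R, 0 < t -> moderate C (r t)}.
Hypothesis vanish : forall (psi : space -> R) i e, test_function setT psi -> 0 < e ->
  ess_infty (fun t => `|\int[lebd]_y (r t y ^+ 2 * (2 * y 0 i * psi y - 'D_(basis_vec i) psi y))| <= e).

(** The filter is fixed before the induction, so reaching uncountably many test functions adds no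
    null set. *)
Lemma mono_class_limit (F : set_system R) g : Filter F -> F (fun t => moderate C (r t)) ->
  (forall s, limit_is F r (fun=> 1) (\1_(under s))) -> mono_class g ->
  (exists B, bounded_by B g) /\ limit_is F r (fun=> 1) g.
Proof.
move=> FF Fr Fs; have F1 : F (fun t => `|(1 : R)| <= 1) by apply: filterS filterT => t _; rewrite normr1.
elim=> [s|a f h _ [[B1 [m1 b1]] l1] _ [[B2 [m2 b2]] l2]|g_ h B _ IH hb hc].
- split=> //; exists 1; split; first exact: measurable_indicR (measurable_under s).
  by move=> y; rewrite indicE; case: (_ \in _); rewrite ?normr1// normr0.
- split.
    exists (`|a| * B1 + B2); split=> [|y].
      by apply: measurable_funD => //; exact: measurable_funM.
    apply: (le_trans (ler_normD _ _)); apply: lerD => //.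
    by rewrite normrM ler_wpM2l.
  apply: (limit_lin FF Fr a (B := Num.max B1 B2)) => //.
    by split=> // y; rewrite le_max b1.
  by split=> // y; rewrite le_max b2 orbT.
- have bg n : bounded_by B (g_ n).
    by split=> [|y]; [have [[B' []]] := IH n|exact: hb].
  split; first by exists B; exact: bounded_by_lim bg hc.
  by apply: (limit_lim FF Fr F1 bg hc) => n; have [] := IH n.
Qed.

Lemma weak_limit : exists2 N : set R, leb.-negligible N & forall g B, bounded_by B g ->
  limit_is (within (~` N) (pinfty_nbhs R)) r (fun=> 1) g.
Proof.
have FE := @ess_infty_filter R.
have Fr : ess_infty (fun t => moderate C (r t)) by exists 0.
(* A countable family: one entry for each rational orthant and each precision 1 / (m + 1), and
   [None] for the bounds on [r], which must hold outside the same null set. *)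
pose Q (k : option (seq ('I_d * rat) * nat)) t : Prop := if k is Some (s, m) then
  `|\int[lebd]_y (r t y ^+ 2 * \1_(under s) y) - 1 * \int[lebd]_y (Gamma y * \1_(under s) y)| <= m.+1%:R^-1
  else moderate C (r t).
have [[[s m]|]//|N N0 hN] := @ess_infty_countable R _ Q.
  by apply: (under_limit FE Fr vanish s); rewrite invr_gt0.
exists N => // g B bg.
apply: (mono_class_limit _ _ _ (mono_measurable bg)).2; first exact: (hN None).
move=> s e e0; have [m hm] : exists m : nat, m.+1%:R^-1 <= e.
  exists (truncn e^-1); rewrite invf_ple ?posrE//; exact/ltW/truncnS_gt.
by have := hN (Some (s, m)); apply: filterS => t /le_trans; apply.
Qed.

End weak_limit.

(** * Test functions and initial data *)

Section essentially_bounded.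
Context {R : realType} (d : nat).
Local Notation lebd := (@lebesgue_rV R d).

(** Clipping at the essential bound gives an everywhere bounded representative, the only kind that
    the monotone class reaches. *)
Lemma Loo_clip (phi : 'rV[R]_d -> R) : phi \in Lfun lebd +oo%E ->
  exists psi B, [/\ measurable_fun setT phi, bounded_by B psi &
    {ae lebd, forall y, phi y = psi y}].
Proof.
rewrite inE => /andP[]; rewrite !inE /= => mphi fin.
have [B hB] : exists B : R, {ae lebd, forall y, `|phi y| <= B}.
  move: fin; rewrite /finite_norm unlock; case: ifPn => [p0|].
    case E : (ess_sup_inf.ess_sup _ _) => [s| |] // _.
      exists s; have /ess_sup_inf.ess_supP : (ess_sup_inf.ess_sup lebd (abse \o (EFin \o phi)) <= s%:E)%E by rewrite E.
      by apply: filterS => y; rewrite /= lee_fin.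
    exists 0; have /ess_sup_inf.ess_supP : (ess_sup_inf.ess_sup lebd (abse \o (EFin \o phi)) <= 0%:E)%E by rewrite E leNye.
    by apply: filterS => y; rewrite /= lee_fin.
  (* If the whole space is null, any bound holds almost everywhere. *)
  rewrite -leNgt => h _; exists 0; exists setT; split => //.
  by apply/eqP; rewrite eq_le measure_ge0 andbT.
pose K := Num.max 0 B; have K0 : 0 <= K by rewrite le_max lexx.
exists (fun y => Num.max (- K) (Num.min (phi y) K)), K; split=> //.
  split=> [|y]; first by apply: measurable_maxr => //; exact: measurable_minr.
  by rewrite ler_norml le_max lexx /= ge_max ge_min lexx orbT andbT ge0_cp.
apply: (ae_imp hB) => y h; have : `|phi y| <= K by rewrite (le_trans h)// le_max lexx orbT.
by rewrite ler_norml => /andP[h1 h2]; rewrite (min_idPl h2) (max_idPr h1).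
Qed.

End essentially_bounded.

Section initial_data.
Context {R : realType} (d : nat).
Local Notation lebd := (@lebesgue_rV R d).
Local Notation space := 'rV[R]_d.

Lemma Lfun2_L2 (f : space -> R) : f \in Lfun lebd 2%:E -> L2 lebd f.
Proof.
move=> /[dup] h; rewrite inE => /andP[]; rewrite !inE /= => mf _; split=> //.
exact: Lfun2_integrable_sqr h.
Qed.

(** The BD-entropy bounds Lambda_0 + 2 nu grad sqrt(R_0) in L^2; subtracting Lambda_0 leaves the
    gradient, also for eps = 0, when the energy says nothing about it. *)
Lemma gradient_L2 (nu eps : R) (r0 : space -> R) (L0 G0 : space -> space) : 0 < nu ->
  (forall i, (fun y => L0 y 0 i) \in Lfun lebd 2%:E) ->
  (forall i, measurable_fun setT (fun y => G0 y 0 i)) ->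
  finite_BD_entropy nu eps r0 L0 G0 -> forall i, L2 lebd (fun y => G0 y 0 i).
Proof.
move=> nu0 hL mG [ik _] i; have LL := Lfun2_L2 (hL i).
have mW : measurable_fun setT (fun y => L0 y 0 i + 2 * nu * G0 y 0 i).
  by apply: measurable_funD; [exact: LL.1|exact: measurable_funM].
have LW : L2 lebd (fun y => L0 y 0 i + 2 * nu * G0 y 0 i).
  split=> //; apply: intg_le ik; first exact: measurable_funX.
  move=> y; rewrite ger0_norm ?sqr_ge0// /kinetic_density.
  have h : (L0 y 0 i + 2 * nu * G0 y 0 i) ^+ 2 <= sqnorm (L0 y + (2 * nu) *: G0 y).
    rewrite sqnorm_row (bigD1 i)//= !mxE lerDl sumr_ge0// => j _; exact: sqr_ge0.
  by apply: (le_trans h); rewrite lerDl mulr_ge0 ?sqr_ge0// sqnorm_ge0.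
have := L2Z (2 * nu)^-1 (L2D LW (L2Z (-1) LL)).
congr (L2 _ _); apply/funext => y; field; exact: lt0r_neq0.
Qed.

End initial_data.

(** * Assembly *)

Section assembly.
Context {R : realType} (d : nat).
Local Notation leb := (@lebesgue_measure R).
Local Notation X := (R * 'rV[R]_d)%type.
Local Notation mX := (measurableTypeR R * 'rV[R]_d)%type.
Local Notation mu := (@muX R d).
Local Notation lebd := (@lebesgue_rV R d).
Local Notation space := 'rV[R]_d.
Variables (tau : R -> R) (eps : R) (c : collection R d) (r0 : space -> R).
Hypothesis ht : is_tau tau.
Hypothesis reg : regularity eps c.
Hypothesis Lr0 : L2 lebd r0.
Local Notation u := (pos (sqrtR c)).
Hypothesis eqR : forall phi, ptest phi ->
  (\int[mu]_z (u_ c r0 z ^+ 2 * dt phi z)) +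
  \sum_j \int[mu]_z (F_ tau c j z * u_ c r0 z * dy j phi z) = 0.

Let u_pos z : 0 < z.1 -> u_ c r0 z = u z.
Proof.
move=> z0; rewrite /u_ /neg indicE memNset ?mul0r ?addr0//=.
by rewrite in_itv /= leNgt z0.
Qed.

Lemma density_mass_pos h : time_test h -> (forall t, t <= 0 -> h t = 0) ->
  \int[mu]_z (u z * u z * h z.1) = (\int[leb]_t h t) * \int[lebd]_y (r0 y ^+ 2).
Proof.
move=> th h0; rewrite -(density_mass ht reg Lr0 eqR th); apply: I_eq => z.
by have [/h0 ->|z0] := leP z.1 0; rewrite ?mulr0// u_pos.
Qed.

Lemma density_delayed chi chi' (psi : space -> R) : delayed chi ->
  (forall t, is_derive t (1 : R) chi (chi' t)) -> test_function setT psi ->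
  \int[mu]_z (u z * u z * (chi' z.1 * psi z.2)) =
  - \sum_j \int[mu]_z (timef (ktau tau) z * q_ c j z * u z * (chi z.1 * 'D_(basis_vec j) psi z.2)).
Proof.
move=> [tc [a a0 ca]] hc tp.
have E0 : \int[mu]_z (u_ c r0 z ^+ 2 * dt (fun z : X => chi z.1 * psi z.2) z) =
    \int[mu]_z (u z * u z * (chi' z.1 * psi z.2)).
  apply: I_eq => z; rewrite (dtE _ hc tp) expr2.
  have [z0|z0] := ltP 0 z.1; first by rewrite u_pos.
  suff -> : chi' z.1 = 0 by rewrite mul0r !mulr0.
  have [_ <-] := hc z.1; have za : z.1 < a by exact: le_lt_trans a0.
  have /near_eq_derive -> : \forall t \near z.1, chi t = 0; rewrite ?derive_cst//.
  near=> t; apply: ca; near: t; exact: lt_nbhsl.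
have E j : \int[mu]_z (F_ tau c j z * u_ c r0 z * dy j (fun z : X => chi z.1 * psi z.2) z) =
    \int[mu]_z (timef (ktau tau) z * q_ c j z * u z * (chi z.1 * 'D_(basis_vec j) psi z.2)).
  apply: I_eq => z; rewrite (dyE _ j tc tp) /F_; congr (_ * _).
  by rewrite -!mulrA; congr (_ * _); rewrite /q_ pos_u.
rewrite -E0 -(eq_bigr _ (fun j _ => E j)).
by apply/eqP; rewrite -addr_eq0; apply/eqP; exact: (eqR (ptest_of tc tp)).
Unshelve. all: by end_near.
Qed.

Lemma slice_rho (rho : R -> space -> R) : st_measurable rho ->
  {ae spacetime_measure d, forall z : X, 0 < z.1 -> rho z.1 z.2 = sqrtR c z.1 z.2 ^+ 2} ->
  {ae leb, forall t : R, 0 < t -> {ae lebd, forall y, rho t y = sqrtR c t y ^+ 2}}.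
Proof.
move=> mr hr; pose f (z : mX) := pos rho z - u z ^+ 2.
have mf : measurable_fun setT f.
  apply: measurable_funB; first exact: measurable_pos.
  by apply: measurable_funX; exact: (L2loc_u0 reg).1.
have f0 : {ae (leb \x lebesgue_rV d)%E, forall z : mX, f z = 0}.
  apply: (ae_imp (mu := (leb \x lebesgue_rV d)%E) hr) => z; rewrite /f /pos.
  by case: ifP => [_ ->//|_ _]; rewrite ?subrr// expr0n subr0.
apply: (ae_imp (ae_ae mf f0)) => t h t0; apply: (ae_imp h) => y.
by rewrite /f /pos t0 => /eqP; rewrite subr_eq0 => /eqP.
Qed.

End assembly.

Theorem corollary1p4 (R : realType) (d : nat) (nu eps : R) (tau : R -> R)
  (r0 : 'rV[R]_d -> R) (L0 G0 : 'rV[R]_d -> 'rV[R]_d)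
  (rho : R -> 'rV[R]_d -> R) (U : R -> 'rV[R]_d -> 'rV[R]_d)
  (c : collection R d) (C : R) :
  (1 <= d <= 3)%N -> 0 < nu -> 0 <= eps -> is_tau tau ->
  r0 \in Lfun (lebesgue_rV d) 2%:E ->
  (forall i, (fun y => L0 y 0 i) \in Lfun (lebesgue_rV d) 2%:E) ->
  (forall i, measurable_fun setT (fun y => G0 y 0 i)) ->
  weak_gradient_space r0 G0 ->
  finite_energy eps r0 L0 G0 ->
  finite_BD_entropy nu eps r0 L0 G0 ->
  {ae lebesgue_rV d, forall y, 0 <= r0 y} ->
  {ae lebesgue_rV d, forall y, r0 y = 0 -> L0 y = 0} ->
  (\int[lebesgue_rV d]_y (r0 y ^+ 2)%:E = \int[lebesgue_rV d]_y (Gamma y)%:E)%E ->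
  global_weak_solution tau nu eps r0 L0 rho U c ->
  energy_inequality tau nu eps c C ->
  weak_L1_cvg_pinfty rho (@Gamma R d).
Proof.
move=> _ nu0 eps0 ht hr0 hL0 mG0 wg0 _ bd _ _ massE [mrho _ hrho _ reg ce me te sk ini] en.
have Lr0 := Lfun2_L2 hr0; have LG0 := gradient_L2 nu0 hL0 mG0 bd.
have ini1 psi (tp : test_function setT psi) := (ini psi tp).1.
have eqR := density_equation ht reg Lr0 LG0 wg0 ce te ini1.
have iG := @intg_Gamma R d.
have massG : \int[lebesgue_rV d]_y (r0 y ^+ 2) = \int[lebesgue_rV d]_y (Gamma y : R).
  by apply/EFin_inj; rewrite -!I_EFin//; exact: Lr0.2.
have mass := mass_conservation ht reg Lr0 eqR.
have iE := intg_ediss ht nu0 reg en massG mass.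
have bounds := energy_bounds ht nu0 reg en massG mass.
have mod_ : {ae lebesgue_measure, forall t : R, 0 < t -> moderate C (sqrtR c t)}.
  apply: (ae_imp (ae_and mass bounds)) => t [h1 h2] t0.
  have [i1 e1] := h1 t0; have [i2 e2 _] := h2 t0.
  by split => //; [exact: measurable_sec_pos (mes_sqrtR reg) t0|rewrite e1].
have vanish (psi : 'rV[R]_d -> R) i e : test_function setT psi -> 0 < e ->
    ess_infty (fun t => `|\int[lebesgue_rV d]_y (sqrtR c t y ^+ 2 *
      (2 * y 0 i * psi y - 'D_(basis_vec i) psi y))| <= e).
  move=> tp e0; have [T _ hT] := position_vanish ht nu0 eps0 reg me sk iE
    (density_mass_pos ht reg Lr0 eqR) (density_delayed eqR) mass i tp e0.
  by exists T.
have [N N0 hN] := weak_limit mod_ vanish.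
have sl := slice_rho reg mrho hrho.
have good := ae_and mod_ sl.
(* Besides the times excluded by the weak limit, those are removed at which the bounds fail or [rho]
   is not the square of [sqrtR] on the slice; all are chosen before the test function. *)
exists (N `|` ~` [set t | 0 < t -> moderate C (sqrtR c t) /\ {ae lebesgue_rV d, forall y, rho t y = sqrtR c t y ^+ 2}]).
have out t : 0 < t -> ~ (N `|` ~` [set t | 0 < t -> moderate C (sqrtR c t) /\ {ae lebesgue_rV d, forall y, rho t y = sqrtR c t y ^+ 2}]) t ->
    [/\ ~ N t, moderate C (sqrtR c t), measurable_fun setT (rho t) &
      {ae lebesgue_rV d, forall y, rho t y = sqrtR c t y ^+ 2}].
  move=> t0 nt; have nN : ~ N t by move=> h; apply: nt; left.
  have : ~ ~ (0 < t -> moderate C (sqrtR c t) /\ {ae lebesgue_rV d, forall y, rho t y = sqrtR c t y ^+ 2}).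
    by move=> h; apply: nt; right.
  by move=> /contrapT /(_ t0)[md ae]; split => //; exact: measurable_sec_pos mrho t0.
split.
- apply: negligibleU => //; apply: (ae_imp good) => t [h1 h2] t0.
  by split; [exact: h1|exact: h2].
- move=> t t0 /(out t t0)[_ md mr ae]; apply/Lfun1_integrable.
  exact: intg_ae_eq mr ae (md_intg md).
- by apply/Lfun1_integrable.
move=> phi /Loo_clip[psi [B [mphi bpsi aep]]].
have -> : \int[lebesgue_rV d]_y (Gamma y * phi y) = \int[lebesgue_rV d]_y (Gamma y * psi y).
  apply: I_ae; [exact: measurable_funM (intg_meas iG) mphi|exact: intg_meas (Gamma_intg bpsi)|].
  by apply: (ae_imp aep) => y ->.
apply/cvgrPdist_le => e e0; have [T [_ hT]] := hN psi B bpsi e e0.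
exists (Num.max 0 T); split; first exact: num_real.
move=> t; rewrite gt_max => /andP[t0 Tt] /(out t t0)[nt md mr ae].
have -> : \int[lebesgue_rV d]_y (rho t y * phi y) = \int[lebesgue_rV d]_y (sqrtR c t y ^+ 2 * psi y).
  apply: I_ae; [exact: measurable_funM|exact: intg_meas (moderate_intg md bpsi)|].
  by apply: (ae_imp (ae_and aep ae)) => y [-> ->].
by rewrite distrC -[X in _ - X]mul1r; exact: hT.
Qed.
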